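(* Let $\mathbb{M}=(M_n)_{n\ge0}$ be a strongly regular sequence admitting a nonzero proximate order. Let $k,p\in\mathbb{N}$ with $1\le k<p$, and let $s_1,s_2>0$ with $s_2p>s_1k$ and $\omega(\mathbb{M})\frac{s_2p}{k}<2$. Let $m_2=(m_2(n))_{n\ge0}$ be a sequence of moments (associated with a strongly regular sequence admitting a nonzero proximate order) for which there exist $\tilde c_1,\tilde c_2>0$ with $\tilde c_1^{\,n}(M_n)^{s_2}\le m_2(n)\le\tilde c_2^{\,n}(M_n)^{s_2}$ for all $n\ge0$. Let $a(z)$ be holomorphic on a closed disc $\overline D$ centered at the origin with $a(z)^{-1}\in\mathcal{O}(\overline D)$, and let $\hat f(z,\varepsilon)\in\mathbb{C}[[z,\varepsilon]]$ and $\hat\psi_j(\varepsilon)\in\mathbb{C}[[\varepsilon]]$, $0\le j\le p-1$, be formal power series. Consider the singularly perturbed moment differential problem $$\left\{\begin{aligned}\varepsilon^k a(z)\,\partial_{m_2,z}^p w(z,\varepsilon)-w(z,\varepsilon)&=\hat f(z,\varepsilon)\\ \partial_{m_2,z}^j w(0,\varepsilon)&=\hat\psi_j(\varepsilon),\qquad j=0,\ldots,p-1.\end{aligned}\right.\qquad(\ast)$$ (i) There exists a unique formal solution $\hat w(z,\varepsilon)\in\mathbb{C}[[z,\varepsilon]]$ of $(\ast)$, which belongs to $\mathcal{O}(\overline D)[[\varepsilon]]$ if $\hat f\in\mathcal{O}(\overline D)[[\varepsilon]]$. (ii) Let $(d_1,d_2)\in\mathbb{R}^2$ with $|d_1-d_2|<\frac{\pi\omega(\mathbb{M})}{2}\left(\frac{s_2p}{k}-s_1\right)$.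 The following statements are equivalent: (ii.1) $\hat w(z,\varepsilon)$ is $(\mathbb{M}^{s_1},\mathbb{M}^{\frac{s_2p}{k}})$-summable (with respect to $\varepsilon$) in the multidirection $(d_1,d_2)$. (ii.2) $\hat f(z,\varepsilon)$ and $\partial_{m_2,z}^j\hat w(0,\varepsilon)$, $j=0,1,\ldots,p-1$, are $(\mathbb{M}^{s_1},\mathbb{M}^{\frac{s_2p}{k}})$-summable (with respect to $\varepsilon$) in the multidirection $(d_1,d_2)$.
   Context: **Sequences.** A sequence $\mathbb{M}=(M_p)_{p\ge0}$ of positive reals with $M_0=1$ is *strongly regular* if (lc) $M_p^2\le M_{p-1}M_{p+1}$ for $p\ge1$; (mg) there is $A_1>0$ with $M_{p+q}\le A_1^{p+q}M_pM_q$ for all $p,q\ge0$; (snq) there is $A_2>0$ with $\sum_{q\ge p}\frac{M_q}{(q+1)M_{q+1}}\le A_2\frac{M_p}{M_{p+1}}$ for all $p\ge0$. Put $M(t)=\sup_{p\ge0}\log(t^p/M_p)$ for $t>0$, $M(0)=0$, and $\omega(\mathbb{M})=\left(\limsup_{r\to\infty}\max\{0,\frac{\log M(r)}{\log r}\}\right)^{-1}$. For $s>0$, $\mathbb{M}^s=(M_p^s)_{p\ge0}$ is again strongly regular with $\omega(\mathbb{M}^s)=s\,\omega(\mathbb{M})$. A proximate order is a continuous, piecewise continuously differentiable $\rho:(c,\infty)\to[0,\infty)$ with $\rho(t)\to\rho<\infty$ and $t\rho'(t)\log t\to0$ as $t\to\infty$; it is nonzero if $\rho>0$. $\mathbb{M}$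 *admits a nonzero proximate order* if there is a nonzero proximate order $\rho(t)$ such that $\log(t)\left(\rho(t)-\frac{\log M(t)}{\log t}\right)$ is bounded for large $t$. **Sectors and growth.** On the Riemann surface $\mathcal{R}$ of the logarithm, $S_d(\theta)=\{z:|\arg z-d|<\theta/2\}$; $S_d$ denotes such an infinite sector with unspecified opening; $\hat S_d=S_d\cup D(0,r)$ for some $r>0$. For a complex Banach space $\mathbb{E}$, $\mathcal{O}^{\mathbb{M}}(S_d(\theta),\mathbb{E})$ is the set of holomorphic $f:S_d(\theta)\to\mathbb{E}$ such that for every $0<\theta'<\theta$ there are $C,K>0$ with $\|f(z)\|_{\mathbb{E}}\le C\exp(M(|z|/K))$ on $S_d(\theta')$. $\mathcal{O}^{\mathbb{M}}(\hat S_d,\mathbb{E})$ consists of functions holomorphic on $\hat S_d$ with this growth on $S_d$. **Kernels and moments.** Let $\mathbb{M}$ be strongly regular, admitting a nonzero proximate order, $\omega(\mathbb{M})<2$. Strong kernel functions for $\mathbb{M}$-summability are functions $e,E$ such that: (1) $e\in\mathcal{O}(S_0(\omega(\mathbb{M})\pi))$, $e(x)\in\mathbb{R}$ for $x>0$; there is $\alpha>0$ such that for every bounded proper subsector $T$ of $S_0(\omega(\mathbb{M})\pi)$ there is $C>0$ with $|e(z)|\le C|z|^\alpha$ on $T$; for every $\delta>0$ there are $C,K>0$ with $|e(z)|\le C\exp(-M(|z|/K))$ on $S_0(\omega(\mathbb{M})\pi-\delta)$. (2) $E$ is entire, $|E(z)|\le\tilde c\exp(M(|z|/\tilde k))$ on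 $\mathbb{C}$ for some $\tilde c,\tilde k>0$; there is $\beta>0$ such that for all $0<\tilde\theta<2\pi-\omega(\mathbb{M})\pi$ and $M_E>0$ there is $\tilde c_2>0$ with $|E(z)|\le\tilde c_2|z|^{-\beta}$ for $z\in S_\pi(\tilde\theta)\setminus D(0,M_E)$. (3) With $m_e(z)=\int_0^\infty t^{z-1}e(t)\,dt$ (holomorphic on $\mathrm{Re}(z)>0$, continuous up to the boundary), $E(z)=\sum_{p\ge0}z^p/m_e(p)$. $(m_e(p))_{p\ge0}$ is a *sequence of moments* associated with $\mathbb{M}$. **Summability.** $\hat{\mathcal{B}}_{m_e,z}(\sum_p u_pz^p)=\sum_p\frac{u_p}{m_e(p)}z^p$. A series $\hat u\in\mathbb{E}[[z]]$ is $\mathbb{M}$-summable along direction $d$ if, for a moment sequence $m_e$ associated with $\mathbb{M}$, $\hat{\mathcal{B}}_{m_e,z}\hat u$ has positive radius of convergence and its sum extends to a function in $\mathcal{O}^{\mathbb{M}}(\hat S_d,\mathbb{E})$ for some $\hat S_d$. This does not depend on the kernel chosen. **Multisummability.** Let $\mathbb{M}_1,\mathbb{M}_2$ be strongly regular, admitting nonzero proximate orders, with $\omega(\mathbb{M}_1)<\omega(\mathbb{M}_2)<2$, and $|d_1-d_2|<\pi(\omega(\mathbb{M}_2)-\omega(\mathbb{M}_1))/2$. A series $\hat f\in\mathbb{E}[[z]]$ is $(\mathbb{M}_1,\mathbb{M}_2)$-summable in the multidirection $(d_1,d_2)$ if $\hat f=\hat f_1+\hat f_2$ with $\hat f_j\in\mathbb{E}[[z]]$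 being $\mathbb{M}_j$-summable along $d_j$, $j=1,2$. **Convention on coefficients.** A series in $(z,\varepsilon)$ is said to be (multi)summable with respect to $\varepsilon$ if it is so as a formal power series in $\varepsilon$ with coefficients in the Banach space $\mathbb{E}$ (with supremum norm) of functions of $z$ holomorphic on some disc centered at the origin (the disc may shrink from one series to another). A series in $\varepsilon$ only has coefficients in $\mathbb{C}$. **Moment derivative.** $\partial_{m,z}\left(\sum_{n\ge0}\frac{a_n}{m(n)}z^n\right)=\sum_{n\ge0}\frac{a_{n+1}}{m(n)}z^n$, acting on formal power series in $z$ (holomorphic functions near $0$ are identified with their Taylor series). $\mathcal{O}(\overline D)$ denotes functions holomorphic on $\overline D$.
   Formalization: The equation alone determines the formal solution (for f=0 it forces w=0, so ψ_0=1 is impossible); hence (i) is stated as: for every f the equation has a unique formal solution, and (∗) is solvable exactly when the ψ_j are the initial traces of that solution. *)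

(* Defs.v *)
From Stdlib Require Import Reals Lra Lia Arith FunctionalExtensionality ProofIrrelevance.
From Coquelicot Require Import Coquelicot.
Open Scope R_scope.

Record strongly_regular (M : nat -> R) : Prop := {
  sr_pos : forall p, 0 < M p;
  sr_0 : M 0%nat = 1;
  sr_lc : forall p, (1 <= p)%nat -> M p ^ 2 <= M (p - 1)%nat * M (p + 1)%nat;
  sr_mg : exists A, 0 < A /\
    forall p q, M (p + q)%nat <= A ^ (p + q) * M p * M q;
  sr_snq : exists A, 0 < A /\ forall p,
    let tail q := M (p + q)%nat / (INR (p + q + 1) * M (p + q + 1)%nat) in
    ex_series tail /\ Series tail <= A * (M p / M (p + 1)%nat)
}.

(** For [t > 0] the supremum is finite as soon as [M p ^ (1 / p)] tends to
    infinity, which holds for strongly regular sequences. *)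
Definition Mfun (M : nat -> R) (t : R) : R :=
  if Req_EM_T t 0 then 0
  else real (Sup_seq (fun p => Finite (ln (t ^ p / M p)))).

Definition limsup_p_infty (f : R -> R) : Rbar :=
  Rbar_glb (fun y => exists x : R,
    y = Lub_Rbar (fun v => exists r, x <= r /\ v = f r)).

(** The limsup lies in (0, +oo) for strongly regular sequences, so the values
    given by the library to the inverses of [0] and of infinity are not used. *)
Definition omega (M : nat -> R) : R :=
  real (Rbar_inv (limsup_p_infty (fun r => Rmax 0 (ln (Mfun M r) / ln r)))).

Definition seq_power (M : nat -> R) (s : R) : nat -> R :=
  fun p => Rpower (M p) s.

(** On each compact subinterval [rho] is continuous and C^1 up to the end points
    of the pieces of a finite subdivision. *)
Definition piecewise_C1 (c : R) (rho : R -> R) : Prop :=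
  forall u v, c < u -> u < v ->
  exists (n : nat) (x : nat -> R),
    x 0%nat = u /\ x n = v /\
    forall i, (i < n)%nat ->
      x i < x (S i) /\
      exists g : R -> R,
        (forall t, ex_derive g t /\ continuous (Derive g) t) /\
        (forall t, x i <= t <= x (S i) -> rho t = g t).

Record proximate_order (c : R) (rho : R -> R) (rho0 : R) : Prop := {
  po_nonneg : forall t, c < t -> 0 <= rho t;
  po_cont : forall t, c < t -> continuous rho t;
  po_C1 : piecewise_C1 c rho;
  po_lim : is_lim rho p_infty rho0;
  po_derive : filterlim (fun t => t * Derive rho t * ln t)
                (within (fun t => ex_derive rho t) (Rbar_locally p_infty))
                (locally 0)
}.

Definition admits_nonzero_proximate_order (M : nat -> R) : Prop :=
  exists (c : R) (rho : R -> R) (rho0 : R),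
    proximate_order c rho rho0 /\ 0 < rho0 /\
    exists B T : R, forall t, T < t ->
      Rabs (ln t * (rho t - ln (Mfun M t) / ln t)) <= B.

(** All sectors below have opening at most [2 * PI], so the sectors of the
    Riemann surface of the logarithm are identified with their projections on
    the punctured plane. *)
Definition sector (d theta : R) (z : C) : Prop :=
  exists r phi, 0 < r /\ Rabs (phi - d) < theta / 2 /\
    z = (r * cos phi, r * sin phi).

Definition disc (r : R) (z : C) : Prop := Cmod z < r.

Definition cdisc (r : R) (z : C) : Prop := Cmod z <= r.

Definition holomorphic_on {V : NormedModule C_AbsRing} (D : C -> Prop)
  (f : C -> V) : Prop :=
  forall z, D z -> ex_derive (K := C_AbsRing) (V := V) f z.

Definition holomorphic_on_cdisc (R0 : R) (f : C -> C) : Prop :=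
  exists R1, R0 < R1 /\ holomorphic_on (V := C_NormedModule) (disc R1) f.

Definition M_growth {V : NormedModule C_AbsRing} (M : nat -> R) (d theta : R)
  (f : C -> V) : Prop :=
  forall theta', 0 < theta' < theta ->
  exists c k, 0 < c /\ 0 < k /\
    forall z, sector d theta' z -> norm (f z) <= c * exp (Mfun M (Cmod z / k)).

Definition cpow (t : R) (w : C) : C :=
  (Rpower t (Re w) * cos (Im w * ln t), Rpower t (Re w) * sin (Im w * ln t)).

Record strong_kernel (M : nat -> R) (e E me : C -> C) : Prop := {
  ke_holo : holomorphic_on (V := C_NormedModule) (sector 0 (omega M * PI)) e;
  ke_real : forall x : R, 0 < x -> Im (e (RtoC x)) = 0;
  ke_zero : exists alpha, 0 < alpha /\
    forall d theta r, 0 < theta -> 0 < r ->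
      Rabs d + theta / 2 < omega M * PI / 2 ->
      exists c, 0 < c /\ forall z, sector d theta z -> disc r z ->
        Cmod (e z) <= c * Rpower (Cmod z) alpha;
  ke_infty : forall delta, 0 < delta ->
    exists c k, 0 < c /\ 0 < k /\
      forall z, sector 0 (omega M * PI - delta) z ->
        Cmod (e z) <= c * exp (- Mfun M (Cmod z / k));
  kE_holo : holomorphic_on (V := C_NormedModule) (fun _ => True) E;
  kE_growth : exists c k, 0 < c /\ 0 < k /\
    forall z, Cmod (E z) <= c * exp (Mfun M (Cmod z / k));
  kE_decay : exists beta, 0 < beta /\
    forall theta r, 0 < theta < 2 * PI - omega M * PI -> 0 < r ->
      exists c, 0 < c /\ forall z, sector PI theta z -> ~ disc r z ->
        Cmod (E z) <= c * Rpower (Cmod z) (- beta);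
  km_moment : forall z : C, 0 <= Re z ->
    is_RInt_gen (V := C_R_NormedModule)
      (fun t : R => Cmult (cpow t (Cminus z (RtoC 1))) (e (RtoC t)))
      (at_right 0) (Rbar_locally p_infty) (me z);
  km_holo : holomorphic_on (V := C_NormedModule) (fun z => 0 < Re z) me;
  km_cont : forall z : C, 0 <= Re z ->
    filterlim me (within (fun w : C => 0 <= Re w) (locally z)) (locally (me z));
  km_neq0 : forall p : nat, me (RtoC (INR p)) <> RtoC 0;
  km_series : forall z : C,
    is_pseries (K := C_AbsRing) (V := C_NormedModule)
      (fun p => Cinv (me (RtoC (INR p)))) z (E z)
}.

Definition moment_sequence (M m : nat -> R) : Prop :=
  strongly_regular M /\ admits_nonzero_proximate_order M /\ omega M < 2 /\
  exists e E me : C -> C, strong_kernel M e E me /\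
    forall p, me (RtoC (INR p)) = RtoC (m p).

(** The coefficient spaces in use are [C] and the Banach spaces [bhol r] below;
    completeness plays no role in the definitions. *)
Definition borel {V : NormedModule C_AbsRing} (m : nat -> R) (u : nat -> V) :
  nat -> V :=
  fun p => scal (RtoC (/ m p) : C_AbsRing) (u p).

Definition sum_near_0 {V : NormedModule C_AbsRing} (g : C -> V) (u : nat -> V) :
  Prop :=
  exists r, 0 < r /\
    forall z, disc r z -> is_pseries (K := C_AbsRing) (V := V) u z (g z).

Definition summable {V : NormedModule C_AbsRing} (M : nat -> R) (d : R)
  (u : nat -> V) : Prop :=
  exists m, moment_sequence M m /\
  exists (g : C -> V) (theta r : R),
    0 < theta <= 2 * PI /\ 0 < r /\
    holomorphic_on (fun z => sector d theta z \/ disc r z) g /\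
    M_growth M d theta g /\
    sum_near_0 g (borel m u).

Definition multisummable {V : NormedModule C_AbsRing} (M1 M2 : nat -> R)
  (d1 d2 : R) (u : nat -> V) : Prop :=
  exists u1 u2 : nat -> V,
    (forall n, u n = plus (u1 n) (u2 n)) /\
    summable M1 d1 u1 /\ summable M2 d2 u2.

(** Bounded holomorphic functions on the disc, with the supremum norm. The
    extension by [0] outside the disc makes the representation unique. *)
Record bhol (r : R) : Type := Bhol {
  bhol_fun :> C -> C;
  bhol_holo : holomorphic_on (V := C_NormedModule) (disc r) bhol_fun;
  bhol_bdd : exists B, forall z, disc r z -> Cmod (bhol_fun z) <= B;
  bhol_out : forall z, ~ disc r z -> bhol_fun z = RtoC 0
}.
Arguments Bhol {r}.

Lemma bhol_eq r (f g : bhol r) : (forall z, f z = g z) -> f = g.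
Proof.
destruct f as [f f1 f2 f3], g as [g g1 g2 g3]; simpl; intros H.
apply functional_extensionality in H; subst g.
f_equal; apply proof_irrelevance.
Qed.

Section BholNormedModule.

Variable r : R.
Implicit Types f g h : bhol r.

Definition bhol_zero : bhol r.
Proof.
exists (fun _ => RtoC 0).
- intros z _. apply (ex_derive_const (K := C_AbsRing) (V := C_NormedModule)).
- exists 0; intros; rewrite Cmod_0; lra.
- reflexivity.
Defined.

Definition bhol_plus f g : bhol r.
Proof.
exists (fun z => Cplus (f z) (g z)).
- intros z Hz.
  apply (ex_derive_plus (K := C_AbsRing) (V := C_NormedModule));
    apply bhol_holo, Hz.
- destruct (bhol_bdd r f) as [A HA], (bhol_bdd r g) as [B HB].
  exists (A + B); intros z Hz.
  eapply Rle_trans; [apply Cmod_triangle|].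
  specialize (HA z Hz); specialize (HB z Hz); lra.
- intros z Hz; rewrite (bhol_out r f z Hz), (bhol_out r g z Hz); apply Cplus_0_l.
Defined.

Definition bhol_scal (c : C) f : bhol r.
Proof.
exists (fun z => Cmult c (f z)).
- intros z Hz. destruct (bhol_holo r f z Hz) as [l Hl].
  exists (Cmult c l). unfold is_derive in *.
  eapply filterdiff_ext_lin.
  + apply (filterdiff_scal_r_fct (K := C_AbsRing)
      (U := AbsRing_NormedModule C_AbsRing) (V := C_NormedModule) c
      f _ Cmult_comm Hl).
  + intros y. change (Cmult c (Cmult y l) = Cmult y (Cmult c l)). ring.
- destruct (bhol_bdd r f) as [A HA].
  exists (Cmod c * A); intros z Hz. rewrite Cmod_mult.
  apply Rmult_le_compat_l; [apply Cmod_ge_0|auto].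
- intros z Hz; rewrite (bhol_out r f z Hz); apply Cmult_0_r.
Defined.

Definition bhol_opp f : bhol r := bhol_scal (RtoC (-1)) f.

Definition bhol_norm f : R :=
  real (Lub_Rbar (fun x => exists z, disc r z /\ x = Cmod (f z))).

Lemma bhol_norm_ub f z : Cmod (f z) <= Rmax 0 (bhol_norm f).
Proof.
destruct (Rlt_dec (Cmod z) r) as [Hz|Hz].
2:{ rewrite (bhol_out r f z Hz), Cmod_0. apply Rmax_l. }
eapply Rle_trans; [|apply Rmax_r].
unfold bhol_norm.
destruct (Lub_Rbar_correct (fun x => exists z, disc r z /\ x = Cmod (f z)))
  as [H1 H2].
destruct (bhol_bdd r f) as [B HB].
assert (Hle : Rbar_le (Lub_Rbar (fun x => exists z, disc r z /\ x = Cmod (f z))) B).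
{ apply H2; intros x [w [Hw ->]]; simpl; auto. }
assert (Hge := H1 (Cmod (f z)) (ex_intro _ z (conj Hz eq_refl))).
destruct (Lub_Rbar _); simpl in *; tauto || auto.
Qed.

Lemma bhol_norm_lub f B :
  0 <= B -> (forall z, disc r z -> Cmod (f z) <= B) -> bhol_norm f <= B.
Proof.
intros HB0 HB; unfold bhol_norm.
destruct (Lub_Rbar_correct (fun x => exists z, disc r z /\ x = Cmod (f z)))
  as [H1 H2].
assert (Hle : Rbar_le (Lub_Rbar (fun x => exists z, disc r z /\ x = Cmod (f z))) B).
{ apply H2; intros x [w [Hw ->]]; simpl; auto. }
destruct (Lub_Rbar _); simpl in *; tauto || auto.
Qed.

Lemma bhol_norm_ge0 f : 0 <= bhol_norm f.
Proof.
destruct (Rlt_dec 0 r) as [Hr|Hr].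
- assert (H0 : disc r (RtoC 0)) by (unfold disc; rewrite Cmod_0; exact Hr).
  unfold bhol_norm.
  destruct (Lub_Rbar_correct (fun x => exists z, disc r z /\ x = Cmod (f z)))
    as [H1 H2].
  assert (Hge := H1 (Cmod (f (RtoC 0))) (ex_intro _ _ (conj H0 eq_refl))).
  assert (Hp := Cmod_ge_0 (f (RtoC 0))).
  destruct (Lub_Rbar _); simpl in *; lra.
- unfold bhol_norm.
  rewrite (is_lub_Rbar_unique _ m_infty); [apply Rle_refl|].
  split; [|intros; exact I].
  intros x [z [Hz _]]; unfold disc in Hz.
  assert (H := Cmod_ge_0 z); lra.
Qed.

Lemma bhol_norm_le f z : Cmod (f z) <= bhol_norm f.
Proof.
assert (H := bhol_norm_ub f z).
rewrite Rmax_right in H; [exact H|apply bhol_norm_ge0].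
Qed.

Definition bhol_AbelianMonoid_mixin : AbelianMonoid.mixin_of (bhol r).
Proof.
apply (AbelianMonoid.Mixin (bhol r) bhol_plus bhol_zero).
- intros f g; apply bhol_eq; intros z; apply Cplus_comm.
- intros f g h; apply bhol_eq; intros z; apply Cplus_assoc.
- intros f; apply bhol_eq; intros z; apply Cplus_0_r.
Defined.

Canonical bhol_AbelianMonoid :=
  AbelianMonoid.Pack (bhol r) bhol_AbelianMonoid_mixin (bhol r).

Definition bhol_AbelianGroup_mixin : AbelianGroup.mixin_of bhol_AbelianMonoid.
Proof.
apply (AbelianGroup.Mixin bhol_AbelianMonoid bhol_opp).
intros f; apply bhol_eq; intros z.
change (Cplus (f z) (Cmult (RtoC (-1)) (f z)) = RtoC 0).
apply injective_projections; simpl; ring.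
Defined.

Canonical bhol_AbelianGroup :=
  AbelianGroup.Pack (bhol r)
    (AbelianGroup.Class (bhol r) bhol_AbelianMonoid_mixin
       bhol_AbelianGroup_mixin) (bhol r).

Definition bhol_ModuleSpace_mixin :
  ModuleSpace.mixin_of C_Ring bhol_AbelianGroup.
Proof.
apply (ModuleSpace.Mixin C_Ring bhol_AbelianGroup bhol_scal).
- intros a b f; apply bhol_eq; intros z; apply Cmult_assoc.
- intros f; apply bhol_eq; intros z; apply Cmult_1_l.
- intros a f g; apply bhol_eq; intros z; apply Cmult_plus_distr_l.
- intros a b f; apply bhol_eq; intros z; apply Cmult_plus_distr_r.
Defined.

Canonical bhol_ModuleSpace :=
  ModuleSpace.Pack C_Ring (bhol r)
    (ModuleSpace.Class C_Ring (bhol r) _ bhol_ModuleSpace_mixin) (bhol r).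

Definition bhol_ball f (eps : R) g : Prop := bhol_norm (minus g f) < eps.

Lemma bhol_norm_eq f g :
  (forall z, Cmod (f z) = Cmod (g z)) -> bhol_norm f = bhol_norm g.
Proof.
intros H; unfold bhol_norm; f_equal; apply Lub_Rbar_eqset.
intros x; split; intros [z [Hz ->]]; exists z; split; auto.
Qed.

Lemma bhol_norm_triangle f g : bhol_norm (plus f g) <= bhol_norm f + bhol_norm g.
Proof.
apply bhol_norm_lub.
- assert (H := bhol_norm_ge0 f); assert (H' := bhol_norm_ge0 g); lra.
- intros z _; change (Cmod (Cplus (f z) (g z)) <= bhol_norm f + bhol_norm g).
  eapply Rle_trans; [apply Cmod_triangle|].
  apply Rplus_le_compat; apply bhol_norm_le.
Qed.

Definition bhol_UniformSpace_mixin : UniformSpace.mixin_of (bhol r).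
Proof.
apply (UniformSpace.Mixin (bhol r) bhol_zero bhol_ball).
- intros f eps; unfold bhol_ball.
  apply Rle_lt_trans with 0; [|apply cond_pos].
  apply bhol_norm_lub; [lra|]; intros z _.
  rewrite minus_eq_zero; change (Cmod (RtoC 0) <= 0); rewrite Cmod_0; lra.
- intros f g eps H; unfold bhol_ball in *.
  rewrite (bhol_norm_eq (minus f g) (minus g f)); [exact H|].
  intros z.
  change (Cmod (Cplus (f z) (Cmult (RtoC (-1)) (g z))) =
          Cmod (Cplus (g z) (Cmult (RtoC (-1)) (f z)))).
  rewrite <- Cmod_opp; f_equal; apply injective_projections; simpl; ring.
- intros f g h e1 e2 H1 H2; unfold bhol_ball in *.
  rewrite (minus_trans g h f).
  eapply Rle_lt_trans; [apply bhol_norm_triangle|lra].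
Defined.

Canonical bhol_UniformSpace :=
  UniformSpace.Pack (bhol r) bhol_UniformSpace_mixin (bhol r).

Canonical bhol_NormedModuleAux :=
  NormedModuleAux.Pack C_AbsRing (bhol r)
    (NormedModuleAux.Class C_AbsRing (bhol r)
       (ModuleSpace.class C_Ring bhol_ModuleSpace) bhol_UniformSpace_mixin)
    (bhol r).

Definition bhol_NormedModule_mixin :
  NormedModule.mixin_of C_AbsRing bhol_NormedModuleAux.
Proof.
apply (NormedModule.Mixin C_AbsRing bhol_NormedModuleAux bhol_norm 1).
- apply bhol_norm_triangle.
- intros c f. apply bhol_norm_lub.
  + apply Rmult_le_pos; [apply Cmod_ge_0|apply bhol_norm_ge0].
  + intros z _; change (Cmod (Cmult c (f z)) <= Cmod c * bhol_norm f).
    rewrite Cmod_mult.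
    apply Rmult_le_compat_l; [apply Cmod_ge_0|apply bhol_norm_le].
- intros f g eps H; exact H.
- intros f g eps H; rewrite Rmult_1_l; exact H.
- intros f H; apply bhol_eq; intros z.
  change (f z = RtoC 0); apply Cmod_eq_0, Rle_antisym; [|apply Cmod_ge_0].
  rewrite <- H; apply bhol_norm_le.
Defined.

Canonical bhol_NormedModule :=
  NormedModule.Pack C_AbsRing (bhol r)
    (NormedModule.Class C_AbsRing (bhol r)
       (NormedModuleAux.class C_AbsRing bhol_NormedModuleAux)
       bhol_NormedModule_mixin)
    (bhol r).

End BholNormedModule.

(** [u : nat -> C] stands for the series with coefficient [u n] of [z ^ n], and
    [w : nat -> nat -> C] for the series with coefficient [w l n] of
    [eps ^ l * z ^ n]; thus [w l] is the coefficient of [eps ^ l], a series in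
    [z]. *)
Notation fps := (nat -> C).
Notation fps2 := (nat -> nat -> C).

(** [(z, eps)]-series seen as power series in [eps] with coefficients in the
    Banach space of bounded holomorphic functions on some disc. *)
Definition multisummable_eps (M1 M2 : nat -> R) (d1 d2 : R) (w : fps2) : Prop :=
  exists r, 0 < r /\ exists v : nat -> bhol r,
    (forall l, sum_near_0 (V := C_NormedModule) (v l) (w l)) /\
    multisummable M1 M2 d1 d2 v.

Definition coeffs_holomorphic (R0 : R) (w : fps2) : Prop :=
  forall l, exists g, holomorphic_on_cdisc R0 g /\
    sum_near_0 (V := C_NormedModule) g (w l).

Definition fps_mul (u v : fps) : fps :=
  fun n => sum_n (G := C_AbelianMonoid) (fun i => Cmult (u i) (v (n - i)%nat)) n.

Definition mul_eps_pow (k : nat) (w : fps2) : fps2 :=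
  fun l n => if (l <? k)%nat then RtoC 0 else w (l - k)%nat n.

(** If [u n = a n / m n], the moment derivative has coefficients
    [a (n + 1) / m n]. *)
Definition moment_derive (m : nat -> R) (u : fps) : fps :=
  fun n => Cmult (RtoC (m (S n) / m n)) (u (S n)).

Definition moment_derive_z (m : nat -> R) (j : nat) (w : fps2) : fps2 :=
  fun l => Nat.iter j (moment_derive m) (w l).

Definition at_z0 (w : fps2) : fps := fun l => w l 0%nat.

Definition sp_equation (k p : nat) (m : nat -> R) (a : fps) (f w : fps2) : Prop :=
  forall l n,
    Cminus (mul_eps_pow k (fun l' => fps_mul a (moment_derive_z m p w l')) l n)
           (w l n)
    = f l n.

(** Since [k >= 1], the equation alone determines [w] order by order in [eps];
    the problem is solvable only for the family [psi] of the traces of that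
    series. *)
Definition sp_solution (k p : nat) (m : nat -> R) (a : fps) (f : fps2)
  (psi : nat -> fps) (w : fps2) : Prop :=
  sp_equation k p m a f w /\
  forall j, (j < p)%nat -> forall l, at_z0 (moment_derive_z m j w) l = psi j l.

(* Main.v *)
Require Import Defs.
From Stdlib Require Import Reals Lra Lia Arith ClassicalEpsilon FunctionalExtensionality.
From Coquelicot Require Import Coquelicot.
Open Scope R_scope.
Set Bullet Behavior "Strict Subproofs".

(** The proof reduces the theorem to families of scalar series in [eps]. Let [W n]
    be the coefficient of [z ^ n] in a series. By Cauchy's estimates
    ([bcoef_functional], [summable_functional]) a summable series yields Borel sums
    of all the [W n] on one common domain, with bounds [C0 * B ^ n] times one
    growth function; conversely such a family ([GBS]) reassembles to a summable
    series on a small disc ([assemble]). Summability with respect to [eps] is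
    therefore a question about bounds of geometric growth in [n].

    In coefficients the equation says that [f] is the [residual] of [w]: a shift by
    [k] in [eps] of a convolution in [z] with weights [m2 (n + p) / m2 n], minus
    [w]. These weights grow at most geometrically, so the residual of each of the
    two summands of [w] is summable, and so is each trace.

    Conversely, as [a] does not vanish at 0, the equation determines the
    coefficients in [z] recursively. A step by [p] in [z] divides by
    [m2 (n + p) / m2 n] and shifts by [k] in [eps]. Dropping [n] terms of a series
    that is summable for [N] multiplies the bounds by [A ^ n * N n] ([BS_shift]).
    For [N] the power [sigma] of [M] with [sigma * k <= s2 * p], logarithmic
    convexity bounds the cost [N (k * s)] of [s] steps by a geometric factor times
    [m2 (p * s)] ([shift_cost]), which is what the divisions gain. The induction
    [recursion_GBS] controls all the shifts of all the coefficients at once. It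
    applies to both exponents, [s1] and [s2 * p / k]: each pair of summands of [f]
    and of the traces defines a summable solution, and by uniqueness the two
    solutions add up to [w].

    Two analytic facts carry this. The first is [multiplier_operator]: a Laplace
    transform with kernel [e], a division by [z ^ n] and a Borel transform with
    kernel [E] compose to an operator that multiplies Taylor coefficients by
    quotients of moments. It gives [BS_shift] and the independence of the moment
    sequence. Near the origin it is termwise integration; on the sector a contour
    is deformed, and the decay of [e] beats the growth of [E].

    The second is [moment_sequence_growth]: a moment sequence [m] of a strongly
    regular [N] is comparable with [N], and so are the quotients of consecutive
    terms. For the quotients one needs that the Mellin transform of [e], which
    interpolates [m], has no zeros with positive real part ([Mellin_neq_0]): then
    it varies by bounded factors at unit distance, because a zero-free function is
    controlled by the Borel-Caratheodory inequality ([zero_free_ratio]). The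
    integral of [E (x * t) * e t / t] is [1 / (1 - x)]. If the transform vanished
    at [s], integrating [x ^ (- s)] times this identity around the origin would
    give a contour integral that tends to zero, against the nonzero residue at
    [x = 1].

    The formal solution comes from a recursion on the powers of [eps]
    ([formal_solution]); since the quotients of consecutive moments grow more
    slowly than any geometric sequence, it preserves holomorphy on the closed disc
    ([solution_holomorphic]). *)

(** [step tac] bounds the left-hand side of an inequality by [tac] and leaves the
    comparison of that bound with the right-hand side; [through x] inserts [x], and
    [times x] multiplies both sides by [x]. *)
Tactic Notation "step" tactic3(tac) :=
  lazymatch goal with |- _ < _ => eapply Rle_lt_trans | _ => eapply Rle_trans end; [tac|].
Tactic Notation "times" constr(x) := apply Rmult_le_reg_r with x.
Tactic Notation "through" constr(x) := apply Rle_trans with x.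
Tactic Notation "have" ident(H) ":" lconstr(T) "by" tactic3(tac) := assert (H : T) by tac.
Tactic Notation "have" ident(H) ":" lconstr(T) := assert (H : T).
Tactic Notation "have" ident(H) ":=" lconstr(t) := assert (H := t).

Lemma exp_mono x y : x <= y -> exp x <= exp y.
Proof. intros [H| ->]; [left; apply exp_increasing, H|right; reflexivity]. Qed.

Lemma C_ext (a b : C) : Re a = Re b -> Im a = Im b -> a = b.
Proof. destruct a, b; simpl; intros -> ->; reflexivity. Qed.

(** [pos] proves that a real is (strictly) positive by following its structure,
    and [bound] compares two expressions of the same shape. Facts about functions
    defined later are added to [pos_fact]. *)
Ltac pos_fact := fail.

Ltac pos := lazymatch goal with
  | |- ?a > ?b => change (b < a); pos
  | |- _ <> 0 => apply Rgt_not_eq; pos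
  | |- _ => first [assumption | lra | pos_fact
    | lazymatch goal with
      | |- 0 < ?e => lazymatch e with
        | _ * _ => apply Rmult_lt_0_compat; pos
        | _ / _ => apply Rdiv_lt_0_compat; pos
        | / _ => apply Rinv_0_lt_compat; pos
        | _ ^ _ => apply pow_lt; pos
        | exp _ => apply exp_pos
        | Rmin _ _ => apply Rmin_pos; pos
        | INR _ => apply lt_0_INR; lia
        | _ + _ => first [apply Rplus_lt_0_compat; pos | apply Rplus_lt_le_0_compat; pos
                         | apply Rplus_le_lt_0_compat; pos]
        end
      | |- 0 <= ?e => lazymatch e with
        | Cmod _ => apply Cmod_ge_0
        | Rabs _ => apply Rabs_pos
        | norm _ => apply norm_ge_0
        | INR _ => apply pos_INR
        | _ * _ => apply Rmult_le_pos; pos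
        | _ / _ => apply Rmult_le_pos; pos
        | _ ^ 2 => apply pow2_ge_0
        | _ ^ _ => apply pow_le; pos
        | _ + _ => apply Rplus_le_le_0_compat; pos
        | _ => left; pos
        end
      end]
  end.

Ltac bound := lazymatch goal with
  | |- ?g => tryif has_evar g then fail else idtac end;
  first [ pos | lazymatch goal with
  | |- _ /\ _ => split; bound
  | |- ?a * _ <= ?a * _ => apply Rmult_le_compat_l; bound
  | |- _ * ?a <= _ * ?a => apply Rmult_le_compat_r; bound
  | |- _ * _ <= _ * _ => apply Rmult_le_compat; bound
  | |- _ / _ <= _ / _ => apply Rmult_le_compat; bound
  | |- / _ <= / _ => apply Rinv_le_contravar; bound
  | |- _ ^ _ <= _ ^ _ => apply pow_incr; bound
  | |- exp _ <= exp _ => apply exp_mono; bound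
  | |- _ + _ <= _ + _ => apply Rplus_le_compat; bound
  | |- Rabs _ <= _ => apply Rabs_le_between; lra
  | |- Rabs _ < _ => apply Rabs_lt_between; lra
  | |- @eq R _ _ => first [ring | field; repeat split; pos]
  | |- @eq C _ _ => first [ring | apply C_ext; simpl; ring]
  end | solve [auto] | lazymatch goal with
  | |- _ / _ <= _ => apply Rle_div_l; [pos|lra]
  | |- _ / _ < _ => apply Rlt_div_l; [pos|lra]
  | |- _ <= _ / _ => apply Rle_div_r; [pos|lra]
  | |- _ < _ / _ => apply Rlt_div_r; [pos|lra]
  | |- @eq nat _ _ => lia
  | |- (_ <= _)%nat => lia
  | |- (_ < _)%nat => lia
  end ].

(** * Complex numbers and the exponential *)

Lemma Cmod_minus_sym (a b : C) : Cmod (a - b) = Cmod (b - a).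
Proof. rewrite <- Cmod_opp. f_equal. ring. Qed.

Lemma Cmod_minus_self (z : C) : Cmod (z - z) = 0.
Proof. replace (z - z)%C with (RtoC 0) by ring. apply Cmod_0. Qed.

Lemma Cmod_triangle_minus (a b : C) : Cmod (a - b) <= Cmod a + Cmod b.
Proof.
unfold Cminus. step apply Cmod_triangle. rewrite Cmod_opp. lra.
Qed.

Lemma Cmod_triangle_3 (a b c : C) : Cmod (a - c) <= Cmod (a - b) + Cmod (b - c).
Proof. replace (a - c)%C with ((a - b) + (b - c))%C by ring. apply Cmod_triangle. Qed.

Lemma Cmod_triangle_inv (a b : C) : Cmod a - Cmod b <= Cmod (a - b).
Proof.
have H := Cmod_triangle (a - b) b.
replace (a - b + b)%C with a in H by ring. lra.
Qed.

Lemma im_le_Cmod (c : C) : Rabs (Im c) <= Cmod c.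
Proof. have H := Rmax_Cmod c. step apply Rmax_r. exact H. Qed.

Lemma Cmod_le_Re_Im (c : C) : Cmod c <= Rabs (Re c) + Rabs (Im c).
Proof.
replace c with (RtoC (Re c) + Ci * RtoC (Im c))%C at 1
  by (destruct c; apply C_ext; simpl; ring).
step apply Cmod_triangle.
rewrite Cmod_mult, Cmod_Ci, !Cmod_R. lra.
Qed.

Lemma Cmod_eq_0_minus (a b : C) : Cmod (a - b) <= 0 -> a = b.
Proof.
intros H. have Hz : (a - b)%C = 0%C.
{ apply Cmod_eq_0. apply Rle_antisym; [exact H|apply Cmod_ge_0]. }
replace a with ((a - b) + b)%C by ring. rewrite Hz. ring.
Qed.

Lemma Ceq_limit (a b : C) :
  (forall eps, 0 < eps -> Cmod (a - b) <= eps) -> a = b.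
Proof.
intros H. apply Cmod_eq_0_minus. apply le_epsilon. intros e He.
rewrite Rplus_0_l. auto.
Qed.

Lemma Cneq_0_of_Cmod (z : C) : 0 < Cmod z -> z <> 0%C.
Proof. intros H ->. rewrite Cmod_0 in H. lra. Qed.

Lemma Cmult_neq_0 (a b : C) : a <> 0%C -> b <> 0%C -> (a * b)%C <> 0%C.
Proof.
intros Ha Hb. apply Cneq_0_of_Cmod. rewrite Cmod_mult.
apply Rmult_lt_0_compat; apply Cmod_gt_0; assumption.
Qed.

Definition mkC (x y : R) : C := (x, y).

Definition Cexp (z : C) : C := (exp (Re z) * cos (Im z), exp (Re z) * sin (Im z)).

Lemma Cexp_add (a b : C) : Cexp (a + b) = (Cexp a * Cexp b)%C.
Proof.
unfold Cexp; destruct a, b; apply C_ext; simpl;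
rewrite exp_plus, ?cos_plus, ?sin_plus; ring.
Qed.

Lemma Cexp_0 : Cexp 0 = 1%C.
Proof. unfold Cexp; apply C_ext; simpl; rewrite exp_0, ?cos_0, ?sin_0; ring. Qed.

Lemma Cmod_Cexp (z : C) : Cmod (Cexp z) = exp (Re z).
Proof.
unfold Cmod, Cexp; simpl.
replace (_ * _ + _)
  with (exp (Re z) * exp (Re z) * (Rsqr (sin (Im z)) + Rsqr (cos (Im z))))
  by (unfold Rsqr; ring).
rewrite sin2_cos2, Rmult_1_r. apply sqrt_square. left; apply exp_pos.
Qed.

Lemma Cexp_neq_0 (z : C) : Cexp z <> 0%C.
Proof. apply Cneq_0_of_Cmod. rewrite Cmod_Cexp. apply exp_pos. Qed.

Lemma Cexp_opp (z : C) : Cexp (- z) = (/ Cexp z)%C.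
Proof.
have H : (Cexp (- z) * Cexp z)%C = 1%C.
{ rewrite <- Cexp_add. replace (- z + z)%C with (RtoC 0) by ring. apply Cexp_0. }
rewrite <- (Cmult_1_l (/ Cexp z)), <- H. field. apply Cexp_neq_0.
Qed.

Lemma Cexp_R (x : R) : Cexp x = RtoC (exp x).
Proof. unfold Cexp; apply C_ext; simpl; rewrite ?cos_0, ?sin_0; ring. Qed.

Lemma Cexp_pow (z : C) n : Cexp (INR n * z)%C = (Cexp z ^ n)%C.
Proof.
induction n.
- simpl. rewrite Cmult_0_l. apply Cexp_0.
- rewrite S_INR, RtoC_plus, Cmult_plus_distr_r, Cmult_1_l, Cexp_add, IHn.
  simpl. ring.
Qed.

Lemma Cexp_2PI (z : C) : Cexp (z + mkC 0 (2 * PI))%C = Cexp z.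
Proof.
rewrite Cexp_add. replace (Cexp (mkC 0 (2 * PI))) with (RtoC 1); [ring|].
unfold Cexp; apply C_ext; simpl; rewrite exp_0, ?cos_2PI, ?sin_2PI; ring.
Qed.

Lemma polar (r phi : R) : 0 < r -> (r * cos phi, r * sin phi) = Cexp (mkC (ln r) phi).
Proof. intros H; unfold Cexp; simpl; rewrite exp_ln by exact H; reflexivity. Qed.

Lemma exp_INR_mult n t : exp (INR n * t) = exp t ^ n.
Proof.
induction n; [simpl; rewrite Rmult_0_l, exp_0; reflexivity|].
rewrite S_INR, Rmult_plus_distr_r, Rmult_1_l, exp_plus, IHn. simpl. ring.
Qed.

Lemma Re_R_mult (x : R) z : Re (x * z) = x * Re z.
Proof. unfold Re. simpl. ring. Qed.

Lemma Re_mult_real s t : Re (s * mkC t 0) = Re s * t.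
Proof. unfold Re. simpl. ring. Qed.

Lemma Cmod_Cexp_le (c v : C) : Cmod (Cexp (c * v)) <= exp (Cmod c * Cmod v).
Proof.
rewrite Cmod_Cexp, <- Cmod_mult. apply exp_mono.
step apply Rle_abs. apply re_le_Cmod.
Qed.

(** * Complex differentiability *)

Definition Cder (f : C -> C) (z l : C) : Prop :=
  forall eps, 0 < eps -> exists d, 0 < d /\ forall y, Cmod (y - z) < d ->
    Cmod (f y - f z - l * (y - z)) <= eps * Cmod (y - z).

Definition holo (D : C -> Prop) (f : C -> C) : Prop :=
  forall z, D z -> exists l, Cder f z l.

Definition Copen (D : C -> Prop) : Prop :=
  forall z, D z -> exists d, 0 < d /\ forall y, Cmod (y - z) < d -> D y.

Definition Ccts (f : C -> C) (z : C) : Prop :=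
  forall eps, 0 < eps -> exists d, 0 < d /\ forall y, Cmod (y - z) < d ->
    Cmod (f y - f z) < eps.

Lemma is_derive_eps {V : NormedModule C_AbsRing} (f : C -> V) (z : C) (l : V) :
  is_derive (K := C_AbsRing) f z l <->
  (forall eps, 0 < eps -> exists d, 0 < d /\ forall y, Cmod (y - z) < d ->
    norm (minus (minus (f y) (f z)) (scal ((y - z)%C : C_AbsRing) l))
      <= eps * Cmod (y - z)).
Proof.
split.
- intros [_ H] eps Heps.
  have Hz : is_filter_lim
    (locally (z : AbsRing_UniformSpace C_AbsRing)) z by (intros P HP; exact HP).
  destruct (H z Hz (mkposreal eps Heps)) as [d Hd].
  exists d; split; [apply cond_pos|]. intros y Hy. exact (Hd y Hy).
- intros H. split.
  + apply is_linear_scal_l.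
  + intros x Hx eps.
    have Ez : z = x.
    { apply (is_filter_lim_locally_unique (K := C_AbsRing)
        (V := AbsRing_NormedModule C_AbsRing)). exact Hx. }
    subst x.
    destruct (H eps (cond_pos eps)) as [d [Hd Hd']].
    exists (mkposreal d Hd). intros y Hy. apply Hd'. exact Hy.
Qed.

Lemma is_derive_Cder (f : C -> C) (z l : C) :
  is_derive (K := C_AbsRing) (V := C_NormedModule) f z l <-> Cder f z l.
Proof.
rewrite is_derive_eps. split; intros H eps He;
destruct (H eps He) as [d [Hd Hd']]; exists d; split; try exact Hd;
intros y Hy; specialize (Hd' y Hy).
- rewrite (Cmult_comm l). exact Hd'.
- rewrite (Cmult_comm l) in Hd'. exact Hd'.
Qed.

Lemma holomorphic_on_holo (D : C -> Prop) (f : C -> C) :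
  holomorphic_on (V := C_NormedModule) D f <-> holo D f.
Proof.
split; intros H z Hz; destruct (H z Hz) as [l Hl]; exists l;
apply is_derive_Cder; exact Hl.
Qed.

Lemma Cder_ext_loc (f g : C -> C) z l :
  (exists d, 0 < d /\ forall y, Cmod (y - z) < d -> f y = g y) ->
  Cder f z l -> Cder g z l.
Proof.
intros [d [Hd Heq]] H eps He. destruct (H eps He) as [d' [Hd' H']].
exists (Rmin d d'); split; [apply Rmin_pos; assumption|].
intros y Hy.
rewrite <- (Heq y) by (eapply Rlt_le_trans; [exact Hy|apply Rmin_l]).
rewrite <- (Heq z).
- apply H'. eapply Rlt_le_trans; [exact Hy|apply Rmin_r].
- replace (z - z)%C with (RtoC 0) by ring. rewrite Cmod_0; exact Hd.
Qed.

Lemma Cder_ext (f g : C -> C) z l :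
  (forall y, f y = g y) -> Cder f z l -> Cder g z l.
Proof. intros H. apply Cder_ext_loc. exists 1; split; [lra|auto]. Qed.

Lemma Cder_eq (f : C -> C) z l l' : l = l' -> Cder f z l -> Cder f z l'.
Proof. intros ->; auto. Qed.

(** [C] carries two equivalent uniform structures. The one of a valued ring is
    the one for which the usual rules of calculus are available. *)
Notation C_absU := (AbsRing_UniformSpace C_AbsRing).
Notation C_abs := (AbsRing_NormedModule C_AbsRing).

Lemma Cder_is_derive (f : C -> C) (z l : C) :
  Cder f z l <-> is_derive (K := C_AbsRing) (V := C_abs) f z l.
Proof.
rewrite is_derive_eps. split; intros H eps He; destruct (H eps He) as [d [Hd H']]; exists d;
(split; [exact Hd|]); intros y Hy; specialize (H' y Hy); rewrite (Cmult_comm l) in *; exact H'.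
Qed.

Lemma continuous_C_eps {K : AbsRing} (f : K -> C) (t : K) :
  continuous (U := C_absU) f t <->
  forall eps, 0 < eps -> exists d, 0 < d /\ forall s, abs (minus s t) < d -> Cmod (f s - f t) < eps.
Proof.
split.
- intros H eps He.
  destruct (proj1 (filterlim_locally (U := C_absU) f (f t)) H (mkposreal eps He)) as [d Hd].
  exists d. split; [apply cond_pos|]. exact Hd.
- intros H. apply (filterlim_locally (U := C_absU)). intros eps.
  destruct (H eps (cond_pos eps)) as [d [Hd Hd']]. exists (mkposreal d Hd). exact Hd'.
Qed.

Lemma Ccts_continuous (f : C -> C) z :
  Ccts f z <-> continuous (T := C_absU) (U := C_absU) f z.
Proof. symmetry. exact (continuous_C_eps (K := C_AbsRing) f z). Qed.

Lemma Cder_Ccts f z l : Cder f z l -> Ccts f z.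
Proof.
rewrite Cder_is_derive, Ccts_continuous. intros H.
exact (ex_derive_continuous (K := C_AbsRing) (V := C_abs) f z (ex_intro _ l H)).
Qed.

Lemma diff_Ccts f z : (exists l, Cder f z l) -> Ccts f z.
Proof. intros [l Hl]. exact (Cder_Ccts f z l Hl). Qed.

Lemma Ccts_mult f h z : Ccts f z -> Ccts h z -> Ccts (fun x => f x * h x)%C z.
Proof. rewrite !Ccts_continuous. exact (continuous_mult (U := C_absU) (K := C_AbsRing) f h z). Qed.

Lemma Cder_const c z : Cder (fun _ => c) z 0.
Proof. apply Cder_is_derive. exact (is_derive_const (K := C_AbsRing) (V := C_abs) c z). Qed.

Lemma Cder_id z : Cder (fun x => x) z 1.
Proof. apply Cder_is_derive. exact (is_derive_id (K := C_AbsRing) z). Qed.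

Lemma Cder_plus f g z l m : Cder f z l -> Cder g z m -> Cder (fun x => f x + g x)%C z (l + m)%C.
Proof. rewrite !Cder_is_derive. exact (is_derive_plus (K := C_AbsRing) (V := C_abs) f g z l m). Qed.

Lemma Cder_comp f g z l m :
  Cder g z m -> Cder f (g z) l -> Cder (fun x => f (g x)) z (l * m)%C.
Proof.
rewrite !Cder_is_derive, (Cmult_comm l). intros Hg Hf.
exact (is_derive_comp (K := C_AbsRing) (V := C_abs) f g z l m Hf Hg).
Qed.

Lemma Cder_mult f g z l m : Cder f z l -> Cder g z m ->
  Cder (fun x => f x * g x)%C z (l * g z + f z * m)%C.
Proof.
rewrite !Cder_is_derive. intros Hf Hg.
exact (is_derive_mult (K := C_AbsRing) f g z l m Hf Hg Cmult_comm).
Qed.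

Lemma Cder_scal a f z l : Cder f z l -> Cder (fun x => a * f x)%C z (a * l)%C.
Proof. intros H. eapply Cder_eq; [|apply (Cder_mult _ _ _ _ _ (Cder_const a z) H)]. cbv beta. ring. Qed.

Lemma Cder_mult_id a z : Cder (fun x => a * x)%C z a.
Proof. eapply Cder_eq; [|apply Cder_scal, Cder_id]. ring. Qed.

Lemma Cder_sqr z : Cder (fun x => x * x)%C z (z + z)%C.
Proof. eapply Cder_eq; [|apply (Cder_mult (fun x => x) (fun x => x)); apply Cder_id]. cbv beta. ring. Qed.

Lemma Cder_inv_id (z : C) : z <> 0%C -> Cder (fun x => / x)%C z (- / (z * z))%C.
Proof.
intros Hz eps He.
have Hm : 0 < Cmod z by (apply Cmod_gt_0; exact Hz).
exists (Rmin (Cmod z / 2) (eps * (Cmod z * Cmod z * Cmod z) / 2)); split.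
{ apply Rmin_pos; [lra|]. apply Rdiv_lt_0_compat; [|lra].
  repeat apply Rmult_lt_0_compat; lra. }
intros y Hy.
have Hy1 := Rlt_le_trans _ _ _ Hy (Rmin_l _ _).
have Hy2 := Rlt_le_trans _ _ _ Hy (Rmin_r _ _).
have Hym : Cmod z / 2 < Cmod y.
{ have H := Cmod_triangle_inv z y. rewrite Cmod_minus_sym in H. lra. }
have Hy0 : y <> 0%C by (apply Cneq_0_of_Cmod; lra).
replace (/ y - / z - - / (z * z) * (y - z))%C
  with ((y - z) * (y - z) * / (z * z * y))%C by (field; split; assumption).
rewrite !Cmod_mult, Cmod_inv, !Cmod_mult
  by (repeat apply Cmult_neq_0; assumption).
rewrite (Rmult_comm eps), Rmult_assoc. apply Rmult_le_compat_l; [apply Cmod_ge_0|].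
times (Cmod z * Cmod z * Cmod y).
{ repeat apply Rmult_lt_0_compat; lra. }
rewrite Rmult_assoc, Rinv_l, Rmult_1_r.
2:{ apply Rgt_not_eq. repeat apply Rmult_lt_0_compat; lra. }
apply Rlt_le. eapply Rlt_le_trans; [exact Hy2|].
replace (eps * (Cmod z * Cmod z * Cmod z) / 2)
  with (eps * (Cmod z * Cmod z) * (Cmod z / 2)) by field.
replace (eps * (Cmod z * Cmod z * Cmod y)) with (eps * (Cmod z * Cmod z) * Cmod y) by ring.
apply Rmult_le_compat_l; [|lra].
apply Rmult_le_pos; [lra|]. apply Rmult_le_pos; lra.
Qed.

Lemma Cder_inv (f : C -> C) z l : f z <> 0%C -> Cder f z l ->
  Cder (fun x => / f x)%C z (- / (f z * f z) * l)%C.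
Proof. intros Hz H. apply (Cder_comp (fun x => / x)%C f z _ l H). apply Cder_inv_id, Hz. Qed.

Lemma Cder_Cexp z : Cder Cexp z (Cexp z).
Proof.
have H0 : forall eps, 0 < eps -> exists d, 0 < d /\ forall h, Cmod h < d ->
  Cmod (Cexp h - 1 - h) <= eps * Cmod h.
{ intros eps He.
  have Hx := derivable_pt_lim_exp 0. have Hc := derivable_pt_lim_cos 0.
  have Hs := derivable_pt_lim_sin 0.
  pose (e := Rmin (eps / 8) 1).
  have Hepos : 0 < e by (apply Rmin_pos; lra).
  destruct (Hx e Hepos) as [d1 H1]. destruct (Hc e Hepos) as [d2 H2].
  destruct (Hs e Hepos) as [d3 H3].
  rewrite exp_0 in H1. rewrite sin_0 in H2. rewrite cos_0 in H3.
  have G : forall (F : R -> R) (F0 L d : R),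
    (forall h, h <> 0 -> Rabs h < d -> Rabs ((F (0 + h) - F0) / h - L) < e) ->
    F 0 = F0 -> forall h, Rabs h < d -> Rabs (F h - F0 - L * h) <= e * Rabs h.
  { intros F F0 L d HF HF0 h Hh. destruct (Req_dec h 0) as [->|Hn].
    - rewrite HF0. replace (F0 - F0 - L * 0) with 0 by ring.
      rewrite Rabs_R0. lra.
    - specialize (HF h Hn Hh). rewrite Rplus_0_l in HF.
      replace (F h - F0 - L * h) with (((F h - F0) / h - L) * h) by (field; exact Hn).
      rewrite Rabs_mult. apply Rmult_le_compat_r; [apply Rabs_pos|lra]. }
  have G1 := G exp 1 1 d1 H1 exp_0.
  rewrite cos_0 in H2. have G2 := G cos 1 (-0) d2 H2 cos_0.
  rewrite sin_0 in H3. have G3 := G sin 0 1 d3 H3 sin_0.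
  exists (Rmin (Rmin d1 e) (Rmin d2 d3)); split.
  { apply Rmin_pos; apply Rmin_pos; try apply cond_pos; exact Hepos. }
  intros [x y] Hh.
  have Rx := Rmax_l (Rabs x) (Rabs y). have Ry := Rmax_r (Rabs x) (Rabs y).
  have Rm := Rmax_Cmod (x, y). simpl fst in Rm; simpl snd in Rm.
  have Q1 := Rmin_l (Rmin d1 e) (Rmin d2 d3). have Q2 := Rmin_r (Rmin d1 e) (Rmin d2 d3).
  have Q3 := Rmin_l d1 e. have Q4 := Rmin_r d1 e.
  have Q5 := Rmin_l d2 d3. have Q6 := Rmin_r d2 d3.
  have Q7 := Rmin_l (eps / 8) 1. have Q8 := Rmin_r (eps / 8) 1. fold e in Q7, Q8.
  specialize (G1 x ltac:(lra)). specialize (G2 y ltac:(lra)). specialize (G3 y ltac:(lra)).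
  set (m := Cmod (x, y)) in *.
  have Hm : 0 <= m by apply Cmod_ge_0.
  step apply Cmod_le_Re_Im. unfold Cexp. simpl.
  replace (exp x * cos y + - (1) + - x)
    with ((exp x - 1 - 1 * x) * cos y + (1 + x) * (cos y - 1 - -0 * y)) by ring.
  replace (exp x * sin y + - 0 + - y)
    with ((exp x - 1 - 1 * x) * sin y + x * sin y + (sin y - 0 - 1 * y)) by ring.
  have B1 : Rabs (cos y) <= 1 by (apply Rabs_le; apply COS_bound).
  have B2 : Rabs (sin y) <= 1 by (apply Rabs_le; apply SIN_bound).
  have Em : e * Rabs x <= e * m by (apply Rmult_le_compat_l; lra).
  have En : e * Rabs y <= e * m by (apply Rmult_le_compat_l; lra).
  have Es : Rabs (sin y) <= 2 * m.
  { replace (sin y) with ((sin y - 0 - 1 * y) + y) by ring.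
    step apply Rabs_triang.
    assert (e * m <= 1 * m) by (apply Rmult_le_compat_r; lra). lra. }
  have A1 : Rabs ((exp x - 1 - 1 * x) * cos y) <= e * m.
  { rewrite Rabs_mult. replace (e * m) with (e * m * 1) by ring.
    apply Rmult_le_compat; try apply Rabs_pos; lra. }
  have A2 : Rabs ((1 + x) * (cos y - 1 - -0 * y)) <= 2 * (e * m).
  { rewrite Rabs_mult. apply Rmult_le_compat; try apply Rabs_pos; [|lra].
    step apply Rabs_triang. rewrite Rabs_R1. lra. }
  have A3 : Rabs ((exp x - 1 - 1 * x) * sin y) <= e * m.
  { rewrite Rabs_mult. replace (e * m) with (e * m * 1) by ring.
    apply Rmult_le_compat; try apply Rabs_pos; lra. }
  have A4 : Rabs (x * sin y) <= 2 * (e * m).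
  { rewrite Rabs_mult. replace (2 * (e * m)) with (e * (2 * m)) by ring.
    apply Rmult_le_compat; try apply Rabs_pos; lra. }
  have T1 := Rabs_triang ((exp x - 1 - 1 * x) * cos y) ((1 + x) * (cos y - 1 - -0 * y)).
  have T2 := Rabs_triang ((exp x - 1 - 1 * x) * sin y + x * sin y) (sin y - 0 - 1 * y).
  have T3 := Rabs_triang ((exp x - 1 - 1 * x) * sin y) (x * sin y).
  have F : 7 * (e * m) <= eps * m.
  { rewrite <- Rmult_assoc. apply Rmult_le_compat_r; lra. }
  lra. }
intros eps He.
have Hz := exp_pos (Re z).
destruct (H0 (eps / exp (Re z))) as [d [Hd H]].
{ apply Rdiv_lt_0_compat; assumption. }
exists d; split; [exact Hd|]. intros y Hy. specialize (H _ Hy).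
replace (Cexp y) with (Cexp z * Cexp (y - z))%C
  by (rewrite <- Cexp_add; f_equal; ring).
replace (Cexp z * Cexp (y - z) - Cexp z - Cexp z * (y - z))%C
  with (Cexp z * (Cexp (y - z) - 1 - (y - z)))%C by ring.
rewrite Cmod_mult, Cmod_Cexp.
through (exp (Re z) * (eps / exp (Re z) * Cmod (y - z))).
- apply Rmult_le_compat_l; lra.
- right. field. lra.
Qed.

Lemma Cder_Cexp_scal (c v : C) : Cder (fun v => Cexp (c * v)) v (Cexp (c * v) * c)%C.
Proof. apply (Cder_comp Cexp (fun v => c * v)%C); [apply Cder_mult_id|apply Cder_Cexp]. Qed.

Lemma Cder_pow n z : Cder (fun x => x ^ n)%C z (INR n * z ^ (n - 1))%C.
Proof.
induction n.
- eapply Cder_eq; [|apply (Cder_const 1%C)]. simpl. ring.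
- eapply Cder_eq; [|exact (Cder_mult (fun x => x) (fun x => x ^ n)%C z _ _ (Cder_id z) IHn)].
  cbv beta. rewrite S_INR, RtoC_plus. replace (S n - 1)%nat with n by lia.
  destruct n as [|n]; [simpl; ring|]. replace (S n - 1)%nat with n by lia.
  simpl. ring.
Qed.

Lemma holo_Ccts D f z : holo D f -> D z -> Ccts f z.
Proof. intros H Hz. destruct (H z Hz) as [l Hl]. exact (Cder_Ccts f z l Hl). Qed.

Lemma holo_sub (D D' : C -> Prop) f : (forall z, D' z -> D z) -> holo D f -> holo D' f.
Proof. intros H Hf z Hz. auto. Qed.

Lemma holo_plus D f g : holo D f -> holo D g -> holo D (fun x => f x + g x)%C.
Proof.
intros Hf Hg z Hz. destruct (Hf z Hz) as [l Hl], (Hg z Hz) as [m Hm].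
eexists. apply Cder_plus; eassumption.
Qed.

Lemma holo_mult D f g : holo D f -> holo D g -> holo D (fun x => f x * g x)%C.
Proof.
intros Hf Hg z Hz. destruct (Hf z Hz) as [l Hl], (Hg z Hz) as [m Hm].
eexists. apply Cder_mult; eassumption.
Qed.

Lemma holo_scal D a f : holo D f -> holo D (fun x => a * f x)%C.
Proof. intros Hf z Hz. destruct (Hf z Hz) as [l Hl]. eexists. apply Cder_scal; eassumption. Qed.

Lemma holo_const D c : holo D (fun _ => c).
Proof. intros z _. eexists; apply Cder_const. Qed.

Lemma holo_id D : holo D (fun z => z).
Proof. intros z _. eexists; apply Cder_id. Qed.

Lemma holo_minus D f g : holo D f -> holo D g -> holo D (fun x => f x - g x)%C.
Proof.
intros Hf Hg z Hz. destruct (Hf z Hz) as [l Hl], (Hg z Hz) as [m Hm].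
exists (l + - (1) * m)%C.
apply Cder_ext with (fun x => f x + - (1) * g x)%C; [intros; ring|].
apply Cder_plus; [exact Hl|]. apply Cder_scal. exact Hm.
Qed.

Lemma holo_comp D D' f g : (forall z, D z -> D' (g z)) ->
  holo D g -> holo D' f -> holo D (fun x => f (g x)).
Proof.
intros HD Hg Hf z Hz. destruct (Hg z Hz) as [l Hl], (Hf _ (HD z Hz)) as [m Hm].
eexists. apply (Cder_comp f g); eassumption.
Qed.

Lemma holo_inv D (f : C -> C) : (forall z, D z -> f z <> 0%C) -> holo D f -> holo D (fun x => / f x)%C.
Proof.
intros HD Hf z Hz. destruct (Hf z Hz) as [l Hl]. eexists. apply Cder_inv; auto. exact Hl.
Qed.

Lemma holo_Cexp D f : holo D f -> holo D (fun x => Cexp (f x)).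
Proof.
intros Hf. apply (holo_comp D (fun _ => True)); auto. intros z _. eexists; apply Cder_Cexp.
Qed.

(** * Complex-valued integrals over real intervals *)

Notation R_CNM := R_CompleteNormedModule.

Definition cts (f : R -> C) (t : R) : Prop :=
  forall eps, 0 < eps -> exists d, 0 < d /\ forall s, Rabs (s - t) < d ->
    Cmod (f s - f t) < eps.

Lemma continuous_eps (f : R -> R) (t : R) :
  continuous f t <->
  forall eps, 0 < eps -> exists d, 0 < d /\ forall s, Rabs (s - t) < d ->
    Rabs (f s - f t) < eps.
Proof.
split.
- intros H eps He.
  destruct (proj1 (filterlim_locally f (f t)) H (mkposreal eps He)) as [d Hd].
  exists d; split; [apply cond_pos|]. bound.
- intros H. apply filterlim_locally. intros eps.
  destruct (H eps (cond_pos eps)) as [d [Hd Hd']].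
  exists (mkposreal d Hd). bound.
Qed.

Lemma cts_Re f t : cts f t -> continuous (fun s => Re (f s)) t.
Proof.
intros H; apply continuous_eps; intros eps He.
destruct (H eps He) as [d [Hd Hd']]. exists d; split; [bound|]. intros s Hs.
eapply Rle_lt_trans; [|apply (Hd' s Hs)]. exact (re_le_Cmod (f s - f t)%C).
Qed.

Lemma cts_Im f t : cts f t -> continuous (fun s => Im (f s)) t.
Proof.
intros H; apply continuous_eps; intros eps He.
destruct (H eps He) as [d [Hd Hd']]. exists d; split; [bound|]. intros s Hs.
eapply Rle_lt_trans; [|apply (Hd' s Hs)]. exact (im_le_Cmod (f s - f t)%C).
Qed.

Lemma cts_continuous (f : R -> C) t :
  cts f t <-> continuous (T := R_UniformSpace) (U := C_absU) f t.
Proof. symmetry. exact (continuous_C_eps (K := R_AbsRing) f t). Qed.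

Lemma cts_comp (F : C -> C) (g : R -> C) t : cts g t -> Ccts F (g t) -> cts (fun s => F (g s)) t.
Proof. rewrite !cts_continuous, Ccts_continuous. exact (continuous_comp (U := R_UniformSpace) (V := C_absU) (W := C_absU) g F t). Qed.

Lemma cts_const c t : cts (fun _ => c) t.
Proof. apply cts_continuous. exact (continuous_const (U := R_UniformSpace) (V := C_absU) c t). Qed.

Lemma cts_plus f g t : cts f t -> cts g t -> cts (fun s => f s + g s)%C t.
Proof. rewrite !cts_continuous. exact (continuous_plus (K := C_AbsRing) (V := C_abs) f g t). Qed.

Lemma cts_mult f g t : cts f t -> cts g t -> cts (fun s => f s * g s)%C t.
Proof. rewrite !cts_continuous. exact (continuous_mult (K := C_AbsRing) f g t). Qed.

Lemma cts_scal a f t : cts f t -> cts (fun s => a * f s)%C t.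
Proof. intros H. apply (cts_mult (fun _ => a)); [apply cts_const|bound]. Qed.

Lemma cts_minus f g t : cts f t -> cts g t -> cts (fun s => f s - g s)%C t.
Proof. rewrite !cts_continuous. exact (continuous_minus (K := C_AbsRing) (V := C_abs) f g t). Qed.

Lemma cts_RtoC (f : R -> R) t : continuous f t -> cts (fun s => RtoC (f s)) t.
Proof.
intros H eps He. destruct (proj1 (continuous_eps f t) H eps He) as [d [Hd H']].
exists d; split; [bound|]. intros s Hs. rewrite <- RtoC_minus, Cmod_R. auto.
Qed.

Lemma cts_line (p q : C) t : cts (fun s => p + RtoC s * q)%C t.
Proof.
apply cts_plus; [apply cts_const|].
apply cts_mult; [apply cts_RtoC, continuous_id|apply cts_const].
Qed.

Lemma cts_ext f g t : (forall s, f s = g s) -> cts f t -> cts g t.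
Proof. intros H. rewrite !cts_continuous. exact (continuous_ext (U := C_absU) f g t H). Qed.

Lemma cts_ext_loc f g t :
  (exists d, 0 < d /\ forall s, Rabs (s - t) < d -> f s = g s) -> cts f t -> cts g t.
Proof.
intros [d0 [Hd0 H]] Hf eps He. destruct (Hf eps He) as [d [Hd H']].
exists (Rmin d0 d); split; [bound|]. intros s Hs.
rewrite <- (H s) by (eapply Rlt_le_trans; [exact Hs|apply Rmin_l]).
rewrite <- (H t) by bound.
apply H'. eapply Rlt_le_trans; [exact Hs|apply Rmin_r].
Qed.

Lemma cts_Cmod f t : cts f t -> continuous (fun s => Cmod (f s)) t.
Proof.
intros H; apply continuous_eps; intros eps He.
destruct (H eps He) as [d [Hd Hd']]. exists d; split; [bound|]. intros s Hs.
eapply Rle_lt_trans; [|apply (Hd' s Hs)].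
apply Rabs_le. split.
- have Q := Cmod_triangle_inv (f t) (f s). rewrite Cmod_minus_sym in Q. lra.
- apply Cmod_triangle_inv.
Qed.

Lemma cts_unif (f : R -> C) t :
  (forall eps, 0 < eps -> exists g, cts g t /\
     exists d, 0 < d /\ forall s, Rabs (s - t) < d -> Cmod (f s - g s) <= eps) ->
  cts f t.
Proof.
intros H eps He. destruct (H (eps / 4) ltac:(lra)) as [g [Hg [d [Hd Hfg]]]].
destruct (Hg (eps / 4) ltac:(lra)) as [d' [Hd' Hg']].
exists (Rmin d d'); split; [bound|]. intros s Hs.
have A1 := Hfg s (Rlt_le_trans _ _ _ Hs (Rmin_l _ _)).
have A2 := Hg' s (Rlt_le_trans _ _ _ Hs (Rmin_r _ _)).
have A3 : Cmod (f t - g t) <= eps / 4.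
{ apply Hfg. bound. }
replace (f s - f t)%C with ((f s - g s) + ((g s - g t) + (g t - f t)))%C by ring.
step apply Cmod_triangle.
have A4 := Cmod_triangle (g s - g t) (g t - f t).
rewrite (Cmod_minus_sym (g t)) in A4. lra.
Qed.

(** Extends functions on an interval to the line, so that continuity can be tested
    with two-sided neighbourhoods. *)
Definition clamp (a b t : R) : R := Rmax a (Rmin b t).

Lemma clamp_in a b t : a <= b -> a <= clamp a b t <= b.
Proof. intros H. split; [apply Rmax_l|]. apply Rmax_lub; [bound|apply Rmin_l]. Qed.

Lemma clamp_id a b t : a <= t <= b -> clamp a b t = t.
Proof. intros H. unfold clamp. rewrite Rmin_right, Rmax_right; lra. Qed.

Lemma clamp_lipschitz a b s t : a <= b -> Rabs (clamp a b s - clamp a b t) <= Rabs (s - t).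
Proof.
intros H. unfold clamp, Rmax, Rmin, Rabs. repeat destruct Rle_dec; repeat destruct Rcase_abs; lra.
Qed.

Lemma lipschitz_cts (g : R -> C) K t : 0 <= K ->
  (forall u, Cmod (g u - g t) <= K * Rabs (u - t)) -> cts g t.
Proof.
intros HK H eps He. exists (eps / (K + 1)). split; [bound|].
intros s Hs. step apply H.
apply Rle_lt_trans with (K * (eps / (K + 1))); [bound|].
apply Rmult_lt_reg_r with (K + 1); [lra|]. field_simplify; nra.
Qed.

Definition CI (f : R -> C) (a b : R) : C :=
  mkC (RInt (fun t => Re (f t)) a b) (RInt (fun t => Im (f t)) a b).

Definition icts (f : R -> C) (a b : R) : Prop := forall t, a <= t <= b -> cts f t.

Lemma ex_RInt_Re f a b : a <= b -> icts f a b -> ex_RInt (fun t => Re (f t)) a b.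
Proof.
intros Hab H. apply (ex_RInt_continuous (V := R_CNM)). intros t.
rewrite Rmin_left, Rmax_right by bound. intros Ht. apply cts_Re, H, Ht.
Qed.

Lemma ex_RInt_Im f a b : a <= b -> icts f a b -> ex_RInt (fun t => Im (f t)) a b.
Proof.
intros Hab H. apply (ex_RInt_continuous (V := R_CNM)). intros t.
rewrite Rmin_left, Rmax_right by bound. intros Ht. apply cts_Im, H, Ht.
Qed.

Lemma CI_ext f g a b : a <= b -> (forall t, a <= t <= b -> f t = g t) -> CI f a b = CI g a b.
Proof.
intros Hab H. unfold CI. apply C_ext; simpl; apply RInt_ext; intros t;
rewrite Rmin_left, Rmax_right by bound; intros Ht; rewrite H; auto; lra.
Qed.

Lemma CI_plus f g a b : a <= b -> icts f a b -> icts g a b ->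
  CI (fun t => f t + g t)%C a b = (CI f a b + CI g a b)%C.
Proof.
intros Hab Hf Hg. unfold CI. apply C_ext; simpl.
- apply (RInt_plus (V := R_CNM) (fun t => Re (f t)) (fun t => Re (g t)));
  apply ex_RInt_Re; assumption.
- apply (RInt_plus (V := R_CNM) (fun t => Im (f t)) (fun t => Im (g t)));
  apply ex_RInt_Im; assumption.
Qed.

Lemma RInt_scal_R (f : R -> R) a b c : ex_RInt f a b ->
  RInt (fun t => c * f t) a b = c * RInt f a b.
Proof. intros H. exact (RInt_scal (V := R_CNM) f a b c H). Qed.

Lemma CI_scal c f a b : a <= b -> icts f a b ->
  CI (fun t => c * f t)%C a b = (c * CI f a b)%C.
Proof.
intros Hab Hf. unfold CI.
have H1 := ex_RInt_Re f a b Hab Hf. have H2 := ex_RInt_Im f a b Hab Hf.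
apply C_ext; simpl; rewrite <- !RInt_scal_R by bound.
- change (RInt (fun t => fst c * Re (f t) - snd c * Im (f t)) a b
      = RInt (fun t => fst c * Re (f t)) a b - RInt (fun t => snd c * Im (f t)) a b).
  apply (RInt_minus (V := R_CNM)
    (fun t => fst c * Re (f t)) (fun t => snd c * Im (f t)) a b);
  apply (ex_RInt_scal (V := R_CNM)); assumption.
- change (RInt (fun t => fst c * Im (f t) + snd c * Re (f t)) a b
      = RInt (fun t => fst c * Im (f t)) a b + RInt (fun t => snd c * Re (f t)) a b).
  apply (RInt_plus (V := R_CNM)
    (fun t => fst c * Im (f t)) (fun t => snd c * Re (f t)) a b);
  apply (ex_RInt_scal (V := R_CNM)); assumption.
Qed.

Lemma CI_minus f g a b : a <= b -> icts f a b -> icts g a b ->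
  CI (fun t => f t - g t)%C a b = (CI f a b - CI g a b)%C.
Proof.
intros Hab Hf Hg.
rewrite (CI_ext _ (fun t => f t + - (1) * g t)%C) by (auto; intros; ring).
rewrite CI_plus, CI_scal; auto. { ring. }
intros t Ht. apply cts_scal, Hg, Ht.
Qed.

Lemma CI_Chasles f a b c : a <= b -> b <= c -> icts f a c ->
  (CI f a b + CI f b c)%C = CI f a c.
Proof.
intros H1 H2 H.
have Ha : icts f a b by (intros t Ht; apply H; lra).
have Hb : icts f b c by (intros t Ht; apply H; lra).
unfold CI; apply C_ext; simpl.
- apply (RInt_Chasles (V := R_CNM)); apply ex_RInt_Re; assumption.
- apply (RInt_Chasles (V := R_CNM)); apply ex_RInt_Im; assumption.
Qed.

Lemma CI_point f a : CI f a a = 0%C.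
Proof.
unfold CI; apply C_ext; simpl; apply (RInt_point (V := R_CNM)).
Qed.

Lemma RInt_cst (c a b : R) : RInt (fun _ => c) a b = (b - a) * c.
Proof. exact (RInt_const (V := R_CNM) a b c). Qed.

Lemma CI_const c a b : CI (fun _ => c) a b = (RtoC (b - a) * c)%C.
Proof.
unfold CI. rewrite !RInt_cst. apply C_ext; unfold Re, Im; simpl; ring.
Qed.

Lemma CI_shift f a b h : a <= b -> icts f (a + h) (b + h) ->
  CI (fun t => f (t + h)) a b = CI f (a + h) (b + h).
Proof.
intros Hab Hf. unfold CI.
have G : forall g : R -> R, ex_RInt g (a + h) (b + h) ->
  RInt (fun t => g (t + h)) a b = RInt g (a + h) (b + h).
{ intros g Hg.
  have H := RInt_comp_lin (V := R_CNM) g 1 h a b.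
  rewrite !Rmult_1_l in H. rewrite <- H by bound.
  apply RInt_ext. intros t _. unfold scal; simpl; unfold mult; simpl.
  rewrite !Rmult_1_l. reflexivity. }
f_equal.
- apply (G (fun t => Re (f t))). apply ex_RInt_Re; [lra|bound].
- apply (G (fun t => Im (f t))). apply ex_RInt_Im; [lra|bound].
Qed.

(** The integral is rotated to the positive real axis, so that only its real
    part has to be estimated. *)
Lemma CI_bound f (g : R -> R) a b : a <= b -> icts f a b -> ex_RInt g a b ->
  (forall t, a <= t <= b -> Cmod (f t) <= g t) -> Cmod (CI f a b) <= RInt g a b.
Proof.
intros Hab Hf Hg H.
destruct (Ceq_dec (CI f a b) 0) as [E|E].
{ rewrite E, Cmod_0. rewrite <- (Rmult_0_r (b - a)).
  have Q := RInt_const (V := R_CNM) a b 0.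
  change (RInt (fun _ => 0) a b = (b - a) * 0) in Q. rewrite <- Q.
  apply RInt_le; auto. { apply (ex_RInt_const (V := R_NormedModule)). }
  intros t Ht. step apply Cmod_ge_0. apply H; lra. }
have HE : 0 < Cmod (CI f a b) by (apply Cmod_gt_0; exact E).
set (u := (RtoC (Cmod (CI f a b)) / CI f a b)%C).
have Hu : Cmod u = 1.
{ unfold u. rewrite Cmod_div, Cmod_R, Rabs_pos_eq by bound. field. lra. }
have Hr : CI (fun t => u * f t)%C a b = RtoC (Cmod (CI f a b)).
{ rewrite CI_scal by auto. unfold u. field. exact E. }
have Hre : RInt (fun t => Re (u * f t)%C) a b = Cmod (CI f a b).
{ change (Re (CI (fun t => u * f t)%C a b) = Cmod (CI f a b)). rewrite Hr. reflexivity. }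
rewrite <- Hre. apply RInt_le; auto.
- apply (ex_RInt_Re (fun t => u * f t)%C); auto. intros t Ht; apply cts_scal, Hf, Ht.
- intros t Ht. step apply Rle_abs.
  step apply re_le_Cmod. rewrite Cmod_mult, Hu, Rmult_1_l. apply H; lra.
Qed.

Lemma CI_bound_const f B a b : a <= b -> icts f a b ->
  (forall t, a <= t <= b -> Cmod (f t) <= B) -> Cmod (CI f a b) <= B * (b - a).
Proof.
intros Hab Hf H. step (apply (CI_bound f (fun _ => B)); auto).
- apply (ex_RInt_const (V := R_NormedModule)).
- rewrite RInt_const. unfold scal; simpl; unfold mult; simpl. lra.
Qed.

Definition Rder (G : R -> C) (t : R) (l : C) : Prop :=
  forall eps, 0 < eps -> exists d, 0 < d /\ forall s, Rabs (s - t) < d ->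
    Cmod (G s - G t - RtoC (s - t) * l) <= eps * Rabs (s - t).

Lemma is_derive_R_eps (f : R -> R) t l :
  (forall eps, 0 < eps -> exists d, 0 < d /\ forall s, Rabs (s - t) < d ->
    Rabs (f s - f t - (s - t) * l) <= eps * Rabs (s - t)) -> is_derive f t l.
Proof.
intros H. split; [apply is_linear_scal_l|].
intros x Hx eps.
have E : t = x.
{ apply (is_filter_lim_locally_unique (K := R_AbsRing) (V := R_NormedModule)). exact Hx. }
subst x. destruct (H eps (cond_pos eps)) as [d [Hd H']].
exists (mkposreal d Hd). bound.
Qed.

Lemma Rder_Re G t l : Rder G t l -> is_derive (fun s => Re (G s)) t (Re l).
Proof.
intros H. apply is_derive_R_eps. intros eps He. destruct (H eps He) as [d [Hd H']].
exists d; split; [bound|]. intros s Hs. eapply Rle_trans; [|apply H', Hs].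
eapply Rle_trans; [|apply re_le_Cmod]. right. f_equal. unfold Re, Im; simpl. ring.
Qed.

Lemma Rder_Im G t l : Rder G t l -> is_derive (fun s => Im (G s)) t (Im l).
Proof.
intros H. apply is_derive_R_eps. intros eps He. destruct (H eps He) as [d [Hd H']].
exists d; split; [bound|]. intros s Hs. eapply Rle_trans; [|apply H', Hs].
eapply Rle_trans; [|apply im_le_Cmod]. right. f_equal. unfold Re, Im; simpl. ring.
Qed.

Lemma CI_FTC (G f : R -> C) a b : a <= b -> icts f a b ->
  (forall t, a <= t <= b -> Rder G t (f t)) -> CI f a b = (G b - G a)%C.
Proof.
intros Hab Hf H. unfold CI. apply C_ext; simpl.
- apply is_RInt_unique.
  apply (is_RInt_derive (V := R_CNM) (fun t => Re (G t)) (fun t => Re (f t)));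
  intros t; rewrite Rmin_left, Rmax_right by bound; intros Ht.
  + apply Rder_Re, H, Ht.
  + apply cts_Re, Hf, Ht.
- apply is_RInt_unique.
  apply (is_RInt_derive (V := R_CNM) (fun t => Im (G t)) (fun t => Im (f t)));
  intros t; rewrite Rmin_left, Rmax_right by bound; intros Ht.
  + apply Rder_Im, H, Ht.
  + apply cts_Im, Hf, Ht.
Qed.

Lemma Cder_line_Rder (F : C -> C) (p q l : C) t :
  Cder F (p + RtoC t * q)%C l -> Rder (fun s => F (p + RtoC s * q)%C) t (q * l)%C.
Proof.
intros H eps He.
have Hq := Cmod_ge_0 q.
destruct (H (eps / (Cmod q + 1)) ltac:(bound)) as [d [Hd H']].
exists (d / (Cmod q + 1)); split; [bound|].
intros s Hs.
have Es : (p + RtoC s * q - (p + RtoC t * q))%C = (RtoC (s - t) * q)%C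
  by bound.
specialize (H' (p + RtoC s * q)%C). rewrite Es, Cmod_mult, Cmod_R in H'.
replace (F (p + s * q) - F (p + t * q) - RtoC (s - t) * (q * l))%C
  with (F (p + s * q) - F (p + t * q) - l * (RtoC (s - t) * q))%C by ring.
step apply H'.
- apply Rle_lt_trans with (Rabs (s - t) * (Cmod q + 1)); [bound|].
  apply Rmult_lt_reg_r with (/ (Cmod q + 1)); [bound|].
  rewrite Rmult_assoc, Rinv_r, Rmult_1_r by lra. exact Hs.
- replace (eps * Rabs (s - t))
    with (eps / (Cmod q + 1) * (Rabs (s - t) * (Cmod q + 1))) by bound.
  bound.
Qed.

Lemma CI_FTC_line (F f : C -> C) (p q : C) a b : a <= b ->
  (forall t, a <= t <= b -> Cder F (p + RtoC t * q)%C (f (p + RtoC t * q)%C)) ->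
  (forall t, a <= t <= b -> Ccts f (p + RtoC t * q)%C) ->
  CI (fun t => q * f (p + RtoC t * q))%C a b
    = (F (p + RtoC b * q) - F (p + RtoC a * q))%C.
Proof.
intros Hab HF Hf. apply (CI_FTC (fun t => F (p + RtoC t * q)%C)); auto.
- intros t Ht. apply cts_scal, (cts_comp f); [apply cts_line|auto].
- intros t Ht. apply Cder_line_Rder, HF, Ht.
Qed.

Lemma Rder_zero_const (G : R -> C) a b : a <= b ->
  (forall t, a <= t <= b -> Rder G t 0) -> G b = G a.
Proof.
intros Hab H.
have E := CI_FTC G (fun _ => RtoC 0) a b Hab (fun t _ => cts_const _ t) H.
rewrite CI_const in E. replace (G b) with ((G b - G a) + G a)%C by ring.
rewrite <- E. ring.
Qed.

Fixpoint Csum (u : nat -> C) (n : nat) : C :=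
  match n with O => RtoC 0 | S k => (Csum u k + u k)%C end.

Lemma CI_Csum (f : nat -> R -> C) a b n : a <= b -> (forall k, icts (f k) a b) ->
  CI (fun t => Csum (fun k => f k t) n) a b = Csum (fun k => CI (f k) a b) n
  /\ icts (fun t => Csum (fun k => f k t) n) a b.
Proof.
intros Hab Hf. induction n as [|n [IH1 IH2]]; simpl.
- split; [rewrite CI_const; ring|intros t _; apply cts_const].
- split.
  + rewrite CI_plus; auto. rewrite IH1. reflexivity.
  + intros t Ht. apply cts_plus; [bound|apply Hf]; auto.
Qed.

(** * Cauchy's theorem for rectangles *)

Definition Hor (H : C -> C) (y a b : R) : C := CI (fun x => H (mkC x y)) a b.
Definition Ver (H : C -> C) (x c d : R) : C := CI (fun y => Ci * H (mkC x y))%C c d.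

Definition RI (H : C -> C) (a b c d : R) : C :=
  (Hor H c a b + Ver H b c d - Hor H d a b - Ver H a c d)%C.

Definition rect (a b c d : R) (z : C) : Prop := a <= Re z <= b /\ c <= Im z <= d.

Definition Cts_rect (H : C -> C) (a b c d : R) : Prop :=
  forall z, rect a b c d z -> Ccts H z.

Lemma mkC_hor x y : mkC x y = (mkC 0 y + RtoC x * RtoC 1)%C.
Proof. bound. Qed.

Lemma mkC_ver x y : mkC x y = (mkC x 0 + RtoC y * Ci)%C.
Proof. bound. Qed.

Lemma cts_hor H y x : Ccts H (mkC x y) -> cts (fun t => H (mkC t y)) x.
Proof.
intros HH. apply (cts_comp H); [|bound].
eapply cts_ext; [intros s; symmetry; apply mkC_hor|apply cts_line].
Qed.

Lemma cts_Cexp_hor s y t : cts (fun t => Cexp (s * mkC t y)) t.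
Proof. apply (cts_hor (fun v => Cexp (s * v))). eapply Cder_Ccts, Cder_Cexp_scal. Qed.

Lemma cts_ver H y x : Ccts H (mkC x y) -> cts (fun t => H (mkC x t)) y.
Proof.
intros HH. apply (cts_comp H); [|bound].
eapply cts_ext; [intros s; symmetry; apply mkC_ver|apply cts_line].
Qed.

Lemma icts_hor H a b c d y : Cts_rect H a b c d -> c <= y <= d ->
  icts (fun x => H (mkC x y)) a b.
Proof. intros HH Hy t Ht. apply cts_hor, HH. split; simpl; lra. Qed.

Lemma icts_ver H a b c d x : Cts_rect H a b c d -> a <= x <= b ->
  icts (fun y => Ci * H (mkC x y))%C c d.
Proof. intros HH Hx t Ht. apply cts_scal, cts_ver, HH. split; simpl; lra. Qed.

Lemma Cts_rect_sub H a b c d a' b' c' d' : a <= a' -> b' <= b -> c <= c' -> d' <= d ->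
  Cts_rect H a b c d -> Cts_rect H a' b' c' d'.
Proof. intros ? ? ? ? HH z [Hz1 Hz2]. apply HH. split; lra. Qed.

Lemma RI_vsplit H a m b c d : a <= m <= b -> c <= d -> Cts_rect H a b c d ->
  RI H a b c d = (RI H a m c d + RI H m b c d)%C.
Proof.
intros Hm Hcd HH. unfold RI, Hor.
rewrite <- (CI_Chasles (fun x => H (mkC x c)) a m b) by
  (try lra; apply (icts_hor H a b c d); auto; lra).
rewrite <- (CI_Chasles (fun x => H (mkC x d)) a m b) by
  (try lra; apply (icts_hor H a b c d); auto; lra).
ring.
Qed.

Lemma RI_hsplit H a b c n d : a <= b -> c <= n <= d -> Cts_rect H a b c d ->
  RI H a b c d = (RI H a b c n + RI H a b n d)%C.
Proof.
intros Hab Hn HH. unfold RI, Ver.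
rewrite <- (CI_Chasles (fun y => Ci * H (mkC a y))%C c n d) by
  (try lra; apply (icts_ver H a b c d); auto; lra).
rewrite <- (CI_Chasles (fun y => Ci * H (mkC b y))%C c n d) by
  (try lra; apply (icts_ver H a b c d); auto; lra).
ring.
Qed.

Lemma RI_bound H a b c d B : a <= b -> c <= d -> Cts_rect H a b c d ->
  (forall z, rect a b c d z -> Cmod (H z) <= B) ->
  Cmod (RI H a b c d) <= 2 * B * ((b - a) + (d - c)).
Proof.
intros Hab Hcd HH HB. unfold RI, Hor, Ver.
have H1 : forall y, c <= y <= d -> Cmod (CI (fun x => H (mkC x y)) a b) <= B * (b - a).
{ intros y Hy. apply CI_bound_const; auto. { apply (icts_hor H a b c d); auto. }
  intros t Ht. apply HB. split; simpl; lra. }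
have H2 : forall x, a <= x <= b ->
  Cmod (CI (fun y => Ci * H (mkC x y))%C c d) <= B * (d - c).
{ intros x Hx. apply CI_bound_const; auto. { apply (icts_ver H a b c d); auto. }
  intros t Ht. rewrite Cmod_mult, Cmod_Ci, Rmult_1_l. apply HB. split; simpl; lra. }
have A1 := H1 c ltac:(lra). have A2 := H1 d ltac:(lra).
have A3 := H2 a ltac:(lra). have A4 := H2 b ltac:(lra).
set (u := CI (fun x => H (mkC x c)) a b) in *. set (v := CI (fun x => H (mkC x d)) a b) in *.
set (s := CI (fun y => Ci * H (mkC a y))%C c d) in *.
set (t := CI (fun y => Ci * H (mkC b y))%C c d) in *.
have T1 := Cmod_triangle_minus (u + t - v) s.
have T2 := Cmod_triangle_minus (u + t) v.
have T3 := Cmod_triangle u t. lra.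
Qed.

Lemma Hor_primitive F f y a b : a <= b ->
  (forall x, a <= x <= b -> Cder F (mkC x y) (f (mkC x y))) ->
  (forall x, a <= x <= b -> Ccts f (mkC x y)) ->
  Hor f y a b = (F (mkC b y) - F (mkC a y))%C.
Proof.
intros Hab HF Hf. unfold Hor.
rewrite (CI_ext _ (fun x => RtoC 1 * f (mkC 0 y + RtoC x * RtoC 1))%C)
  by (auto; intros; rewrite <- mkC_hor; ring).
rewrite (CI_FTC_line F f); auto.
- rewrite <- !mkC_hor. reflexivity.
- intros t Ht. rewrite <- mkC_hor. auto.
- intros t Ht. rewrite <- mkC_hor. auto.
Qed.

Lemma Ver_primitive F f x a b : a <= b ->
  (forall y, a <= y <= b -> Cder F (mkC x y) (f (mkC x y))) ->
  (forall y, a <= y <= b -> Ccts f (mkC x y)) ->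
  Ver f x a b = (F (mkC x b) - F (mkC x a))%C.
Proof.
intros Hab HF Hf. unfold Ver.
rewrite (CI_ext _ (fun y => Ci * f (mkC x 0 + RtoC y * Ci))%C)
  by (auto; intros; rewrite <- mkC_ver; ring).
rewrite (CI_FTC_line F f); auto.
- rewrite <- !mkC_ver. reflexivity.
- intros t Ht. rewrite <- mkC_ver. auto.
- intros t Ht. rewrite <- mkC_ver. auto.
Qed.

Lemma RI_primitive F f a b c d : a <= b -> c <= d ->
  (forall z, rect a b c d z -> Cder F z (f z)) -> Cts_rect f a b c d ->
  RI f a b c d = 0%C.
Proof.
intros Hab Hcd HF Hf. unfold RI.
rewrite !(Hor_primitive F f), !(Ver_primitive F f); auto; try ring;
intros; (apply HF || apply Hf); split; simpl; lra.
Qed.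

Lemma RI_minus f g a b c d : a <= b -> c <= d -> Cts_rect f a b c d -> Cts_rect g a b c d ->
  RI (fun z => f z - g z)%C a b c d = (RI f a b c d - RI g a b c d)%C.
Proof.
intros Hab Hcd Hf Hg. unfold RI, Hor, Ver.
rewrite !(CI_minus (fun x => f (mkC x _)) (fun x => g (mkC x _))); auto;
try (apply (icts_hor _ a b c d); auto; lra).
rewrite !(CI_ext (fun y => Ci * (f (mkC _ y) - g (mkC _ y)))%C
  (fun y => Ci * f (mkC _ y) - Ci * g (mkC _ y))%C c d) by (auto; intros; ring).
rewrite !(CI_minus (fun y => Ci * f (mkC _ y))%C (fun y => Ci * g (mkC _ y))%C); auto;
try (apply (icts_ver _ a b c d); auto; lra).
ring.
Qed.

Lemma Ccts_affine A B z : Ccts (fun w => A + B * w)%C z.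
Proof.
eapply Cder_Ccts. apply Cder_plus; [apply Cder_const|apply Cder_mult_id].
Qed.

Lemma RI_affine A B a b c d : a <= b -> c <= d -> RI (fun z => A + B * z)%C a b c d = 0%C.
Proof.
intros Hab Hcd.
apply (RI_primitive (fun z => A * z + B * / (1 + 1) * (z * z))%C); auto.
- intros z _. eapply Cder_eq; [|apply Cder_plus; [apply Cder_mult_id|
    apply Cder_scal, Cder_sqr]].
  field.
- intros z _. apply Ccts_affine.
Qed.

Section Bisection.

Variables (H : C -> C) (a b c d eps : R).
Hypotheses (Hab : a <= b) (Hcd : c <= d).
Hypothesis (HH : forall z, rect a b c d z -> exists l, Cder H z l).

Let w (n : nat) := (b - a) / 2 ^ n.
Let h (n : nat) := (d - c) / 2 ^ n.

(** The sub-rectangle of generation [n] with lower left corner [q]. *)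
Let good (n : nat) (q : R * R) : Prop :=
  Cmod (RI H (fst q) (fst q + w n) (snd q) (snd q + h n)) <= eps * (w n + h n) ^ 2.

Let next (n : nat) (q : R * R) : R * R :=
  let x' := fst q + w (S n) in let y' := snd q + h (S n) in
  let test q' := Rle_dec
    (Cmod (RI H (fst q') (fst q' + w (S n)) (snd q') (snd q' + h (S n))))
    (eps * (w (S n) + h (S n)) ^ 2) in
  if test q then if test (x', snd q) then if test (fst q, y') then (x', y')
    else (fst q, y') else (x', snd q) else q.

Let q (n : nat) : R * R := nat_rect (fun _ => (R * R)%type) (a, c) next n.

Lemma bisection_sizes n : 0 <= w n /\ 0 <= h n /\ w n = w (S n) + w (S n) /\ h n = h (S n) + h (S n).
Proof.
have Hp : 0 < 2 ^ n by bound.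
unfold w, h; repeat split; try (simpl; field; lra);
apply Rmult_le_pos; try lra; left; apply Rinv_0_lt_compat; exact Hp.
Qed.

Lemma next_fst n p : fst (next n p) = fst p \/ fst (next n p) = fst p + w (S n).
Proof. unfold next. repeat destruct Rle_dec; simpl; auto. Qed.

Lemma next_snd n p : snd (next n p) = snd p \/ snd (next n p) = snd p + h (S n).
Proof. unfold next. repeat destruct Rle_dec; simpl; auto. Qed.

Lemma bisection_inside n : a <= fst (q n) /\ fst (q n) + w n <= b /\
  c <= snd (q n) /\ snd (q n) + h n <= d.
Proof.
induction n as [|n IH].
- simpl. unfold w, h; simpl. bound.
- destruct (bisection_sizes n) as [H1 [H2 [H3 H4]]].
  destruct (bisection_sizes (S n)) as [H5 [H6 _]].
  change (q (S n)) with (next n (q n)).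
  destruct (next_fst n (q n)) as [E|E], (next_snd n (q n)) as [E'|E']; rewrite E, E'; lra.
Qed.

Lemma Cts_rect_bis : Cts_rect H a b c d.
Proof. intros z Hz. apply diff_Ccts, (HH z Hz). Qed.

(** If all four quarters satisfied the quadratic bound, so would the whole. *)
Lemma bisection_bad n : ~ good 0 (q 0) -> ~ good n (q n).
Proof.
intros H0. induction n as [|n IH]; [bound|].
destruct (bisection_sizes n) as [H1 [H2 [H3 H4]]].
destruct (bisection_sizes (S n)) as [H5 [H6 _]].
destruct (bisection_inside n) as [I1 [I2 [I3 I4]]].
change (q (S n)) with (next n (q n)). set (p := q n) in *.
unfold next. unfold good at 1.
destruct Rle_dec as [Q1|Q1]; [|bound].
destruct Rle_dec as [Q2|Q2]; [|bound].
destruct Rle_dec as [Q3|Q3]; [|bound].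
intros Q4. apply IH. unfold good.
simpl fst in *; simpl snd in *.
have HC : Cts_rect H (fst p) (fst p + w n) (snd p) (snd p + h n).
{ apply (Cts_rect_sub H a b c d); auto. exact Cts_rect_bis. }
rewrite (RI_vsplit H _ (fst p + w (S n))) by bound.
rewrite (RI_hsplit H _ _ _ (snd p + h (S n))) by
  (try lra; apply (Cts_rect_sub H a b c d); try lra; exact Cts_rect_bis).
rewrite (RI_hsplit H (fst p + w (S n)) _ _ (snd p + h (S n))) by
  (try lra; apply (Cts_rect_sub H a b c d); try lra; exact Cts_rect_bis).
replace (fst p + w n) with (fst p + w (S n) + w (S n)) by lra.
replace (snd p + h n) with (snd p + h (S n) + h (S n)) by lra.
rewrite H3, H4.
replace (eps * (w (S n) + w (S n) + (h (S n) + h (S n))) ^ 2)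
  with (eps * (w (S n) + h (S n)) ^ 2 + eps * (w (S n) + h (S n)) ^ 2 +
    (eps * (w (S n) + h (S n)) ^ 2 + eps * (w (S n) + h (S n)) ^ 2)) by ring.
step apply Cmod_triangle.
apply Rplus_le_compat; (step apply Cmod_triangle);
apply Rplus_le_compat; assumption.
Qed.

Lemma bisection_limit : exists z, forall n,
  fst (q n) <= Re z <= fst (q n) + w n /\ snd (q n) <= Im z <= snd (q n) + h n.
Proof.
have G : forall (u : nat -> R) (s : nat -> R) B,
  (forall n, u n <= u (S n)) -> (forall n, u (S n) + s (S n) <= u n + s n) ->
  (forall n, 0 <= s n) -> (forall n, u n + s n <= B) ->
  exists x, forall n, u n <= x <= u n + s n.
{ intros u s B Hu Hus Hs HB.
  destruct (ex_finite_lim_seq_incr u B Hu) as [x Hx].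
  { intros n. specialize (Hs n); specialize (HB n); lra. }
  exists x. intros n. split.
  - apply (is_lim_seq_incr_compare u x Hx Hu).
  - apply (is_lim_seq_le_loc u (fun _ => u n + s n) x (u n + s n)); auto.
    2: apply is_lim_seq_const.
    exists n. intros m Hm.
    have M : u m + s m <= u n + s n.
    { induction Hm; [lra|]. specialize (Hus m). lra. }
    specialize (Hs m). lra. }
destruct (G (fun n => fst (q n)) w b) as [x Hx].
- intros n. destruct (bisection_sizes (S n)) as [H5 [H6 _]].
  change (q (S n)) with (next n (q n)). destruct (next_fst n (q n)) as [E|E]; rewrite E; lra.
- intros n. destruct (bisection_sizes n) as [H1 [H2 [H3 H4]]].
  destruct (bisection_sizes (S n)) as [H5 [H6 _]].
  change (q (S n)) with (next n (q n)). destruct (next_fst n (q n)) as [E|E]; rewrite E; lra.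
- intros n; apply bisection_sizes.
- intros n; apply bisection_inside.
- destruct (G (fun n => snd (q n)) h d) as [y Hy].
  + intros n. destruct (bisection_sizes (S n)) as [H5 [H6 _]].
    change (q (S n)) with (next n (q n)). destruct (next_snd n (q n)) as [E|E]; rewrite E; lra.
  + intros n. destruct (bisection_sizes n) as [H1 [H2 [H3 H4]]].
    destruct (bisection_sizes (S n)) as [H5 [H6 _]].
    change (q (S n)) with (next n (q n)). destruct (next_snd n (q n)) as [E|E]; rewrite E; lra.
  + intros n; apply bisection_sizes.
  + intros n; apply bisection_inside.
  + exists (mkC x y). bound.
Qed.

(** Near the limit point the integrand is affine up to a relative error, and
    affine functions integrate to zero. *)
Lemma Goursat_quadratic : 0 < eps -> good 0 (q 0).
Proof.
intros Heps. apply NNPP. intros Hbad.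
destruct bisection_limit as [z Hz].
have Hrz : rect a b c d z.
{ specialize (Hz 0%nat). have I := bisection_inside 0. split; lra. }
destruct (HH z Hrz) as [l Hl].
destruct (Hl (eps / 2) ltac:(lra)) as [de [Hde Hd]].
have Hlim : exists n, w n + h n < de.
{ destruct (pow_lt_1_zero (/ 2)) with (y := de / ((b - a) + (d - c) + 1)) as [N HN].
  - bound.
  - bound.
  - exists N. specialize (HN N (le_n _)).
    rewrite Rabs_pos_eq in HN by bound.
    unfold w, h, Rdiv. rewrite <- Rmult_plus_distr_r.
    rewrite <- pow_inv.
    apply Rle_lt_trans with ((b - a + (d - c) + 1) * (/ 2) ^ N).
    + bound.
    + replace de with ((b - a + (d - c) + 1) * (de / (b - a + (d - c) + 1))) by bound.
      apply Rmult_lt_compat_l; lra. }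
destruct Hlim as [n Hn].
apply (bisection_bad n Hbad). unfold good.
destruct (bisection_sizes n) as [H1 [H2 _]].
destruct (bisection_inside n) as [I1 [I2 [I3 I4]]].
destruct (Hz n) as [Z1 Z2].
set (p := q n) in *.
have HC : Cts_rect H (fst p) (fst p + w n) (snd p) (snd p + h n).
{ apply (Cts_rect_sub H a b c d); auto. exact Cts_rect_bis. }
pose (A := fun y => ((H z - l * z) + l * y)%C).
have E : RI H (fst p) (fst p + w n) (snd p) (snd p + h n) =
  RI (fun y => H y - A y)%C (fst p) (fst p + w n) (snd p) (snd p + h n).
{ rewrite RI_minus; try lra; auto.
  - unfold A at 1. rewrite RI_affine by lra. ring.
  - intros y _. apply Ccts_affine. }
rewrite E.
step apply (RI_bound _ _ _ _ _ (eps / 2 * (w n + h n))).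
- lra.
- lra.
- intros y Hy e He.
  have Hc : Ccts (fun y => H y - A y)%C y.
  { destruct (HH y) as [l' Hl'].
    { destruct Hy; split; lra. }
    eapply Cder_Ccts with (l := (l' + - (1) * l)%C).
    apply Cder_ext with (fun y => H y + - (1) * A y)%C; [intros; ring|].
    apply Cder_plus; [bound|]. apply Cder_scal.
    unfold A. eapply Cder_eq; [|apply Cder_plus; [apply Cder_const|apply Cder_mult_id]].
    ring. }
  bound.
- intros y Hy. unfold A.
  replace (H y - (H z - l * z + l * y))%C with (H y - H z - l * (y - z))%C by ring.
  have Hyz : Cmod (y - z) <= w n + h n.
  { step apply Cmod_le_Re_Im. destruct Hy as [Y1 Y2].
    change (Re (y - z)) with (Re y + - Re z). change (Im (y - z)) with (Im y + - Im z).
    bound. }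
  step (apply Hd; lra). bound.
- bound.
Qed.

End Bisection.

Lemma Goursat H a b c d : a <= b -> c <= d ->
  (forall z, rect a b c d z -> exists l, Cder H z l) -> RI H a b c d = 0%C.
Proof.
intros Hab Hcd HH. apply Ceq_limit. intros eps Heps.
replace (RI H a b c d - 0)%C with (RI H a b c d) by ring.
set (D := (b - a + (d - c)) ^ 2).
have HD : 0 <= D by apply pow2_ge_0.
have G := Goursat_quadratic H a b c d (eps / (D + 1)) Hab Hcd HH
  ltac:(bound).
simpl in G. rewrite !Rdiv_1_r in G.
replace (a + (b - a)) with b in G by ring. replace (c + (d - c)) with d in G by ring.
step exact G.
replace ((b - a + (d - c)) * ((b - a + (d - c)) * 1)) with D by bound.
replace eps with (eps / (D + 1) * (D + 1)) at 2 by bound.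
bound.
Qed.

(** The lines through the sides of the square cut off rectangles on which
    Cauchy's theorem applies. *)
Lemma RI_square H a b c d p q e : 0 < e -> a <= p - e -> p + e <= b -> c <= q - e -> q + e <= d ->
  (forall z, rect a b c d z -> z <> mkC p q -> exists l, Cder H z l) ->
  Ccts H (mkC p q) ->
  RI H a b c d = RI H (p - e) (p + e) (q - e) (q + e).
Proof.
intros He H1 H2 H3 H4 HH Hpq.
have HC : Cts_rect H a b c d.
{ intros z Hz. destruct (Ceq_dec z (mkC p q)) as [->|Hn]; [bound|].
  apply diff_Ccts, (HH z Hz Hn). }
rewrite (RI_vsplit H a (p - e)) by bound.
rewrite (Goursat H a (p - e)) by (try lra; (intros z [Z1 Z2]; apply HH;
  [split; lra|intros E; rewrite E in Z1; simpl in Z1; lra])).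
have HC1 : Cts_rect H (p - e) b c d by (apply (Cts_rect_sub H a b c d); auto; lra).
rewrite (RI_vsplit H (p - e) (p + e)) by bound.
rewrite (Goursat H (p + e)) by (try lra; (intros z [Z1 Z2]; apply HH;
  [split; lra|intros E; rewrite E in Z1; simpl in Z1; lra])).
have HC2 : Cts_rect H (p - e) (p + e) c d by (apply (Cts_rect_sub H a b c d); auto; lra).
rewrite (RI_hsplit H (p - e) (p + e) c (q - e)) by bound.
rewrite (Goursat H (p - e) (p + e) c (q - e)) by (try lra; (intros z [Z1 Z2]; apply HH;
  [split; lra|intros E; rewrite E in Z2; simpl in Z2; lra])).
have HC3 : Cts_rect H (p - e) (p + e) (q - e) d
  by (apply (Cts_rect_sub H a b c d); auto; lra).
rewrite (RI_hsplit H (p - e) (p + e) (q - e) (q + e)) by bound.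
rewrite (Goursat H (p - e) (p + e) (q + e) d) by (try lra; (intros z [Z1 Z2]; apply HH;
  [split; lra|intros E; rewrite E in Z2; simpl in Z2; lra])).
ring.
Qed.

(** * Limits and power series *)

Lemma fun_choice {A B : Type} (P : A -> B -> Prop) :
  (forall x, exists y, P x y) -> exists f, forall x, P x (f x).
Proof.
intros H. exists (fun x => proj1_sig (constructive_indefinite_description _ (H x))).
intros x. apply proj2_sig.
Qed.

Definition Clim (u : nat -> C) (l : C) : Prop :=
  forall eps, 0 < eps -> exists N, forall n, (N <= n)%nat -> Cmod (u n - l) <= eps.

Lemma Clim_unique u l l' : Clim u l -> Clim u l' -> l = l'.
Proof.
intros H H'. apply Ceq_limit. intros eps He.
destruct (H (eps / 2) ltac:(lra)) as [N HN]. destruct (H' (eps / 2) ltac:(lra)) as [N' HN'].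
specialize (HN (max N N') (Nat.le_max_l _ _)). specialize (HN' (max N N') (Nat.le_max_r _ _)).
step apply (Cmod_triangle_3 _ (u (max N N'))).
rewrite (Cmod_minus_sym l). lra.
Qed.

Lemma Clim_ext u v l : (forall n, u n = v n) -> Clim u l -> Clim v l.
Proof. intros H Hu eps He. destruct (Hu eps He) as [N HN]. exists N. intros. rewrite <- H. auto. Qed.

Lemma Clim_plus u v l m : Clim u l -> Clim v m -> Clim (fun n => u n + v n)%C (l + m)%C.
Proof.
intros H H' eps He.
destruct (H (eps / 2) ltac:(lra)) as [N HN]. destruct (H' (eps / 2) ltac:(lra)) as [N' HN'].
exists (max N N'). intros n Hn.
specialize (HN n ltac:(lia)). specialize (HN' n ltac:(lia)).
replace (u n + v n - (l + m))%C with ((u n - l) + (v n - m))%C by ring.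
step apply Cmod_triangle. lra.
Qed.

Lemma Clim_scal a u l : Clim u l -> Clim (fun n => a * u n)%C (a * l)%C.
Proof.
intros H eps He. have Ha := Cmod_ge_0 a.
destruct (H (eps / (Cmod a + 1)) ltac:(bound)) as [N HN].
exists N. intros n Hn. specialize (HN n Hn).
replace (a * u n - a * l)%C with (a * (u n - l))%C by ring. rewrite Cmod_mult.
through ((Cmod a + 1) * (eps / (Cmod a + 1))).
- bound.
- right. field. lra.
Qed.

Lemma Clim_const l : Clim (fun _ => l) l.
Proof.
intros eps He. exists O. intros n _. replace (l - l)%C with (RtoC 0) by ring.
rewrite Cmod_0. lra.
Qed.

Lemma Clim_le u l B : Clim u l -> (forall n, Cmod (u n) <= B) -> Cmod l <= B.
Proof.
intros H HB. apply le_epsilon. intros e He. destruct (H e He) as [N HN].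
specialize (HN N (le_n _)). specialize (HB N). rewrite Cmod_minus_sym in HN.
have Q := Cmod_triangle_inv l (u N). lra.
Qed.

Lemma Clim_incr u l k : Clim u l <-> Clim (fun n => u (n + k)%nat) l.
Proof.
split; intros H eps He; destruct (H eps He) as [N HN].
- exists N. intros n Hn. apply HN. lia.
- exists (N + k)%nat. intros n Hn. replace n with ((n - k) + k)%nat by lia. apply HN. lia.
Qed.

Lemma Clim_0_of_bound u l (e : nat -> R) :
  is_lim_seq e 0 -> (forall n, Cmod (u n - l) <= e n) -> Clim u l.
Proof.
intros He H eps Heps.
apply is_lim_seq_spec in He. destruct (He (mkposreal eps Heps)) as [N HN].
exists N. intros n Hn. specialize (HN n Hn). simpl in HN.
rewrite Rminus_0_r in HN. step apply H.
through (Rabs (e n)); [apply Rle_abs|lra].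
Qed.

Lemma Clim_cauchy u : (forall eps, 0 < eps -> exists N, forall n m,
  (N <= n)%nat -> (N <= m)%nat -> Cmod (u n - u m) <= eps) -> exists l, Clim u l.
Proof.
intros H.
have G : forall f : C -> R, (forall a b, Rabs (f a - f b) <= Cmod (a - b)) ->
  exists x, is_lim_seq (fun n => f (u n)) (Finite x).
{ intros f Hf.
  destruct (proj2 (ex_lim_seq_cauchy_corr (fun n => f (u n)))) as [x Hx]; [|exists x; exact Hx].
  intros eps. destruct (H (eps / 2)) as [N HN]. { destruct eps; simpl; lra. }
  exists N. intros n m Hn Hm. step apply Hf.
  specialize (HN n m Hn Hm). destruct eps; simpl in *; lra. }
destruct (G Re) as [x Hx]. { intros a b. exact (re_le_Cmod (a - b)%C). }
destruct (G Im) as [y Hy]. { intros a b. exact (im_le_Cmod (a - b)%C). }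
exists (mkC x y). intros eps He.
apply is_lim_seq_spec in Hx. apply is_lim_seq_spec in Hy.
have He2 : 0 < eps / 2 by lra.
destruct (Hx (mkposreal _ He2)) as [N HN]. destruct (Hy (mkposreal _ He2)) as [N' HN'].
exists (max N N'). intros n Hn. specialize (HN n ltac:(lia)). specialize (HN' n ltac:(lia)).
simpl in HN, HN'. step apply Cmod_le_Re_Im.
change (Rabs (Re (u n) - x) + Rabs (Im (u n) - y) <= eps). lra.
Qed.

Lemma geom_lim (q K : R) : 0 <= q < 1 -> is_lim_seq (fun n => K * q ^ n) 0.
Proof.
intros Hq. replace (Finite 0) with (Rbar_mult K 0) by (simpl; f_equal; ring).
apply is_lim_seq_scal_l. apply is_lim_seq_geom. bound.
Qed.

Lemma Csum_ext u v n : (forall k, (k < n)%nat -> u k = v k) -> Csum u n = Csum v n.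
Proof. induction n; intros H; simpl; [bound|]. rewrite IHn, H; auto. Qed.

Lemma Csum_plus u v n : Csum (fun k => u k + v k)%C n = (Csum u n + Csum v n)%C.
Proof. induction n; simpl; [ring|]. rewrite IHn. ring. Qed.

Lemma Csum_scal a u n : Csum (fun k => a * u k)%C n = (a * Csum u n)%C.
Proof. induction n; simpl; [ring|]. rewrite IHn. ring. Qed.

Lemma Csum_zero n : Csum (fun _ => RtoC 0) n = RtoC 0.
Proof. induction n; simpl; [bound|]. rewrite IHn. ring. Qed.

Lemma Csum_add u n m : Csum u (n + m) = (Csum u n + Csum (fun k => u (n + k)%nat) m)%C.
Proof.
induction m; simpl.
- rewrite Nat.add_0_r. ring.
- rewrite Nat.add_succ_r. simpl. rewrite IHm. ring.
Qed.

Lemma Csum_shift_l u n : Csum u (S n) = (u O + Csum (fun k => u (S k)) n)%C.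
Proof. change (S n) with (1 + n)%nat. rewrite Csum_add. simpl. ring. Qed.

Lemma Csum_geom_bound u K q n : 0 <= q < 1 -> 0 <= K ->
  (forall k, (k < n)%nat -> Cmod (u k) <= K * q ^ k) -> Cmod (Csum u n) <= K / (1 - q).
Proof.
intros Hq HK H.
have G : Cmod (Csum u n) <= K * (1 - q ^ n) / (1 - q).
{ induction n; simpl.
  - rewrite Cmod_0. bound.
  - step apply Cmod_triangle.
    replace (K * (1 - q * q ^ n) / (1 - q)) with (K * (1 - q ^ n) / (1 - q) + K * q ^ n)
      by bound.
    bound. }
step exact G.
unfold Rdiv. apply Rmult_le_compat_r; [bound|].
assert (0 <= q ^ n) by bound.
rewrite <- (Rmult_1_r K) at 2. bound.
Qed.

Definition ps (c : nat -> C) (z l : C) : Prop := Clim (Csum (fun j => c j * z ^ j)%C) l.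

Lemma pow_n_Cpow (z : C) n : pow_n (K := C_Ring) z n = (z ^ n)%C.
Proof. bound. Qed.

Lemma sum_n_Csum (u : nat -> C) n : sum_n (G := C_AbelianMonoid) u n = Csum u (S n).
Proof.
induction n.
- rewrite sum_O. simpl. ring.
- rewrite sum_Sn, IHn. reflexivity.
Qed.

Lemma C_locally_eps (P : C -> Prop) (l : C) :
  locally (T := C_UniformSpace) l P <->
  exists d, 0 < d /\ forall y, Cmod (y - l) < d -> P y.
Proof.
split.
- intros [d Hd]. exists d; split; [apply cond_pos|]. intros y Hy. apply Hd.
  apply C_NormedModule_mixin_compat1. exact Hy.
- intros [d [Hd H]].
  have Hs : 0 < d / 2 by lra.
  exists (mkposreal _ Hs). intros y [H1 H2].
  apply H. step apply Cmod_le_Re_Im.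
  change (Rabs (fst y - fst l) < d / 2) in H1. change (Rabs (snd y - snd l) < d / 2) in H2.
  change (Rabs (fst y - fst l) + Rabs (snd y - snd l) < d). lra.
Qed.

Lemma is_pseries_ps (c : nat -> C) (z l : C) :
  is_pseries (K := C_AbsRing) (V := C_NormedModule) c z l <-> ps c z l.
Proof.
have E : forall n, sum_n (G := C_AbelianMonoid) (fun k : nat =>
  scal (V := C_NormedModule) (pow_n (K := C_AbsRing) z k : C_AbsRing) (c k)) n
  = Csum (fun j => c j * z ^ j)%C (S n).
{ intros n. rewrite sum_n_Csum. apply Csum_ext. intros k _.
  change (pow_n (K := C_Ring) z k * c k = c k * z ^ k)%C.
  rewrite pow_n_Cpow. ring. }
split; intros H.
- apply (Clim_incr _ _ 1). intros eps He.
  destruct (H (fun y => Cmod (y - l) <= eps)) as [N HN].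
  { apply C_locally_eps. exists eps; split; [bound|]. intros; lra. }
  exists N. intros n Hn. specialize (HN n Hn). cbv beta in HN.
  rewrite Nat.add_1_r, <- E. exact HN.
- intros P HP. apply C_locally_eps in HP. destruct HP as [d [Hd HP]].
  destruct (H (d / 2) ltac:(lra)) as [N HN]. exists N. intros n Hn. apply HP.
  specialize (HN (S n) ltac:(lia)). rewrite <- E in HN.
  step exact HN. lra.
Qed.

Lemma ps_unique c z l l' : ps c z l -> ps c z l' -> l = l'.
Proof. apply Clim_unique. Qed.

Lemma ps_ext c c' z l : (forall n, c n = c' n) -> ps c z l -> ps c' z l.
Proof. intros H. apply Clim_ext. intros n. apply Csum_ext. intros k _. rewrite H. reflexivity. Qed.

Lemma ps_plus c c' z l l' : ps c z l -> ps c' z l' -> ps (fun n => c n + c' n)%C z (l + l')%C.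
Proof.
intros H H'. eapply Clim_ext; [|apply (Clim_plus _ _ _ _ H H')].
intros n. cbv beta. rewrite <- Csum_plus. apply Csum_ext. intros. ring.
Qed.

Lemma ps_scal a c z l : ps c z l -> ps (fun n => a * c n)%C z (a * l)%C.
Proof.
intros H. eapply Clim_ext; [|apply (Clim_scal a _ _ H)].
intros n. cbv beta. rewrite <- Csum_scal. apply Csum_ext. intros. ring.
Qed.

Lemma ps_exists c z K q : 0 <= q < 1 -> 0 <= K ->
  (forall n, Cmod (c n * z ^ n) <= K * q ^ n) ->
  exists l, ps c z l /\ forall n, Cmod (Csum (fun j => c j * z ^ j)%C n - l) <= K / (1 - q) * q ^ n.
Proof.
intros Hq HK H.
have T : forall n m, (n <= m)%nat ->
  Cmod (Csum (fun j => c j * z ^ j)%C n - Csum (fun j => c j * z ^ j)%C m)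
    <= K / (1 - q) * q ^ n.
{ intros n m Hnm. replace m with (n + (m - n))%nat by lia.
  rewrite Csum_add, Cmod_minus_sym.
  match goal with |- Cmod (?a + ?b - ?a)%C <= _ => replace (a + b - a)%C with b by ring end.
  through (K * q ^ n / (1 - q)); [|bound].
  apply Csum_geom_bound; auto. { bound. }
  intros k _. step apply H. rewrite pow_add. right; ring. }
destruct (Clim_cauchy (Csum (fun j => c j * z ^ j)%C)) as [l Hl].
- intros eps He.
  have L := geom_lim q (K / (1 - q)) Hq. apply is_lim_seq_spec in L.
  destruct (L (mkposreal (eps / 2) ltac:(lra))) as [N HN]. exists N.
  specialize (HN N (le_n _)). simpl in HN. rewrite Rminus_0_r in HN.
  have HN2 := Rle_abs (K / (1 - q) * q ^ N).
  intros n m Hn Hm.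
  step apply (Cmod_triangle_3 _ (Csum (fun j => c j * z ^ j)%C N)).
  rewrite (Cmod_minus_sym _ (Csum (fun j => c j * z ^ j)%C N)).
  have A := T N n Hn. have B := T N m Hm. lra.
- exists l. split; [bound|]. intros n. apply le_epsilon. intros e He.
  destruct (Hl e He) as [N HN].
  step apply (Cmod_triangle_3 _ (Csum (fun j => c j * z ^ j)%C (max n N))).
  apply Rplus_le_compat; [apply T; lia|apply HN; lia].
Qed.

(** * Circles in logarithmic coordinates *)

Lemma exp_circle_inj (v v0 : C) : Cexp v = Cexp v0 -> Rabs (Im v - Im v0) <= PI -> v = v0.
Proof.
intros E H.
have E1 : Re v = Re v0.
{ apply exp_inv. rewrite <- !Cmod_Cexp. f_equal. exact E. }
have E2 : Cexp (v - v0) = 1%C.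
{ unfold Cminus. rewrite Cexp_add, Cexp_opp, E. field. apply Cexp_neq_0. }
have Hc : cos (Im v - Im v0) = 1.
{ have Q := f_equal Re E2. unfold Cexp in Q. simpl in Q.
  unfold Re, Im in *. rewrite E1 in Q. replace (fst v0 + - fst v0) with 0 in Q by ring.
  rewrite exp_0 in Q. unfold Rminus. lra. }
apply C_ext; [bound|].
have Hy : Im v - Im v0 = 0; [|lra].
set (y := Im v - Im v0) in *. clearbody y.
have Ha : cos (Rabs y) = 1.
{ unfold Rabs. destruct Rcase_abs; [rewrite cos_neg|]; exact Hc. }
destruct (Req_dec (Rabs y) 0) as [Q|Q].
- destruct (Req_dec y 0); auto. apply Rabs_no_R0 in H0. contradiction.
- exfalso. have P := Rabs_pos y.
  have L := cos_decreasing_1 0 (Rabs y). rewrite cos_0 in L.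
  bound.
Qed.

Lemma polar_exists (z : C) : z <> 0%C -> exists t, z = Cexp (mkC (ln (Cmod z)) t).
Proof.
intros Hz. have Hm : 0 < Cmod z by (apply Cmod_gt_0; exact Hz).
set (x := Re z / Cmod z). set (y := Im z / Cmod z).
have Hxy : x² + y² = 1.
{ unfold x, y, Rsqr.
  replace (Re z / Cmod z * (Re z / Cmod z) + Im z / Cmod z * (Im z / Cmod z))
    with ((Re z ^ 2 + Im z ^ 2) / (Cmod z ^ 2)) by bound.
  rewrite <- Cmod2_alt. field. lra. }
have Hx : -1 <= x <= 1.
{ unfold Rsqr in *. nra. }
have Hs : sin (acos x) = Rabs y.
{ rewrite sin_acos by bound. replace (1 - x²) with (y²) by lra. apply sqrt_Rsqr_abs. }
have Hc := cos_acos x Hx.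
have E : exists t, cos t = x /\ sin t = y.
{ destruct (Rle_dec 0 y) as [Hy|Hy].
  - exists (acos x). rewrite Hs, Rabs_pos_eq; auto.
  - exists (- acos x). rewrite cos_neg, sin_neg, Hs, Rabs_left by lra. split; lra. }
destruct E as [t [E1 E2]]. exists t. unfold Cexp, mkC. simpl. rewrite exp_ln, E1, E2 by bound.
apply C_ext; simpl; unfold x, y; field; lra.
Qed.

Lemma CI_periodic (f : R -> C) (T t0 : R) : 0 < T -> (forall t, f (t + T) = f t) ->
  (forall t, cts f t) -> CI f t0 (t0 + T) = CI f 0 T.
Proof.
intros HT Hp Hc.
have Hi : forall a b, icts f a b by (intros a b t _; apply Hc).
have G : forall a b, a <= b -> CI f (a + T) (b + T) = CI f a b.
{ intros a b Hab. rewrite <- (CI_shift f a b T) by auto.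
  apply CI_ext; auto. }
destruct (Rle_dec 0 t0) as [H0|H0].
- have E1 := CI_Chasles f 0 T (t0 + T) ltac:(lra) ltac:(lra) (Hi _ _).
  have E2 := CI_Chasles f 0 t0 (t0 + T) ltac:(lra) ltac:(lra) (Hi _ _).
  have E3 := G 0 t0 H0. rewrite Rplus_0_l in E3.
  rewrite E3 in E1. rewrite <- E2 in E1.
  replace (CI f 0 T) with ((CI f 0 T + CI f 0 t0) - CI f 0 t0)%C by ring.
  rewrite E1. ring.
- have E1 := CI_Chasles f t0 0 T ltac:(lra) ltac:(lra) (Hi _ _).
  have E2 := CI_Chasles f t0 (t0 + T) T ltac:(lra) ltac:(lra) (Hi _ _).
  have E3 := G t0 0 ltac:(lra). rewrite Rplus_0_l in E3.
  rewrite E3 in E2. rewrite <- E1 in E2.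
  replace (CI f t0 (t0 + T)) with ((CI f t0 (t0 + T) + CI f t0 0) - CI f t0 0)%C by ring.
  rewrite E2. ring.
Qed.

Lemma CI_exp_circle (x s : R) : x <> 0 -> Cexp (RtoC x * mkC 0 (2 * PI)) = 1%C ->
  CI (fun t => Cexp (RtoC x * mkC s t))%C 0 (2 * PI) = 0%C.
Proof.
intros Hx HP. have PP := PI_RGT_0.
have E : CI (fun t => Ci * (fun v => Cexp (RtoC x * v)) (mkC s 0 + RtoC t * Ci))%C 0 (2 * PI)
  = 0%C.
{ rewrite (CI_FTC_line (fun v => / RtoC x * Cexp (RtoC x * v))%C
    (fun v => Cexp (RtoC x * v))%C); try lra.
  - replace (RtoC x * (mkC s 0 + RtoC (2 * PI) * Ci))%C
      with (RtoC x * (mkC s 0 + RtoC 0 * Ci) + RtoC x * mkC 0 (2 * PI))%C.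
    + rewrite Cexp_add, HP. ring.
    + bound.
  - intros t _. eapply Cder_eq; [|apply Cder_scal;
      apply Cder_Cexp_scal].
    field. intros Q; apply RtoC_inj in Q; auto.
  - intros t _. eapply Cder_Ccts, Cder_Cexp_scal. }
cbv beta in E.
rewrite CI_scal in E; try lra.
- rewrite (CI_ext _ (fun t => Cexp (RtoC x * mkC s t))%C) in E.
  + have HCi : Ci <> 0%C by (apply Cneq_0_of_Cmod; rewrite Cmod_Ci; lra).
    replace (CI (fun t => Cexp (RtoC x * mkC s t))%C 0 (2 * PI))
      with (/ Ci * (Ci * CI (fun t => Cexp (RtoC x * mkC s t))%C 0 (2 * PI)))%C
      by (field; exact HCi).
    rewrite E. ring.
  + lra.
  + intros t _. do 2 f_equal. bound.
- intros t _. apply (cts_comp (fun v => Cexp (RtoC x * v))%C); [apply cts_line|].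
  eapply Cder_Ccts, Cder_Cexp_scal.
Qed.

Lemma Cexp_nat_period n : Cexp (RtoC (INR n) * mkC 0 (2 * PI)) = 1%C.
Proof.
rewrite Cexp_pow. replace (Cexp (mkC 0 (2 * PI))) with (RtoC 1).
- induction n; simpl; [bound|]. rewrite IHn. ring.
- have H := Cexp_2PI 0. rewrite Cplus_0_l, Cexp_0 in H. auto.
Qed.

(** Circles are parametrized by the logarithm of their radius: in the coordinate
    [log u] an annulus becomes a rectangle. *)
Definition circ (s t : R) : C := Cexp (mkC s t).

Lemma Cmod_circ s t : Cmod (circ s t) = exp s.
Proof. apply Cmod_Cexp. Qed.

Lemma circ_neq_0 s t : circ s t <> 0%C.
Proof. apply Cexp_neq_0. Qed.

Lemma circ_period s t : circ s (t + 2 * PI) = circ s t.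
Proof.
unfold circ. replace (mkC s (t + 2 * PI)) with (mkC s t + mkC 0 (2 * PI))%C
  by bound. apply Cexp_2PI.
Qed.

Lemma cts_circ s t : cts (circ s) t.
Proof.
apply (cts_comp Cexp (fun y => mkC s y)).
- eapply cts_ext; [intros y; symmetry; apply mkC_ver|apply cts_line].
- eapply Cder_Ccts, Cder_Cexp.
Qed.

Lemma Cpow_neq_0 (z : C) n : z <> 0%C -> (z ^ n)%C <> 0%C.
Proof. intros H. induction n; simpl; [apply Cneq_0_of_Cmod; rewrite Cmod_1; lra|]. apply Cmult_neq_0; auto. Qed.

Lemma Cpow_add (z : C) n m : (z ^ (n + m) = z ^ n * z ^ m)%C.
Proof. induction n; simpl; [ring|]. rewrite IHn. ring. Qed.

Lemma Cpow_mult (a b : C) n : ((a * b) ^ n = a ^ n * b ^ n)%C.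
Proof. induction n; simpl; [ring|]. rewrite IHn. ring. Qed.

Lemma Cinv_pow (z : C) n : z <> 0%C -> (/ (z ^ n))%C = ((/ z) ^ n)%C.
Proof.
intros H. induction n; simpl; [field|]. rewrite <- IHn. field.
split; [apply Cpow_neq_0|]; exact H.
Qed.

Lemma CI_circ_monomial s j n :
  CI (fun t => circ s t ^ j * / (circ s t ^ n))%C 0 (2 * PI)
    = if Nat.eqb j n then RtoC (2 * PI) else RtoC 0.
Proof.
have PP := PI_RGT_0.
destruct (Nat.eqb_spec j n) as [->|Hn].
- rewrite (CI_ext _ (fun _ => RtoC 1)); [|lra|].
  + rewrite CI_const. bound.
  + intros t _. field. apply Cpow_neq_0, circ_neq_0.
- destruct (Nat.lt_trichotomy j n) as [H|[H|H]]; [|contradiction|].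
  + rewrite (CI_ext _ (fun t => Cexp (RtoC (- INR (n - j)) * mkC s t))); [|lra|].
    * apply CI_exp_circle.
      { apply Ropp_neq_0_compat, not_0_INR. lia. }
      { rewrite RtoC_opp. replace (- RtoC (INR (n - j)) * mkC 0 (2 * PI))%C
          with (- (RtoC (INR (n - j)) * mkC 0 (2 * PI)))%C by ring.
        rewrite Cexp_opp, Cexp_nat_period. field. }
    * intros t _. rewrite RtoC_opp.
      replace (- RtoC (INR (n - j)) * mkC s t)%C with (- (RtoC (INR (n - j)) * mkC s t))%C by ring.
      rewrite Cexp_opp, Cexp_pow. fold (circ s t).
      replace n with (j + (n - j))%nat at 1 by lia. rewrite Cpow_add.
      field. split; apply Cpow_neq_0, circ_neq_0.
  + rewrite (CI_ext _ (fun t => Cexp (RtoC (INR (j - n)) * mkC s t))); [|lra|].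
    * apply CI_exp_circle; [bound|apply Cexp_nat_period].
    * intros t _. rewrite Cexp_pow. fold (circ s t).
      replace j with ((j - n) + n)%nat at 1 by lia. rewrite Cpow_add.
      field. apply Cpow_neq_0, circ_neq_0.
Qed.

(** * Taylor expansion of holomorphic functions *)

Lemma Hor_periodic H a b y : (forall v, H (v + mkC 0 (2 * PI))%C = H v) -> a <= b ->
  Hor H (y + 2 * PI) a b = Hor H y a b.
Proof.
intros HP Hab. unfold Hor. apply CI_ext; auto. intros x _. rewrite <- (HP (mkC x y)).
f_equal. bound.
Qed.

(** Small squares about the singularity have small perimeter, and the function is
    bounded there. *)
Lemma RI_removable H a b c d p q : a < p < b -> c < q < d ->
  (forall z, rect a b c d z -> z <> mkC p q -> exists l, Cder H z l) ->
  Ccts H (mkC p q) -> RI H a b c d = 0%C.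
Proof.
intros Hp Hq HH Hc. apply Ceq_limit. intros eps He.
replace (RI H a b c d - 0)%C with (RI H a b c d) by ring.
destruct (Hc 1 Rlt_0_1) as [de [Hde Hd]].
set (B := Cmod (H (mkC p q)) + 1).
have HB : 0 < B by (have Q := Cmod_ge_0 (H (mkC p q)); unfold B; lra).
set (e := Rmin (Rmin (p - a) (b - p)) (Rmin (Rmin (q - c) (d - q))
  (Rmin (de / 4) (eps / (8 * B))))).
have He0 : 0 < e.
{ unfold e. bound. }
have L1 : e <= p - a by (unfold e; eapply Rle_trans; [apply Rmin_l|apply Rmin_l]).
have L2 : e <= b - p by (unfold e; eapply Rle_trans; [apply Rmin_l|apply Rmin_r]).
have L3 : e <= q - c.
{ unfold e; eapply Rle_trans; [apply Rmin_r|eapply Rle_trans; [apply Rmin_l|apply Rmin_l]]. }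
have L4 : e <= d - q.
{ unfold e; eapply Rle_trans; [apply Rmin_r|eapply Rle_trans; [apply Rmin_l|apply Rmin_r]]. }
have L5 : e <= de / 4.
{ unfold e; eapply Rle_trans; [apply Rmin_r|eapply Rle_trans; [apply Rmin_r|apply Rmin_l]]. }
have L6 : e <= eps / (8 * B).
{ unfold e; eapply Rle_trans; [apply Rmin_r|eapply Rle_trans; [apply Rmin_r|apply Rmin_r]]. }
rewrite (RI_square H a b c d p q e); auto; try lra.
step (apply (RI_bound _ _ _ _ _ B); try lra).
- intros z Hz. destruct (Ceq_dec z (mkC p q)) as [->|Hn]; [bound|].
  destruct (HH z) as [l Hl]; auto. { destruct Hz; split; lra. }
  exact (Cder_Ccts _ _ _ Hl).
- intros z [Z1 Z2].
  have Hz : Cmod (z - mkC p q) < de.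
  { step apply Cmod_le_Re_Im.
    change (Rabs (Re z - p) + Rabs (Im z - q) < de).
    assert (Rabs (Re z - p) <= e) by bound.
    assert (Rabs (Im z - q) <= e) by bound. lra. }
  specialize (Hd z Hz). have Q := Cmod_triangle_inv (H z) (H (mkC p q)). unfold B. lra.
- through (8 * B * (eps / (8 * B))); [|right; field; lra].
  replace (2 * B * (p + e - (p - e) + (q + e - (q - e)))) with (8 * B * e) by ring.
  bound.
Qed.

Lemma Ver_annulus H s1 s2 c : s1 <= s2 ->
  (forall v, H (v + mkC 0 (2 * PI))%C = H v) ->
  RI H s1 s2 c (c + 2 * PI) = 0%C -> Ver H s1 c (c + 2 * PI) = Ver H s2 c (c + 2 * PI).
Proof.
intros Hs HP E. unfold RI in E. rewrite (Hor_periodic H s1 s2 c HP Hs) in E.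
replace (Ver H s2 c (c + 2 * PI)) with
  ((Hor H c s1 s2 + Ver H s2 c (c + 2 * PI) - Hor H c s1 s2 - Ver H s1 c (c + 2 * PI)) +
   Ver H s1 c (c + 2 * PI))%C by ring.
rewrite E. ring.
Qed.

Lemma Ci_neq_0 : Ci <> 0%C.
Proof. apply Cneq_0_of_Cmod. rewrite Cmod_Ci. lra. Qed.

Lemma Ver_circ F s : (forall t, cts (fun t => F (circ s t)) t) ->
  Ver (fun v => F (Cexp v)) s 0 (2 * PI) = (Ci * CI (fun t => F (circ s t)) 0 (2 * PI))%C.
Proof.
intros H. have PP := PI_RGT_0. unfold Ver.
rewrite (CI_scal Ci (fun t => F (Cexp (mkC s t)))); try lra; auto.
intros t _. apply H.
Qed.

(** In the coordinate [log u] the annulus is a rectangle, whose horizontal sides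
    cancel by periodicity. *)
Lemma circle_mean_annulus F s1 s2 : s1 <= s2 ->
  (forall u, exp s1 <= Cmod u <= exp s2 -> exists l, Cder F u l) ->
  CI (fun t => F (circ s1 t)) 0 (2 * PI) = CI (fun t => F (circ s2 t)) 0 (2 * PI).
Proof.
intros Hs HF. have PP := PI_RGT_0.
set (H := fun v => F (Cexp v)).
have HP : forall v, H (v + mkC 0 (2 * PI))%C = H v.
{ intros v. unfold H. rewrite Cexp_2PI. reflexivity. }
have E : RI H s1 s2 0 (0 + 2 * PI) = 0%C.
{ apply Goursat; try lra. intros z [Z1 Z2]. destruct (HF (Cexp z)) as [l Hl].
  { rewrite Cmod_Cexp. bound. }
  eexists. apply (Cder_comp F Cexp); [apply Cder_Cexp|exact Hl]. }
have V := Ver_annulus H s1 s2 0 Hs HP E. rewrite Rplus_0_l in V.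
unfold H in V. rewrite !Ver_circ in V.
- have HC := Ci_neq_0.
  replace (CI (fun t => F (circ s1 t)) 0 (2 * PI))
    with (/ Ci * (Ci * CI (fun t => F (circ s1 t)) 0 (2 * PI)))%C by (field; exact HC).
  rewrite V. field. exact HC.
- intros t. apply (cts_comp F (circ s2)); [apply cts_circ|].
  destruct (HF (circ s2 t)) as [l Hl]; [|exact (Cder_Ccts _ _ _ Hl)].
  rewrite Cmod_circ. bound.
- intros t. apply (cts_comp F (circ s1)); [apply cts_circ|].
  destruct (HF (circ s1 t)) as [l Hl]; [|exact (Cder_Ccts _ _ _ Hl)].
  rewrite Cmod_circ. bound.
Qed.

Definition ball0 (r : R) (z : C) : Prop := Cmod z < r.

Lemma Copen_ball0 r : Copen (ball0 r).
Proof.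
intros z Hz. unfold ball0 in *. exists (r - Cmod z). split; [lra|].
intros y Hy. have Q := Cmod_triangle_inv y z. lra.
Qed.

Definition coef (f : C -> C) (s : R) (n : nat) : C :=
  (/ RtoC (2 * PI) * CI (fun t => f (circ s t) * / (circ s t ^ n)) 0 (2 * PI))%C.

Lemma RtoC_2PI_neq_0 : RtoC (2 * PI) <> 0%C.
Proof. have PP := PI_RGT_0. intros E. apply RtoC_inj in E. lra. Qed.

Lemma exp_lt_of_ln s r : 0 < r -> s < ln r -> exp s < r.
Proof. intros Hr Hs. rewrite <- (exp_ln r Hr). apply exp_increasing, Hs. Qed.

Lemma holo_coef_integrand f R0 n : holo (ball0 R0) f -> forall u : C, u <> 0%C -> Cmod u < R0 ->
  exists l, Cder (fun u => f u * / (u ^ n))%C u l.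
Proof.
intros Hf u Hu Hu'.
destruct (holo_mult (fun u => Cmod u < R0 /\ u <> 0%C) f (fun u => / (u ^ n))%C) with (z := u)
  as [l Hl]; auto.
- intros z [Hz _]. apply Hf, Hz.
- apply holo_inv. { intros z [_ Hz]. apply Cpow_neq_0, Hz. }
  intros z _. eexists. apply Cder_pow.
- exists l; exact Hl.
Qed.

Lemma coef_indep f R0 n s s' : holo (ball0 R0) f -> exp s < R0 -> exp s' < R0 ->
  coef f s n = coef f s' n.
Proof.
intros Hf.
have G : forall s s', s <= s' -> exp s' < R0 -> coef f s n = coef f s' n.
{ intros s1 s2 Hs Hs2. unfold coef. f_equal.
  apply (circle_mean_annulus (fun u => f u * / (u ^ n))%C); auto.
  intros u [Hu1 Hu2]. apply (holo_coef_integrand f R0 n Hf); [|lra].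
  apply Cneq_0_of_Cmod. eapply Rlt_le_trans; [apply exp_pos|exact Hu1]. }
intros H1 H2. destruct (Rle_dec s s'); [|symmetry]; apply G; auto; lra.
Qed.

Lemma cts_coef_integrand f R0 n s t : holo (ball0 R0) f -> exp s < R0 ->
  cts (fun t => f (circ s t) * / (circ s t ^ n))%C t.
Proof.
intros Hf Hs. apply (cts_comp (fun u => f u * / (u ^ n))%C (circ s)); [apply cts_circ|].
destruct (holo_coef_integrand f R0 n Hf (circ s t)) as [l Hl].
- apply circ_neq_0.
- rewrite Cmod_circ. exact Hs.
- exact (Cder_Ccts _ _ _ Hl).
Qed.

Lemma Cmod_inv_circ_pow s t n : Cmod (/ (circ s t ^ n)) = / exp s ^ n.
Proof.
rewrite Cmod_inv by (apply Cpow_neq_0, circ_neq_0). rewrite Cmod_pow, Cmod_circ. reflexivity.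
Qed.

Lemma coef_bound f R0 n s B : holo (ball0 R0) f -> exp s < R0 ->
  (forall t, Cmod (f (circ s t)) <= B) -> Cmod (coef f s n) <= B / exp s ^ n.
Proof.
intros Hf Hs HB. have PP := PI_RGT_0. unfold coef.
rewrite Cmod_mult, Cmod_inv, Cmod_R, Rabs_pos_eq by (try apply RtoC_2PI_neq_0; lra).
have A : Cmod (CI (fun t => f (circ s t) * / (circ s t ^ n))%C 0 (2 * PI))
  <= B / exp s ^ n * (2 * PI - 0).
{ apply CI_bound_const; try lra.
  - intros t _. apply (cts_coef_integrand f R0); auto.
  - intros t _. rewrite Cmod_mult, Cmod_inv_circ_pow. apply Rmult_le_compat_r; auto.
    bound. }
through (/ (2 * PI) * (B / exp s ^ n * (2 * PI - 0))).
- bound.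
- right. field. bound.
Qed.

Definition quot (f : C -> C) (z l u : C) : C :=
  if Ceq_dec u z then l else ((f u - f z) / (u - z))%C.

Lemma quot_spec f z l u : (quot f z l u * (u - z))%C = (f u - f z)%C.
Proof.
unfold quot. destruct Ceq_dec as [->|Hn]; [ring|]. field.
intros E. apply Hn. replace u with ((u - z) + z)%C by ring. rewrite E. ring.
Qed.

Lemma Ccts_quot f z l : Cder f z l -> Ccts (quot f z l) z.
Proof.
intros H eps He. destruct (H (eps / 2) ltac:(lra)) as [d [Hd H']].
exists d. split; [bound|]. intros y Hy.
unfold quot at 2. destruct Ceq_dec as [_|Q]; [|contradiction].
destruct (Ceq_dec y z) as [->|Hn].
{ unfold quot. destruct Ceq_dec as [_|Q]; [|contradiction].
  rewrite Cmod_minus_self. exact He. }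
have Hyz : (y - z)%C <> 0%C.
{ intros E. apply Hn. replace y with ((y - z) + z)%C by ring. rewrite E. ring. }
have Hm : 0 < Cmod (y - z) by (apply Cmod_gt_0; exact Hyz).
specialize (H' y Hy). rewrite <- (quot_spec f z l) in H'.
replace (quot f z l y * (y - z) - l * (y - z))%C with ((quot f z l y - l) * (y - z))%C in H' by ring.
rewrite Cmod_mult in H'. apply Rmult_le_reg_r in H'; [lra|bound].
Qed.

Lemma Cder_quot f z l u m : u <> z -> Cder f u m -> exists m', Cder (quot f z l) u m'.
Proof.
intros Hn Hm.
have Huz : (u - z)%C <> 0%C.
{ intros E. apply Hn. replace u with ((u - z) + z)%C by ring. rewrite E. ring. }
have H1 := Cder_mult (fun u => f u + - f z)%C (fun u => / (u + - z))%C u _ _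
  (Cder_plus _ _ _ _ _ Hm (Cder_const (- f z) u))
  (Cder_inv (fun u => u + - z)%C u _ Huz
    (Cder_plus _ _ _ _ _ (Cder_id u) (Cder_const (- z) u))).
eexists. eapply Cder_ext_loc; [|exact H1].
exists (Cmod (u - z)). split; [apply Cmod_gt_0; exact Huz|].
intros y Hy. cbv beta. unfold quot. destruct Ceq_dec as [->|_]; [|bound].
rewrite Cmod_minus_sym in Hy. lra.
Qed.

Lemma CI_quot_circle f R0 z l s : holo (ball0 R0) f -> Cder f z l -> Cmod z < exp s ->
  exp s < R0 -> CI (fun t => quot f z l (circ s t) * circ s t)%C 0 (2 * PI) = 0%C.
Proof.
intros Hf Hl Hz Hs. have PP := PI_RGT_0.
set (F := fun u => (quot f z l u * u)%C).
have HF : forall u, Cmod u < R0 -> u <> z -> exists m, Cder F u m.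
{ intros u Hu Hn. destruct (Hf u Hu) as [m Hm].
  destruct (Cder_quot f z l u m Hn Hm) as [m' Hm'].
  eexists. apply (Cder_mult (quot f z l) (fun u => u)); [exact Hm'|apply Cder_id]. }
have HFz : Ccts F z.
{ intros eps He. have Q := Ccts_quot f z l Hl.
  set (A := Cmod l + Cmod z + 1).
  have HA : 0 < A by (unfold A; have Z1 := Cmod_ge_0 l; have Z2 := Cmod_ge_0 z; lra).
  destruct (Q (Rmin 1 (eps / (2 * A)))) as [d [Hd H']].
  { bound. }
  exists (Rmin d (Rmin 1 (eps / (2 * A)))). split.
  { bound. }
  intros y Hy. unfold F.
  have Y1 := Rlt_le_trans _ _ _ Hy (Rmin_l _ _).
  have Y2 := Rlt_le_trans _ _ _ Hy (Rmin_r _ _).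
  specialize (H' y Y1).
  have Eq : quot f z l z = l by (unfold quot; destruct Ceq_dec; [bound|contradiction]).
  rewrite Eq in *.
  replace (quot f z l y * y - l * z)%C
    with ((quot f z l y - l) * (y - z) + ((quot f z l y - l) * z + l * (y - z)))%C by ring.
  step (eapply Rle_trans; [apply Cmod_triangle|
    apply Rplus_le_compat_l, Cmod_triangle]). rewrite !Cmod_mult.
  set (e := Rmin 1 (eps / (2 * A))) in *.
  have M1 : e <= 1 by apply Rmin_l. have M2 : e <= eps / (2 * A) by apply Rmin_r.
  have M3 : e * A <= eps / 2.
  { through (eps / (2 * A) * A); [bound|right; field; lra]. }
  have S1 : Cmod (quot f z l y - l) * Cmod (y - z) <= e * 1 by bound.
  have S2 : Cmod (quot f z l y - l) * Cmod z <= e * Cmod z by bound.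
  have S3 : Cmod l * Cmod (y - z) <= Cmod l * e by bound.
  unfold A in M3. lra. }
have HFc : forall u, Cmod u < R0 -> Ccts F u.
{ intros u Hu. destruct (Ceq_dec u z) as [->|Hn]; [bound|].
  apply diff_Ccts, (HF u Hu Hn). }
(* The integral over a small circle tends to zero because of the factor [u]. *)
have HF0 : F 0%C = 0%C by bound.
have Main : forall s0, s0 <= s -> (z = 0%C \/ exp s0 < Cmod z) ->
  CI (fun t => F (circ s t)) 0 (2 * PI) = CI (fun t => F (circ s0 t)) 0 (2 * PI).
{ intros s0 Hs0 [E|E].
  - symmetry. apply circle_mean_annulus; auto. intros u [U1 U2]. apply HF; [lra|].
    rewrite E. apply Cneq_0_of_Cmod. have Q := exp_pos s0. lra.
  - have Hz0 : z <> 0%C by (apply Cneq_0_of_Cmod; have Q := exp_pos s0; lra).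
    destruct (polar_exists z Hz0) as [t0 Ht0].
    set (H := fun v => F (Cexp v)).
    have HP : forall v, H (v + mkC 0 (2 * PI))%C = H v.
    { intros v. unfold H. rewrite Cexp_2PI. reflexivity. }
    have Hlz : exp (ln (Cmod z)) = Cmod z by (apply exp_ln, Cmod_gt_0, Hz0).
    have ER : RI H s0 s (t0 - PI) (t0 - PI + 2 * PI) = 0%C.
    { apply (RI_removable H _ _ _ _ (ln (Cmod z)) t0).
      - split; apply exp_lt_inv; rewrite Hlz; assumption.
      - lra.
      - intros v [V1 V2] Hn. destruct (HF (Cexp v)) as [m Hm].
        + rewrite Cmod_Cexp. eapply Rle_lt_trans; [|exact Hs].
          bound.
        + intros E'. apply Hn. apply exp_circle_inj; [rewrite E'; exact Ht0|].
          simpl. bound.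
        + eexists. apply (Cder_comp F Cexp); [apply Cder_Cexp|exact Hm].
      - intros eps He. rewrite Ht0 in HFz.
        destruct (HFz eps He) as [d [Hd H']].
        destruct (Cder_Ccts _ _ _ (Cder_Cexp (mkC (ln (Cmod z)) t0)) d Hd) as [d' [Hd' H'']].
        rewrite <- Ht0 in H'.
        exists d'. split; [bound|]. intros y Hy. unfold H.
        rewrite <- Ht0. apply H'. rewrite Ht0. bound. }
    have V := Ver_annulus H s0 s (t0 - PI) Hs0 HP ER.
    have G : forall s', s' <= s -> Ver H s' (t0 - PI) (t0 - PI + 2 * PI) =
      (Ci * CI (fun t => F (circ s' t)) 0 (2 * PI))%C.
    { intros s' Hs'. unfold Ver, H.
      rewrite (CI_periodic (fun y => Ci * F (Cexp (mkC s' y)))%C (2 * PI) (t0 - PI)); [|lra| |].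
      - rewrite (CI_scal Ci (fun t => F (circ s' t))); auto; [lra|].
        intros t _. apply (cts_comp F (circ s')); [apply cts_circ|apply HFc].
        rewrite Cmod_circ. eapply Rle_lt_trans; [|exact Hs].
        bound.
      - intros t. do 2 f_equal. apply circ_period.
      - intros t. apply cts_scal, (cts_comp F (circ s')); [apply cts_circ|apply HFc].
        rewrite Cmod_circ. eapply Rle_lt_trans; [|exact Hs].
        bound. }
    rewrite !G in V by lra.
    have HC := Ci_neq_0.
    replace (CI (fun t => F (circ s t)) 0 (2 * PI))
      with (/ Ci * (Ci * CI (fun t => F (circ s t)) 0 (2 * PI)))%C by (field; exact HC).
    rewrite <- V. field. exact HC. }
change (CI (fun t => F (circ s t)) 0 (2 * PI) = 0%C).
apply Ceq_limit. intros eps He.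
replace (CI (fun t => F (circ s t)) 0 (2 * PI) - 0)%C
  with (CI (fun t => F (circ s t)) 0 (2 * PI)) by ring.
have He' : 0 < eps / (2 * PI) by bound.
have H00 : Cmod 0 < R0.
{ rewrite Cmod_0. eapply Rlt_trans; [apply exp_pos|exact Hs]. }
destruct (HFc 0%C H00 (eps / (2 * PI)) He') as [d [Hd Hd']].
set (s0 := Rmin s (Rmin (ln d - 1) (if Ceq_dec z 0 then s else ln (Cmod z) - 1))).
rewrite (Main s0).
- replace eps with (eps / (2 * PI) * (2 * PI - 0)) by bound.
  apply CI_bound_const; try lra.
  + intros t _. apply (cts_comp F (circ s0)); [apply cts_circ|apply HFc].
    rewrite Cmod_circ. eapply Rle_lt_trans; [|exact Hs].
    apply exp_mono, Rmin_l.
  + intros t _. left. replace (F (circ s0 t)) with (F (circ s0 t) - F 0)%C by bound.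
    apply Hd'. replace (circ s0 t - 0)%C with (circ s0 t) by ring. rewrite Cmod_circ.
    apply exp_lt_of_ln; auto. unfold s0.
    eapply Rle_lt_trans; [eapply Rle_trans; [apply Rmin_r|apply Rmin_l]|lra].
- apply Rmin_l.
- destruct (Ceq_dec z 0) as [E|E]; [bound|right].
  apply exp_lt_of_ln; [apply Cmod_gt_0, E|]. unfold s0.
  eapply Rle_lt_trans; [eapply Rle_trans; [apply Rmin_r|apply Rmin_r]|lra].
Qed.

Lemma Csum_geom_identity (x : C) n : ((1 - x) * Csum (fun j => x ^ j) n)%C = (1 - x ^ n)%C.
Proof. induction n; simpl; [ring|]. rewrite Cmult_plus_distr_l, IHn. ring. Qed.

(** Cauchy's formula, expanded as a geometric series in [z / u]. *)
Lemma Taylor_coef f R0 s z : holo (ball0 R0) f -> exp s < R0 -> Cmod z < exp s ->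
  ps (coef f s) z (f z).
Proof.
intros Hf Hs Hz. have PP := PI_RGT_0.
destruct (Hf z) as [l Hl]; [unfold ball0; lra|].
have Q0 := CI_quot_circle f R0 z l s Hf Hl Hz Hs.
set (q := fun t => (quot f z l (circ s t) * circ s t)%C) in Q0.
have Hne : forall t, circ s t <> z.
{ intros t E. have A := Cmod_circ s t. rewrite E in A. lra. }
have Hq : forall t, cts q t.
{ intros t. apply cts_mult; [|apply cts_circ].
  apply (cts_comp (quot f z l) (circ s)); [apply cts_circ|].
  destruct (Hf (circ s t)) as [m Hm]. { unfold ball0. rewrite Cmod_circ. exact Hs. }
  destruct (Cder_quot f z l (circ s t) m (Hne t) Hm) as [m' Hm'].
  exact (Cder_Ccts _ _ _ Hm'). }
have HB : exists B, 0 <= B /\ forall t, 0 <= t <= 2 * PI -> Cmod (q t) <= B.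
{ destruct (continuity_ab_maj (fun t => Cmod (q t)) 0 (2 * PI)) as [tm [Hm _]]; [lra| |].
  - intros t _. apply continuity_pt_filterlim. apply cts_Cmod, Hq.
  - exists (Cmod (q tm)). bound. }
destruct HB as [B [HB0 HB]].
set (x := Cmod z / exp s).
have Hx : 0 <= x < 1.
{ unfold x. bound. }
have Hcm : forall j t, cts (fun t => f (circ s t) * / (circ s t ^ j))%C t.
{ intros j t. apply (cts_coef_integrand f R0); auto. }
have Hc1 : forall j t, cts (fun t => / (circ s t ^ j))%C t.
{ intros j t.
  apply (cts_ext (fun t => circ s t ^ 0 * / (circ s t ^ j))%C). { intros; simpl; ring. }
  apply (cts_comp (fun u => u ^ 0 * / (u ^ j))%C (circ s)); [apply cts_circ|].
  destruct (holo_coef_integrand (fun u => u ^ 0)%C R0 j) with (u := circ s t) as [m Hm].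
  - intros u _. eexists; apply Cder_pow.
  - apply circ_neq_0.
  - rewrite Cmod_circ; exact Hs.
  - exact (Cder_Ccts _ _ _ Hm). }
apply (Clim_incr _ _ 1).
apply (Clim_0_of_bound _ _ (fun n => B * x * x ^ n)); [apply geom_lim; exact Hx|].
intros n. rewrite Nat.add_1_r.
set (N := S n).
have E1 : CI (fun t => (z / circ s t) ^ N * q t)%C 0 (2 * PI) =
  (RtoC (2 * PI) * (f z - Csum (fun j => coef f s j * z ^ j) N))%C.
{ have A1 : CI (fun t => (Csum (fun j => z ^ j * (f (circ s t) * / circ s t ^ j)) N))%C 0 (2 * PI)
    = (RtoC (2 * PI) * Csum (fun j => coef f s j * z ^ j) N)%C.
  { destruct (CI_Csum (fun j t => z ^ j * (f (circ s t) * / circ s t ^ j))%C 0 (2 * PI) N) as [A _].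
    - lra.
    - intros j t _. apply cts_scal, Hcm.
    - rewrite A, <- Csum_scal. apply Csum_ext. intros j _.
      rewrite CI_scal; [|lra|intros t _; apply Hcm]. unfold coef. field. apply RtoC_2PI_neq_0. }
  have A2 : CI (fun t => (Csum (fun j => (f z * z ^ j) * / circ s t ^ j) N))%C 0 (2 * PI)
    = (RtoC (2 * PI) * f z)%C.
  { destruct (CI_Csum (fun j t => (f z * z ^ j) * / circ s t ^ j)%C 0 (2 * PI) N) as [A _].
    - lra.
    - intros j t _. apply cts_scal, Hc1.
    - rewrite A. unfold N. rewrite Csum_shift_l.
      rewrite (Csum_ext _ (fun _ => RtoC 0)), Csum_zero.
      + rewrite CI_scal; [|lra|intros t _; apply Hc1].
        rewrite (CI_ext _ (fun _ => RtoC 1)); [|lra|intros; simpl; field].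
        rewrite CI_const. bound.
      + intros j _. rewrite CI_scal; [|lra|intros t _; apply Hc1].
        have M := CI_circ_monomial s 0 (S j). simpl Nat.eqb in M. cbv iota in M.
        rewrite (CI_ext _ (fun t => circ s t ^ 0 * / circ s t ^ S j)%C);
          [|lra|intros; simpl (circ s t ^ 0)%C; ring].
        rewrite M. ring. }
  have A3 : CI (fun t => q t - ((Csum (fun j => z ^ j * (f (circ s t) * / circ s t ^ j)) N)
    - (Csum (fun j => (f z * z ^ j) * / circ s t ^ j) N)))%C 0 (2 * PI) =
    (RtoC (2 * PI) * (f z - Csum (fun j => coef f s j * z ^ j) N))%C.
  { rewrite CI_minus; [|lra|intros t _; apply Hq|].
    - rewrite Q0, CI_minus; [|lra| |].
      + rewrite A1, A2. ring.
      + apply CI_Csum; [lra|]. intros j t _. apply cts_scal, Hcm.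
      + apply CI_Csum; [lra|]. intros j t _. apply cts_scal, Hc1.
    - intros t Ht. apply cts_minus.
      + revert t Ht. apply CI_Csum; [lra|]. intros j t _. apply cts_scal, Hcm.
      + revert t Ht. apply CI_Csum; [lra|]. intros j t _. apply cts_scal, Hc1. }
  rewrite <- A3. apply CI_ext; [lra|]. intros t _.
  set (u := circ s t). have Hu : u <> 0%C by apply circ_neq_0.
  rewrite (Csum_ext _ (fun j => f u * (z / u) ^ j)%C).
  2:{ intros j _. unfold Cdiv. rewrite Cinv_pow by bound.
      rewrite Cpow_mult. ring. }
  rewrite (Csum_ext (fun j => f z * z ^ j * / u ^ j)%C (fun j => f z * (z / u) ^ j)%C).
  2:{ intros j _. unfold Cdiv. rewrite Cinv_pow by bound.
      rewrite Cpow_mult. ring. }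
  rewrite !Csum_scal.
  have G := Csum_geom_identity (z / u) N.
  have Sq := quot_spec f z l u. unfold q. fold u.
  change (Csum (fun j => (z / u) ^ j)%C N) with (Csum (Cpow (z / u)) N) in *.
  generalize dependent (Csum (Cpow (z / u)) N). intros S0 G.
  replace (f u * S0 - f z * S0)%C with ((f u - f z) * S0)%C by ring.
  rewrite <- Sq.
  replace (quot f z l u * (u - z) * S0)%C
    with (quot f z l u * u * ((1 - z / u) * S0))%C by (field; exact Hu).
  rewrite G. ring. }
have E2 : Cmod (CI (fun t => (z / circ s t) ^ N * q t)%C 0 (2 * PI)) <= x ^ N * B * (2 * PI - 0).
{ apply CI_bound_const; [lra| |].
  - intros t _. apply cts_mult; [|bound].
    apply (cts_ext (fun t => z ^ N * / circ s t ^ N)%C); [|apply cts_scal, Hc1].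
    intros t'. unfold Cdiv. rewrite Cinv_pow by apply circ_neq_0.
    rewrite Cpow_mult. reflexivity.
  - intros t Ht. rewrite Cmod_mult, Cmod_pow, Cmod_div by apply circ_neq_0.
    rewrite Cmod_circ. fold x. bound. }
rewrite E1 in E2. rewrite Cmod_mult, Cmod_R, Rabs_pos_eq in E2 by lra.
rewrite Cmod_minus_sym. apply Rmult_le_reg_l with (2 * PI); [lra|].
step exact E2. right. unfold N. simpl. ring.
Qed.

Theorem Taylor f R0 : 0 < R0 -> holo (ball0 R0) f -> exists c,
  (forall z, Cmod z < R0 -> ps c z (f z)) /\
  (forall r B n, 0 < r < R0 -> (forall z, Cmod z = r -> Cmod (f z) <= B) -> Cmod (c n) <= B / r ^ n).
Proof.
intros HR Hf.
have Hh : exp (ln (R0 / 2)) = R0 / 2 by (apply exp_ln; lra).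
exists (coef f (ln (R0 / 2))). split.
- intros z Hz. set (r := (Cmod z + R0) / 2).
  have Hr : exp (ln r) = r by (apply exp_ln; have Q := Cmod_ge_0 z; unfold r; lra).
  apply (ps_ext (coef f (ln r))).
  + intros n. apply (coef_indep f R0); auto; rewrite ?Hr, ?Hh; unfold r; lra.
  + apply (Taylor_coef f R0); auto; rewrite Hr; unfold r; lra.
- intros r B n [Hr1 Hr2] HB.
  have Hr : exp (ln r) = r by (apply exp_ln; lra).
  rewrite (coef_indep f R0 n _ (ln r)); auto; try lra.
  have G := coef_bound f R0 n (ln r) B Hf. rewrite Hr in G. apply G; [lra|].
  intros t. apply HB. rewrite Cmod_circ. exact Hr.
Qed.

Lemma ps_terms_bounded c z l : ps c z l -> exists K, 0 <= K /\ forall n, Cmod (c n * z ^ n) <= K.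
Proof.
intros H. destruct (H 1 Rlt_0_1) as [N HN].
have G : forall n, exists K, 0 <= K /\ forall m, (m < n)%nat -> Cmod (c m * z ^ m) <= K.
{ induction n as [|n [K [HK IH]]].
  - exists 0. split; [lra|]. intros; lia.
  - exists (Rmax K (Cmod (c n * z ^ n))). split.
    { step exact HK. apply Rmax_l. }
    intros m Hm. destruct (Nat.eq_dec m n) as [->|Hn]; [apply Rmax_r|].
    step (apply IH; lia). apply Rmax_l. }
destruct (G N) as [K [HK HG]]. exists (Rmax K 2). split.
{ step exact HK. apply Rmax_l. }
intros n. destruct (le_lt_dec N n) as [Hn|Hn].
- eapply Rle_trans; [|apply Rmax_r].
  have A := HN n Hn. have B := HN (S n) ltac:(lia). simpl in B.
  set (S0 := Csum (fun j => c j * z ^ j)%C n) in *.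
  replace (c n * z ^ n)%C with ((S0 + c n * z ^ n - l) - (S0 - l))%C by ring.
  step apply Cmod_triangle_minus. lra.
- step apply HG, Hn. apply Rmax_l.
Qed.

Lemma ps_coef_bounds c d : 0 < d -> (forall z, Cmod z < d -> exists l, ps c z l) ->
  forall r, 0 < r < d -> exists K, 0 <= K /\ forall n, Cmod (c n) <= K / r ^ n.
Proof.
intros Hd H r Hr. destruct (H (RtoC r)) as [l Hl].
{ rewrite Cmod_R, Rabs_pos_eq; lra. }
destruct (ps_terms_bounded c r l Hl) as [K [HK HKb]]. exists K. split; [bound|].
intros n. specialize (HKb n). rewrite Cmod_mult, Cmod_pow, Cmod_R, Rabs_pos_eq in HKb by lra.
bound.
Qed.

Lemma bounds_term c K r z n : 0 < r -> Cmod (c n) <= K / r ^ n ->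
  Cmod (c n * z ^ n) <= K * (Cmod z / r) ^ n.
Proof.
intros Hr H. rewrite Cmod_mult, Cmod_pow. unfold Rdiv. rewrite Rpow_mult_distr, pow_inv.
through (K / r ^ n * Cmod z ^ n).
- bound.
- bound.
Qed.

Lemma bounds_ps c K r z : 0 < r -> 0 <= K -> (forall n, Cmod (c n) <= K / r ^ n) -> Cmod z < r ->
  exists l, ps c z l /\
    forall n, Cmod (Csum (fun j => c j * z ^ j)%C n - l) <= K / (1 - Cmod z / r) * (Cmod z / r) ^ n.
Proof.
intros Hr HK H Hz. apply ps_exists; auto.
- bound.
- intros n. apply bounds_term; auto.
Qed.

Lemma ps_zero_coefs c d : 0 < d -> (forall z, Cmod z < d -> ps c z 0) -> forall n, c n = 0%C.
Proof.
intros Hd H n. induction n as [n IH] using lt_wf_ind.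
destruct (ps_coef_bounds c d Hd (fun z Hz => ex_intro _ _ (H z Hz)) (d / 2)) as [K [HK HKb]].
{ lra. }
set (r := d / 2) in *.
apply Ceq_limit. intros eps He. replace (c n - 0)%C with (c n) by ring.
set (C0 := K / r ^ n / r * 2).
have Hrn : 0 < r ^ n by (apply pow_lt; unfold r; lra).
have HC0 : 0 <= C0.
{ unfold C0. apply Rmult_le_pos; [|lra].
  apply Rmult_le_pos; [|left; apply Rinv_0_lt_compat; unfold r; lra].
  bound. }
set (t := Rmin (r / 2) (eps / (C0 + 1))).
have Ht : 0 < t.
{ apply Rmin_pos; [unfold r; lra|bound]. }
have Ht1 : t <= r / 2 by apply Rmin_l.
have Ht2 : t <= eps / (C0 + 1) by apply Rmin_r.
have Hr0 : 0 < r by bound.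
have Hzt : ps c (RtoC t) 0.
{ apply H. rewrite Cmod_R, Rabs_pos_eq; unfold r in *; lra. }
have Hps : ps (fun j => c (S n + j)%nat) (RtoC t) (- c n / RtoC t)%C.
{ have A : Clim (fun m => Csum (fun j => c j * t ^ j)%C (S n + m)) 0.
  { apply (Clim_ext (fun m => Csum (fun j => c j * t ^ j)%C (m + S n))).
    { intros m. rewrite Nat.add_comm. reflexivity. }
    apply (proj1 (Clim_incr _ _ (S n))). exact Hzt. }
  have Htc : RtoC t <> 0%C by (intros E; apply RtoC_inj in E; lra).
  have Htn : (RtoC t ^ n)%C <> 0%C by (apply Cpow_neq_0, Htc).
  eapply Clim_ext; [|replace (- c n / t)%C with (/ (t ^ S n) * (0 + - (c n * t ^ n)))%C;
    [apply Clim_scal, Clim_plus; [exact A|apply (Clim_const (- (c n * t ^ n)))]|]].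
  - intros m. cbv beta. rewrite Csum_add.
    have E1 : Csum (fun j => c j * t ^ j)%C (S n) = (c n * t ^ n)%C.
    { simpl. rewrite (Csum_ext _ (fun _ => RtoC 0)); [rewrite Csum_zero; ring|].
      intros k Hk. rewrite IH by bound. ring. }
    rewrite E1.
    replace (c n * t ^ n + Csum (fun k => c (S n + k)%nat * t ^ (S n + k)) m + - (c n * t ^ n))%C
      with (Csum (fun k => c (S n + k)%nat * t ^ (S n + k)) m)%C by ring.
    rewrite <- Csum_scal. apply Csum_ext. intros k _. rewrite Cpow_add. field.
    apply Cpow_neq_0, Htc.
  - simpl. field. bound. }
destruct (bounds_ps (fun j => c (S n + j)%nat) (K / r ^ S n) r (RtoC t)) as [l [Hl Hlb]]; auto.
- bound.
- intros m. step apply HKb. rewrite pow_add. right. bound.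
- rewrite Cmod_R, Rabs_pos_eq; lra.
- rewrite <- (ps_unique _ _ _ _ Hps Hl) in Hlb. specialize (Hlb O). simpl in Hlb.
  replace (0 - - c n / t)%C with (c n / t)%C in Hlb.
  2:{ field. intros E; apply RtoC_inj in E; lra. }
  rewrite Cmod_div, Cmod_R, (Rabs_pos_eq t), Rmult_1_r in Hlb
    by (try lra; intros E; apply RtoC_inj in E; lra).
  have Hq : / (1 - t / r) <= 2.
  { replace 2 with (/ (/ 2)) by field. apply Rinv_le_contravar; [lra|].
    assert (t / r <= / 2); [|lra]. bound. }
  have Hb : Cmod (c n) / t <= C0.
  { step exact Hlb. unfold C0. unfold Rdiv at 1.
    replace (K / r ^ n / r) with (K / (r * r ^ n)) by bound.
    bound. }
  through (C0 * t).
  + times (/ t); [bound|].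
    rewrite Rmult_assoc, Rinv_r, Rmult_1_r by lra. exact Hb.
  + through ((C0 + 1) * (eps / (C0 + 1))); [|right; field; lra].
    bound.
Qed.

Lemma ps_inj c c' d f : 0 < d -> (forall z, Cmod z < d -> ps c z (f z)) ->
  (forall z, Cmod z < d -> ps c' z (f z)) -> forall n, c n = c' n.
Proof.
intros Hd H H' n.
have E : (c n + - (1) * c' n)%C = 0%C.
{ apply (ps_zero_coefs (fun n => c n + - (1) * c' n)%C d Hd).
  intros z Hz. replace (RtoC 0) with (f z + - (1) * f z)%C by ring.
  apply (ps_plus _ (fun n => - (1) * c' n)%C); [auto|]. apply ps_scal; auto. }
replace (c n) with ((c n + - (1) * c' n) + c' n)%C by ring. rewrite E. ring.
Qed.

(** The Taylor expansion converges on the whole disc, and its coefficients are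
    determined near the centre. *)
Lemma Taylor_unique f R0 d c : 0 < d -> 0 < R0 -> holo (ball0 R0) f ->
  (forall z, Cmod z < d -> ps c z (f z)) ->
  (forall z, Cmod z < R0 -> ps c z (f z)) /\
  (forall r B n, 0 < r < R0 -> (forall z, Cmod z = r -> Cmod (f z) <= B) -> Cmod (c n) <= B / r ^ n).
Proof.
intros Hd HR Hf Hc. destruct (Taylor f R0 HR Hf) as [c' [H1 H2]].
have E : forall n, c n = c' n.
{ apply (ps_inj c c' (Rmin d R0) f); [bound| |].
  - intros z Hz. apply Hc. eapply Rlt_le_trans; [exact Hz|apply Rmin_l].
  - intros z Hz. apply H1. eapply Rlt_le_trans; [exact Hz|apply Rmin_r]. }
split.
- intros z Hz. apply (ps_ext c'); auto.
- intros r B n Hr HB. rewrite E. bound.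
Qed.

(** * Second-order estimate, limits, parameter integrals *)

Lemma Cder_translate f z0 z l : Cder (fun h => f (z0 + h)%C) z l -> Cder f (z0 + z)%C l.
Proof.
intros H. intros eps He. destruct (H eps He) as [d [Hd H']]. exists d; split; [bound|].
intros y Hy. specialize (H' (y - z0)%C).
replace (y - z0 - z)%C with (y - (z0 + z))%C in H' by ring.
replace (z0 + (y - z0))%C with y in H' by ring. auto.
Qed.

Lemma holo_translate (D : C -> Prop) f z0 : holo D f ->
  holo (fun h => D (z0 + h)%C) (fun h => f (z0 + h)%C).
Proof.
intros H z Hz. destruct (H _ Hz) as [l Hl]. exists (l * (0 + 1))%C.
apply (Cder_comp f (fun h => z0 + h)%C); [|bound].
apply Cder_plus; [apply Cder_const|apply Cder_id].
Qed.

Lemma second_order f z0 R0 B : 0 < R0 -> holo (fun z => Cmod (z - z0) < R0) f ->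
  (forall z, Cmod (z - z0) < R0 -> Cmod (f z) <= B) ->
  exists l, Cder f z0 l /\ Cmod l <= 2 * B / R0 /\
    forall h, Cmod h <= R0 / 4 -> Cmod (f (z0 + h)%C - f z0 - l * h) <= 8 * B / R0 ^ 2 * Cmod h ^ 2.
Proof.
intros HR Hf HB.
have HB0 : 0 <= B.
{ step apply Cmod_ge_0. apply (HB z0).
  rewrite Cmod_minus_self. exact HR. }
set (g := fun h => f (z0 + h)%C).
have Hg : holo (ball0 R0) g.
{ apply (holo_sub (fun h => Cmod (z0 + h - z0) < R0)).
  - intros z Hz. replace (z0 + z - z0)%C with z by ring. exact Hz.
  - apply (holo_translate (fun z => Cmod (z - z0) < R0)). exact Hf. }
destruct (Taylor g R0 HR Hg) as [c [H1 H2]].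
have Hc : forall n, Cmod (c n) <= B / (R0 / 2) ^ n.
{ intros n. apply H2; [lra|]. intros z Hz. apply HB.
  replace (z0 + z - z0)%C with z by ring. lra. }
have Est : forall h, Cmod h <= R0 / 4 ->
  Cmod (g h - g 0%C - c 1%nat * h) <= 8 * B / R0 ^ 2 * Cmod h ^ 2.
{ intros h Hh.
  destruct (bounds_ps c B (R0 / 2) h) as [l [Hl Hlb]]; auto; try lra.
  rewrite <- (ps_unique _ _ _ _ (H1 h ltac:(lra)) Hl) in Hlb.
  have E0 : g 0%C = c O.
  { apply (ps_unique c 0%C); [apply H1; rewrite Cmod_0; exact HR|].
    apply (Clim_incr _ _ 1). eapply Clim_ext; [|apply Clim_const].
    intros n. rewrite Nat.add_1_r, Csum_shift_l.
    rewrite (Csum_ext _ (fun _ => RtoC 0)), Csum_zero; [bound|].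
    intros k _. simpl. ring. }
  specialize (Hlb 2%nat). simpl Csum in Hlb. simpl Cpow in Hlb.
  rewrite E0. rewrite Cmod_minus_sym in Hlb.
  replace (g h - c 0%nat - c 1%nat * h)%C
    with (g h - (0 + c 0%nat * 1 + c 1%nat * (h * 1)))%C by ring.
  step exact Hlb.
  have Hq : / (1 - Cmod h / (R0 / 2)) <= 2.
  { replace 2 with (/ (/ 2)) at 2 by field. apply Rinv_le_contravar; [lra|].
    assert (Cmod h / (R0 / 2) <= / 2); [|lra].
    bound. }
  through (B * 2 * (Cmod h / (R0 / 2)) ^ 2).
  - apply Rmult_le_compat_r; [bound|]. apply Rmult_le_compat_l; auto.
  - right. field. lra. }
exists (c 1%nat). split; [|split].
- replace z0 with (z0 + 0)%C by ring. apply Cder_translate. intros eps He.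
  set (A := 8 * B / R0 ^ 2).
  have HA : 0 <= A.
  { unfold A. bound. }
  exists (Rmin (R0 / 4) (eps / (A + 1))). split.
  { bound. }
  intros y Hy. replace (y - 0)%C with y in * by ring.
  have Y1 := Rlt_le_trans _ _ _ Hy (Rmin_l _ _).
  have Y2 := Rlt_le_trans _ _ _ Hy (Rmin_r _ _).
  change (Cmod (g y - g 0%C - c 1%nat * y) <= eps * Cmod y).
  step (apply Est; lra). fold A.
  replace (A * Cmod y ^ 2) with (A * Cmod y * Cmod y) by ring.
  apply Rmult_le_compat_r; [bound|].
  through ((A + 1) * (eps / (A + 1))); [|right; field; lra].
  bound.
- specialize (Hc 1%nat). step exact Hc. right. field. lra.
- intros h Hh. specialize (Est h Hh). unfold g in Est.
  replace (z0 + 0)%C with z0 in Est by ring. exact Est.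
Qed.

Lemma Cder_unique f z l l' : Cder f z l -> Cder f z l' -> l = l'.
Proof.
intros H H'. apply Ceq_limit. intros eps He.
destruct (H (eps / 2) ltac:(lra)) as [d [Hd H1]].
destruct (H' (eps / 2) ltac:(lra)) as [d' [Hd' H2]].
set (t := Rmin d d' / 2).
have Hm : 0 < Rmin d d' by bound.
have Ht : 0 < t by (unfold t; lra).
have Q1 := Rmin_l d d'. have Q2 := Rmin_r d d'.
have Et : (z + RtoC t - z)%C = RtoC t by ring.
specialize (H1 (z + RtoC t)%C). specialize (H2 (z + RtoC t)%C).
rewrite Et, Cmod_R, Rabs_pos_eq in H1, H2 by lra.
specialize (H1 ltac:(unfold t; lra)). specialize (H2 ltac:(unfold t; lra)).
times t; auto.
replace (Cmod (l - l') * t) with (Cmod ((l - l') * t)) by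
  (rewrite Cmod_mult, Cmod_R, (Rabs_pos_eq t); lra).
replace ((l - l') * t)%C with
  ((f (z + t) - f z - l' * t) - (f (z + t) - f z - l * t))%C by ring.
step apply Cmod_triangle_minus. lra.
Qed.

(** Bounded pointwise limits of holomorphic functions are holomorphic: the
    second-order estimate is uniform, so the derivatives form a Cauchy sequence. *)
Lemma holo_limit_at (f : nat -> C -> C) (g : C -> C) z0 R0 B : 0 < R0 ->
  (forall n, holo (fun z => Cmod (z - z0) < R0) (f n)) ->
  (forall n z, Cmod (z - z0) < R0 -> Cmod (f n z) <= B) ->
  (forall z, Cmod (z - z0) < R0 -> Clim (fun n => f n z) (g z)) ->
  exists l, Cder g z0 l /\ forall l', (forall n, Cder (f n) z0 (l' n)) -> Clim l' l.
Proof.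
intros HR Hf HB Hg.
destruct (fun_choice (fun n l => Cder (f n) z0 l /\ Cmod l <= 2 * B / R0 /\
    forall h, Cmod h <= R0 / 4 ->
      Cmod (f n (z0 + h)%C - f n z0 - l * h) <= 8 * B / R0 ^ 2 * Cmod h ^ 2)) as [l Hl].
{ intros n. apply second_order; auto. }
set (A := 8 * B / R0 ^ 2) in *.
have HB0 : 0 <= B.
{ step apply Cmod_ge_0. apply (HB O z0).
  rewrite Cmod_minus_self. exact HR. }
have HA : 0 <= A.
{ unfold A. bound. }
have Hcv : forall h, Cmod h < R0 -> Clim (fun n => f n (z0 + h)%C) (g (z0 + h)%C).
{ intros h Hh. apply Hg. replace (z0 + h - z0)%C with h by ring. exact Hh. }
have Hcv0 : Clim (fun n => f n z0) (g z0).
{ apply Hg. rewrite Cmod_minus_self. exact HR. }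
destruct (Clim_cauchy l) as [L HL].
{ intros eps He.
  set (t := Rmin (R0 / 4) (eps / (4 * (A + 1)))).
  have Ht : 0 < t by (apply Rmin_pos; [lra|bound]).
  have Ht1 : t <= R0 / 4 by apply Rmin_l.
  have Ht2 : t <= eps / (4 * (A + 1)) by apply Rmin_r.
  have HAt : A * t <= eps / 4.
  { through ((A + 1) * (eps / (4 * (A + 1)))); [|right; field; lra].
    bound. }
  have Hmt : Cmod (RtoC t) = t by (rewrite Cmod_R, Rabs_pos_eq; lra).
  destruct (Hcv (RtoC t) ltac:(bound) (eps * t / 8) ltac:(nra)) as [N1 HN1].
  destruct (Hcv0 (eps * t / 8) ltac:(nra)) as [N2 HN2].
  exists (max N1 N2). intros n m Hn Hm.
  destruct (Hl n) as [_ [_ En]]. destruct (Hl m) as [_ [_ Em]].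
  specialize (En (RtoC t) ltac:(bound)). specialize (Em (RtoC t) ltac:(bound)).
  rewrite Hmt in En, Em.
  have n1 := HN1 n ltac:(lia). have m1 := HN1 m ltac:(lia).
  have n2 := HN2 n ltac:(lia). have m2 := HN2 m ltac:(lia).
  times t; auto.
  replace (Cmod (l n - l m) * t) with (Cmod ((l n - l m) * t)) by
    (rewrite Cmod_mult, Hmt; reflexivity).
  replace ((l n - l m) * t)%C with
    (((f m (z0 + t) - f m z0 - l m * t) - (f n (z0 + t) - f n z0 - l n * t)) +
     (((f n (z0 + t) - g (z0 + t)) - (f m (z0 + t) - g (z0 + t))) -
      ((f n z0 - g z0) - (f m z0 - g z0))))%C by ring.
  step apply Cmod_triangle.
  have T1 := Cmod_triangle_minus (f m (z0 + t) - f m z0 - l m * t)%C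
    (f n (z0 + t) - f n z0 - l n * t)%C.
  have T2 := Cmod_triangle_minus
    ((f n (z0 + t) - g (z0 + t)) - (f m (z0 + t) - g (z0 + t)))%C
    ((f n z0 - g z0) - (f m z0 - g z0))%C.
  have T3 := Cmod_triangle_minus (f n (z0 + t) - g (z0 + t))%C (f m (z0 + t) - g (z0 + t))%C.
  have T4 := Cmod_triangle_minus (f n z0 - g z0)%C (f m z0 - g z0)%C.
  have Q : A * t ^ 2 <= eps / 4 * t.
  { replace (A * t ^ 2) with (A * t * t) by ring. bound. }
  lra. }
exists L. split.
- intros eps He.
  exists (Rmin (R0 / 4) (eps / (A + 1))). split.
  { bound. }
  intros y Hy.
  have Y1 := Rlt_le_trans _ _ _ Hy (Rmin_l _ _).
  have Y2 := Rlt_le_trans _ _ _ Hy (Rmin_r _ _).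
  set (h := (y - z0)%C) in *.
  replace y with (z0 + h)%C by (unfold h; ring).
  have Lim : Clim (fun n => (f n (z0 + h) + (- (1) * f n z0 + - h * l n))%C)
    (g (z0 + h) + (- (1) * g z0 + - h * L))%C.
  { apply Clim_plus; [apply Hcv; lra|]. apply Clim_plus; apply Clim_scal; auto. }
  replace (g (z0 + h) - g z0 - L * h)%C with (g (z0 + h) + (- (1) * g z0 + - h * L))%C by ring.
  apply (Clim_le _ _ _ Lim). intros n.
  replace (f n (z0 + h) + (- (1) * f n z0 + - h * l n))%C
    with (f n (z0 + h) - f n z0 - l n * h)%C by ring.
  step (apply Hl; lra).
  replace (A * Cmod h ^ 2) with (A * Cmod h * Cmod h) by ring.
  apply Rmult_le_compat_r; [bound|].
  through ((A + 1) * (eps / (A + 1))); [|right; field; lra].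
  bound.
- intros l' Hl'. apply (Clim_ext l); [|bound].
  intros n. apply (Cder_unique (f n) z0); [apply Hl|bound].
Qed.

Definition loc_bdd {A : Type} (D : C -> Prop) (f : A -> C -> C) : Prop :=
  forall z, D z -> exists d B, 0 < d /\
    forall y, Cmod (y - z) < d -> D y /\ forall a, Cmod (f a y) <= B.

Lemma holo_limit (D : C -> Prop) (f : nat -> C -> C) (g : C -> C) :
  loc_bdd D f -> (forall n, holo D (f n)) -> (forall z, D z -> Clim (fun n => f n z) (g z)) ->
  holo D g.
Proof.
intros Hb Hf Hg z Hz. destruct (Hb z Hz) as [d [B [Hd H]]].
destruct (holo_limit_at f g z d B) as [l [Hl _]]; auto.
- intros n. apply (holo_sub D); auto. intros y Hy. apply H, Hy.
- intros n y Hy. apply H, Hy.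
- intros y Hy. apply Hg, H, Hy.
- exists l. exact Hl.
Qed.

(** The second-order estimate holds uniformly on the interval of integration, so
    the derivative may be taken under the integral. *)
Lemma holo_CI (D : C -> Prop) (phi : C -> R -> C) a b : a <= b ->
  (forall t, a <= t <= b -> holo D (fun z => phi z t)) ->
  (forall z, D z -> icts (phi z) a b) ->
  (forall z, D z -> exists d B, 0 < d /\ forall y, Cmod (y - z) < d -> D y /\
     forall t, a <= t <= b -> Cmod (phi y t) <= B) ->
  holo D (fun z => CI (phi z) a b).
Proof.
intros Hab Hh Hc Hb z Hz.
destruct (Hb z Hz) as [d [B [Hd H]]].
destruct (fun_choice (fun t l => a <= t <= b -> Cder (fun y => phi y t) z l /\
    Cmod l <= 2 * B / d /\ forall h, Cmod h <= d / 4 ->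
      Cmod (phi (z + h)%C t - phi z t - l * h) <= 8 * B / d ^ 2 * Cmod h ^ 2)) as [l Hl].
{ intros t. destruct (classic (a <= t <= b)) as [Ht|Ht].
  - destruct (second_order (fun y => phi y t) z d B Hd) as [l Hl].
    + apply (holo_sub D); auto. intros y Hy; apply H, Hy.
    + intros y Hy. apply H; auto.
    + exists l. bound.
  - exists 0%C. bound. }
set (A := 8 * B / d ^ 2) in *.
have HB0 : 0 <= B.
{ eapply Rle_trans; [apply Cmod_ge_0|apply (proj2 (H z ltac:(replace (z - z)%C with (RtoC 0) by ring;
    rewrite Cmod_0; exact Hd)) a); lra]. }
have HA : 0 <= A.
{ unfold A. bound. }
set (cl := clamp a b).
have Hcl : forall t, a <= cl t <= b by (intros t; apply clamp_in, Hab).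
have Hcc : forall y t, D y -> cts (fun s => phi y (cl s)) t.
{ intros y t Hy eps He. destruct (Hc y Hy (cl t) (Hcl t) eps He) as [e [He0 H']].
  exists e; split; auto. intros s Hs. apply H'. eapply Rle_lt_trans; [apply clamp_lipschitz, Hab|bound]. }
have Hlc : forall t, cts (fun s => l (cl s)) t.
{ intros t. apply cts_unif. intros eps He.
  set (x := Rmin (d / 8) (eps / (A + 1))).
  have Hx : 0 < x by (apply Rmin_pos; [lra|bound]).
  have Hmx : Cmod (RtoC x) = x by (rewrite Cmod_R, Rabs_pos_eq; lra).
  have X1 : x <= d / 8 by apply Rmin_l.
  have X2 : x <= eps / (A + 1) by apply Rmin_r.
  have Hxc : RtoC x <> 0%C by (intros E; apply RtoC_inj in E; lra).
  exists (fun s => / RtoC x * (phi (z + x)%C (cl s) + - (1) * phi z (cl s)))%C. split.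
  - apply cts_scal, cts_plus; [apply Hcc; apply H|apply cts_scal, Hcc, Hz].
    replace (z + x - z)%C with (RtoC x) by ring. bound.
  - exists 1. split; [lra|]. intros s _.
    destruct (Hl (cl s) (Hcl s)) as [_ [_ E]].
    specialize (E (RtoC x) ltac:(bound)). rewrite Hmx in E.
    replace (l (cl s) - / x * (phi (z + x) (cl s) + - (1) * phi z (cl s)))%C
      with (- / x * (phi (z + x) (cl s) - phi z (cl s) - l (cl s) * x))%C by (field; exact Hxc).
    rewrite Cmod_mult, Cmod_opp, Cmod_inv, Hmx by bound.
    through (/ x * (A * x ^ 2)).
    + bound.
    + replace (/ x * (A * x ^ 2)) with (A * x) by bound.
      through ((A + 1) * (eps / (A + 1))); [|right; field; lra].
      bound. }
have Ecl : forall y, CI (phi y) a b = CI (fun s => phi y (cl s)) a b.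
{ intros y. apply CI_ext; auto. intros t Ht. unfold cl. rewrite clamp_id; auto. }
exists (CI (fun s => l (cl s)) a b). intros eps He.
set (A' := A * (b - a)).
have HA' : 0 <= A' by (apply Rmult_le_pos; lra).
exists (Rmin (d / 4) (eps / (A' + 1))). split.
{ bound. }
intros y Hy.
have Y1 := Rlt_le_trans _ _ _ Hy (Rmin_l _ _).
have Y2 := Rlt_le_trans _ _ _ Hy (Rmin_r _ _).
set (h := (y - z)%C) in *.
have Ey : y = (z + h)%C by (unfold h; ring).
have HDy : D y by (apply H; unfold h in *; lra).
rewrite !Ecl.
have E1 : (CI (fun s => phi y (cl s)) a b - CI (fun s => phi z (cl s)) a b -
  CI (fun s => l (cl s)) a b * h)%C =
  CI (fun s => (phi y (cl s) - phi z (cl s)) - h * l (cl s))%C a b.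
{ rewrite CI_minus, CI_minus, CI_scal; auto.
  - ring.
  - intros t _; apply Hlc.
  - intros t _; apply Hcc; auto.
  - intros t _; apply Hcc; auto.
  - intros t _; apply cts_minus; apply Hcc; auto.
  - intros t _; apply cts_scal, Hlc. }
rewrite E1.
through (A * Cmod h ^ 2 * (b - a)).
- apply CI_bound_const; auto.
  + intros t _. apply cts_minus; [apply cts_minus; apply Hcc; auto|apply cts_scal, Hlc].
  + intros t _. destruct (Hl (cl t) (Hcl t)) as [_ [_ E]]. specialize (E h ltac:(lra)).
    rewrite <- Ey in E. rewrite (Cmult_comm h). exact E.
- replace (A * Cmod h ^ 2 * (b - a)) with (A' * Cmod h * Cmod h) by (unfold A'; ring).
  apply Rmult_le_compat_r; [bound|].
  through ((A' + 1) * (eps / (A' + 1))); [|right; field; lra].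
  bound.
Qed.

(** * Termwise differentiation and identity theorem *)

Definition PSum (c : nat -> C) (z : C) : C := epsilon (inhabits (RtoC 0)) (ps c z).

Lemma PSum_spec c z l : ps c z l -> PSum c z = l.
Proof.
intros H. apply (ps_unique c z); [|bound].
apply (epsilon_spec (inhabits (RtoC 0)) (ps c z)). exists l; exact H.
Qed.

Lemma PSum_ps c K r z : 0 < r -> 0 <= K -> (forall n, Cmod (c n) <= K / r ^ n) -> Cmod z < r ->
  ps c z (PSum c z).
Proof.
intros Hr HK H Hz. destruct (bounds_ps c K r z Hr HK H Hz) as [l [Hl _]].
rewrite (PSum_spec c z l Hl). exact Hl.
Qed.

Lemma PSum_bound c K r z : 0 < r -> 0 <= K -> (forall n, Cmod (c n) <= K / r ^ n) -> Cmod z < r ->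
  Cmod (PSum c z) <= K / (1 - Cmod z / r).
Proof.
intros Hr HK H Hz. destruct (bounds_ps c K r z Hr HK H Hz) as [l [Hl Hb]].
rewrite (PSum_spec c z l Hl). specialize (Hb O). simpl in Hb. rewrite Rmult_1_r in Hb.
replace l with (- (0 - l))%C by ring. rewrite Cmod_opp. exact Hb.
Qed.

Lemma Cder_partial_sum c n z :
  Cder (fun y => Csum (fun j => c j * y ^ j)%C n) z
    (Csum (fun j => RtoC (INR j) * c j * z ^ (j - 1))%C n).
Proof.
induction n; simpl; [apply Cder_const|].
apply Cder_plus; [bound|]. eapply Cder_eq; [|apply Cder_scal, Cder_pow]. ring.
Qed.

Lemma partial_sum_bound c K r n z : 0 < r -> 0 <= K -> (forall n, Cmod (c n) <= K / r ^ n) ->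
  Cmod z < r -> Cmod (Csum (fun j => c j * z ^ j)%C n) <= K / (1 - Cmod z / r).
Proof.
intros Hr HK H Hz. apply Csum_geom_bound; auto.
- bound.
- intros k _. apply bounds_term; auto.
Qed.

Lemma PSum_Cder c K r z : 0 < r -> 0 <= K -> (forall n, Cmod (c n) <= K / r ^ n) -> Cmod z < r ->
  exists l, Cder (PSum c) z l /\ ps (fun n => RtoC (INR (S n)) * c (S n))%C z l.
Proof.
intros Hr HK H Hz. set (d := (r - Cmod z) / 2).
have Hd : 0 < d by (unfold d; lra).
have Hy : forall y, Cmod (y - z) < d -> Cmod y < (r + Cmod z) / 2.
{ intros y Hy. have Q := Cmod_triangle_inv y z. unfold d in Hy. lra. }
destruct (holo_limit_at (fun n y => Csum (fun j => c j * y ^ j)%C n) (PSum c) z d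
  (K / (1 - (r + Cmod z) / 2 / r))) as [l [Hl1 Hl2]]; auto.
- intros n y _. eexists. apply Cder_partial_sum.
- intros n y Hyz. specialize (Hy y Hyz).
  step (apply partial_sum_bound with (K := K) (r := r); auto; lra).
  unfold Rdiv at 1 3. apply Rmult_le_compat_l; auto. apply Rinv_le_contravar.
  + assert ((r + Cmod z) / 2 / r < 1); [|lra].
    bound.
  + assert (Cmod y / r <= (r + Cmod z) / 2 / r); [|lra].
    bound.
- intros y Hyz. specialize (Hy y Hyz). apply (PSum_ps c K r); auto. lra.
- exists l. split; [bound|].
  have L := Hl2 _ (fun n => Cder_partial_sum c n z).
  apply (Clim_incr _ _ 1) in L. eapply Clim_ext; [|exact L].
  intros n. cbv beta. rewrite Nat.add_1_r, Csum_shift_l.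
  change (INR 0) with 0. replace (RtoC 0 * c O * z ^ (0 - 1))%C with (RtoC 0) by ring.
  rewrite Cplus_0_l. apply Csum_ext.
  intros k _. replace (S k - 1)%nat with k by lia. reflexivity.
Qed.

Lemma PSum_holo c K r : 0 < r -> 0 <= K -> (forall n, Cmod (c n) <= K / r ^ n) ->
  holo (ball0 r) (PSum c).
Proof. intros Hr HK H z Hz. destruct (PSum_Cder c K r z Hr HK H Hz) as [l [Hl _]]. exists l; auto. Qed.

Lemma ps_at_0 c : ps c 0 (c O).
Proof.
apply (Clim_incr _ _ 1). eapply Clim_ext; [|apply Clim_const].
intros n. rewrite Nat.add_1_r, Csum_shift_l.
rewrite (Csum_ext _ (fun _ => RtoC 0)), Csum_zero; [bound|].
intros k _. simpl. ring.
Qed.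

Lemma ps_shift c (z l : C) k : z <> 0%C -> ps c z l ->
  ps (fun n => c (n + k)%nat) z ((l - Csum (fun j => c j * z ^ j) k) / z ^ k)%C.
Proof.
intros Hz H. apply (proj1 (Clim_incr _ _ k)) in H.
have Hk := Cpow_neq_0 z k Hz.
eapply Clim_ext; [|replace ((l - Csum (fun j => c j * z ^ j) k) / z ^ k)%C with
  (/ z ^ k * (l + - Csum (fun j => c j * z ^ j) k))%C by bound;
  apply Clim_scal, Clim_plus; [exact H|apply (Clim_const (- Csum (fun j => c j * z ^ j)%C k))]].
intros n. cbv beta. rewrite Nat.add_comm, Csum_add.
match goal with |- (/ z ^ k * (?a + ?b + - ?a))%C = _ =>
  replace (a + b + - a)%C with b by ring end.
rewrite <- Csum_scal. apply Csum_ext. intros j _. rewrite Cpow_add, Nat.add_comm.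
field. exact Hk.
Qed.

Lemma zero_propagates f z0 R0 d : 0 < d -> 0 < R0 -> holo (fun z => Cmod (z - z0) < R0) f ->
  (forall z, Cmod (z - z0) < d -> f z = 0%C) -> forall z, Cmod (z - z0) < R0 -> f z = 0%C.
Proof.
intros Hd HR Hf H z Hz.
have Hg : holo (ball0 R0) (fun h => f (z0 + h)%C).
{ apply (holo_sub (fun h => Cmod (z0 + h - z0) < R0)).
  - intros y Hy. replace (z0 + y - z0)%C with y by ring. exact Hy.
  - apply (holo_translate (fun z => Cmod (z - z0) < R0)). exact Hf. }
have P0 : forall y l : C, l = 0%C -> ps (fun _ => RtoC 0) y l.
{ intros y l ->. eapply Clim_ext; [|apply Clim_const]. intros n. symmetry.
  rewrite (Csum_ext _ (fun _ => RtoC 0)), Csum_zero; auto. intros; ring. }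
destruct (Taylor_unique _ R0 d (fun _ => RtoC 0) Hd HR Hg) as [T _].
{ intros y Hy. apply P0. apply H. replace (z0 + y - z0)%C with y by ring. exact Hy. }
specialize (T (z - z0)%C Hz). replace (z0 + (z - z0))%C with z in T by ring.
apply (ps_unique _ _ _ _ T). bound.
Qed.

(** Analytic continuation along a horizontal strip by overlapping discs. *)
Lemma strip_identity H s0 e : 0 < e -> holo (fun z => Rabs (Im z) < e) H ->
  (forall z, Rabs (Im z) < e -> Re z < s0 -> H z = 0%C) -> forall x, H (RtoC x) = 0%C.
Proof.
intros He HH H0 x.
have G : forall n z, Cmod (z - RtoC (s0 - e + INR n * (e / 4))) < e / 2 -> H z = 0%C.
{ induction n as [|n IH]; intros z Hz.
  - simpl in Hz. rewrite Rmult_0_l, Rplus_0_r in Hz.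
    have Q1 := im_le_Cmod (z - RtoC (s0 - e)). have Q2 := re_le_Cmod (z - RtoC (s0 - e)).
    change (Im (z - RtoC (s0 - e))) with (Im z + - 0) in Q1.
    change (Re (z - RtoC (s0 - e))) with (Re z + - (s0 - e)) in Q2.
    apply H0.
    + rewrite Ropp_0, Rplus_0_r in Q1. lra.
    + have Q3 := Rle_abs (Re z + - (s0 - e)). lra.
  - apply (zero_propagates H (RtoC (s0 - e + INR n * (e / 4))) e (e / 2)); try lra; auto.
    + apply (holo_sub (fun z => Rabs (Im z) < e)); auto. intros y Hy.
      have Q1 := im_le_Cmod (y - RtoC (s0 - e + INR n * (e / 4))).
      change (Im (y - RtoC (s0 - e + INR n * (e / 4)))) with (Im y + - 0) in Q1.
      rewrite Ropp_0, Rplus_0_r in Q1. lra.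
    + step apply (Cmod_triangle_3 _ (RtoC (s0 - e + INR (S n) * (e / 4)))).
      rewrite <- RtoC_minus, Cmod_R.
      replace (s0 - e + INR (S n) * (e / 4) - (s0 - e + INR n * (e / 4))) with (e / 4)
        by (rewrite S_INR; field).
      rewrite Rabs_pos_eq; lra. }
destruct (Rlt_dec x s0) as [Hx|Hx].
- apply H0; simpl; [bound|]; lra.
- destruct (nfloor_ex ((x - (s0 - e)) / (e / 4))) as [n [N1 N2]].
  { bound. }
  apply (G n). rewrite <- RtoC_minus, Cmod_R.
  have M1 : INR n * (e / 4) <= x - (s0 - e).
  { through ((x - (s0 - e)) / (e / 4) * (e / 4)); [bound|].
    right; field; lra. }
  have M2 : x - (s0 - e) < (INR n + 1) * (e / 4).
  { apply Rle_lt_trans with ((x - (s0 - e)) / (e / 4) * (e / 4)); [right; field; lra|].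
    apply Rmult_lt_compat_r; lra. }
  bound.
Qed.

(** * Growth of zero-free functions *)

Lemma CI_conj f a b : a <= b -> icts f a b -> CI (fun t => Cconj (f t)) a b = Cconj (CI f a b).
Proof.
intros Hab Hf. unfold CI. apply C_ext; simpl.
- bound.
- apply (RInt_opp (V := R_CNM) (fun t => Im (f t))).
  apply ex_RInt_Im; auto.
Qed.

Lemma Cconj_mult_self u : (Cconj u * u)%C = RtoC (Cmod u ^ 2).
Proof. rewrite Cmod2_conj. ring. Qed.

Definition dcoef (c : nat -> C) (n : nat) : C := (RtoC (INR (S n)) * c (S n))%C.

Lemma ps_disc_Cder c R0 : 0 < R0 -> (forall z, Cmod z < R0 -> exists l, ps c z l) ->
  forall z, Cmod z < R0 -> Cder (PSum c) z (PSum (dcoef c) z) /\ ps (dcoef c) z (PSum (dcoef c) z).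
Proof.
intros HR H z Hz. have Hz0 := Cmod_ge_0 z.
destruct (ps_coef_bounds c R0 HR H ((Cmod z + R0) / 2)) as [K [HK HKb]]; [lra|].
destruct (PSum_Cder c K ((Cmod z + R0) / 2) z) as [l [H1 H2]]; auto; try lra.
have E : PSum (dcoef c) z = l by (apply PSum_spec; exact H2).
rewrite E. bound.
Qed.

(** The logarithm is the primitive of [F' / F], found by integrating its Taylor
    series. *)
Lemma zero_free_log F R0 : 0 < R0 -> holo (ball0 R0) F -> (forall z, Cmod z < R0 -> F z <> 0%C) ->
  exists g, holo (ball0 R0) g /\ g 0%C = 0%C /\ forall z, Cmod z < R0 -> F z = (F 0 * Cexp (g z))%C.
Proof.
intros HR HF Hnz.
destruct (Taylor F R0 HR HF) as [c [Hc _]].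
have Hex : forall z, Cmod z < R0 -> exists l, ps c z l by (intros z Hz; exists (F z); auto).
have HD : forall z, Cmod z < R0 -> Cder F z (PSum (dcoef c) z).
{ intros z Hz. apply Cder_ext_loc with (PSum c); [|apply (ps_disc_Cder c R0); auto].
  destruct (Copen_ball0 R0 z Hz) as [d [Hd Hd']]. exists d; split; auto.
  intros y Hy. apply PSum_spec, Hc, Hd', Hy. }
have HF1 : holo (ball0 R0) (PSum (dcoef c)).
{ intros z Hz. exists (PSum (dcoef (dcoef c)) z). apply (ps_disc_Cder (dcoef c) R0); auto.
  intros y Hy. exists (PSum (dcoef c) y). apply (ps_disc_Cder c R0); auto. }
have Hq : holo (ball0 R0) (fun z => PSum (dcoef c) z * / F z)%C.
{ apply holo_mult; [bound|]. apply holo_inv; auto. }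
destruct (Taylor _ R0 HR Hq) as [d [Hd _]].
set (e := fun j => match j with O => RtoC 0 | S k => (d k / RtoC (INR (S k)))%C end).
have Hed : forall n, dcoef e n = d n.
{ intros n. unfold dcoef, e. field. intros E; apply RtoC_inj in E.
  apply (not_0_INR (S n)); auto. }
have He : forall z, Cmod z < R0 -> exists l, ps e z l.
{ intros z Hz. set (r := (Cmod z + R0) / 2).
  have Hr : Cmod z < r < R0 by (unfold r; lra). have Hz0 := Cmod_ge_0 z.
  destruct (ps_coef_bounds d R0 HR (fun y Hy => ex_intro _ _ (Hd y Hy)) r ltac:(lra)) as [K [HK HKb]].
  destruct (bounds_ps e (K * r) r z) as [l [Hl _]]; try lra.
  - bound.
  - intros [|n]; simpl e.
    + rewrite Cmod_0. bound.
    + have Hn : 1 <= INR (S n) by (rewrite S_INR; have Q := pos_INR n; lra).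
      change (Cmod (d n / RtoC (INR (S n))) <= K * r / r ^ S n).
      rewrite Cmod_div by (intros E; apply RtoC_inj in E; lra).
      rewrite Cmod_R, Rabs_pos_eq by lra.
      through (Cmod (d n)).
      * unfold Rdiv. rewrite <- (Rmult_1_r (Cmod (d n))) at 2.
        apply Rmult_le_compat_l; [bound|].
        rewrite <- Rinv_1. bound.
      * step apply HKb. right. simpl. field. bound.
  - exists l; exact Hl. }
have HgD : forall z, Cmod z < R0 -> Cder (PSum e) z (PSum (dcoef c) z * / F z)%C.
{ intros z Hz. destruct (ps_disc_Cder e R0 HR He z Hz) as [H1 H2].
  eapply Cder_eq; [|exact H1]. apply (ps_unique _ _ _ _ H2).
  apply (ps_ext d); [bound|]. apply Hd, Hz. }
have Hg0 : PSum e 0%C = 0%C by (apply PSum_spec, ps_at_0).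
exists (PSum e). split; [|split; [bound|]].
{ intros z Hz. eexists. apply HgD, Hz. }
intros z Hz.
set (P := fun y => (F y * Cexp (- (1) * PSum e y))%C).
have HP : forall y, Cmod y < R0 -> Cder P y 0.
{ intros y Hy. eapply Cder_eq; [|apply Cder_mult; [apply HD, Hy|
    apply (Cder_comp Cexp (fun x => - (1) * PSum e x)%C); [apply Cder_scal, HgD, Hy|apply Cder_Cexp]]].
  cbv beta. field. apply Hnz, Hy. }
have E : P (0 + RtoC 1 * z)%C = P (0 + RtoC 0 * z)%C.
{ apply (Rder_zero_const (fun t => P (0 + RtoC t * z)%C) 0 1 ltac:(lra)).
  intros t Ht. have G : Cder P (0 + RtoC t * z)%C 0;
    [|apply Cder_line_Rder in G; rewrite Cmult_0_r in G; exact G].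
  apply HP.
  replace (0 + RtoC t * z)%C with (RtoC t * z)%C by ring.
  rewrite Cmod_mult, Cmod_R, Rabs_pos_eq by lra.
  apply Rle_lt_trans with (1 * Cmod z); [|lra].
  bound. }
replace (0 + RtoC 1 * z)%C with z in E by ring.
replace (0 + RtoC 0 * z)%C with (RtoC 0) in E by ring.
unfold P in E. rewrite Hg0 in E. replace (- (1) * 0)%C with (RtoC 0) in E by ring.
rewrite Cexp_0 in E. replace (- (1) * PSum e z)%C with (- PSum e z)%C in E by ring.
rewrite Cexp_opp in E.
replace (F 0%C) with (F 0%C * 1)%C by ring. rewrite <- E. field. apply Cexp_neq_0.
Qed.

(** Coefficient bound from a one-sided bound on the real part: the integral of
    [g] against [u ^ j] vanishes, hence so does that of the conjugate of [g]
    against [1 / u ^ j], and only the real part of [g] remains. *)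
Lemma Re_bound_coef g R0 K s : holo (ball0 R0) g -> g 0%C = 0%C -> exp s < R0 ->
  (forall z, Cmod z < R0 -> Re (g z) <= K) ->
  forall j, (1 <= j)%nat -> Cmod (coef g s j) <= 2 * K / exp s ^ j.
Proof.
intros Hg Hg0 Hs HK j Hj. have PP := PI_RGT_0.
set (r := exp s). have Hr : 0 < r by apply exp_pos.
have Hcg : forall t, cts (fun t => g (circ s t)) t.
{ intros t. apply (cts_comp g (circ s)); [apply cts_circ|].
  apply (holo_Ccts (ball0 R0)); auto. unfold ball0. rewrite Cmod_circ; exact Hs. }
have Hval : forall f, holo (ball0 R0) f -> coef f s 0 = f 0%C.
{ intros f Hf. apply (ps_unique (coef f s) 0); [apply ps_at_0|].
  apply (Taylor_coef f R0); auto. rewrite Cmod_0. exact Hr. }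
have Hpow : holo (ball0 R0) (fun u => g u * u ^ j)%C.
{ apply holo_mult; auto. intros z _. eexists; apply Cder_pow. }
have I1 : CI (fun t => g (circ s t) * circ s t ^ j)%C 0 (2 * PI) = 0%C.
{ have E := Hval _ Hpow. cbv beta in E. rewrite Hg0 in E. unfold coef in E.
  rewrite (CI_ext _ (fun t => g (circ s t) * circ s t ^ j)%C) in E; [|lra|].
  - replace (CI (fun t => g (circ s t) * circ s t ^ j)%C 0 (2 * PI))
      with (RtoC (2 * PI) * (/ RtoC (2 * PI) * CI (fun t => g (circ s t) * circ s t ^ j)%C 0 (2 * PI)))%C
      by (field; apply RtoC_2PI_neq_0).
    rewrite E. ring.
  - intros t _. simpl. field. }
have I0 : CI (fun t => g (circ s t)) 0 (2 * PI) = 0%C.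
{ have E := Hval _ Hg. rewrite Hg0 in E. unfold coef in E.
  rewrite (CI_ext _ (fun t => g (circ s t))) in E; [|lra|intros t _; simpl; field].
  replace (CI (fun t => g (circ s t)) 0 (2 * PI))
    with (RtoC (2 * PI) * (/ RtoC (2 * PI) * CI (fun t => g (circ s t)) 0 (2 * PI)))%C
    by (field; apply RtoC_2PI_neq_0).
  rewrite E. ring. }
have Hcu : forall n t, cts (fun t => circ s t ^ n)%C t.
{ intros n t. apply (cts_comp (fun u => u ^ n)%C (circ s)); [apply cts_circ|].
  eapply Cder_Ccts, Cder_pow. }
have Hci : forall n t, cts (fun t => / circ s t ^ n)%C t.
{ intros n t. apply (cts_comp (fun u => / u ^ n)%C (circ s)); [apply cts_circ|].
  eapply Cder_Ccts. apply Cder_inv; [apply Cpow_neq_0, circ_neq_0|apply Cder_pow]. }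
have Hconj : forall f : R -> C, (forall t, cts f t) -> forall t, cts (fun t => Cconj (f t)) t.
{ intros f Hf t. apply (cts_comp Cconj f); [bound|].
  intros eps He. exists eps; split; auto. intros y Hy.
  replace (Cconj y - Cconj (f t))%C with (Cconj (y - f t)%C) by bound.
  rewrite Cmod_conj. exact Hy. }
have Hr2 : RtoC (r ^ 2) <> 0%C.
{ intros E; apply RtoC_inj in E. assert (0 < r ^ 2) by bound. lra. }
(* On the circle, conjugation is inversion up to the factor [r ^ 2]. *)
have Hinv : forall t, Cconj (circ s t ^ j) = (RtoC (r ^ 2) ^ j * / circ s t ^ j)%C.
{ intros t. have Hn := circ_neq_0 s t.
  have E : Cconj (circ s t) = (RtoC (r ^ 2) * / circ s t)%C.
  { have Q := Cconj_mult_self (circ s t). rewrite Cmod_circ in Q. fold r in Q.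
    rewrite <- Q. field. exact Hn. }
  rewrite Cinv_pow by bound.
  rewrite Cpow_conj, E, Cpow_mult. reflexivity. }
have I2 : CI (fun t => Cconj (g (circ s t)) * / circ s t ^ j)%C 0 (2 * PI) = 0%C.
{ rewrite (CI_ext _ (fun t => / RtoC (r ^ 2) ^ j * Cconj (g (circ s t) * circ s t ^ j))%C); [|lra|].
  - rewrite CI_scal; [|lra|].
    + rewrite CI_conj; [|lra|intros t _; apply cts_mult; [bound|bound]].
      rewrite I1. bound.
    + intros t _. apply Hconj. intros t'. apply cts_mult; [bound|bound].
  - intros t _. rewrite Cmult_conj, Hinv. field. split.
    + apply Cpow_neq_0, circ_neq_0.
    + apply Cpow_neq_0, Hr2. }
have I3 : CI (fun t => / circ s t ^ j)%C 0 (2 * PI) = 0%C.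
{ have M := CI_circ_monomial s 0 j. destruct j as [|j']; [lia|].
  simpl Nat.eqb in M. cbv iota in M. rewrite <- M. apply CI_ext; [lra|].
  intros t _. bound. }
set (phi := fun t => (RtoC (2 * (K - Re (g (circ s t)))) * / circ s t ^ j)%C).
have Hphi : forall t, phi t = (RtoC (2 * K) * / circ s t ^ j -
  (g (circ s t) * / circ s t ^ j + Cconj (g (circ s t)) * / circ s t ^ j))%C.
{ intros t. unfold phi.
  replace (RtoC (2 * (K - Re (g (circ s t))))) with
    (RtoC (2 * K) - (g (circ s t) + Cconj (g (circ s t))))%C; [ring|].
  apply C_ext; simpl; unfold Re; ring. }
have Ephi : CI phi 0 (2 * PI) = (- (RtoC (2 * PI) * coef g s j))%C.
{ rewrite (CI_ext _ _ 0 (2 * PI) ltac:(lra) (fun t _ => Hphi t)).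
  rewrite CI_minus, CI_plus, CI_scal, I2, I3; try lra.
  - unfold coef. field. apply RtoC_2PI_neq_0.
  - intros t _. apply Hci.
  - intros t _. apply cts_mult; [bound|bound].
  - intros t _. apply cts_mult; [bound|bound].
  - intros t _. apply cts_scal, Hci.
  - intros t _. apply cts_plus; apply cts_mult; try apply Hci; [bound|].
    bound. }
have Bphi : Cmod (CI phi 0 (2 * PI)) <= RInt (fun t => 2 * (K - Re (g (circ s t))) / r ^ j) 0 (2 * PI).
{ have Hre : ex_RInt (fun t => Re (g (circ s t))) 0 (2 * PI).
  { apply (ex_RInt_Re (fun t => g (circ s t))); [lra|]. intros t _; apply Hcg. }
  apply CI_bound; try lra.
  - intros t _. apply (cts_ext _ _ t (fun s => eq_sym (Hphi s))). apply cts_minus.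
    + apply cts_scal, Hci.
    + apply cts_plus; apply cts_mult; try apply Hci; [bound|].
      bound.
  - apply (ex_RInt_ext (fun t => scal (/ r ^ j * 2) (minus K (Re (g (circ s t)))))).
    + intros t _. unfold scal, minus, plus, opp; simpl; unfold mult; simpl. bound.
    + apply (ex_RInt_scal (V := R_NormedModule)), (ex_RInt_minus (V := R_NormedModule));
      [apply (ex_RInt_const (V := R_NormedModule))|bound].
  - intros t _. unfold phi. rewrite Cmod_mult, Cmod_inv_circ_pow, Cmod_R. fold r.
    rewrite Rabs_pos_eq; [bound|].
    have Q : Re (g (circ s t)) <= K; [|lra]. apply HK. rewrite Cmod_circ. exact Hs. }
have Ere : RInt (fun t => 2 * (K - Re (g (circ s t))) / r ^ j) 0 (2 * PI) = 2 * K / r ^ j * (2 * PI).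
{ have Hre : ex_RInt (fun t => Re (g (circ s t))) 0 (2 * PI).
  { apply (ex_RInt_Re (fun t => g (circ s t))); [lra|]. intros t _; apply Hcg. }
  have Ept : forall t, 2 * (K - Re (g (circ s t))) / r ^ j = 2 / r ^ j * (K - Re (g (circ s t)))
    by (intros t; unfold Rdiv; ring).
  rewrite (RInt_ext _ _ _ _ (fun t _ => Ept t)).
  rewrite RInt_scal_R.
  2:{ apply (ex_RInt_minus (V := R_NormedModule));
      [apply (ex_RInt_const (V := R_NormedModule))|bound]. }
  have E := RInt_minus (V := R_CNM) (fun _ => K) (fun t => Re (g (circ s t))) 0 (2 * PI)
    (ex_RInt_const (V := R_NormedModule) _ _ _) Hre.
  change (RInt (fun t => K - Re (g (circ s t))) 0 (2 * PI) =
    RInt (fun _ => K) 0 (2 * PI) - RInt (fun t => Re (g (circ s t))) 0 (2 * PI)) in E.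
  rewrite E, RInt_cst.
  have E0 : RInt (fun t => Re (g (circ s t))) 0 (2 * PI) = 0 by (exact (f_equal Re I0)).
  rewrite E0. bound. }
rewrite Ere, Ephi, Cmod_opp, Cmod_mult, Cmod_R, Rabs_pos_eq in Bphi by lra.
apply Rmult_le_reg_l with (2 * PI); [lra|]. fold r. lra.
Qed.

(** The logarithm [g] of [F / F 0] vanishes at 0 and has real part at most [K], so
    its Taylor coefficients of index [n] are at most [2 * K / (R0 / 2) ^ n]. *)
Lemma zero_free_ratio F R0 K : 4 < R0 -> 0 <= K -> holo (ball0 R0) F ->
  (forall z, Cmod z < R0 -> F z <> 0%C) ->
  (forall z, Cmod z < R0 -> Cmod (F z) <= exp K * Cmod (F 0%C)) ->
  exp (- (8 * K / R0)) * Cmod (F 0%C) <= Cmod (F 1%C) <= exp (8 * K / R0) * Cmod (F 0%C).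
Proof.
intros HR HK HF Hnz HB.
destruct (zero_free_log F R0 ltac:(lra) HF Hnz) as [g [Hg [Hg0 HFg]]].
have HF0 : 0 < Cmod (F 0%C).
{ apply Cmod_gt_0, Hnz. rewrite Cmod_0. lra. }
have HRe : forall z, Cmod z < R0 -> Re (g z) <= K.
{ intros z Hz. specialize (HB z Hz). rewrite (HFg z Hz), Cmod_mult, Cmod_Cexp, Rmult_comm in HB.
  apply Rmult_le_reg_r in HB; auto. destruct HB as [Q|Q].
  - left. apply exp_lt_inv, Q.
  - right. apply exp_inv, Q. }
set (s := ln (R0 / 2)). have Hs : exp s = R0 / 2 by (apply exp_ln; lra).
have Hc := Re_bound_coef g R0 K s Hg Hg0 ltac:(lra) HRe. rewrite Hs in Hc.
have Hone : Cmod 1 = 1 by apply Cmod_1.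
have Hps : ps (coef g s) 1 (g 1%C) by (apply (Taylor_coef g R0); auto; lra).
have Hb : Cmod (g 1%C) <= 8 * K / R0.
{ apply (Clim_le (fun n => Csum (fun j => coef g s j * 1 ^ j)%C (S n))).
  { apply (Clim_ext (fun n => Csum (fun j => coef g s j * 1 ^ j)%C (n + 1))).
    { intros n. rewrite Nat.add_1_r. reflexivity. }
    apply (proj1 (Clim_incr _ _ 1)). exact Hps. }
  intros n. rewrite Csum_shift_l.
  have E0 : coef g s 0 = 0%C.
  { rewrite <- Hg0. apply (ps_unique (coef g s) 0); [apply ps_at_0|].
    apply (Taylor_coef g R0); auto; rewrite ?Cmod_0; lra. }
  rewrite E0, Cmult_0_l, Cplus_0_l.
  set (q := 2 / R0).
  have Hq : 0 <= q <= / 2.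
  { unfold q. bound. }
  step apply (Csum_geom_bound _ (2 * K * q) q).
  - lra.
  - bound.
  - intros k _. rewrite Cmod_mult, Cmod_pow, Hone, pow1, Rmult_1_r.
    step (apply Hc; lia). right.
    replace (R0 / 2) with (/ q) by (unfold q; field; lra).
    unfold Rdiv. rewrite pow_inv, Rinv_inv. simpl. ring.
  - through (2 * K * q * 2).
    + unfold Rdiv. apply Rmult_le_compat_l; [bound|].
      replace 2 with (/ (/ 2)) by field. bound.
    + right. unfold q. field. lra. }
rewrite (HFg 1%C) by lra. rewrite Cmod_mult, Cmod_Cexp.
have R1 := re_le_Cmod (g 1%C). have R2 := Rle_abs (Re (g 1%C)).
have R3 := Rle_abs (- Re (g 1%C)). rewrite Rabs_Ropp in R3.
split; [rewrite Rmult_comm|rewrite (Rmult_comm (exp (8 * K / R0)))];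
apply Rmult_le_compat_l; try lra; apply exp_mono; lra.
Qed.

(** * Strongly regular sequences and their growth functions *)

(** A proximate order keeps [ln (Mfun M r) / ln r] near its positive limit. *)
Lemma omega_pos M : admits_nonzero_proximate_order M -> 0 < omega M.
Proof.
intros [c [rho [rho0 [Hpo [Hr0 [B [T HB]]]]]]].
set (phi := fun r => Rmax 0 (ln (Mfun M r) / ln r)).
have Hlim := po_lim c rho rho0 Hpo. apply is_lim_spec in Hlim.
have Hr4 : 0 < rho0 / 4 by lra.
destruct (Hlim (mkposreal _ Hr4)) as [X HX]. simpl in HX.
have HB0 : 0 <= B.
{ step apply Rabs_pos. apply (HB (T + 1)); lra. }
set (X0 := Rmax (Rmax X T) (exp (4 * B / rho0 + 1)) + 1).
have HX0 : forall t, X0 <= t -> rho0 / 2 <= phi t <= 3 * rho0 / 2.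
{ intros t Ht.
  have Q1 := Rmax_l (Rmax X T) (exp (4 * B / rho0 + 1)).
  have Q2 := Rmax_r (Rmax X T) (exp (4 * B / rho0 + 1)).
  have Q3 := Rmax_l X T. have Q4 := Rmax_r X T.
  have Hq : 0 <= 4 * B / rho0 by bound.
  have Hln : 4 * B / rho0 + 1 <= ln t.
  { rewrite <- (ln_exp (4 * B / rho0 + 1)). apply ln_le; [bound|unfold X0 in Ht; lra]. }
  have H1 := HX t ltac:(unfold X0 in Ht; lra). have H2 := HB t ltac:(unfold X0 in Ht; lra).
  rewrite Rabs_mult, (Rabs_pos_eq (ln t)) in H2 by lra.
  have H3 : Rabs (rho t - ln (Mfun M t) / ln t) <= rho0 / 4.
  { apply Rmult_le_reg_l with (ln t); [lra|]. step exact H2.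
    through (4 * B / rho0 * (rho0 / 4)); [right; field; lra|].
    bound. }
  apply Rabs_le_between in H3. apply Rabs_def2 in H1.
  unfold phi. rewrite Rmax_right; lra. }
have HL : Rbar_is_glb (fun y => exists x : R, y = Lub_Rbar (fun v => exists r, x <= r /\ v = phi r))
  (limsup_p_infty phi) by exact (proj2_sig (Rbar_ex_glb _)).
destruct HL as [HL1 HL2].
have Lo : Rbar_le (rho0 / 2) (limsup_p_infty phi).
{ apply HL2. intros y [x ->].
  destruct (Lub_Rbar_correct (fun v => exists r, x <= r /\ v = phi r)) as [U _].
  apply Rbar_le_trans with (Finite (phi (Rmax x X0))).
  - apply HX0, Rmax_r.
  - apply U. exists (Rmax x X0). split; [apply Rmax_l|bound]. }
have Up : Rbar_le (limsup_p_infty phi) (3 * rho0 / 2).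
{ eapply Rbar_le_trans; [apply HL1; exists X0; reflexivity|].
  apply (Lub_Rbar_correct (fun v => exists r, X0 <= r /\ v = phi r)).
  intros v [r [Hr ->]]. apply HX0, Hr. }
unfold omega. fold phi. destruct (limsup_p_infty phi) as [l| |]; simpl in *; try contradiction.
bound.
Qed.

Lemma series_bounded (u : nat -> R) : (forall n, 0 <= u n) -> ex_series u ->
  exists K, forall n, sum_n u n <= K.
Proof.
intros Hu [l Hl]. exists l. intros n.
apply (is_lim_seq_incr_compare (sum_n u) l Hl).
intros m. rewrite sum_Sn. unfold plus; simpl. specialize (Hu (S m)). lra.
Qed.

Lemma ln_le_harmonic n : ln (INR (n + 2)) <= sum_n (fun q => / INR (q + 1)) n.
Proof.
have St : forall m, (1 <= m)%nat -> ln (INR (m + 1)) <= ln (INR m) + / INR m.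
{ intros m Hm. have Hp : 0 < INR m by bound.
  rewrite plus_INR. simpl (INR 1).
  replace (INR m + 1) with (INR m * (1 + / INR m)) by bound.
  have Hi := Rinv_0_lt_compat _ Hp.
  rewrite ln_mult by lra. apply Rplus_le_compat_l.
  rewrite <- (ln_exp (/ INR m)) at 2. apply ln_le; [lra|].
  left. apply exp_ineq1. lra. }
induction n.
- rewrite sum_O. simpl (0 + 2)%nat. have H := St 1%nat ltac:(lia).
  replace (1 + 1)%nat with 2%nat in H by lia. simpl (0 + 1)%nat.
  replace (ln (INR 1)) with 0 in H by (simpl; rewrite ln_1; reflexivity). lra.
- rewrite sum_Sn. unfold plus; simpl plus. specialize (St (n + 2)%nat ltac:(lia)).
  replace (n + 2 + 1)%nat with (S n + 2)%nat in St by lia.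
  replace (S n + 1)%nat with (n + 2)%nat by lia.
  step exact St. apply Rplus_le_compat_r. exact IHn.
Qed.

Section Regular.

Variable M : nat -> R.
Hypothesis HM : strongly_regular M.

Definition nu (n : nat) : R := M (S n) / M n.

Lemma M_pos n : 0 < M n.
Proof. apply (sr_pos M HM). Qed.

Lemma nu_pos n : 0 < nu n.
Proof. apply Rdiv_lt_0_compat; apply M_pos. Qed.

Lemma M_S n : M (S n) = nu n * M n.
Proof. unfold nu. field. apply Rgt_not_eq, M_pos. Qed.

Lemma nu_step n : nu n <= nu (S n).
Proof.
unfold nu. have H := sr_lc M HM (S n) ltac:(lia).
replace (S n - 1)%nat with n in H by lia. rewrite Nat.add_1_r in H.
have H0 := M_pos n. have H1 := M_pos (S n).
times (M n * M (S n)); [bound|].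
replace (M (S n) / M n * (M n * M (S n))) with (M (S n) ^ 2) by bound.
replace (M (S (S n)) / M (S n) * (M n * M (S n))) with (M n * M (S (S n))) by bound.
exact H.
Qed.

Lemma nu_mono n m : (n <= m)%nat -> nu n <= nu m.
Proof. induction 1; [lra|]. step exact IHle. apply nu_step. Qed.

Lemma M_upper n j : M (n + j) <= M n * nu (n + j) ^ j.
Proof.
induction j.
- rewrite Nat.add_0_r. simpl. lra.
- rewrite Nat.add_succ_r, M_S.
  have H1 := nu_mono (n + j) (S (n + j)) ltac:(lia). have H2 := nu_pos (n + j).
  have Hm := M_pos n. have Hmj := M_pos (n + j).
  simpl pow. through (nu (S (n + j)) * (M n * nu (S (n + j)) ^ j)); [|bound].
  apply Rmult_le_compat; try lra.
  step exact IHj. bound.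
Qed.

Lemma M_lower n j : M n * nu n ^ j <= M (n + j).
Proof.
induction j.
- rewrite Nat.add_0_r. simpl. lra.
- rewrite Nat.add_succ_r, M_S.
  have H1 := nu_mono n (n + j) ltac:(lia). have H2 := nu_pos n.
  have Hm := M_pos n.
  simpl pow. through (nu n * (M n * nu n ^ j)); [bound|].
  bound.
Qed.

Lemma M_lower_0 n : nu 0 ^ n <= M n.
Proof. have H := M_lower 0 n. rewrite (sr_0 M HM) in H. rewrite Nat.add_0_l in H. lra. Qed.

Lemma M_upper_0 n : M n <= nu n ^ n.
Proof. have H := M_upper 0 n. rewrite (sr_0 M HM), Nat.add_0_l in H. lra. Qed.

Lemma M_ratio_mono i n j : (i <= n)%nat -> M (i + j) / M i <= M (n + j) / M n.
Proof.
intros Hin. have H1 := M_pos i. have H2 := M_pos n.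
induction j.
- rewrite !Nat.add_0_r. unfold Rdiv. rewrite !Rinv_r; lra.
- rewrite !Nat.add_succ_r, !M_S. unfold Rdiv in *. rewrite !Rmult_assoc.
  apply Rmult_le_compat; try exact IHj.
  + left; apply nu_pos.
  + apply Rmult_le_pos; left; [apply M_pos|bound].
  + apply nu_mono. lia.
Qed.

Lemma mg_const : exists A, 1 <= A /\ forall p q, M (p + q) <= A ^ (p + q) * M p * M q.
Proof.
destruct (sr_mg M HM) as [A [HA H]]. exists (Rmax 1 A). split; [apply Rmax_l|].
intros p q. step apply H.
apply Rmult_le_compat_r; [left; apply M_pos|].
apply Rmult_le_compat_r; [left; apply M_pos|]. apply pow_incr. split; [lra|apply Rmax_r].
Qed.

(** The tail condition fails for bounded quotients, by comparison with the
    harmonic series. *)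
Lemma nu_unbounded B : exists n, B < nu n.
Proof.
apply NNPP. intros Hn.
have Hb : forall n, nu n <= B.
{ intros n. apply Rnot_lt_le. intros H. apply Hn. exists n; exact H. }
have HB : 0 < B by (eapply Rlt_le_trans; [apply (nu_pos 0)|bound]).
destruct (sr_snq M HM) as [A [HA H]]. destruct (H 0%nat) as [Hs _].
set (u := fun q : nat => M (0 + q) / (INR (0 + q + 1) * M (0 + q + 1))) in Hs.
have Hu : forall q, / B * / INR (q + 1) <= u q.
{ intros q. unfold u. rewrite !Nat.add_0_l. replace (q + 1)%nat with (S q) by lia.
  have Hi : 0 < INR (S q) by bound.
  rewrite M_S. have Hq := M_pos q. have Hnq := nu_pos q.
  specialize (Hb q). set (i := INR (S q)) in *. clearbody i.
  replace (M q / (i * (nu q * M q))) with (/ nu q * / i) by bound.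
  bound. }
destruct (series_bounded u) as [K HK]; auto.
{ intros n. eapply Rle_trans; [|apply Hu]. bound. }
destruct (INR_unbounded (exp (B * K))) as [n Hn'].
have L : B * K < ln (INR (n + 2)).
{ rewrite <- (ln_exp (B * K)). apply ln_increasing; [bound|].
  rewrite plus_INR. simpl (INR 2). lra. }
have L2 := ln_le_harmonic n.
have L3 : / B * sum_n (fun q => / INR (q + 1)) n <= sum_n u n.
{ clear - Hu. induction n.
  - rewrite !sum_O. apply Hu.
  - rewrite !sum_Sn. unfold plus; simpl plus. specialize (Hu (S n)).
    rewrite Rmult_plus_distr_l. apply Rplus_le_compat; [bound|bound]. }
specialize (HK n).
have L4 : / B * (B * K) < / B * sum_n (fun q => / INR (q + 1)) n.
{ apply Rmult_lt_compat_l; [bound|lra]. }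
rewrite <- Rmult_assoc, Rinv_l, Rmult_1_l in L4 by lra. lra.
Qed.

Lemma pow_over_M_bounded t : 0 < t -> exists B, forall p, t ^ p <= M p * B.
Proof.
intros Ht. destruct (nu_unbounded t) as [n Hn].
have G : forall m, exists B, 0 < B /\ forall p, (p <= m)%nat -> t ^ p <= M p * B.
{ induction m as [|m [B [HB IH]]].
  - exists 1. split; [lra|]. intros p Hp. replace p with 0%nat by lia.
    rewrite (sr_0 M HM). simpl. lra.
  - exists (Rmax B (t ^ S m / M (S m))). split.
    { eapply Rlt_le_trans; [exact HB|apply Rmax_l]. }
    intros p Hp. have Hmp := M_pos p. destruct (Nat.eq_dec p (S m)) as [->|Hne].
    + through (M (S m) * (t ^ S m / M (S m))); [right; field; lra|].
      apply Rmult_le_compat_l; [lra|apply Rmax_r].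
    + step (apply IH; lia). apply Rmult_le_compat_l; [lra|apply Rmax_l]. }
destruct (G n) as [B [HB HBn]]. exists B. intros p.
destruct (le_lt_dec p n) as [Hp|Hp]; [auto|].
replace p with (n + (p - n))%nat by lia. set (j := (p - n)%nat).
rewrite pow_add.
have L := M_lower n j.
through ((M n * B) * nu n ^ j).
- bound.
- replace (M n * B * nu n ^ j) with (M n * nu n ^ j * B) by ring.
  bound.
Qed.

(** Equal to the supremum of [t ^ p / M p]; the multiplicative form of the growth
    function avoids logarithms. *)
Definition G (t : R) : R := exp (Mfun M t).

Lemma G_pos t : 0 < G t.
Proof. apply exp_pos. Qed.

Lemma G_0 : G 0 = 1.
Proof. unfold G, Mfun. destruct Req_EM_T; [apply exp_0|bound]. Qed.

Lemma Mfun_spec t : 0 < t -> (forall p, ln (t ^ p / M p) <= Mfun M t) /\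
  forall B, (forall p, ln (t ^ p / M p) <= B) -> Mfun M t <= B.
Proof.
intros Ht. unfold Mfun. destruct Req_EM_T as [E|_]; [lra|].
have HS := Sup_seq_correct (fun p => Finite (ln (t ^ p / M p))).
destruct (pow_over_M_bounded t Ht) as [B HB].
destruct (Sup_seq (fun p => Finite (ln (t ^ p / M p)))) as [s| |] eqn:E; simpl in HS |- *.
- split.
  + intros p. apply le_epsilon. intros e He. destruct (HS (mkposreal e He)) as [H1 _].
    left. exact (H1 p).
  + intros B' HB'. apply le_epsilon. intros e He. destruct (HS (mkposreal e He)) as [_ [p Hp]].
    simpl in Hp. specialize (HB' p). lra.
- exfalso. destruct (HS (ln B)) as [p Hp].
  have Hpos : 0 < t ^ p / M p by (apply Rdiv_lt_0_compat; [bound|apply M_pos]).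
  have Hle : t ^ p / M p <= B.
  { apply Rmult_le_reg_l with (M p); [apply M_pos|].
    replace (M p * (t ^ p / M p)) with (t ^ p) by (field; apply Rgt_not_eq, M_pos). apply HB. }
  have Q := ln_le _ _ Hpos Hle. lra.
- exfalso. specialize (HS 0 O). specialize (HS). clear -HS HM.
  rewrite (sr_0 M HM) in HS. simpl in HS. unfold Rdiv in HS. rewrite Rinv_1, Rmult_1_r, ln_1 in HS. lra.
Qed.

Lemma G_ge t p : 0 <= t -> t ^ p <= M p * G t.
Proof.
intros [Ht|<-].
- destruct (Mfun_spec t Ht) as [H _]. specialize (H p).
  have Hpos : 0 < t ^ p / M p by (apply Rdiv_lt_0_compat; [bound|apply M_pos]).
  apply exp_mono in H. rewrite exp_ln in H by bound. fold (G t) in H.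
  apply (Rmult_le_compat_l (M p)) in H; [|left; apply M_pos].
  replace (M p * (t ^ p / M p)) with (t ^ p) in H by (field; apply Rgt_not_eq, M_pos). exact H.
- rewrite G_0. destruct p; simpl.
  + rewrite (sr_0 M HM). lra.
  + rewrite Rmult_0_l. have Q := M_pos (S p). lra.
Qed.

Lemma G_lub t B : 0 < t -> 0 < B -> (forall p, t ^ p <= M p * B) -> G t <= B.
Proof.
intros Ht HB H. unfold G. rewrite <- (exp_ln B HB). apply exp_mono.
apply (Mfun_spec t Ht). intros p. apply ln_le.
- apply Rdiv_lt_0_compat; [bound|apply M_pos].
- apply Rmult_le_reg_l with (M p); [apply M_pos|].
  replace (M p * (t ^ p / M p)) with (t ^ p) by (field; apply Rgt_not_eq, M_pos). apply H.
Qed.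

Lemma G_ge1 t : 0 <= t -> 1 <= G t.
Proof. intros Ht. have H := G_ge t 0 Ht. rewrite (sr_0 M HM) in H. bound. Qed.

Lemma G_mono s t : 0 <= s -> s <= t -> G s <= G t.
Proof.
intros [Hs|<-] Hst.
- apply G_lub; auto; [apply G_pos|]. intros p.
  through (t ^ p); [bound|apply G_ge; lra].
- rewrite G_0. apply G_ge1, Hst.
Qed.

(** The product of [t ^ p / M p] and [t ^ q / M q] is at most
    [(A * t) ^ (p + q) / M (p + q)]. *)
Lemma G_square A : 1 <= A -> (forall p q, M (p + q) <= A ^ (p + q) * M p * M q) ->
  forall t, 0 <= t -> G t * G t <= G (A * t).
Proof.
intros HA Hmg t [Ht|<-].
- have HAt : 0 < A * t by bound.
  have P : forall p q, t ^ p * t ^ q <= M p * (M q * G (A * t)).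
  { intros p q. have H := G_ge (A * t) (p + q) ltac:(lra).
    rewrite Rpow_mult_distr in H. rewrite (pow_add t) in H.
    have HAp : 0 < A ^ (p + q) by bound.
    apply Rmult_le_reg_l with (A ^ (p + q)); auto.
    step exact H. have Gp := G_pos (A * t).
    through (A ^ (p + q) * M p * M q * G (A * t)); [|bound].
    bound. }
  have Hg := G_pos t.
  have Q : G t <= G (A * t) / G t.
  { apply G_lub; auto. { apply Rdiv_lt_0_compat; [apply G_pos|bound]. }
    intros q. times (G t); auto.
    replace (M q * (G (A * t) / G t) * G t) with (M q * G (A * t)) by bound.
    have Htq : 0 < t ^ q by bound.
    have R : G t <= M q * G (A * t) / t ^ q.
    { apply G_lub; auto.
      { apply Rdiv_lt_0_compat; [apply Rmult_lt_0_compat; [apply M_pos|apply G_pos]|bound]. }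
      intros p. times (t ^ q); auto.
      replace (M p * (M q * G (A * t) / t ^ q) * t ^ q) with (M p * (M q * G (A * t))) by bound.
      apply P. }
    apply Rmult_le_compat_l with (r := t ^ q) in R; [|lra].
    replace (t ^ q * (M q * G (A * t) / t ^ q)) with (M q * G (A * t)) in R by bound.
    exact R. }
  apply Rmult_le_compat_r with (r := G t) in Q; [|lra].
  replace (G (A * t) / G t * G t) with (G (A * t)) in Q by bound. exact Q.
- rewrite Rmult_0_r, G_0. lra.
Qed.

(** By logarithmic convexity the supremum at [t = nu n] is attained for [p = n]. *)
Lemma G_at_nu n : G (nu n) <= nu n ^ n / M n.
Proof.
have Hn := nu_pos n. have HMn := M_pos n.
apply G_lub; auto. { bound. }
intros p. times (M n); auto.
replace (M p * (nu n ^ n / M n) * M n) with (M p * nu n ^ n) by bound.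
destruct (le_lt_dec n p) as [H|H].
- replace p with (n + (p - n))%nat by lia. have L := M_lower n (p - n).
  rewrite pow_add.
  replace (nu n ^ n * nu n ^ (p - n) * M n) with (M n * nu n ^ (p - n) * nu n ^ n) by ring.
  bound.
- have L := M_upper p (n - p). replace (p + (n - p))%nat with n in L by lia.
  replace (nu n ^ n) with (nu n ^ p * nu n ^ (n - p)) by (rewrite <- pow_add; f_equal; lia).
  replace (M p * (nu n ^ p * nu n ^ (n - p))) with (nu n ^ p * (M p * nu n ^ (n - p))) by ring.
  bound.
Qed.

Lemma pow_le_inv x y n : (1 <= n)%nat -> 0 <= x -> 0 <= y -> x ^ n <= y ^ n -> x <= y.
Proof.
intros Hn Hx Hy H. apply Rnot_lt_le. intros Hlt.
have Q : y ^ n < x ^ n; [|lra].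
destruct n as [|n]; [lia|]. clear Hn H. induction n.
- bound.
- change (y * y ^ S n < x * x ^ S n). apply Rmult_le_0_lt_compat; auto.
  bound.
Qed.

Lemma nu_pow_le A n : (forall p q, M (p + q) <= A ^ (p + q) * M p * M q) ->
  nu n ^ n <= A ^ (n + n) * M n.
Proof.
intros Hmg. have L := M_lower n n. have U := Hmg n n. have P := M_pos n.
apply Rmult_le_reg_l with (M n); auto. lra.
Qed.

Lemma nu_double A n : 1 <= A -> (forall p q, M (p + q) <= A ^ (p + q) * M p * M q) ->
  (1 <= n)%nat -> nu (n + n) <= A ^ 3 * nu n.
Proof.
intros HA Hmg Hn. have Hp := nu_pos n. have Hp2 := nu_pos (n + n).
apply (pow_le_inv _ _ n); auto; try lra. { bound. }
have L := M_lower (n + n) n. have U := Hmg (n + n)%nat n.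
have P := M_pos (n + n). have Un := M_upper_0 n.
through (A ^ (n + n + n) * M n).
- apply Rmult_le_reg_l with (M (n + n)%nat); auto. lra.
- rewrite Rpow_mult_distr. rewrite <- pow_mult. replace (3 * n)%nat with (n + n + n)%nat by lia.
  bound.
Qed.

(** Doubling bounds make the quotients grow at most polynomially; the weaker
    bound by every geometric sequence is enough below. *)
Lemma nu_subexp x : 1 < x -> exists C, 0 < C /\ forall n, nu n <= C * x ^ n.
Proof.
intros Hx. destruct mg_const as [A [HA Hmg]].
set (D := A ^ 3). have HD : 1 <= D by (apply pow_R1_Rle; exact HA).
destruct (Pow_x_infinity x) with (b := D * D) as [N0 HN0]. { rewrite Rabs_pos_eq; lra. }
have HN : forall n, (N0 <= n)%nat -> D * D <= x ^ n.
{ intros n Hn. have Q := HN0 n Hn. rewrite Rabs_pos_eq in Q by bound. lra. }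
(* For [n] large, [nu n <= D * nu (ceil (n / 2))] gains a factor [x ^ (n / 2)]. *)
set (N := (2 * N0 + 4)%nat).
exists (nu N + 1). split; [have Q := nu_pos N; lra|].
intros n. induction n as [n IH] using lt_wf_ind.
have HP : 1 <= x ^ n by (apply pow_R1_Rle; lra). have HnN := nu_pos N.
destruct (le_lt_dec n N) as [Hn|Hn].
- have Q := nu_mono n N Hn. through ((nu N + 1) * 1); [lra|].
  bound.
- set (h := ((n + 1) / 2)%nat).
  have Hh : (n <= h + h /\ h + h <= n + 1)%nat.
  { unfold h. have Q := Nat.div_mod (n + 1) 2 ltac:(lia).
    have Q2 := Nat.mod_upper_bound (n + 1) 2 ltac:(lia). lia. }
  have Q1 := nu_mono n (h + h) (proj1 Hh).
  have Q2 := nu_double A h HA Hmg ltac:(bound). fold D in Q2.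
  have Q3 := IH h ltac:(bound).
  have Q4 : D * x ^ h <= x ^ n.
  { replace n with (h + (n - h))%nat by lia. rewrite pow_add, (Rmult_comm (x ^ h)).
    apply Rmult_le_compat_r; [bound|].
    through (D * D); [|apply HN; unfold N in *; lia].
    rewrite <- (Rmult_1_r D) at 1. bound. }
  through (D * ((nu N + 1) * x ^ h)).
  + step exact Q1. step exact Q2.
    bound.
  + replace (D * ((nu N + 1) * x ^ h)) with ((nu N + 1) * (D * x ^ h)) by ring.
    bound.
Qed.

End Regular.

Ltac pos_fact ::= match goal with
  | |- 0 < G _ _ => apply G_pos
  | H : strongly_regular ?M |- 0 < ?M _ => apply (M_pos M H)
  | H : strongly_regular ?M |- 0 < nu ?M _ => apply (nu_pos M H)
  | H : strongly_regular ?M |- 1 <= G ?M _ => apply (G_ge1 M H); pos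
  | H : strongly_regular ?M |- G ?M _ <= G ?M _ => apply (G_mono M H); bound
  end.

(** * Integrals over the real line *)

Definition dom (f : R -> C) (B a : R) : Prop :=
  0 < a /\ (forall t, cts f t) /\ forall t, Cmod (f t) <= B * exp (- (a * Rabs t)).

Definition Iinf (f : R -> C) : C :=
  epsilon (inhabits (RtoC 0)) (Clim (fun n => CI f (- INR n) (INR n))).

Lemma dom_nonneg f B a : dom f B a -> 0 <= B.
Proof.
intros [Ha [_ H]]. specialize (H 0). rewrite Rabs_R0, Rmult_0_r, Ropp_0, exp_0 in H.
have Q := Cmod_ge_0 (f 0). lra.
Qed.

Lemma RInt_exp_neg c x y : 0 < c -> ex_RInt (fun t => exp (- (c * t))) x y /\
  RInt (fun t => exp (- (c * t))) x y = (exp (- (c * x)) - exp (- (c * y))) / c.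
Proof.
intros Hc.
have H : is_RInt (fun t => exp (- (c * t))) x y
  (minus (- exp (- (c * y)) / c) (- exp (- (c * x)) / c)).
{ apply (is_RInt_derive (V := R_CNM) (fun t => - exp (- (c * t)) / c)).
  - intros t _. auto_derive; auto. field. lra.
  - intros t _. apply (continuous_comp (fun t => - (c * t)) exp).
    + apply (continuous_opp (V := R_NormedModule)).
      apply (continuous_scal_r (V := R_NormedModule) c (fun t : R => t)), continuous_id.
    + apply continuous_exp. }
split; [eexists; exact H|]. rewrite (is_RInt_unique (V := R_CNM) _ _ _ _ H).
unfold minus, plus, opp; simpl. field. lra.
Qed.

Lemma dom_tail f B a x y : dom f B a -> 0 <= x <= y ->
  Cmod (CI f x y) <= B / a * exp (- (a * x)) /\ Cmod (CI f (- y) (- x)) <= B / a * exp (- (a * x)).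
Proof.
intros Hd Hxy. have HB := dom_nonneg _ _ _ Hd. destruct Hd as [Ha [Hc Hb]].
destruct (RInt_exp_neg a x y Ha) as [E1 E2].
have Epos : 0 < exp (- (a * y)) by bound.
have Fin : B * ((exp (- (a * x)) - exp (- (a * y))) / a) <= B / a * exp (- (a * x)).
{ replace (B / a * exp (- (a * x))) with (B * (exp (- (a * x)) / a)) by bound.
  apply Rmult_le_compat_l; auto. apply Rmult_le_compat_r; [bound|lra]. }
split.
- step (apply (CI_bound f (fun t => B * exp (- (a * t)))); try lra).
  + intros t _; apply Hc.
  + apply (ex_RInt_scal (V := R_NormedModule)). exact E1.
  + intros t Ht. rewrite <- (Rabs_pos_eq t) at 2 by lra. apply Hb.
  + rewrite RInt_scal_R by bound. rewrite E2. exact Fin.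
- have E3 : is_RInt (fun t => exp (a * t)) (- y) (- x) ((exp (- (a * x)) - exp (- (a * y))) / a).
  { replace ((exp (- (a * x)) - exp (- (a * y))) / a)
      with (minus (exp (a * - x) / a) (exp (a * - y) / a)).
    - apply (is_RInt_derive (V := R_CNM) (fun t => exp (a * t) / a)).
      + intros t _. auto_derive; auto. field. lra.
      + intros t _. apply (continuous_comp (fun t => a * t) exp).
        * apply (continuous_scal_r (V := R_NormedModule) a (fun t : R => t)), continuous_id.
        * apply continuous_exp.
    - unfold minus, plus, opp; simpl.
      replace (a * - x) with (- (a * x)) by ring. replace (a * - y) with (- (a * y)) by ring.
      field. lra. }
  step (apply (CI_bound f (fun t => B * exp (a * t))); try lra).
  + intros t _; apply Hc.
  + apply (ex_RInt_scal (V := R_NormedModule)). eexists; exact E3.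
  + intros t Ht. step apply Hb. rewrite Rabs_left1 by lra.
    bound.
  + rewrite RInt_scal_R by (eexists; exact E3). rewrite (is_RInt_unique (V := R_CNM) _ _ _ _ E3). exact Fin.
Qed.

Lemma Iinf_spec f B a : dom f B a ->
  Clim (fun n => CI f (- INR n) (INR n)) (Iinf f) /\
  forall n, Cmod (CI f (- INR n) (INR n) - Iinf f) <= 2 * B / a * exp (- (a * INR n)).
Proof.
intros Hd.
have Ha : 0 < a by apply Hd. have Hc : forall x y, icts f x y by (intros x y t _; apply Hd).
have T : forall n m, (n <= m)%nat ->
  Cmod (CI f (- INR n) (INR n) - CI f (- INR m) (INR m)) <= 2 * B / a * exp (- (a * INR n)).
{ intros n m Hnm. have Hn := pos_INR n. have Hm := le_INR _ _ Hnm.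
  rewrite <- (CI_Chasles f (- INR m) (- INR n) (INR m)) by bound.
  rewrite <- (CI_Chasles f (- INR n) (INR n) (INR m)) by bound.
  destruct (dom_tail f B a (INR n) (INR m) Hd ltac:(lra)) as [T1 T2].
  match goal with |- Cmod (?u - (?v + (?u + ?w))) <= _ =>
    replace (u - (v + (u + w)))%C with (- (v + w))%C by ring; rewrite Cmod_opp;
    have Q := Cmod_triangle v w end.
  bound. }
have L : is_lim_seq (fun n => 2 * B / a * exp (- (a * INR n))) 0.
{ apply (is_lim_seq_ext (fun n => 2 * B / a * (exp (- a)) ^ n)).
  - intros n. f_equal.
    rewrite <- exp_INR_mult. f_equal. ring.
  - apply geom_lim. split; [bound|]. rewrite <- exp_0. apply exp_increasing. lra. }
have Hex : exists l, Clim (fun n => CI f (- INR n) (INR n)) l.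
{ apply Clim_cauchy. intros eps He. apply is_lim_seq_spec in L.
  destruct (L (mkposreal (eps / 2) ltac:(lra))) as [N HN]. exists N. intros n m Hn Hm.
  specialize (HN N (le_n _)). simpl in HN. rewrite Rminus_0_r in HN.
  have HN2 := Rle_abs (2 * B / a * exp (- (a * INR N))).
  step apply (Cmod_triangle_3 _ (CI f (- INR N) (INR N))).
  rewrite (Cmod_minus_sym _ (CI f (- INR N) (INR N))).
  have A1 := T N n Hn. have A2 := T N m Hm. lra. }
have S := epsilon_spec (inhabits (RtoC 0)) _ Hex. fold (Iinf f) in S.
split; [bound|]. intros n. apply le_epsilon. intros e He.
destruct (S e He) as [N HN].
step apply (Cmod_triangle_3 _ (CI f (- INR (max n N)) (INR (max n N)))).
apply Rplus_le_compat; [apply T; lia|apply HN; lia].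
Qed.

Lemma Iinf_unique f l : Clim (fun n => CI f (- INR n) (INR n)) l -> Iinf f = l.
Proof.
intros H. apply (Clim_unique (fun n => CI f (- INR n) (INR n))); [|bound].
apply (epsilon_spec (inhabits (RtoC 0)) (Clim (fun n => CI f (- INR n) (INR n)))). exists l; exact H.
Qed.

Lemma Iinf_bound f B a : dom f B a -> Cmod (Iinf f) <= 2 * B / a.
Proof.
intros H. destruct (Iinf_spec f B a H) as [_ E]. specialize (E O). simpl INR in E.
rewrite Ropp_0, CI_point, Rmult_0_r, Ropp_0, exp_0, Rmult_1_r in E.
replace (Iinf f) with (- (0 - Iinf f))%C by ring. rewrite Cmod_opp. exact E.
Qed.

Lemma Iinf_ext f g : (forall t, f t = g t) -> Iinf f = Iinf g.
Proof. intros H. replace g with f; [bound|]. apply functional_extensionality, H. Qed.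

Lemma INR_neg_le n : - INR n <= INR n.
Proof. have Q := pos_INR n. lra. Qed.

Lemma Iinf_plus f g B a B' a' : dom f B a -> dom g B' a' ->
  Iinf (fun t => f t + g t)%C = (Iinf f + Iinf g)%C.
Proof.
intros Hf Hg. apply Iinf_unique.
eapply Clim_ext; [|apply Clim_plus; [apply (Iinf_spec f B a Hf)|apply (Iinf_spec g B' a' Hg)]].
intros n. cbv beta. rewrite CI_plus; [bound|apply INR_neg_le| |];
intros t _; [apply Hf|apply Hg].
Qed.

Lemma Iinf_scal c f B a : dom f B a -> Iinf (fun t => c * f t)%C = (c * Iinf f)%C.
Proof.
intros Hf. apply Iinf_unique.
eapply Clim_ext; [|apply (Clim_scal c), (Iinf_spec f B a Hf)].
intros n. cbv beta. rewrite CI_scal; [bound|apply INR_neg_le|]. intros t _; apply Hf.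
Qed.

Lemma dom_scal c f B a : dom f B a -> dom (fun t => c * f t)%C (Cmod c * B) a.
Proof.
intros [Ha [Hc H]]. split; [bound|split].
- intros t; apply cts_scal, Hc.
- intros t. rewrite Cmod_mult, Rmult_assoc. bound.
Qed.

Lemma dom_plus f g B B' a : dom f B a -> dom g B' a -> dom (fun t => f t + g t)%C (B + B') a.
Proof.
intros [Ha [Hc H]] [_ [Hc' H']]. split; [bound|split].
- intros t; apply cts_plus; auto.
- intros t. step apply Cmod_triangle. rewrite Rmult_plus_distr_r.
  bound.
Qed.

Lemma Iinf_Csum (f : nat -> R -> C) (B : nat -> R) a n : 0 < a -> (forall k, dom (f k) (B k) a) ->
  Iinf (fun t => Csum (fun k => f k t) n) = Csum (fun k => Iinf (f k)) n /\
  exists B', dom (fun t => Csum (fun k => f k t) n) B' a.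
Proof.
intros Ha H. induction n as [|n [IH1 [B' IH2]]].
- simpl. split.
  + apply Iinf_unique. eapply Clim_ext; [|apply Clim_const]. intros n. cbv beta.
    rewrite CI_const. ring.
  + exists 0. split; [bound|split]; [intros; apply cts_const|].
    intros t. rewrite Cmod_0. lra.
- simpl. split.
  + rewrite (Iinf_plus (fun t => Csum (fun k => f k t) n) (f n) B' a (B n) a); auto.
    rewrite IH1. reflexivity.
  + exists (B' + B n). apply (dom_plus (fun t => Csum (fun k => f k t) n) (f n)); auto.
Qed.

(** Cauchy's theorem for rectangles whose vertical sides tend to infinity. *)
Lemma Iinf_shift_line H t1 t2 B a : t1 <= t2 -> 0 < a ->
  (forall z, t1 <= Im z <= t2 -> exists l, Cder H z l) ->
  (forall z, t1 <= Im z <= t2 -> Cmod (H z) <= B * exp (- (a * Rabs (Re z)))) ->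
  Iinf (fun t => H (mkC t t1)) = Iinf (fun t => H (mkC t t2)).
Proof.
intros H12 Ha HH HB.
have D : forall y, t1 <= y <= t2 -> dom (fun t => H (mkC t y)) B a.
{ intros y Hy. split; [bound|split].
  - intros t. apply cts_hor. destruct (HH (mkC t y)) as [l Hl]; [bound|].
    exact (Cder_Ccts _ _ _ Hl).
  - bound. }
apply Iinf_unique.
destruct (Iinf_spec _ B a (D t2 ltac:(lra))) as [S2 _].
set (V := fun x => Ver H x t1 t2).
have HV : forall x, Cmod (V x) <= B * exp (- (a * Rabs x)) * (t2 - t1).
{ intros x. unfold V, Ver. apply CI_bound_const; auto.
  - intros y Hy. apply cts_scal, cts_ver. destruct (HH (mkC x y)) as [l Hl]; [bound|].
    exact (Cder_Ccts _ _ _ Hl).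
  - intros y Hy. rewrite Cmod_mult, Cmod_Ci, Rmult_1_l. bound. }
have E : forall n, CI (fun t => H (mkC t t1)) (- INR n) (INR n) =
  (CI (fun t => H (mkC t t2)) (- INR n) (INR n) + (V (- INR n)%R + - (1) * V (INR n)))%C.
{ intros n. have Q : RI H (- INR n) (INR n) t1 t2 = 0%C.
  { apply Goursat; auto; [apply INR_neg_le|]. intros z [_ Z2]. apply HH, Z2. }
  unfold RI, Hor in Q. fold (V (INR n)) in Q. fold (V (- INR n)%R) in Q.
  set (p := CI (fun t => H (mkC t t1)) (- INR n) (INR n)) in *.
  set (q := CI (fun t => H (mkC t t2)) (- INR n) (INR n)) in *.
  replace p with ((p + V (INR n) - q - V (- INR n)%R) + (q + (V (- INR n)%R + - (1) * V (INR n))))%C by ring.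
  rewrite Q. ring. }
apply (Clim_ext _ _ _ (fun n => eq_sym (E n))).
replace (Iinf (fun t => H (mkC t t2))) with (Iinf (fun t => H (mkC t t2)) + 0)%C by ring.
apply Clim_plus; [bound|].
apply (Clim_0_of_bound _ _ (fun n => 2 * (B * (t2 - t1)) * (exp (- a)) ^ n)).
- apply geom_lim. split; [bound|]. rewrite <- exp_0. apply exp_increasing. lra.
- intros n. replace (V (- INR n)%R + - (1) * V (INR n) - 0)%C with (V (- INR n)%R - V (INR n))%C by ring.
  step apply Cmod_triangle_minus.
  have Q1 := HV (INR n). have Q2 := HV (- INR n)%R. rewrite Rabs_Ropp in Q2.
  rewrite Rabs_pos_eq in Q1, Q2 by bound.
  have Ee : exp (- (a * INR n)) = exp (- a) ^ n.
  { rewrite <- exp_INR_mult. f_equal. ring. }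
  rewrite Ee in Q1, Q2. lra.
Qed.

Lemma holo_Iinf (D : C -> Prop) (phi : C -> R -> C) a : 0 < a ->
  (forall t, holo D (fun z => phi z t)) -> (forall z t, D z -> cts (phi z) t) ->
  (forall z, D z -> exists d B, 0 < d /\ forall y, Cmod (y - z) < d -> D y /\
     forall t, Cmod (phi y t) <= B * exp (- (a * Rabs t))) ->
  holo D (fun z => Iinf (phi z)).
Proof.
intros Ha Hh Hc Hb.
apply (holo_limit D (fun n z => CI (phi z) (- INR n) (INR n))).
- intros z Hz. destruct (Hb z Hz) as [d [B [Hd H]]]. exists d, (2 * B / a + 2 * B / a).
  split; [bound|]. intros y Hy. destruct (H y Hy) as [Hy1 Hy2]. split; [bound|].
  intros n. have Dm : dom (phi y) B a by (split; bound).
  have HB := dom_nonneg _ _ _ Dm.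
  destruct (Iinf_spec _ _ _ Dm) as [_ E]. specialize (E n). have E2 := Iinf_bound _ _ _ Dm.
  replace (CI (phi y) (- INR n) (INR n)) with
    ((CI (phi y) (- INR n) (INR n) - Iinf (phi y)) + Iinf (phi y))%C by ring.
  step apply Cmod_triangle. apply Rplus_le_compat; auto.
  step exact E. rewrite <- (Rmult_1_r (2 * B / a)) at 2.
  apply Rmult_le_compat_l.
  + bound.
  + rewrite <- exp_0. apply exp_mono.
    assert (0 <= a * INR n) by bound. lra.
- intros n. apply holo_CI.
  + apply INR_neg_le.
  + bound.
  + intros z Hz t _. apply Hc, Hz.
  + intros z Hz. destruct (Hb z Hz) as [d [B [Hd H]]]. exists d, B. split; [bound|].
    intros y Hy. destruct (H y Hy) as [Hy1 Hy2]. split; [bound|]. intros t _.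
    have Dm : dom (phi y) B a by (split; bound).
    have HB := dom_nonneg _ _ _ Dm.
    step apply Hy2. rewrite <- (Rmult_1_r B) at 2. apply Rmult_le_compat_l; auto.
    rewrite <- exp_0. apply exp_mono.
    assert (0 <= a * Rabs t) by bound. lra.
- intros z Hz. destruct (Hb z Hz) as [d [B [Hd H]]].
  destruct (H z) as [_ Hz2].
  { rewrite Cmod_minus_self. exact Hd. }
  apply (Iinf_spec (phi z) B a). split; bound.
Qed.

(** * Kernels in logarithmic coordinates *)

Lemma atan_abs_le x : Rabs (atan x) <= Rabs x.
Proof.
have P : forall y, 0 <= y -> 0 <= atan y <= y.
{ intros y [Hy|<-]; [|rewrite atan_0; lra].
  have H0 : 0 < atan y by (rewrite <- atan_0; apply atan_increasing, Hy).
  split; [lra|].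
  destruct (MVT_cor2 atan (fun t => / (1 + t ^ 2)) 0 y Hy) as [c [Hc _]].
  { intros c _. apply derivable_pt_lim_atan. }
  rewrite atan_0 in Hc.
  assert (/ (1 + c ^ 2) <= 1).
  { rewrite <- Rinv_1. apply Rinv_le_contravar; [lra|]. have Q := pow2_ge_0 c. lra. }
  have Q : / (1 + c ^ 2) * (y - 0) <= 1 * (y - 0) by bound. lra. }
destruct (Rle_dec 0 x) as [H|H].
- specialize (P x H). rewrite !Rabs_pos_eq; lra.
- specialize (P (- x) ltac:(lra)). rewrite atan_opp in P. rewrite !Rabs_left1; lra.
Qed.

Lemma near_one_exp (u : C) : Cmod (u - 1) <= / 2 ->
  exists w, u = Cexp w /\ Rabs (Im w) <= 2 * Cmod (u - 1).
Proof.
intros Hu.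
have HR : Rabs (Re u - 1) <= Cmod (u - 1) by exact (re_le_Cmod (u - 1)%C).
have HI : Rabs (Im u) <= Cmod (u - 1).
{ have Q := im_le_Cmod (u - 1)%C. change (Im (u - 1)) with (Im u + - 0) in Q.
  rewrite Ropp_0, Rplus_0_r in Q. exact Q. }
apply Rabs_le_between in HR.
set (x := Im u / Re u).
have Hm : 0 < Cmod u.
{ eapply Rlt_le_trans; [|apply re_le_Cmod]. rewrite Rabs_pos_eq; lra. }
exists (mkC (ln (Cmod u)) (atan x)). split.
- unfold Cexp, mkC. simpl. rewrite exp_ln by bound. rewrite cos_atan, sin_atan.
  have E : sqrt (1 + x²) = Cmod u / Re u.
  { unfold Cmod. replace (fst u ^ 2 + snd u ^ 2) with (Re u ^ 2 * (1 + x²)).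
    - rewrite sqrt_mult_alt by bound. rewrite sqrt_pow2 by lra. field. lra.
    - unfold x, Rsqr, Re, Im. field. unfold Re in HR. lra. }
  rewrite E. apply C_ext; simpl; unfold x; field; lra.
- simpl. step apply atan_abs_le. unfold x, Rdiv. rewrite Rabs_mult, Rabs_inv.
  rewrite (Rabs_pos_eq (Re u)) by lra. rewrite Rmult_comm.
  apply Rmult_le_compat; auto; try apply Rabs_pos.
  + bound.
  + replace 2 with (/ / 2) by field. bound.
Qed.

Lemma Cexp_open y eps : 0 < eps -> exists d, 0 < d /\ forall x, Cmod (x - Cexp y) < d ->
  exists y', x = Cexp y' /\ Rabs (Im y' - Im y) < eps.
Proof.
intros He. have Hy := exp_pos (Re y).
exists (exp (Re y) * Rmin (/ 2) (eps / 4)). split.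
{ bound. }
intros x Hx. set (u := (x / Cexp y)%C).
have Hu : Cmod (u - 1) < Rmin (/ 2) (eps / 4).
{ apply Rmult_lt_reg_l with (exp (Re y)); auto. eapply Rle_lt_trans; [|exact Hx].
  rewrite <- Cmod_Cexp, <- Cmod_mult. right. f_equal. unfold u. field. apply Cexp_neq_0. }
have M1 := Rmin_l (/ 2) (eps / 4). have M2 := Rmin_r (/ 2) (eps / 4).
destruct (near_one_exp u ltac:(lra)) as [w [Hw1 Hw2]].
exists (y + w)%C. split.
- rewrite Cexp_add, <- Hw1. unfold u. field. apply Cexp_neq_0.
- change (Im (y + w)) with (Im y + Im w). replace (Im y + Im w - Im y) with (Im w) by ring. lra.
Qed.

Lemma sector_log d theta z : sector d theta z <-> exists y, z = Cexp y /\ Rabs (Im y - d) < theta / 2.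
Proof.
split.
- intros [r [phi [Hr [Hp ->]]]]. exists (mkC (ln r) phi). split; [apply polar, Hr|bound].
- intros [y [-> Hy]]. exists (exp (Re y)), (Im y). bound.
Qed.

Lemma Copen_sector d theta : Copen (sector d theta).
Proof.
intros z Hz. apply sector_log in Hz. destruct Hz as [y [-> Hy]].
destruct (Cexp_open y (theta / 2 - Rabs (Im y - d)) ltac:(lra)) as [e [He H]].
exists e. split; [bound|]. intros x Hx. destruct (H x Hx) as [y' [-> Hy']].
apply sector_log. exists y'. split; [bound|].
have Q := Rabs_triang (Im y' - Im y) (Im y - d).
replace (Im y' - Im y + (Im y - d)) with (Im y' - d) in Q by ring. lra.
Qed.

(** The kernel [e] is used through [ee v = e (exp v)] on the strip of half-width
    [th]. *)
Record kernel_data (M : nat -> R) (th : R) (ee : C -> C) (m : nat -> C) : Prop := {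
  kd_th : 0 < th < PI;
  kd_holo : forall v, Rabs (Im v) < th -> exists l, Cder ee v l;
  kd_decay : forall t0, 0 < t0 < th -> exists c al k, 0 < c /\ 0 < al /\ 0 < k /\
    forall t tau, Rabs tau <= t0 ->
      (t <= 0 -> Cmod (ee (mkC t tau)) <= c * exp (al * t)) /\
      Cmod (ee (mkC t tau)) <= c / G M (exp t / k);
  kd_moment : forall n, Iinf (fun t => Cexp (INR n * mkC t 0) * ee (mkC t 0))%C = m n
}.

(** [Et] is a Taylor shift of the kernel [E]; it is bounded outside the sector of
    half-opening [th]. *)
Record entire_data (M : nat -> R) (th : R) (b : nat -> C) (Et : C -> C) : Prop := {
  ed_ps : forall z, ps b z (Et z);
  ed_growth : exists c k, 0 < c /\ 0 < k /\ forall z, Cmod (Et z) <= c * G M (Cmod z / k);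
  ed_bounded : forall de, 0 < de -> exists c, 0 < c /\
    forall v, th + de <= Im v <= 2 * PI - th - de -> Cmod (Et (Cexp v)) <= c
}.

Lemma exp_between x j t : 0 <= x <= INR j -> exp (x * t) <= 1 + exp (INR j * t).
Proof.
intros Hx. have Q := exp_pos (INR j * t). destruct (Rle_dec t 0).
- assert (exp (x * t) <= exp 0) by (apply exp_mono; nra). rewrite exp_0 in *. lra.
- assert (exp (x * t) <= exp (INR j * t)) by bound. lra.
Qed.

Section Kernel.

Variables (M : nat -> R) (th : R) (ee : C -> C) (m : nat -> C) (b : nat -> C) (Et : C -> C).
Hypothesis HM : strongly_regular M.
Hypothesis HK : kernel_data M th ee m.
Hypothesis HE : entire_data M th b Et.

Lemma Et_holo z : exists l, Cder Et z l.
Proof.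
set (R0 := Cmod z + 2). have Hz := Cmod_ge_0 z.
destruct (ps_coef_bounds b R0 ltac:(unfold R0; lra)
  (fun y _ => ex_intro _ _ (ed_ps _ _ _ _ HE y)) (Cmod z + 1) ltac:(unfold R0; lra)) as [K [HK0 HKb]].
destruct (PSum_Cder b K (Cmod z + 1) z) as [l [Hl _]]; auto; try lra.
exists l. apply Cder_ext with (PSum b); [|bound].
intros y. apply PSum_spec, (ed_ps _ _ _ _ HE).
Qed.

(** Cauchy's inequality on the circle of radius [r]. *)
Lemma b_bound c k : 0 < c -> 0 < k -> (forall z, Cmod (Et z) <= c * G M (Cmod z / k)) ->
  forall r n, 0 < r -> Cmod (b n) <= c * G M (r / k) / r ^ n.
Proof.
intros Hc Hk H r n Hr.
destruct (Taylor_unique Et (2 * r) 1 b ltac:(lra) ltac:(lra)) as [_ T].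
- intros z _. apply Et_holo.
- intros z _. apply (ed_ps _ _ _ _ HE).
- apply T; [lra|]. intros z Hz. rewrite <- Hz. apply H.
Qed.

(** The integrability that everything rests on: the decay of the kernel beats
    powers together with a growth factor of smaller type. *)
Lemma kernel_decay t0 : 0 < t0 < th -> exists c0 C0 A0 a, 0 < c0 /\ 0 < C0 /\ 1 <= A0 /\ 0 < a /\
  (forall n, 1 <= A0 ^ n * M n) /\
  forall n t tau, Rabs tau <= t0 ->
    exp (INR n * t) * Cmod (ee (mkC t tau)) <= C0 * (A0 ^ n * M n) * exp (- (a * Rabs t)) /\
    G M (c0 * exp t) * (exp (INR n * t) * Cmod (ee (mkC t tau))) <=
      C0 * (A0 ^ n * M n) * exp (- (a * Rabs t)).
Proof.
intros Ht0.
destruct (kd_decay _ _ _ _ HK t0 Ht0) as [c [al [k [Hc [Hal [Hk H]]]]]].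
destruct (mg_const M HM) as [A [HA Hmg]].
have HM1 := M_pos M HM 1. have Hnu := nu_pos M HM 0.
set (c0 := / (k * A)).
have Hc0 : 0 < c0 by (apply Rinv_0_lt_compat, Rmult_lt_0_compat; lra).
set (A0 := Rmax (Rmax 1 (/ nu M 0)) (A / c0)).
have HA01 : 1 <= A0 by (unfold A0; eapply Rle_trans; [apply Rmax_l|apply Rmax_l]).
have HA02 : / nu M 0 <= A0 by (unfold A0; eapply Rle_trans; [apply Rmax_r|apply Rmax_l]).
have HA03 : A / c0 <= A0 by (unfold A0; apply Rmax_r).
set (C1 := c * G M c0). set (C2 := c * (A / c0) * M 1%nat).
have HG0 := G_pos M c0.
have HC1 : 0 < C1 by (apply Rmult_lt_0_compat; auto).
have HC2 : 0 < C2 by (unfold C2; apply Rmult_lt_0_compat; [bound|]; auto).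
set (a := Rmin al 1). have Ha : 0 < a by (apply Rmin_pos; lra).
have Hone : forall n, 1 <= A0 ^ n * M n.
{ intros n. through ((A0 * nu M 0) ^ n).
  - apply pow_R1_Rle. through (/ nu M 0 * nu M 0); [rewrite Rinv_l; lra|].
    bound.
  - rewrite Rpow_mult_distr. apply Rmult_le_compat_l; [bound|apply M_lower_0, HM]. }
exists c0, (C1 + C2), A0, a. repeat (split; [bound||lra|]).
intros n t tau Htau. destruct (H t tau Htau) as [H1 H2].
cut (G M (c0 * exp t) * (exp (INR n * t) * Cmod (ee (mkC t tau))) <=
  (C1 + C2) * (A0 ^ n * M n) * exp (- (a * Rabs t))).
{ intros Q. split; [|exact Q]. have P := G_ge1 M HM (c0 * exp t) ltac:(bound).
  assert (0 <= exp (INR n * t) * Cmod (ee (mkC t tau))) by bound. nra. }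
have HGp := G_pos M (c0 * exp t).
destruct (Rle_dec t 0) as [Ht|Ht].
- rewrite Rabs_left1 by lra.
  have E1 : G M (c0 * exp t) <= G M c0.
  { apply G_mono; auto. { bound. }
    rewrite <- (Rmult_1_r c0) at 2. apply Rmult_le_compat_l; [lra|]. rewrite <- exp_0. bound. }
  have E2 : exp (INR n * t) <= 1.
  { rewrite <- exp_0. apply exp_mono. have Q := pos_INR n. nra. }
  have E3 : Cmod (ee (mkC t tau)) <= c * exp (- (a * - t)).
  { step apply H1, Ht. apply Rmult_le_compat_l; [lra|]. apply exp_mono.
    have Q := Rmin_l al 1. fold a in Q. nra. }
  through (G M c0 * (1 * (c * exp (- (a * - t))))).
  { bound. }
  replace (G M c0 * (1 * (c * exp (- (a * - t))))) with (C1 * 1 * exp (- (a * - t))) by (unfold C1; ring).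
  bound.
- rewrite Rabs_pos_eq by lra.
  have HGk := G_pos M (exp t / k).
  have E1 : G M (c0 * exp t) * G M (c0 * exp t) <= G M (exp t / k).
  { replace (exp t / k) with (A * (c0 * exp t)) by (unfold c0; field; lra).
    apply G_square; auto. bound. }
  have E2 : G M (c0 * exp t) * Cmod (ee (mkC t tau)) <= c / G M (c0 * exp t).
  { times (G M (c0 * exp t)); auto.
    replace (c / G M (c0 * exp t) * G M (c0 * exp t)) with c by bound.
    through (G M (exp t / k) * (c / G M (exp t / k))); [|right; field; lra].
    replace (G M (c0 * exp t) * Cmod (ee (mkC t tau)) * G M (c0 * exp t)) with
      (G M (c0 * exp t) * G M (c0 * exp t) * Cmod (ee (mkC t tau))) by ring.
    bound. }
  have E3 := G_ge M HM (c0 * exp t) (S n) ltac:(bound).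
  have E5 : M (S n) <= A ^ S n * M 1%nat * M n by (apply (Hmg 1%nat n)).
  have E6 : exp (INR n * t) * / G M (c0 * exp t) <= (A / c0) ^ S n * M 1%nat * M n * exp (- t).
  { rewrite exp_INR_mult, exp_Ropp. times (G M (c0 * exp t) * exp t * c0 ^ S n).
    { bound. }
    replace (exp t ^ n * / G M (c0 * exp t) * (G M (c0 * exp t) * exp t * c0 ^ S n))
      with ((c0 * exp t) ^ S n) by (rewrite Rpow_mult_distr; simpl; field; lra).
    replace ((A / c0) ^ S n * M 1%nat * M n * / exp t * (G M (c0 * exp t) * exp t * c0 ^ S n))
      with (A ^ S n * M 1%nat * M n * G M (c0 * exp t)).
    - step exact E3. bound.
    - unfold Rdiv. rewrite Rpow_mult_distr, pow_inv. bound. }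
  through (c * (exp (INR n * t) * / G M (c0 * exp t))).
  { replace (G M (c0 * exp t) * (exp (INR n * t) * Cmod (ee (mkC t tau)))) with
      (exp (INR n * t) * (G M (c0 * exp t) * Cmod (ee (mkC t tau)))) by ring.
    replace (c * (exp (INR n * t) * / G M (c0 * exp t))) with
      (exp (INR n * t) * (c / G M (c0 * exp t))) by bound.
    bound. }
  through (c * ((A / c0) ^ S n * M 1%nat * M n * exp (- t))).
  { bound. }
  have E7 : (A / c0) ^ S n <= A / c0 * A0 ^ n.
  { simpl. bound. }
  have E8 : exp (- t) <= exp (- (a * t)).
  { apply exp_mono. have Q := Rmin_r al 1. fold a in Q. nra. }
  through (C2 * (A0 ^ n * M n) * exp (- (a * t))).
  + replace (c * ((A / c0) ^ S n * M 1%nat * M n * exp (- t))) with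
      (c * M 1%nat * M n * ((A / c0) ^ S n) * exp (- t)) by ring.
    replace (C2 * (A0 ^ n * M n)) with (c * M 1%nat * M n * (A / c0 * A0 ^ n)) by (unfold C2; ring).
    bound.
  + bound.
Qed.

Definition Jint (n : nat) (x v : C) : C := (Cexp (INR n * v) * (Et (x * Cexp v) * ee v))%C.

(** The transform of [t ^ n * e t] with kernel [Et (x * t)] along the ray of
    direction [tau], in the coordinate [v = log t]. Its Taylor coefficients at 0
    are the [kappa n]. *)
Definition J (n : nat) (tau : R) (x : C) : C := Iinf (fun t => Jint n x (mkC t tau)).

Definition kappa (n l : nat) : C := (b l * m (l + n)%nat)%C.

Lemma Jint_holo_v n x v : Rabs (Im v) < th -> exists l, Cder (Jint n x) v l.
Proof.
intros Hv. destruct (kd_holo _ _ _ _ HK v Hv) as [l1 H1].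
destruct (Et_holo (x * Cexp v)%C) as [l2 H2].
eexists. apply (Cder_mult (fun v => Cexp (INR n * v)) (fun v => Et (x * Cexp v) * ee v)%C).
- apply Cder_Cexp_scal.
- apply (Cder_mult (fun v => Et (x * Cexp v)%C) ee); [|exact H1].
  apply (Cder_comp Et (fun v => x * Cexp v)%C); [apply Cder_scal, Cder_Cexp|exact H2].
Qed.

Lemma Jint_holo_x n v : holo (fun _ => True) (fun x => Jint n x v).
Proof.
intros x _. destruct (Et_holo (x * Cexp v)%C) as [l2 H2].
eexists. apply Cder_scal.
apply (Cder_mult (fun x => Et (x * Cexp v)%C) (fun _ => ee v)); [|apply Cder_const].
apply (Cder_comp Et (fun x => x * Cexp v)%C); [|exact H2].
apply (Cder_ext (fun x => Cexp v * x)%C); [intros; ring|apply Cder_mult_id].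
Qed.

Lemma Cmod_Jint n x t tau : Cmod (Jint n x (mkC t tau)) =
  exp (INR n * t) * (Cmod (Et (x * Cexp (mkC t tau))) * Cmod (ee (mkC t tau))).
Proof.
unfold Jint. rewrite !Cmod_mult, Cmod_Cexp. do 2 f_equal. simpl. ring.
Qed.

Lemma ee_cts tau t : Rabs tau < th -> cts (fun t => ee (mkC t tau)) t.
Proof.
intros H. apply cts_hor. destruct (kd_holo _ _ _ _ HK (mkC t tau) H) as [l Hl].
exact (Cder_Ccts _ _ _ Hl).
Qed.

Lemma cts_Mellin s tau t : Rabs tau < th -> cts (fun t => Cexp (s * mkC t tau) * ee (mkC t tau))%C t.
Proof. intros H. apply cts_mult; [apply cts_Cexp_hor|apply ee_cts, H]. Qed.

Lemma Mellin_dom K a s tau : 0 < a -> Rabs tau < th ->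
  (forall t, exp (Re (s * mkC t tau)) * Cmod (ee (mkC t tau)) <= K * exp (- (a * Rabs t))) ->
  dom (fun t => Cexp (s * mkC t tau) * ee (mkC t tau))%C K a.
Proof.
intros Ha Htau H. split; [exact Ha|]. split; [intros t; apply cts_Mellin, Htau|].
intros t. rewrite Cmod_mult, Cmod_Cexp. apply H.
Qed.

Lemma kernel_weight : exists al, 0 < al /\ forall x0, exists K, 0 < K /\ forall x t, 0 <= x <= x0 ->
  exp (x * t) * Cmod (ee (mkC t 0)) <= K * exp (- (al * Rabs t)).
Proof.
have Hth := kd_th _ _ _ _ HK.
destruct (kernel_decay (th / 2) ltac:(lra)) as [c0 [C0 [A0 [al [Hc0 [HC0 [HA0 [Hal [Hone Hd]]]]]]]]].
exists al. split; [exact Hal|]. intros x0. destruct (INR_unbounded x0) as [j Hj].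
exists (C0 * (A0 ^ 0 * M 0%nat) + C0 * (A0 ^ j * M j)). split; [bound|]. intros x t Hx.
destruct (Hd 0%nat t 0 ltac:(bound)) as [H0 _]. destruct (Hd j t 0 ltac:(bound)) as [H1 _].
simpl INR in H0. rewrite Rmult_0_l, exp_0 in H0.
have Hex := exp_between x j t ltac:(lra).
through ((1 + exp (INR j * t)) * Cmod (ee (mkC t 0))); [bound|]. lra.
Qed.

Lemma rotated_moment t0 K a n tau : t0 < th -> 0 < a -> (forall t tau, Rabs tau <= t0 ->
    exp (INR n * t) * Cmod (ee (mkC t tau)) <= K * exp (- (a * Rabs t))) -> Rabs tau <= t0 ->
  Iinf (fun t => Cexp (INR n * mkC t tau) * ee (mkC t tau))%C = m n.
Proof.
intros Ht0 Ha Hd Htau. rewrite <- (kd_moment _ _ _ _ HK n).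
have HH : forall z, Rabs (Im z) <= t0 -> exists l, Cder (fun v => Cexp (INR n * v) * ee v)%C z l.
{ intros z Hz. destruct (kd_holo _ _ _ _ HK z) as [l Hl]; [lra|].
  eexists. apply (Cder_mult (fun v => Cexp (INR n * v)) ee); [|exact Hl].
  apply Cder_Cexp_scal. }
apply Rabs_le_between in Htau.
have Hin : forall x y, Rabs x <= t0 -> Rabs y <= t0 -> x <= y ->
  Iinf (fun t => Cexp (INR n * mkC t x) * ee (mkC t x))%C =
  Iinf (fun t => Cexp (INR n * mkC t y) * ee (mkC t y))%C.
{ intros x y Hx Hy Hxy. apply Rabs_le_between in Hx. apply Rabs_le_between in Hy.
  apply (Iinf_shift_line (fun v => Cexp (INR n * v) * ee v)%C x y K a); auto.
  - intros z Hz. apply HH, Rabs_le. lra.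
  - intros [t y'] Hz. rewrite Cmod_mult, Cmod_Cexp, Re_R_mult. apply (Hd t y'), Rabs_le. simpl in Hz. lra. }
destruct (Rle_dec tau 0) as [H|H]; [|symmetry]; apply Hin; try (apply Rabs_le; lra); lra.
Qed.

(** Near the origin the growth of [Et] is of smaller type than the decay of the
    kernel, so the series of [Et] can be integrated termwise. *)
Lemma J_small t0 : 0 < t0 < th -> exists c1 C1 A1 a, 0 < c1 /\ 0 < C1 /\ 1 <= A1 /\ 0 < a /\
  (forall n, 1 <= A1 ^ n * M n) /\
  (forall n l, Cmod (kappa n l) <= C1 * (A1 ^ n * M n) / (2 * c1) ^ l) /\
  (forall n tau x, Rabs tau <= t0 -> Cmod x <= c1 -> ps (kappa n) x (J n tau x)) /\
  (forall n t tau, Rabs tau <= t0 -> exp (INR n * t) * Cmod (ee (mkC t tau)) <=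
      C1 * (A1 ^ n * M n) * exp (- (a * Rabs t))).
Proof.
intros Ht0.
destruct (kernel_decay t0 Ht0) as [c0 [C0 [A0 [a [Hc0 [HC0 [HA0 [Ha [Hone Hd]]]]]]]]].
destruct (ed_growth _ _ _ _ HE) as [cE [kE [HcE [HkE HEt]]]].
have Hb := b_bound cE kE HcE HkE HEt.
set (c1 := c0 * kE / 2). have Hc1 : 0 < c1 by (unfold c1; apply Rdiv_lt_0_compat; [bound|]; lra).
set (C1 := C0 + 2 * (cE * C0) / a).
have HC1a : 0 < 2 * (cE * C0) / a by bound.
(* Domination of a single term of the series. *)
have Hterm : forall n l tau x, Rabs tau <= t0 -> Cmod x <= c1 ->
  dom (fun t => b l * x ^ l * (Cexp (INR (l + n) * mkC t tau) * ee (mkC t tau)))%C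
    (cE * C0 * (A0 ^ n * M n) * (/ 2) ^ l) a.
{ intros n l tau x Htau Hx. split; [bound|split].
  - intros t. apply cts_scal, cts_Mellin. lra.
  - intros t. destruct (Hd n t tau Htau) as [_ HG].
    rewrite !Cmod_mult, Cmod_pow, Cmod_Cexp.
    replace (Re (INR (l + n) * mkC t tau)) with (INR l * t + INR n * t)
      by (unfold Re; simpl; rewrite plus_INR; ring).
    rewrite exp_plus.
    have Hbl := Hb (2 * c1 * exp t) l ltac:(bound).
    replace (2 * c1 * exp t / kE) with (c0 * exp t) in Hbl by (unfold c1; field; lra).
    have Hblx : Cmod (b l) * Cmod x ^ l * exp (INR l * t) <= cE * G M (c0 * exp t) * (/ 2) ^ l.
    { rewrite exp_INR_mult. through (cE * G M (c0 * exp t) / (2 * c1 * exp t) ^ l * (c1 ^ l * exp t ^ l)).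
      - rewrite Rmult_assoc. bound.
      - right. rewrite !Rpow_mult_distr, pow_inv. field. bound. }
    set (E := Cmod (ee (mkC t tau))) in *. have HEp : 0 <= E by apply Cmod_ge_0.
    replace (Cmod (b l) * Cmod x ^ l * (exp (INR l * t) * exp (INR n * t) * E)) with
      ((Cmod (b l) * Cmod x ^ l * exp (INR l * t)) * (exp (INR n * t) * E)) by ring.
    through (cE * G M (c0 * exp t) * (/ 2) ^ l * (exp (INR n * t) * E)).
    + bound.
    + replace (cE * G M (c0 * exp t) * (/ 2) ^ l * (exp (INR n * t) * E)) with
        (cE * (/ 2) ^ l * (G M (c0 * exp t) * (exp (INR n * t) * E))) by ring.
      replace (cE * C0 * (A0 ^ n * M n) * (/ 2) ^ l * exp (- (a * Rabs t))) with
        (cE * (/ 2) ^ l * (C0 * (A0 ^ n * M n) * exp (- (a * Rabs t)))) by ring.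
      bound. }
have Hmom : forall n tau, Rabs tau <= t0 ->
  Iinf (fun t => Cexp (INR n * mkC t tau) * ee (mkC t tau))%C = m n.
{ intros n tau Htau. apply (rotated_moment t0 (C0 * (A0 ^ n * M n)) a); auto; [lra|].
  intros t tau' H. apply (Hd n t tau' H). }
have Hdm : forall n tau, Rabs tau <= t0 ->
  dom (fun t => Cexp (INR n * mkC t tau) * ee (mkC t tau))%C (C0 * (A0 ^ n * M n)) a.
{ intros n tau Htau. apply Mellin_dom; [exact Ha|lra|]. intros t. rewrite Re_R_mult. apply (Hd n t tau Htau). }
have Hti : forall n l tau x, Rabs tau <= t0 ->
  Iinf (fun t => b l * x ^ l * (Cexp (INR (l + n) * mkC t tau) * ee (mkC t tau)))%C
    = (kappa n l * x ^ l)%C.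
{ intros n l tau x Htau. rewrite (Iinf_scal _ _ _ _ (Hdm (l + n)%nat tau Htau)).
  rewrite Hmom by bound. bound. }
exists c1, C1, A0, a. repeat (split; [assumption || (unfold C1; lra)|]). split; [|split].
- intros n l.
  have Hz : Rabs 0 <= t0 by bound.
  have Q := Iinf_bound _ _ _ (Hterm n l 0 (RtoC c1) Hz ltac:(rewrite Cmod_R, Rabs_pos_eq; lra)).
  rewrite Hti in Q by bound. rewrite Cmod_mult, Cmod_pow, Cmod_R, (Rabs_pos_eq c1) in Q by lra.
  have Hp : 0 < c1 ^ l by bound.
  times (c1 ^ l); auto. step exact Q.
  rewrite pow_inv, Rpow_mult_distr.
  replace (2 * (cE * C0 * (A0 ^ n * M n) * / 2 ^ l) / a) with
    (2 * (cE * C0) / a * (A0 ^ n * M n) * / 2 ^ l) by bound.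
  replace (C1 * (A0 ^ n * M n) / (2 ^ l * c1 ^ l) * c1 ^ l) with (C1 * (A0 ^ n * M n) * / 2 ^ l)
    by bound.
  apply Rmult_le_compat_r; [bound|].
  apply Rmult_le_compat_r; [bound|unfold C1; lra].
- intros n tau x Htau Hx.
  have HJd : forall L, dom (fun t => Jint n x (mkC t tau) + - (1) * Csum (fun l =>
      b l * x ^ l * (Cexp (INR (l + n) * mkC t tau) * ee (mkC t tau))) L)%C
      (2 * (cE * C0) * (A0 ^ n * M n) * (/ 2) ^ L) a.
  { intros L. split; [bound|split].
    - intros t. apply cts_plus.
      + apply cts_hor. destruct (Jint_holo_v n x (mkC t tau)) as [l Hl]; [simpl; lra|].
        exact (Cder_Ccts _ _ _ Hl).
      + apply cts_scal. induction L; simpl; [apply cts_const|].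
        apply cts_plus; [bound|apply (Hterm n L tau x Htau Hx)].
    - intros t. set (v := mkC t tau).
      have E1 : Csum (fun l => b l * x ^ l * (Cexp (INR (l + n) * v) * ee v))%C L =
        (Cexp (INR n * v) * ee v * Csum (fun l => b l * (x * Cexp v) ^ l) L)%C.
      { rewrite <- Csum_scal. apply Csum_ext. intros l _. rewrite Cpow_mult.
        rewrite plus_INR, RtoC_plus, Cmult_plus_distr_r, Cexp_add, (Cexp_pow v l). ring. }
      rewrite E1. unfold Jint.
      replace (Cexp (INR n * v) * (Et (x * Cexp v) * ee v) +
        - (1) * (Cexp (INR n * v) * ee v * Csum (fun l => b l * (x * Cexp v) ^ l) L))%C
        with (Cexp (INR n * v) * ee v * (Et (x * Cexp v) - Csum (fun l => b l * (x * Cexp v) ^ l) L))%C by ring.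
      have Het := exp_pos t.
      have Hmx : Cmod (x * Cexp v) <= c1 * exp t.
      { rewrite Cmod_mult, Cmod_Cexp. simpl. bound. }
      set (r := 2 * c1 * exp t). have Hr : 0 < r by (apply Rmult_lt_0_compat; lra).
      have Hr2 : c1 * exp t = r / 2 by (unfold r; field).
      have HKr : cE * G M (r / kE) = cE * G M (c0 * exp t).
      { do 2 f_equal. unfold r, c1. field. lra. }
      destruct (bounds_ps b (cE * G M (r / kE)) r (x * Cexp v)%C Hr) as [l [Hl Hlb]].
      { bound. }
      { bound. }
      { lra. }
      rewrite <- (ps_unique _ _ _ _ (ed_ps _ _ _ _ HE _) Hl) in Hlb. specialize (Hlb L).
      set (q := Cmod (x * Cexp v) / r) in *.
      have Hq : 0 <= q <= / 2.
      { unfold q. bound. }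
      have Hd' : Cmod (Et (x * Cexp v) - Csum (fun l => b l * (x * Cexp v) ^ l)%C L) <=
        2 * cE * G M (c0 * exp t) * (/ 2) ^ L.
      { rewrite Cmod_minus_sym. step exact Hlb. rewrite HKr.
        apply Rmult_le_compat; try (apply pow_le; lra).
        - bound.
        - replace (2 * cE * G M (c0 * exp t)) with (cE * G M (c0 * exp t) * 2) by ring.
          unfold Rdiv. apply Rmult_le_compat_l; [bound|].
          replace 2 with (/ / 2) by field. bound.
        - bound. }
      rewrite !Cmod_mult, Cmod_Cexp.
      replace (Re (INR n * v)) with (INR n * t) by (unfold Re, v; simpl; ring).
      destruct (Hd n t tau Htau) as [_ HG]. fold v in HG.
      set (E := Cmod (ee v)) in *. have HEp : 0 <= E by apply Cmod_ge_0.
      through (exp (INR n * t) * E * (2 * cE * G M (c0 * exp t) * (/ 2) ^ L)).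
      { bound. }
      replace (exp (INR n * t) * E * (2 * cE * G M (c0 * exp t) * (/ 2) ^ L)) with
        (2 * cE * (/ 2) ^ L * (G M (c0 * exp t) * (exp (INR n * t) * E))) by ring.
      replace (2 * (cE * C0) * (A0 ^ n * M n) * (/ 2) ^ L * exp (- (a * Rabs t))) with
        (2 * cE * (/ 2) ^ L * (C0 * (A0 ^ n * M n) * exp (- (a * Rabs t)))) by ring.
      bound. }
  have HS : forall L, exists B', dom (fun t => Csum (fun l =>
      b l * x ^ l * (Cexp (INR (l + n) * mkC t tau) * ee (mkC t tau)))%C L) B' a /\
      Iinf (fun t => Csum (fun l =>
      b l * x ^ l * (Cexp (INR (l + n) * mkC t tau) * ee (mkC t tau)))%C L) =
      Csum (fun l => kappa n l * x ^ l)%C L.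
  { intros L. destruct (Iinf_Csum (fun l t =>
      b l * x ^ l * (Cexp (INR (l + n) * mkC t tau) * ee (mkC t tau)))%C
      (fun l => cE * C0 * (A0 ^ n * M n) * (/ 2) ^ l) a L Ha) as [E1 [B' E2]].
    { bound. }
    exists B'. split; [bound|]. rewrite E1. apply Csum_ext. bound. }
  apply (Clim_0_of_bound _ _ (fun L => 2 * (2 * (cE * C0) * (A0 ^ n * M n)) / a * (/ 2) ^ L)).
  { apply geom_lim. lra. }
  intros L. destruct (HS L) as [B' [D1 E1]].
  have E2 : J n tau x = (Iinf (fun t => Jint n x (mkC t tau) + - (1) * Csum (fun l =>
      b l * x ^ l * (Cexp (INR (l + n) * mkC t tau) * ee (mkC t tau))) L)%C +
      Csum (fun l => kappa n l * x ^ l)%C L)%C.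
  { rewrite <- E1, <- (Iinf_plus _ _ _ _ _ _ (HJd L) D1). apply Iinf_ext. intros t. ring. }
  rewrite E2.
  match goal with |- Cmod (?s - (?i + ?s)) <= _ => replace (s - (i + s))%C with (- i)%C by ring end.
  rewrite Cmod_opp. step apply (Iinf_bound _ _ _ (HJd L)).
  bound.
- intros n t tau Htau.
  step apply (Hd n t tau Htau). apply Rmult_le_compat_r; [bound|].
  apply Rmult_le_compat_r; [bound|unfold C1; lra].
Qed.

(** Arguments away from the positive axis. The direction [tau] of integration may
    be varied as long as [x * exp v] stays in the region where [Et] is bounded. *)
Lemma J_sector t0 C1 A1 a de : 0 < t0 < th -> 0 < a -> 0 < de -> 0 < C1 ->
  (forall n, 1 <= A1 ^ n * M n) ->
  (forall n t tau, Rabs tau <= t0 -> exp (INR n * t) * Cmod (ee (mkC t tau)) <=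
      C1 * (A1 ^ n * M n) * exp (- (a * Rabs t))) ->
  exists C2, 0 < C2 /\ forall n,
    (forall tau y, Rabs tau <= t0 -> th + de <= Im y + tau <= 2 * PI - th - de ->
      Cmod (J n tau (Cexp y)) <= C2 * (A1 ^ n * M n)) /\
    (forall tau tau' y, Rabs tau <= t0 -> Rabs tau' <= t0 ->
      th + de <= Im y + tau <= 2 * PI - th - de ->
      th + de <= Im y + tau' <= 2 * PI - th - de -> J n tau (Cexp y) = J n tau' (Cexp y)) /\
    (forall tau y, Rabs tau <= t0 -> th + de < Im y + tau < 2 * PI - th - de ->
      exists l, Cder (J n tau) (Cexp y) l).
Proof.
intros Ht0 Ha Hde HC1 Hone Hd.
destruct (ed_bounded _ _ _ _ HE de Hde) as [CE [HCE HB]].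
have Hbd : forall n t tau y, Rabs tau <= t0 -> th + de <= Im y + tau <= 2 * PI - th - de ->
  Cmod (Jint n (Cexp y) (mkC t tau)) <= CE * (C1 * (A1 ^ n * M n)) * exp (- (a * Rabs t)).
{ intros n t tau y Htau Hy. rewrite Cmod_Jint, <- Cexp_add.
  specialize (Hd n t tau Htau).
  set (E := Cmod (ee (mkC t tau))) in *. have HEp : 0 <= E by apply Cmod_ge_0.
  through (CE * (exp (INR n * t) * E)).
  - replace (CE * (exp (INR n * t) * E)) with (exp (INR n * t) * (CE * E)) by ring.
    bound.
  - rewrite Rmult_assoc. bound. }
have Hdom : forall n tau y, Rabs tau <= t0 -> th + de <= Im y + tau <= 2 * PI - th - de ->
  dom (fun t => Jint n (Cexp y) (mkC t tau)) (CE * (C1 * (A1 ^ n * M n))) a.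
{ intros n tau y Htau Hy. split; [bound|split].
  - intros t. apply cts_hor. destruct (Jint_holo_v n (Cexp y) (mkC t tau)) as [l Hl]; [simpl; lra|].
    exact (Cder_Ccts _ _ _ Hl).
  - bound. }
exists (2 * (CE * C1) / a). split.
{ bound. }
intros n. split; [|split].
- intros tau y Htau Hy. step apply (Iinf_bound _ _ _ (Hdom n tau y Htau Hy)).
  bound.
- intros tau tau' y Htau Htau' Hy Hy'.
  have S : forall s s', Rabs s <= t0 -> Rabs s' <= t0 -> s <= s' ->
    th + de <= Im y + s <= 2 * PI - th - de -> th + de <= Im y + s' <= 2 * PI - th - de ->
    J n s (Cexp y) = J n s' (Cexp y).
  { intros s s' Hs Hs' Hss Hys Hys'. apply Rabs_le_between in Hs. apply Rabs_le_between in Hs'.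
    apply (Iinf_shift_line (Jint n (Cexp y)) s s' (CE * (C1 * (A1 ^ n * M n))) a); auto.
    - intros z Hz. apply Jint_holo_v. bound.
    - intros z Hz. replace z with (mkC (Re z) (Im z)) at 1 by bound.
      apply Hbd; [bound|lra]. }
  destruct (Rle_dec tau tau'); [|symmetry]; apply S; auto; lra.
- intros tau y Htau Hy.
  apply (holo_Iinf (fun x => exists y, x = Cexp y /\ th + de < Im y + tau < 2 * PI - th - de)
    (fun x t => Jint n x (mkC t tau)) a); auto.
  + intros t x _. apply (Jint_holo_x n (mkC t tau) x I).
  + intros x t [y' [-> Hy']]. apply (Hdom n tau y' Htau). lra.
  + intros x [y' [-> Hy']].
    set (g := Rmin (Im y' + tau - (th + de)) (2 * PI - th - de - (Im y' + tau))).
    have Hg : 0 < g by (apply Rmin_pos; lra).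
    have G1 : g <= Im y' + tau - (th + de) by apply Rmin_l.
    have G2 : g <= 2 * PI - th - de - (Im y' + tau) by apply Rmin_r.
    destruct (Cexp_open y' g Hg) as [d [Hd1 Hd2]].
    exists d, (CE * (C1 * (A1 ^ n * M n))). split; [bound|].
    intros x Hx. destruct (Hd2 x Hx) as [y'' [-> Hy'']]. apply Rabs_def2 in Hy''.
    split; [exists y''; split; [bound|lra]|].
    intros t. apply Hbd; auto. lra.
  + exists y. bound.
Qed.

End Kernel.

(** * The contour operator *)

Definition sdomain (d theta rho : R) (z : C) : Prop := sector d theta z \/ Cmod z < rho.

Lemma Copen_domain d theta rho : Copen (sdomain d theta rho).
Proof.
intros z [Hz|Hz].
- destruct (Copen_sector d theta z Hz) as [e [He H]]. exists e. split; auto.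
  intros y Hy. left; auto.
- destruct (Copen_ball0 rho z Hz) as [e [He H]]. exists e. split; auto.
  intros y Hy. right. apply H, Hy.
Qed.

(** The transform [contour_sum] is the integral of [g w * J n (z / w) / w ^ n] against
    [dw / w] over a closed contour around the origin which follows the boundary of
    the sector of half-opening [be] about [d] out to radius [exp L]. Off the outer
    arc, the ray of integration in [J] depends on [w], so that the argument of [Et]
    avoids the directions of growth. On the outer arc [z / w] is small and [J] is
    given by its power series [PSk]. *)
Section Contour.

Variables (M : nat -> R) (th : R) (ee : C -> C) (m : nat -> C) (b : nat -> C) (Et : C -> C).
Hypothesis HM : strongly_regular M.
Hypothesis HK : kernel_data M th ee m.
Hypothesis HE : entire_data M th b Et.

Variables (d theta rho : R).
Hypothesis Htheta : 0 < theta /\ theta <= th /\ theta <= PI - th.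
Hypothesis Hrho : 0 < rho.

Let be := 3 * theta / 8.
Let de := theta / 16.
Let t0 := th - theta / 16.
Let L0 := ln (rho / 2).

Variables (c1 C1 A1 a C2 : R).
Hypothesis Hc1 : 0 < c1.
Hypothesis HC1 : 0 < C1.
Hypothesis HC2 : 0 < C2.
Hypothesis Hone : forall n, 1 <= A1 ^ n * M n.
Hypothesis Hkappa : forall n l, Cmod (kappa m b n l) <= C1 * (A1 ^ n * M n) / (2 * c1) ^ l.
Hypothesis Hsmall : forall n tau x, Rabs tau <= t0 -> Cmod x <= c1 ->
  ps (kappa m b n) x (J ee Et n tau x).
Hypothesis HJ1 : forall n tau y, Rabs tau <= t0 -> th + de <= Im y + tau <= 2 * PI - th - de ->
  Cmod (J ee Et n tau (Cexp y)) <= C2 * (A1 ^ n * M n).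
Hypothesis HJ2 : forall n tau tau' y, Rabs tau <= t0 -> Rabs tau' <= t0 ->
  th + de <= Im y + tau <= 2 * PI - th - de -> th + de <= Im y + tau' <= 2 * PI - th - de ->
  J ee Et n tau (Cexp y) = J ee Et n tau' (Cexp y).
Hypothesis HJ3 : forall n tau y, Rabs tau <= t0 -> th + de < Im y + tau < 2 * PI - th - de ->
  exists l, Cder (J ee Et n tau) (Cexp y) l.

Variables (g : C -> C) (n : nat).
Hypothesis Hg : holo (sdomain d theta rho) g.

Let PSk := PSum (kappa m b n).
Let Jn := J ee Et n.
Let W (v : C) : C := (g (Cexp v) * / Cexp v ^ n)%C.
Let arg (z v : C) : C := (z * / Cexp v)%C.

(** Direction of integration attached to the point of argument [phi] of the arc;
    it interpolates between the extreme admissible directions. *)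
Let tau (phi : R) : R := Rmax (- t0) (Rmin t0 (t0 / (PI - be) * (phi - (d + PI)))).

Let small_sector := sector d (theta / 2).

Lemma contour_angles : 0 < PI /\ 0 < th < PI /\ 0 < t0 /\ 0 < de /\ t0 <= PI - be /\ be < PI.
Proof.
have H := kd_th _ _ _ _ HK. unfold t0, de, be. lra.
Qed.

Lemma tau_bound phi : Rabs (tau phi) <= t0.
Proof.
destruct contour_angles as [_ [_ [H _]]]. apply Rabs_le. unfold tau. split; [apply Rmax_l|].
apply Rmax_lub; [lra|apply Rmin_l].
Qed.

Lemma tau_lip phi phi' : Rabs (tau phi - tau phi') <= Rabs (phi - phi').
Proof.
destruct contour_angles as [_ [_ [H [_ [H1 H2]]]]].
set (s := t0 / (PI - be)).
have Hs : 0 <= s <= 1.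
{ unfold s. bound. }
through (Rabs (s * (phi - (d + PI)) - s * (phi' - (d + PI)))).
- unfold tau. fold s.
  generalize (s * (phi - (d + PI))) (s * (phi' - (d + PI))). intros x y.
  unfold Rmax, Rmin, Rabs. repeat destruct Rle_dec; repeat destruct Rcase_abs; lra.
- rewrite <- Rmult_minus_distr_l, Rabs_mult, (Rabs_pos_eq s) by lra.
  replace (phi - (d + PI) - (phi' - (d + PI))) with (phi - phi') by ring.
  rewrite <- (Rmult_1_l (Rabs (phi - phi'))) at 2. bound.
Qed.

(** The admissibility computation: with [u = phi - d - PI] one has
    [tau = t0 * u / (PI - be)], and the total angle stays within
    [PI - th - de] of [PI]. *)
Lemma tau_admissible phi y : d + be <= phi <= d - be + 2 * PI -> Rabs (Im y - d) < theta / 4 ->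
  th + de < Im y - phi + 2 * PI + tau phi < 2 * PI - th - de.
Proof.
destruct contour_angles as [HP [Hth [H [_ [H1 H2]]]]]. intros Hphi Hy. apply Rabs_def2 in Hy.
set (u := phi - (d + PI)). have Hu : - (PI - be) <= u <= PI - be by (unfold u; lra).
set (s := t0 / (PI - be)).
have Es : s * (PI - be) = t0 by (unfold s; field; lra).
have Hs : 0 <= s <= 1.
{ unfold s. bound. }
have Hsu : - t0 <= s * u <= t0.
{ split; [through (s * - (PI - be)); [lra|]|through (s * (PI - be)); [|lra]];
  apply Rmult_le_compat_l; lra. }
have Et0 : tau phi = s * u.
{ unfold tau. fold s u. rewrite Rmin_right, Rmax_right; lra. }
rewrite Et0. replace (Im y - phi + 2 * PI + s * u) with ((Im y - d) + PI - (1 - s) * u)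
  by (unfold u; ring).
have Q1 : (1 - s) * u <= (1 - s) * (PI - be) by bound.
have Q2 : (1 - s) * - (PI - be) <= (1 - s) * u by bound.
unfold de, be, t0 in *. lra.
Qed.

Lemma low_admissible y : Rabs (Im y - d) < theta / 4 ->
  th + de < Im y - (d - be) + t0 < 2 * PI - th - de.
Proof.
destruct contour_angles as [HP [Hth _]]. intros Hy. apply Rabs_def2 in Hy.
unfold t0, de, be in *. lra.
Qed.

Lemma high_admissible y : Rabs (Im y - d) < theta / 4 ->
  th + de < Im y - (d + be) + 2 * PI + - t0 < 2 * PI - th - de.
Proof.
destruct contour_angles as [HP [Hth _]]. intros Hy. apply Rabs_def2 in Hy.
unfold t0, de, be in *. lra.
Qed.

Lemma arg_log y v k : arg (Cexp y) v = Cexp (mkC (Re y - Re v) (Im y - Im v + INR k * (2 * PI))).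
Proof.
unfold arg. rewrite <- Cexp_opp, <- Cexp_add.
replace (mkC (Re y - Re v) (Im y - Im v + INR k * (2 * PI)))
  with (y + - v + RtoC (INR k) * mkC 0 (2 * PI))%C
  by (apply C_ext; unfold Re, Im; simpl; ring).
rewrite (Cexp_add (y + - v)), Cexp_nat_period. ring.
Qed.

Lemma Cmod_arg z v : Cmod (arg z v) = Cmod z * exp (- Re v).
Proof. unfold arg. rewrite Cmod_mult, <- Cexp_opp, Cmod_Cexp. reflexivity. Qed.

Lemma g_arc_domain v : Re v <= L0 \/ Rabs (Im v - d) <= be -> sdomain d theta rho (Cexp v).
Proof.
intros [H|H].
- right. rewrite Cmod_Cexp. step apply exp_mono, H.
  unfold L0. rewrite exp_ln by lra. lra.
- left. apply sector_log. exists v. split; [bound|]. unfold be in H. lra.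
Qed.

Lemma W_holo v : Re v <= L0 \/ Rabs (Im v - d) <= be -> exists l, Cder W v l.
Proof.
intros H. destruct (Hg _ (g_arc_domain v H)) as [l Hl].
eexists. apply (Cder_mult (fun v => g (Cexp v)) (fun v => / Cexp v ^ n)%C).
- apply (Cder_comp g Cexp); [apply Cder_Cexp|exact Hl].
- apply (Cder_inv (fun v => Cexp v ^ n)%C); [apply Cpow_neq_0, Cexp_neq_0|].
  apply (Cder_comp (fun x => x ^ n)%C Cexp); [apply Cder_Cexp|apply Cder_pow].
Qed.

Lemma Cmod_W v : Cmod (W v) = Cmod (g (Cexp v)) * / exp (Re v) ^ n.
Proof.
unfold W. rewrite Cmod_mult, Cmod_inv, Cmod_pow, Cmod_Cexp by apply Cpow_neq_0, Cexp_neq_0. reflexivity.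
Qed.

Lemma Cder_arg_v z v : Cder (arg z) v (- (z * / Cexp v))%C.
Proof.
unfold arg. eapply Cder_eq; [|apply (Cder_scal z (fun v => / Cexp v)%C v _
  (Cder_inv Cexp v _ (Cexp_neq_0 v) (Cder_Cexp v)))].
field. apply Cexp_neq_0.
Qed.

Lemma Cder_arg_z z v : Cder (fun z => arg z v) z (/ Cexp v)%C.
Proof.
apply (Cder_ext (fun z => / Cexp v * z)%C); [intros; unfold arg; ring|apply Cder_mult_id].
Qed.

Lemma PSk_holo : holo (ball0 (2 * c1)) PSk.
Proof.
apply (PSum_holo _ (C1 * (A1 ^ n * M n))); [lra| |bound].
apply Rmult_le_pos; [lra|]. have Q := Hone n. lra.
Qed.

Lemma J_PSk t x : Rabs t <= t0 -> Cmod x <= c1 -> Jn t x = PSk x.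
Proof. intros Ht Hx. symmetry. apply PSum_spec. bound. Qed.

Lemma PSk_bound x : Cmod x <= c1 -> Cmod (PSk x) <= 2 * C1 * (A1 ^ n * M n).
Proof.
intros Hx. have Q := Hone n.
step (apply (PSum_bound _ (C1 * (A1 ^ n * M n)) (2 * c1)); try lra).
- bound.
- bound.
- have Hq : Cmod x / (2 * c1) <= / 2.
  { bound. }
  replace (2 * C1 * (A1 ^ n * M n)) with (C1 * (A1 ^ n * M n) * / / 2) by field.
  unfold Rdiv at 1. bound.
Qed.

(** The four pieces of the contour, the outer arc having radius [exp L]. *)
Let Arc (z : C) : C :=
  CI (fun phi => W (mkC L0 phi) * Jn (tau phi) (arg z (mkC L0 phi)))%C (d + be) (d - be + 2 * PI).
Let Low (L : R) (z : C) : C := CI (fun x => W (mkC x (d - be)) * Jn t0 (arg z (mkC x (d - be))))%C L0 L.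
Let High (L : R) (z : C) : C :=
  CI (fun x => W (mkC x (d + be)) * Jn (- t0) (arg z (mkC x (d + be))))%C L0 L.
Let Out (L : R) (z : C) : C :=
  CI (fun phi => W (mkC L phi) * PSk (arg z (mkC L phi)))%C (d - be) (d + be).

Definition contour_sum (L : R) (z : C) : C :=
  (/ RtoC (2 * PI) * ((Arc z + Out L z) + / Ci * (Low L z + - (1) * High L z)))%C.

Lemma cts_W_hor y x : Rabs (y - d) <= be -> cts (fun x => W (mkC x y)) x.
Proof.
intros Hy. apply cts_hor. destruct (W_holo (mkC x y)) as [l Hl]; [bound|].
exact (Cder_Ccts _ _ _ Hl).
Qed.

Lemma cts_W_ver x y : x <= L0 \/ Rabs (y - d) <= be -> cts (fun y => W (mkC x y)) y.
Proof.
intros Hy. apply cts_ver. destruct (W_holo (mkC x y)) as [l Hl]; [bound|].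
exact (Cder_Ccts _ _ _ Hl).
Qed.

Lemma Arc_cts z phi : small_sector z -> d + be <= phi <= d - be + 2 * PI ->
  cts (fun phi => W (mkC L0 phi) * Jn (tau phi) (arg z (mkC L0 phi)))%C phi.
Proof.
intros Hz Hphi. apply sector_log in Hz. destruct Hz as [y [-> Hy]].
have Hy4 : Rabs (Im y - d) < theta / 4 by lra.
apply cts_mult; [apply cts_W_ver; left; lra|].
have Ad := tau_admissible phi y Hphi Hy4.
set (e := Rmin (Im y - phi + 2 * PI + tau phi - (th + de))
  (2 * PI - th - de - (Im y - phi + 2 * PI + tau phi))).
have He : 0 < e by (apply Rmin_pos; lra).
have E1 : e <= Im y - phi + 2 * PI + tau phi - (th + de) by apply Rmin_l.
have E2 : e <= 2 * PI - th - de - (Im y - phi + 2 * PI + tau phi) by apply Rmin_r.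
apply (cts_ext_loc (fun s => Jn (tau phi) (arg (Cexp y) (mkC L0 s)))).
- exists (e / 2). split; [lra|]. intros s Hs.
  rewrite (arg_log y (mkC L0 s) 1). simpl INR. rewrite Rmult_1_l.
  have Hl := tau_lip s phi. have Hl2 : Rabs (tau s - tau phi) < e / 2 by lra.
  apply Rabs_def2 in Hl2. apply Rabs_def2 in Hs.
  apply HJ2; try apply tau_bound; simpl; lra.
- apply (cts_comp (Jn (tau phi)) (fun s => arg (Cexp y) (mkC L0 s))).
  + apply (cts_ver (arg (Cexp y))). eapply Cder_Ccts, Cder_arg_v.
  + rewrite (arg_log y (mkC L0 phi) 1). simpl INR. rewrite Rmult_1_l.
    destruct (HJ3 n (tau phi) (mkC (Re y - L0) (Im y - phi + 2 * PI))) as [l Hl];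
      [apply tau_bound|bound|].
    exact (Cder_Ccts _ _ _ Hl).
Qed.

Lemma Low_point z x : small_sector z -> exists l, Cder (Jn t0) (arg z (mkC x (d - be))) l.
Proof.
destruct contour_angles as [_ [_ [H _]]].
intros Hz. apply sector_log in Hz. destruct Hz as [y [-> Hy]].
rewrite (arg_log y (mkC x (d - be)) 0). simpl INR. rewrite Rmult_0_l, Rplus_0_r.
apply HJ3; [bound|]. simpl. apply low_admissible. lra.
Qed.

Lemma High_point z x : small_sector z -> exists l, Cder (Jn (- t0)) (arg z (mkC x (d + be))) l.
Proof.
destruct contour_angles as [_ [_ [H _]]].
intros Hz. apply sector_log in Hz. destruct Hz as [y [-> Hy]].
rewrite (arg_log y (mkC x (d + be)) 1). simpl INR. rewrite Rmult_1_l.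
apply HJ3; [bound|]. simpl. apply high_admissible. lra.
Qed.

Lemma Low_cts z x : small_sector z ->
  cts (fun x => W (mkC x (d - be)) * Jn t0 (arg z (mkC x (d - be))))%C x.
Proof.
intros Hz. apply cts_mult; [apply cts_W_hor|].
{ replace (d - be - d) with (- be) by ring. rewrite Rabs_Ropp, Rabs_pos_eq; unfold be; lra. }
apply (cts_comp (Jn t0) (fun x => arg z (mkC x (d - be)))).
- apply (cts_hor (arg z)). eapply Cder_Ccts, Cder_arg_v.
- apply diff_Ccts, (Low_point z x Hz).
Qed.

Lemma High_cts z x : small_sector z ->
  cts (fun x => W (mkC x (d + be)) * Jn (- t0) (arg z (mkC x (d + be))))%C x.
Proof.
intros Hz. apply cts_mult; [apply cts_W_hor|].
{ replace (d + be - d) with be by ring. rewrite Rabs_pos_eq; unfold be; lra. }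
apply (cts_comp (Jn (- t0)) (fun x => arg z (mkC x (d + be)))).
- apply (cts_hor (arg z)). eapply Cder_Ccts, Cder_arg_v.
- apply diff_Ccts, (High_point z x Hz).
Qed.

Lemma small_arg z v L : Cmod z < 2 * c1 * exp L -> L <= Re v -> Cmod (arg z v) < 2 * c1.
Proof.
intros Hz Hv. rewrite Cmod_arg. have He := exp_pos (- Re v).
apply Rlt_le_trans with (2 * c1 * exp L * exp (- Re v)); [bound|].
rewrite Rmult_assoc, <- exp_plus. rewrite <- (Rmult_1_r (2 * c1)) at 2.
apply Rmult_le_compat_l; [lra|]. rewrite <- exp_0. bound.
Qed.

Lemma small_arg_le z v L : Cmod z <= c1 * exp L -> L <= Re v -> Cmod (arg z v) <= c1.
Proof.
intros Hz Hv. rewrite Cmod_arg.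
through (c1 * exp L * exp (- Re v)); [bound|].
rewrite Rmult_assoc, <- exp_plus. rewrite <- (Rmult_1_r c1) at 2.
apply Rmult_le_compat_l; [lra|]. rewrite <- exp_0. bound.
Qed.

Lemma WPS_holo z v L : Cmod z < 2 * c1 * exp L -> L <= Re v -> Rabs (Im v - d) <= be \/ Re v <= L0 ->
  exists l, Cder (fun v => W v * PSk (arg z v))%C v l.
Proof.
intros Hz Hv1 Hv2. destruct (W_holo v) as [l1 H1]; [tauto|].
destruct (PSk_holo (arg z v)) as [l2 H2]; [apply (small_arg z v L); auto|].
eexists. apply (Cder_mult W (fun v => PSk (arg z v))); [exact H1|].
apply (Cder_comp PSk (arg z)); [apply Cder_arg_v|exact H2].
Qed.

Lemma Out_cts z phi L : Cmod z < 2 * c1 * exp L -> Rabs (phi - d) <= be ->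
  cts (fun phi => W (mkC L phi) * PSk (arg z (mkC L phi)))%C phi.
Proof.
intros Hz Hp. destruct (WPS_holo z (mkC L phi) L Hz) as [l Hl].
- simpl; lra.
- bound.
- apply (cts_ver (fun v => W v * PSk (arg z v))%C). exact (Cder_Ccts _ _ _ Hl).
Qed.

Lemma abs_be phi : d - be <= phi <= d + be -> Rabs (phi - d) <= be.
Proof. intros H. bound. Qed.

(** Enlarging the outer arc does not change the sum: on the added region the
    integrand is [W * PSk], and Cauchy's theorem applies to a rectangle. *)
Lemma contour_sum_indep z L L' : small_sector z -> L0 <= L -> L <= L' -> Cmod z <= c1 * exp L ->
  contour_sum L z = contour_sum L' z.
Proof.
intros Hz HL HL' Hzm.
destruct contour_angles as [_ [_ [H _]]].
have HbeP : 0 < be by (unfold be; lra).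
have Hz2 : Cmod z < 2 * c1 * exp L.
{ assert (0 < c1 * exp L) by bound. lra. }
set (Phi := fun v => (W v * PSk (arg z v))%C).
have HR : RI Phi L L' (d - be) (d + be) = 0%C.
{ apply Goursat; try lra. intros v [V1 V2]. apply (WPS_holo z v L); auto; [lra|].
  left. bound. }
have E1 : Low L' z = (Low L z + Hor Phi (d - be) L L')%C.
{ unfold Low. rewrite <- (CI_Chasles _ L0 L L'); auto.
  - f_equal. unfold Hor. apply CI_ext; auto. intros x Hx. unfold Phi.
    rewrite J_PSk; auto; [bound|].
    apply (small_arg_le z _ L); auto. simpl. lra.
  - intros x _. apply Low_cts, Hz. }
have E2 : High L' z = (High L z + Hor Phi (d + be) L L')%C.
{ unfold High. rewrite <- (CI_Chasles _ L0 L L'); auto.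
  - f_equal. unfold Hor. apply CI_ext; auto. intros x Hx. unfold Phi.
    rewrite J_PSk; auto; [bound|].
    apply (small_arg_le z _ L); auto. simpl. lra.
  - intros x _. apply High_cts, Hz. }
have E3 : forall l, L <= l -> Ver Phi l (d - be) (d + be) = (Ci * Out l z)%C.
{ intros l Hl. unfold Ver, Out. rewrite <- CI_scal; [bound|lra|].
  intros phi Hp. apply Out_cts; [|bound].
  eapply Rlt_le_trans; [exact Hz2|]. bound. }
unfold RI in HR. rewrite !E3 in HR by lra.
unfold contour_sum. rewrite E1, E2. f_equal.
have HCi := Ci_neq_0.
set (hb := Hor Phi (d - be) L L') in *. set (ht := Hor Phi (d + be) L L') in *.
replace (Out L z) with (Out L' z + / Ci * (hb - ht) -
  / Ci * (hb + Ci * Out L' z - ht - Ci * Out L z))%C by (field; exact HCi).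
rewrite HR. ring.
Qed.

Variables (Q K0 : R).
Hypothesis HQ : 0 <= Q.
Hypothesis HK0 : 0 < K0.
Hypothesis Hgb : forall z, sdomain d theta rho z -> Cmod (g z) <= Q * G M (Cmod z / K0).

Let P := A1 ^ n * M n.

Lemma W_bound v L : L0 <= Re v <= L -> Rabs (Im v - d) <= be \/ Re v <= L0 ->
  Cmod (W v) <= Q * G M (exp L / K0) * (2 / rho) ^ n.
Proof.
intros Hv Hv2. rewrite Cmod_W.
have HL0 : exp L0 = rho / 2 by (unfold L0; apply exp_ln; lra).
apply Rmult_le_compat.
- bound.
- bound.
- step (apply Hgb, g_arc_domain; tauto). rewrite Cmod_Cexp.
  bound.
- replace (2 / rho) with (/ (rho / 2)) by bound. rewrite pow_inv.
  apply Rinv_le_contravar; [bound|]. apply pow_incr. split; [lra|].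
  rewrite <- HL0. bound.
Qed.

Lemma P_pos : 1 <= P.
Proof. apply Hone. Qed.

Lemma Arc_point_bound z phi : small_sector z -> d + be <= phi <= d - be + 2 * PI ->
  Cmod (Jn (tau phi) (arg z (mkC L0 phi))) <= C2 * P.
Proof.
intros Hz Hphi. apply sector_log in Hz. destruct Hz as [y [-> Hy]].
rewrite (arg_log y (mkC L0 phi) 1). simpl INR. rewrite Rmult_1_l.
have Ad := tau_admissible phi y Hphi ltac:(lra).
apply HJ1; [apply tau_bound|simpl; lra].
Qed.

Lemma Low_point_bound z x : small_sector z -> Cmod (Jn t0 (arg z (mkC x (d - be)))) <= C2 * P.
Proof.
destruct contour_angles as [_ [_ [H _]]].
intros Hz. apply sector_log in Hz. destruct Hz as [y [-> Hy]].
rewrite (arg_log y (mkC x (d - be)) 0). simpl INR. rewrite Rmult_0_l, Rplus_0_r.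
have Ad := low_admissible y ltac:(lra).
apply HJ1; [bound|simpl; lra].
Qed.

Lemma High_point_bound z x : small_sector z -> Cmod (Jn (- t0) (arg z (mkC x (d + be)))) <= C2 * P.
Proof.
destruct contour_angles as [_ [_ [H _]]].
intros Hz. apply sector_log in Hz. destruct Hz as [y [-> Hy]].
rewrite (arg_log y (mkC x (d + be)) 1). simpl INR. rewrite Rmult_1_l.
have Ad := high_admissible y ltac:(lra).
apply HJ1; [bound|simpl; lra].
Qed.

Lemma contour_sum_holo L : L0 <= L ->
  holo (fun z => small_sector z /\ Cmod z < c1 * exp L) (contour_sum L).
Proof.
intros HL. destruct contour_angles as [HP [_ [H [_ [H1 H2]]]]].
have HbeP : 0 < be by (unfold be; lra).
set (D := fun z => small_sector z /\ Cmod z < c1 * exp L).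
have HD : forall z, D z -> exists e, 0 < e /\ forall y, Cmod (y - z) < e -> D y.
{ intros z [Hz1 Hz2]. destruct (Copen_sector _ _ z Hz1) as [e [He He']].
  destruct (Copen_ball0 _ z Hz2) as [e2 [He2 He2']].
  exists (Rmin e e2). split; [bound|]. intros y Hy. split.
  - apply He'. eapply Rlt_le_trans; [exact Hy|apply Rmin_l].
  - apply He2'. eapply Rlt_le_trans; [exact Hy|apply Rmin_r]. }
set (BW := Q * G M (exp L / K0) * (2 / rho) ^ n).
have HL2 : forall z, D z -> Cmod z < 2 * c1 * exp L.
{ intros z [_ Hz].
  assert (0 < c1 * exp L) by bound. lra. }
have HA : holo D Arc.
{ apply holo_CI.
  - lra.
  - intros phi Hphi. apply holo_mult; [apply holo_const|].
    intros z [Hz _]. apply sector_log in Hz. destruct Hz as [y [-> Hy]].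
    destruct (HJ3 n (tau phi) (mkC (Re y - L0) (Im y - phi + INR 1 * (2 * PI)))) as [l Hl].
    + apply tau_bound.
    + simpl. rewrite Rmult_1_l. apply tau_admissible; [bound|lra].
    + eexists. apply (Cder_comp (Jn (tau phi)) (fun z => arg z (mkC L0 phi))); [apply Cder_arg_z|].
      rewrite (arg_log y (mkC L0 phi) 1). exact Hl.
  - intros z [Hz _] phi Hphi. apply Arc_cts; auto.
  - intros z Hz. destruct (HD z Hz) as [e [He He']]. exists e, (BW * (C2 * P)).
    split; [bound|]. intros y Hy. split; [auto|]. intros phi Hphi.
    rewrite Cmod_mult. apply Rmult_le_compat; try apply Cmod_ge_0.
    + apply W_bound; [simpl; lra|right; simpl; lra].
    + apply Arc_point_bound; [apply (He' y Hy)|bound]. }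
have HLo : holo D (Low L).
{ apply holo_CI; auto.
  - intros x Hx. apply holo_mult; [apply holo_const|].
    intros z [Hz _]. destruct (Low_point z x Hz) as [l Hl].
    eexists. apply (Cder_comp (Jn t0) (fun z => arg z (mkC x (d - be)))); [apply Cder_arg_z|exact Hl].
  - intros z [Hz _] x _. apply Low_cts, Hz.
  - intros z Hz. destruct (HD z Hz) as [e [He He']]. exists e, (BW * (C2 * P)).
    split; [bound|]. intros y Hy. split; [auto|]. intros x Hx.
    rewrite Cmod_mult. apply Rmult_le_compat; try apply Cmod_ge_0.
    + apply W_bound; [bound|left; apply abs_be; simpl; lra].
    + apply Low_point_bound, (He' y Hy). }
have HHi : holo D (High L).
{ apply holo_CI; auto.
  - intros x Hx. apply holo_mult; [apply holo_const|].
    intros z [Hz _]. destruct (High_point z x Hz) as [l Hl].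
    eexists. apply (Cder_comp (Jn (- t0)) (fun z => arg z (mkC x (d + be)))); [apply Cder_arg_z|exact Hl].
  - intros z [Hz _] x _. apply High_cts, Hz.
  - intros z Hz. destruct (HD z Hz) as [e [He He']]. exists e, (BW * (C2 * P)).
    split; [bound|]. intros y Hy. split; [auto|]. intros x Hx.
    rewrite Cmod_mult. apply Rmult_le_compat; try apply Cmod_ge_0.
    + apply W_bound; [bound|left; apply abs_be; simpl; lra].
    + apply High_point_bound, (He' y Hy). }
have HO : holo D (Out L).
{ apply holo_CI.
  - lra.
  - intros phi Hphi. apply holo_mult; [apply holo_const|].
    intros z Hz. destruct (PSk_holo (arg z (mkC L phi))) as [l Hl].
    { apply (small_arg z _ L); [bound|simpl; lra]. }
    eexists. apply (Cder_comp PSk (fun z => arg z (mkC L phi))); [apply Cder_arg_z|exact Hl].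
  - intros z Hz phi Hphi. apply Out_cts; [bound|bound].
  - intros z Hz. destruct (HD z Hz) as [e [He He']]. exists e, (BW * (2 * C1 * P)).
    split; [bound|]. intros y Hy. split; [auto|]. intros phi Hphi.
    rewrite Cmod_mult. apply Rmult_le_compat; try apply Cmod_ge_0.
    + apply W_bound; [simpl; lra|left; apply abs_be; simpl; lra].
    + apply PSk_bound. apply (small_arg_le y _ L); [left; apply (He' y Hy)|simpl; lra]. }
unfold contour_sum. apply holo_scal, holo_plus; [apply holo_plus; auto|].
apply holo_scal, holo_plus; [auto|]. apply holo_scal; auto.
Qed.

(** With [exp L] of the order of the modulus of [z], this is growth of the same kind
    as that of [g]. *)
Lemma contour_sum_bound L z : L0 <= L -> small_sector z -> Cmod z <= c1 * exp L ->
  Cmod (contour_sum L z) <= Q * G M (exp L / K0) * (2 / rho) ^ n * (P * (2 * C1 + C2 * (1 + (L - L0)))).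
Proof.
intros HL Hz Hzm. destruct contour_angles as [HP [_ [H [_ [H1 H2]]]]].
have HbeP : 0 < be by (unfold be; lra).
have HPp := P_pos.
set (BW := Q * G M (exp L / K0) * (2 / rho) ^ n).
have HBW : 0 <= BW.
{ unfold BW. bound. }
have HA : Cmod (Arc z) <= BW * (C2 * P) * (2 * PI).
{ step (apply (CI_bound_const _ (BW * (C2 * P))); try lra).
  - intros phi Hphi. apply Arc_cts; auto.
  - intros phi Hphi. rewrite Cmod_mult. apply Rmult_le_compat; try apply Cmod_ge_0.
    + apply W_bound; [simpl; lra|right; simpl; lra].
    + apply Arc_point_bound; auto.
  - bound. }
have HO : Cmod (Out L z) <= BW * (2 * C1 * P) * (2 * PI).
{ step (apply (CI_bound_const _ (BW * (2 * C1 * P))); try lra).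
  - intros phi Hphi. apply Out_cts; [|bound].
    assert (0 < c1 * exp L) by bound. lra.
  - intros phi Hphi. rewrite Cmod_mult. apply Rmult_le_compat; try apply Cmod_ge_0.
    + apply W_bound; [simpl; lra|left; apply abs_be; simpl; lra].
    + apply PSk_bound. apply (small_arg_le z _ L); [bound|simpl; lra].
  - bound. }
have HLo : Cmod (Low L z) <= BW * (C2 * P) * (L - L0).
{ apply CI_bound_const; auto.
  - intros x _. apply Low_cts, Hz.
  - intros x Hx. rewrite Cmod_mult. apply Rmult_le_compat; try apply Cmod_ge_0.
    + apply W_bound; [bound|left; apply abs_be; simpl; lra].
    + apply Low_point_bound, Hz. }
have HHi : Cmod (High L z) <= BW * (C2 * P) * (L - L0).
{ apply CI_bound_const; auto.
  - intros x _. apply High_cts, Hz.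
  - intros x Hx. rewrite Cmod_mult. apply Rmult_le_compat; try apply Cmod_ge_0.
    + apply W_bound; [bound|left; apply abs_be; simpl; lra].
    + apply High_point_bound, Hz. }
unfold contour_sum. rewrite Cmod_mult, Cmod_inv, Cmod_R, Rabs_pos_eq by (try apply RtoC_2PI_neq_0; lra).
have T1 := Cmod_triangle (Arc z + Out L z) (/ Ci * (Low L z + - (1) * High L z)).
have T2 := Cmod_triangle (Arc z) (Out L z).
rewrite Cmod_mult, Cmod_inv, Cmod_Ci, Rinv_1, Rmult_1_l in T1 by apply Ci_neq_0.
have T3 := Cmod_triangle (Low L z) (- (1) * High L z).
rewrite Cmod_mult, Cmod_m1, Rmult_1_l in T3.
set (X := BW * P). have HX : 0 <= X by (apply Rmult_le_pos; lra).
replace (BW * (C2 * P) * (2 * PI)) with (X * C2 * (2 * PI)) in HA by (unfold X; ring).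
replace (BW * (2 * C1 * P) * (2 * PI)) with (X * (2 * C1) * (2 * PI)) in HO by (unfold X; ring).
replace (BW * (C2 * P) * (L - L0)) with (X * C2 * (L - L0)) in HLo, HHi by (unfold X; ring).
replace (BW * (P * (2 * C1 + C2 * (1 + (L - L0))))) with (X * (2 * C1 + C2 * (1 + (L - L0))))
  by (unfold X; ring).
apply Rmult_le_reg_l with (2 * PI); [lra|]. rewrite <- Rmult_assoc, Rinv_r, Rmult_1_l by lra.
have HP1 : 1 <= PI by (have Q1 := PI2_1; lra).
have HX3 : X * C2 * (L - L0) * 1 <= X * C2 * (L - L0) * PI by bound.
lra.
Qed.

(** For small [z] the contour is a full circle, and its integral is the Taylor
    series obtained by termwise integration. *)
Lemma contour_sum_small gc z : (forall z, Cmod z < rho -> ps gc z (g z)) ->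
  small_sector z -> Cmod z <= c1 * exp L0 ->
  ps (fun l => kappa m b n l * gc (l + n)%nat)%C z (contour_sum L0 z).
Proof.
intros Hgc Hz Hzm. destruct contour_angles as [HP [_ [H [_ [H1 H2]]]]].
have HbeP : 0 < be by (unfold be; lra).
have HPp := P_pos.
have HL0 : exp L0 = rho / 2 by (unfold L0; apply exp_ln; lra).
have Hz2 : Cmod z < 2 * c1 * exp L0.
{ assert (0 < c1 * exp L0) by bound. lra. }
have Hgh : holo (ball0 rho) g.
{ apply (holo_sub (sdomain d theta rho)); [|bound]. intros y Hy. right. exact Hy. }
set (F := fun phi => (W (mkC L0 phi) * PSk (arg z (mkC L0 phi)))%C).
have HFc : forall phi, cts F phi.
{ intros phi. destruct (WPS_holo z (mkC L0 phi) L0 Hz2) as [l Hl].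
  - simpl; lra.
  - right; simpl; lra.
  - apply (cts_ver (fun v => W v * PSk (arg z v))%C). exact (Cder_Ccts _ _ _ Hl). }
have E : contour_sum L0 z = (/ RtoC (2 * PI) * CI F 0 (2 * PI))%C.
{ unfold contour_sum, Low, High. rewrite !CI_point.
  replace (Arc z) with (CI F (d + be) (d - be + 2 * PI)).
  - unfold Out. fold F.
    replace (CI F (d + be) (d - be + 2 * PI) + CI F (d - be) (d + be))%C with (CI F (d - be) (d - be + 2 * PI)).
    + rewrite (CI_periodic F (2 * PI) (d - be)); auto; [ring|lra|].
      intros phi. unfold F, W, arg. fold (circ L0 (phi + 2 * PI)). fold (circ L0 phi).
      rewrite circ_period. reflexivity.
    + rewrite <- (CI_Chasles F (d - be) (d + be)); [ring|lra|lra|]. intros t _; apply HFc.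
  - unfold Arc. apply CI_ext; [lra|]. intros phi _. unfold F. f_equal. symmetry. apply J_PSk.
    + apply tau_bound.
    + apply (small_arg_le z _ L0); [bound|simpl; lra]. }
rewrite E.
have Hcoef : forall j, coef g L0 j = gc j.
{ apply (ps_inj _ _ (rho / 2) g); [lra| |].
  - intros y Hy. apply (Taylor_coef g rho); auto; lra.
  - intros y Hy. apply Hgc. lra. }
set (u := circ L0).
have Hterm : forall l, icts (fun phi => kappa m b n l * z ^ l * (g (u phi) * / u phi ^ (l + n)))%C 0 (2 * PI).
{ intros l t _. apply cts_scal. apply (cts_coef_integrand g rho); auto. lra. }
have Hsum : forall N, CI (fun phi => Csum (fun l => kappa m b n l * z ^ l * (g (u phi) * / u phi ^ (l + n)))%C N)
  0 (2 * PI) = (RtoC (2 * PI) * Csum (fun l => kappa m b n l * gc (l + n)%nat * z ^ l)%C N)%C.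
{ intros N. destruct (CI_Csum (fun l phi => kappa m b n l * z ^ l * (g (u phi) * / u phi ^ (l + n)))%C 0 (2 * PI) N) as [A _].
  - lra.
  - bound.
  - rewrite A, <- Csum_scal. apply Csum_ext. intros l _.
    rewrite CI_scal; [|lra|intros t _; apply (cts_coef_integrand g rho); auto; lra].
    rewrite <- Hcoef. unfold coef, u. field. apply RtoC_2PI_neq_0. }
set (B := Q * G M (exp L0 / K0) * (2 / rho) ^ n * (2 * C1 * P)).
apply (Clim_0_of_bound _ _ (fun N => B * (/ 2) ^ N)); [apply geom_lim; lra|].
intros N.
replace (Csum (fun j => kappa m b n j * gc (j + n)%nat * z ^ j)%C N) with
  (/ RtoC (2 * PI) * CI (fun phi => Csum (fun l => kappa m b n l * z ^ l * (g (u phi) * / u phi ^ (l + n)))%C N)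
  0 (2 * PI))%C by (rewrite Hsum; field; apply RtoC_2PI_neq_0).
rewrite <- Cmult_minus_distr_l || idtac.
replace (/ RtoC (2 * PI) * CI (fun phi => Csum (fun l => kappa m b n l * z ^ l * (g (u phi) * / u phi ^ (l + n)))%C N)
  0 (2 * PI) - / RtoC (2 * PI) * CI F 0 (2 * PI))%C with
  (/ RtoC (2 * PI) * (CI (fun phi => Csum (fun l => kappa m b n l * z ^ l * (g (u phi) * / u phi ^ (l + n)))%C N)
  0 (2 * PI) - CI F 0 (2 * PI)))%C by ring.
rewrite <- CI_minus; [|lra| |intros t _; apply HFc].
2:{ apply CI_Csum; [lra|bound]. }
rewrite Cmod_mult, Cmod_inv, Cmod_R, Rabs_pos_eq by (try apply RtoC_2PI_neq_0; lra).
apply Rmult_le_reg_l with (2 * PI); [lra|]. rewrite <- Rmult_assoc, Rinv_r, Rmult_1_l by lra.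
replace (2 * PI * (B * (/ 2) ^ N)) with (B * (/ 2) ^ N * (2 * PI - 0)) by ring.
apply CI_bound_const; [lra| |].
- intros t Ht. apply cts_minus; [|bound]. revert t Ht. apply CI_Csum; [lra|bound].
- intros phi _. set (v := mkC L0 phi).
  have Hu : u phi = Cexp v by bound.
  have Hun : u phi <> 0%C by apply circ_neq_0.
  rewrite (Csum_ext _ (fun l => W v * (kappa m b n l * arg z v ^ l))%C).
  2:{ intros l _. unfold W, arg. rewrite <- Hu, Cpow_mult, <- Cinv_pow, Cpow_add by bound.
      field. split; apply Cpow_neq_0, Hun. }
  rewrite Csum_scal. unfold F. fold v.
  replace (W v * Csum (fun k => kappa m b n k * arg z v ^ k) N - W v * PSk (arg z v))%C
    with (W v * (Csum (fun k => kappa m b n k * arg z v ^ k) N - PSk (arg z v)))%C by ring.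
  rewrite Cmod_mult.
  have Ha : Cmod (arg z v) <= c1 by (apply (small_arg_le z v L0); [bound|simpl; lra]).
  have HC1P : 0 <= C1 * P by bound.
  destruct (bounds_ps (kappa m b n) (C1 * P) (2 * c1) (arg z v)) as [l [Hl Hlb]]; try lra.
  { bound. }
  unfold PSk. rewrite (PSum_spec _ _ _ Hl). specialize (Hlb N).
  set (q := Cmod (arg z v) / (2 * c1)) in *.
  have Hq : 0 <= q <= / 2.
  { unfold q. bound. }
  unfold B. rewrite Rmult_assoc. apply Rmult_le_compat; try apply Cmod_ge_0.
  + apply W_bound; [simpl; lra|right; simpl; lra].
  + step exact Hlb. apply Rmult_le_compat.
    * bound.
    * bound.
    * replace (2 * C1 * P) with (C1 * P * / / 2) by field. unfold Rdiv.
      bound.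
    * bound.
Qed.

End Contour.

Lemma G_split M (HM : strongly_regular M) s t : 0 <= s -> 0 <= t -> G M ((s + t) / 2) <= G M s * G M t.
Proof.
intros Hs Ht.
destruct (Rle_dec s t) as [H|H].
- through (1 * G M t); [|bound].
  rewrite Rmult_1_l. bound.
- through (G M s * 1); [|bound].
  rewrite Rmult_1_r. bound.
Qed.

Lemma sdomain_mono d theta theta' rho rho' z : theta <= theta' -> rho <= rho' ->
  sdomain d theta rho z -> sdomain d theta' rho' z.
Proof.
intros Ht Hr [H|H].
- left. apply sector_log in H. apply sector_log. destruct H as [y [E Hy]].
  exists y. bound.
- right. lra.
Qed.

(** The contour sums for all large [L] agree, so together they define [h] on a
    smaller sector; near the origin [h] is its Taylor series. With kernels of two
    different moment sequences this is a Laplace transform, a division by [z ^ n]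
    and a Borel transform. *)
Lemma multiplier_operator M th ee m b Et d theta rho K0 :
  strongly_regular M -> kernel_data M th ee m -> entire_data M th b Et ->
  0 < theta -> 0 < rho -> 0 < K0 ->
  exists theta' rho' K' C0 A, 0 < theta' <= theta /\ 0 < rho' /\ 0 < K' /\ 0 < C0 /\ 0 < A /\
  forall g gc Q, 0 <= Q -> holo (sdomain d theta rho) g ->
    (forall z, sdomain d theta rho z -> Cmod (g z) <= Q * G M (Cmod z / K0)) ->
    (forall z, Cmod z < rho -> ps gc z (g z)) ->
    forall n, exists h, holo (sdomain d theta' rho') h /\
      (forall z, sdomain d theta' rho' z ->
         Cmod (h z) <= C0 * (A ^ n * M n) * Q * G M (Cmod z / K')) /\
      (forall z, Cmod z < rho' -> ps (fun l => kappa m b n l * gc (l + n)%nat)%C z (h z)).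
Proof.
intros HM HK HE Hth Hrho HK0.
have Hkt := kd_th _ _ _ _ HK.
set (th1 := Rmin theta (Rmin th (PI - th))).
have Hth1 : 0 < th1 by (repeat apply Rmin_pos; lra).
have T1 : th1 <= theta by apply Rmin_l.
have T2 : th1 <= th by (eapply Rle_trans; [apply Rmin_r|apply Rmin_l]).
have T3 : th1 <= PI - th by (eapply Rle_trans; [apply Rmin_r|apply Rmin_r]).
have Ht0 : 0 < th - th1 / 16 < th by lra.
destruct (J_small M th ee m b Et HM HK HE (th - th1 / 16) Ht0)
  as [c1 [C1 [A1 [a [Hc1 [HC1 [HA1 [Ha [Hone [Hkap [Hsm Hdec]]]]]]]]]]].
destruct (J_sector M th ee m b Et HK HE (th - th1 / 16) C1 A1 a (th1 / 16) Ht0 Ha ltac:(lra) HC1 Hone Hdec)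
  as [C2 [HC2 HJ]].
have HJ1 := fun n => proj1 (HJ n). have HJ2 := fun n => proj1 (proj2 (HJ n)).
have HJ3 := fun n => proj2 (proj2 (HJ n)).
destruct (mg_const M HM) as [A [HA Hmg]].
set (X := Rmax (2 / (c1 * K0)) 1).
have HX1 : 1 <= X by apply Rmax_r. have HX2 : 2 / (c1 * K0) <= X by apply Rmax_l.
set (CL := 2 + 2 * M 1%nat / (c1 * rho)).
have HCL : 0 < CL.
{ unfold CL. bound. }
have HGr := G_pos M (rho / K0).
set (C0 := G M (rho / K0) * (2 * C1 + C2 * CL)).
have H2C : 0 < 2 * C1 + C2 * CL by bound.
have HC0 : 0 < C0 by (apply Rmult_lt_0_compat; auto).
exists (th1 / 2), (c1 * rho / 2), (/ (A * X)), C0, (A1 * (2 / rho)).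
have H2r : 0 < 2 / rho by bound.
have Hc1r : 0 < c1 * rho by bound.
split; [lra|]. split; [lra|]. split; [bound|].
split; [bound|]. split; [bound|].
intros g gc Q HQ Hg Hgb Hgc n.
have Hg1 : holo (sdomain d th1 rho) g.
{ apply (holo_sub (sdomain d theta rho)); auto. intros z. apply sdomain_mono; lra. }
have Hgb1 : forall z, sdomain d th1 rho z -> Cmod (g z) <= Q * G M (Cmod z / K0).
{ intros z Hz. apply Hgb. eapply sdomain_mono; [| |exact Hz]; lra. }
have Hthc : 0 < th1 /\ th1 <= th /\ th1 <= PI - th by auto.
set (L0 := ln (rho / 2)).
have HL0 : exp L0 = rho / 2 by (unfold L0; apply exp_ln; lra).
set (cs := contour_sum th ee m b Et d th1 rho g n).
set (ck := fun l => (kappa m b n l * gc (l + n)%nat)%C).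
set (P := A1 ^ n * M n). have HP : 1 <= P by apply Hone.
set (P2 := (2 / rho) ^ n). have HP2 : 0 < P2 by (apply pow_lt, H2r).
have Indep : forall z L L', sector d (th1 / 2) z -> L0 <= L -> L <= L' -> Cmod z <= c1 * exp L ->
  cs L z = cs L' z.
{ intros z L L' Hz HL HL' Hzm. apply (contour_sum_indep M th ee m b Et HK d th1 rho Hthc Hrho c1 C1 A1 Hc1 HC1 Hone Hkap Hsm HJ3); auto. }
have Small : forall z, sector d (th1 / 2) z -> Cmod z <= c1 * exp L0 -> ps ck z (cs L0 z).
{ intros z Hz Hzm. apply (contour_sum_small M th ee m b Et HM HK d th1 rho Hthc Hrho c1 C1 A1 Hc1 HC1 Hone Hkap Hsm) with (Q := Q) (K0 := K0);
  auto. }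
have Hgcb : forall j, Cmod (gc j) <= Q * G M (rho / K0) / (rho / 2) ^ j.
{ have Hgh : holo (ball0 rho) g.
  { apply (holo_sub (sdomain d theta rho)); [|bound]. intros y Hy. right. exact Hy. }
  destruct (Taylor_unique g rho rho gc Hrho Hrho Hgh Hgc) as [_ T].
  intros j. apply T; [lra|]. intros z Hz. step (apply Hgb; right; lra).
  bound. }
set (Kc := C1 * P * (Q * G M (rho / K0)) * P2).
have HKc : 0 <= Kc.
{ unfold Kc. bound. }
have Hckb : forall l, Cmod (ck l) <= Kc / (c1 * rho) ^ l.
{ intros l. unfold ck. rewrite Cmod_mult.
  through (C1 * P / (2 * c1) ^ l * (Q * G M (rho / K0) / (rho / 2) ^ (l + n))).
  - bound.
  - right. unfold Kc, P2. rewrite pow_add. unfold Rdiv.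
    rewrite !Rpow_mult_distr, !pow_inv. bound. }
set (h := fun z => if excluded_middle_informative (sector d (th1 / 2) z)
  then cs (ln (rho / 2 + Cmod z / c1)) z else PSum ck z).
have HRL : forall z, L0 <= ln (rho / 2 + Cmod z / c1).
{ intros z. apply ln_le; [lra|]. assert (0 <= Cmod z / c1); [|lra].
  bound. }
have HRz : forall z, Cmod z <= c1 * exp (ln (rho / 2 + Cmod z / c1)).
{ intros z. rewrite exp_ln by bound. rewrite Rmult_plus_distr_l.
  replace (c1 * (Cmod z / c1)) with (Cmod z) by bound.
  bound. }
have Hh1 : forall z L, sector d (th1 / 2) z -> L0 <= L -> Cmod z <= c1 * exp L -> h z = cs L z.
{ intros z L Hz HL Hzm. unfold h. destruct excluded_middle_informative as [_|N]; [|contradiction].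
  destruct (Rle_dec (ln (rho / 2 + Cmod z / c1)) L).
  - bound.
  - symmetry. apply Indep; auto. lra. }
have Hh2 : forall z, Cmod z < c1 * rho / 2 -> h z = PSum ck z.
{ intros z Hz. destruct (excluded_middle_informative (sector d (th1 / 2) z)) as [S|N].
  - have Hzm : Cmod z <= c1 * exp L0 by (rewrite HL0; lra).
    rewrite (Hh1 z L0 S (Rle_refl _) Hzm). symmetry. apply PSum_spec, Small; auto.
  - unfold h. destruct excluded_middle_informative; [contradiction|bound]. }
have Hps : forall z, Cmod z < c1 * rho / 2 -> ps ck z (h z).
{ intros z Hz. rewrite Hh2 by bound. apply (PSum_ps ck Kc (c1 * rho)); auto. lra. }
exists h. split; [|split; [|bound]].
- intros z [Hz|Hz].
  + set (L := ln (rho / 2 + (Cmod z + 1) / c1)).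
    have Hz1 : 0 < (Cmod z + 1) / c1 by bound.
    have HL : L0 <= L by (apply ln_le; lra).
    have HLe : c1 * exp L = c1 * rho / 2 + (Cmod z + 1).
    { unfold L. rewrite exp_ln by lra. field. lra. }
    have Hho : holo (fun z => sector d (th1 / 2) z /\ Cmod z < c1 * exp L) (cs L).
    { apply (contour_sum_holo M th ee m b Et HM HK d th1 rho Hthc Hrho c1 C1 A1 C2 Hc1 HC1 Hone Hkap HJ1 HJ2 HJ3)
        with (Q := Q) (K0 := K0); auto. }
    destruct (Hho z) as [l Hl]; [bound|].
    exists l. apply Cder_ext_loc with (cs L); [|bound].
    destruct (Copen_sector _ _ z Hz) as [e [He He']].
    exists (Rmin e 1). split; [bound|]. intros y Hy. symmetry. apply Hh1.
    * apply He'. eapply Rlt_le_trans; [exact Hy|apply Rmin_l].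
    * bound.
    * have Q1 := Cmod_triangle_inv y z. have Q2 := Rmin_r e 1. lra.
  + have Hho := PSum_holo ck Kc (c1 * rho) Hc1r HKc Hckb.
    destruct (Hho z) as [l Hl]; [unfold ball0; lra|].
    exists l. apply Cder_ext_loc with (PSum ck); [|bound].
    destruct (Copen_ball0 _ z Hz) as [e [He He']]. exists e. split; [bound|].
    intros y Hy. symmetry. apply Hh2. apply He', Hy.
- intros z Hz.
  replace (C0 * ((A1 * (2 / rho)) ^ n * M n) * Q * G M (Cmod z / / (A * X))) with
    (C0 * P * P2 * Q * G M (Cmod z / / (A * X))) by (unfold P, P2; rewrite Rpow_mult_distr; ring).
  destruct Hz as [Hz|Hz].
  + have B := contour_sum_bound M th ee m b Et HM HK d th1 rho Hthc Hrho c1 C1 A1 C2 Hc1 HC1 HC2 Hone Hkap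
      HJ1 HJ2 HJ3 g n Hg1 Q K0 HQ HK0 Hgb1 (ln (rho / 2 + Cmod z / c1)) z (HRL z) Hz (HRz z).
    fold cs in B. rewrite <- (Hh1 z _ Hz (HRL z) (HRz z)) in B. fold P P2 L0 in B.
    rewrite exp_ln in B by bound.
    have Hz0 := Cmod_ge_0 z.
    set (t := 2 * Cmod z / (c1 * K0)).
    have Ht : 0 <= t.
    { apply Rmult_le_pos; [lra|bound]. }
    have B1 : G M ((rho / 2 + Cmod z / c1) / K0) <= G M (rho / K0) * G M t.
    { replace ((rho / 2 + Cmod z / c1) / K0) with ((rho / K0 + t) / 2) by (unfold t; field; lra).
      apply (G_split M HM); auto. bound. }
    have HGz1 := G_ge1 M HM (Cmod z) Hz0.
    have B2 : 1 + (ln (rho / 2 + Cmod z / c1) - L0) <= CL * G M (Cmod z).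
    { unfold L0. rewrite <- ln_div by bound.
      have Hln : ln ((rho / 2 + Cmod z / c1) / (rho / 2)) <= (rho / 2 + Cmod z / c1) / (rho / 2).
      { have Hp : 0 < (rho / 2 + Cmod z / c1) / (rho / 2) by bound.
        rewrite <- (ln_exp ((rho / 2 + Cmod z / c1) / (rho / 2))) at 2. apply ln_le; auto.
        left. eapply Rlt_trans; [|apply exp_ineq1; lra]. lra. }
      replace ((rho / 2 + Cmod z / c1) / (rho / 2)) with (1 + 2 / (c1 * rho) * Cmod z) in Hln at 2
        by bound.
      have Hg1' := G_ge M HM (Cmod z) 1 Hz0. rewrite pow_1 in Hg1'.
      have B3 : 2 / (c1 * rho) * Cmod z <= 2 / (c1 * rho) * (M 1%nat * G M (Cmod z))
        by bound.
      unfold CL. bound. }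
    have B4 : G M t * G M (Cmod z) <= G M (Cmod z / / (A * X)).
    { replace (Cmod z / / (A * X)) with (A * (X * Cmod z)) by bound.
      have HXz : 0 <= X * Cmod z by bound.
      eapply Rle_trans; [|apply (G_square M HM A HA Hmg); exact HXz].
      apply Rmult_le_compat; try (left; apply G_pos); apply (G_mono M HM); auto.
      - unfold t. replace (2 * Cmod z / (c1 * K0)) with (2 / (c1 * K0) * Cmod z) by bound.
        bound.
      - rewrite <- (Rmult_1_l (Cmod z)) at 1. bound. }
    have HCLG : 0 <= 1 + (ln (rho / 2 + Cmod z / c1) - L0) by (have Q1 := HRL z; lra).
    step exact B.
    through (Q * (G M (rho / K0) * G M t) * P2 * (P * ((2 * C1 + C2 * CL) * G M (Cmod z)))).
    * apply Rmult_le_compat.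
      { bound. }
      { bound. }
      { bound. }
      { apply Rmult_le_compat_l; [lra|]. rewrite Rmult_plus_distr_r. apply Rplus_le_compat.
        - rewrite <- (Rmult_1_r (2 * C1)) at 1. bound.
        - rewrite Rmult_assoc. bound. }
    * replace (Q * (G M (rho / K0) * G M t) * P2 * (P * ((2 * C1 + C2 * CL) * G M (Cmod z)))) with
        (C0 * P * P2 * Q * (G M t * G M (Cmod z))) by (unfold C0; ring).
      bound.
  + rewrite Hh2 by bound.
    step (apply (PSum_bound ck Kc (c1 * rho)); auto; lra).
    have Hq : Cmod z / (c1 * rho) <= / 2 by bound.
    through (Kc * 2).
    { unfold Rdiv at 1. apply Rmult_le_compat_l; auto. replace 2 with (/ / 2) by field.
      bound. }
    unfold Kc, C0.
    through (G M (rho / K0) * (2 * C1) * P * P2 * Q * 1); [bound|].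
    have Hx : 0 <= P * P2 * Q by bound.
    replace (G M (rho / K0) * (2 * C1) * P * P2 * Q * 1) with
      (G M (rho / K0) * (2 * C1) * 1 * (P * P2 * Q)) by ring.
    replace (G M (rho / K0) * (2 * C1 + C2 * CL) * P * P2 * Q * G M (Cmod z / / (A * X))) with
      (G M (rho / K0) * (2 * C1 + C2 * CL) * G M (Cmod z / / (A * X)) * (P * P2 * Q)) by ring.
    apply Rmult_le_compat_r; auto.
    assert (0 < C2 * CL) by bound.
    bound.
Qed.

(** * Strong kernels *)

Lemma CI_log_change (f : R -> C) n : (forall v, cts (fun v => RtoC (exp v) * f (exp v))%C v) ->
  (forall t, 0 < t -> cts f t) ->
  CI (fun v => RtoC (exp v) * f (exp v))%C (- INR n) (INR n) = CI f (exp (- INR n)) (exp (INR n)).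
Proof.
intros _ Hf. unfold CI. f_equal.
- rewrite <- (RInt_comp (V := R_CNM) (fun t => Re (f t)) exp exp).
  + apply RInt_ext. intros v _. unfold scal; simpl; unfold mult; simpl. unfold Re; simpl. ring.
  + intros v _. apply cts_Re, Hf, exp_pos.
  + intros v _. split; [apply is_derive_exp|apply continuous_exp].
- rewrite <- (RInt_comp (V := R_CNM) (fun t => Im (f t)) exp exp).
  + apply RInt_ext. intros v _. unfold scal; simpl; unfold mult; simpl. unfold Im; simpl. ring.
  + intros v _. apply cts_Im, Hf, exp_pos.
  + intros v _. split; [apply is_derive_exp|apply continuous_exp].
Qed.

Lemma strong_kernel_data N e E me : strongly_regular N -> admits_nonzero_proximate_order N ->
  omega N < 2 -> strong_kernel N e E me ->
  kernel_data N (omega N * PI / 2) (fun v => e (Cexp v)) (fun n => me (RtoC (INR n))).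
Proof.
intros HN Hpo Hom HK. have H0 := omega_pos N Hpo. have HP := PI_RGT_0.
have Hth : 0 < omega N * PI / 2 < PI by (split; nra).
have Hs : forall v, Rabs (Im v) < omega N * PI / 2 -> sector 0 (omega N * PI) (Cexp v).
{ intros v Hv. apply sector_log. exists v. split; auto. rewrite Rminus_0_r. exact Hv. }
have He : holo (sector 0 (omega N * PI)) e.
{ apply holomorphic_on_holo. apply (ke_holo _ _ _ _ HK). }
constructor.
- bound.
- intros v Hv. destruct (He (Cexp v) (Hs v Hv)) as [l Hl].
  eexists. apply (Cder_comp e Cexp); [apply Cder_Cexp|exact Hl].
- intros t0 Ht0.
  destruct (ke_zero _ _ _ _ HK) as [al [Hal Hz]].
  set (w := t0 + omega N * PI / 2).
  destruct (Hz 0 w 2) as [c2 [Hc2 Hz2]].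
  { unfold w; lra. } { lra. } { rewrite Rabs_R0. unfold w. lra. }
  destruct (ke_infty _ _ _ _ HK (omega N * PI / 2 - t0)) as [c3 [k [Hc3 [Hk Hi]]]]; [lra|].
  exists (c2 + c3), al, k. repeat (split; [lra|]).
  intros t tau Htau. have Hm : Cmod (Cexp (mkC t tau)) = exp t by apply Cmod_Cexp. split.
  + intros Ht. have Q : Cmod (e (Cexp (mkC t tau))) <= c2 * Rpower (Cmod (Cexp (mkC t tau))) al.
    { apply Hz2.
      - apply sector_log. exists (mkC t tau). split; auto. simpl. rewrite Rminus_0_r. unfold w. lra.
      - unfold Defs.disc. rewrite Hm. assert (exp t <= exp 0) by bound.
        rewrite exp_0 in H. lra. }
    rewrite Hm in Q. unfold Rpower in Q. rewrite ln_exp in Q.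
    step exact Q. bound.
  + have Q : Cmod (e (Cexp (mkC t tau))) <= c3 * exp (- Mfun N (Cmod (Cexp (mkC t tau)) / k)).
    { apply Hi. apply sector_log. exists (mkC t tau). split; auto. simpl. rewrite Rminus_0_r. lra. }
    rewrite Hm, exp_Ropp in Q. fold (G N (exp t / k)) in Q. unfold Rdiv.
    step exact Q. bound.
- intros n. apply Iinf_unique.
  have Hg := km_moment _ _ _ _ HK (RtoC (INR n)) ltac:(simpl; apply pos_INR).
  set (f := fun t : R => Cmult (cpow t (Cminus (RtoC (INR n)) (RtoC 1))) (e (RtoC t))) in Hg.
  have Hfe : forall v, (RtoC (exp v) * f (exp v))%C = (Cexp (INR n * mkC v 0) * e (Cexp (mkC v 0)))%C.
  { intros v. unfold f. rewrite Cmult_assoc. f_equal.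
    - unfold cpow, Rpower, Cexp. rewrite ln_exp. apply C_ext; simpl.
      + replace (0 + - 0) with 0 by ring. rewrite Rmult_0_l.
        replace (INR n * 0 + 0 * v) with 0 by ring. rewrite ?cos_0, ?sin_0.
        replace (cos (INR n * 0 + 0)) with 1 by (rewrite <- cos_0; f_equal; ring).
        replace (INR n * v - 0 * 0) with (v + (INR n + - (1)) * v) by ring. rewrite exp_plus. ring.
      + replace (0 + - 0) with 0 by ring. rewrite Rmult_0_l.
        replace (INR n * 0 + 0 * v) with 0 by ring.
        replace (INR n * 0 + 0) with 0 by ring.
        rewrite ?cos_0, ?sin_0. ring.
    - f_equal. rewrite <- Cexp_R. reflexivity. }
  have Hec : forall t, 0 < t -> cts (fun t => e (RtoC t)) t.
  { intros t Ht. apply (cts_comp e (fun t => RtoC t)); [apply cts_RtoC, continuous_id|].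
    apply (holo_Ccts _ _ _ He). rewrite <- (exp_ln t Ht), <- Cexp_R. apply Hs. simpl. bound. }
  have Hfc : forall t, 0 < t -> cts f t.
  { intros t Ht. unfold f. apply cts_mult; [|bound].
    apply (cts_ext_loc (fun t => RtoC (Rpower t (INR n - 1)))).
    - exists t. split; [bound|]. intros s _. unfold cpow. apply C_ext; simpl.
      + replace (0 + - 0) with 0 by ring. rewrite Rmult_0_l, cos_0. unfold Rminus. ring.
      + replace (0 + - 0) with 0 by ring. rewrite Rmult_0_l, sin_0. ring.
    - apply cts_RtoC. unfold Rpower.
      apply (continuous_comp (fun t => (INR n - 1) * ln t) exp); [|apply continuous_exp].
      apply (continuous_scal_r (V := R_NormedModule) (INR n - 1) ln).
      apply continuity_pt_filterlim. apply derivable_continuous_pt. exists (/ t).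
      apply derivable_pt_lim_ln, Ht. }
  apply (Clim_ext (fun j => CI (fun v => RtoC (exp v) * f (exp v))%C (- INR j) (INR j))).
  { intros j. f_equal. apply functional_extensionality. exact Hfe. }
  intros eps Heps.
  have Hl : locally (T := C_UniformSpace) (me (RtoC (INR n))) (fun y => Cmod (y - me (RtoC (INR n))) <= eps).
  { apply C_locally_eps. exists eps. split; auto. intros; lra. }
  destruct (Hg _ Hl) as [Q R0 [dq Hq] [Br Hr] HQR].
  destruct (INR_unbounded (Rmax Br (- ln dq))) as [J0 HJ0].
  have J1 := Rmax_l Br (- ln dq). have J2 := Rmax_r Br (- ln dq).
  exists J0. intros j Hj. apply le_INR in Hj.
  destruct (HQR (exp (- INR j)) (exp (INR j))) as [y [Hy1 Hy2]].
  + apply Hq; [|bound]. change (Rabs (exp (- INR j) - 0) < dq).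
    rewrite Rminus_0_r, Rabs_pos_eq by bound.
    rewrite <- (exp_ln dq) by apply cond_pos. apply exp_increasing. lra.
  + apply Hr. have Q1 := exp_ineq1_le (INR j). lra.
  + cbv beta in Hy2.
    rewrite CI_log_change.
    * replace (CI f (exp (- INR j)) (exp (INR j))) with y; [bound|].
      simpl fst in Hy1; simpl snd in Hy1. unfold CI. apply C_ext; simpl; symmetry.
      -- apply (is_RInt_unique (V := R_CNM)).
         apply (is_RInt_fct_extend_fst (U := R_NormedModule) (V := R_NormedModule) f _ _ y Hy1).
      -- apply (is_RInt_unique (V := R_CNM)).
         apply (is_RInt_fct_extend_snd (U := R_NormedModule) (V := R_NormedModule) f _ _ y Hy1).
    * intros v. apply (cts_ext _ _ v (fun s => eq_sym (Hfe s))).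
      apply cts_mult.
      -- apply cts_Cexp_hor.
      -- apply cts_hor with (H := fun v => e (Cexp v)).
         destruct (He (Cexp (mkC v 0))) as [l Hl2].
         { apply Hs. simpl. rewrite Rabs_R0. lra. }
         eapply Cder_Ccts. apply (Cder_comp e Cexp); [apply Cder_Cexp|exact Hl2].
    * bound.
Qed.

(** Shifting the coefficients by [k] amounts to dividing [E] minus a polynomial by
    [z ^ k], which preserves growth and boundedness. *)
Lemma strong_entire_data N e E me k : strongly_regular N -> admits_nonzero_proximate_order N ->
  omega N < 2 -> strong_kernel N e E me ->
  entire_data N (omega N * PI / 2) (fun n => / me (RtoC (INR (n + k))))%C
    (PSum (fun n => / me (RtoC (INR (n + k))))%C).
Proof.
intros HN Hpo Hom HK.
set (c := fun n => (/ me (RtoC (INR n)))%C). set (b := fun n => c (n + k)%nat).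
change (entire_data N (omega N * PI / 2) b (PSum b)).
have HEps : forall z, ps c z (E z).
{ intros z. apply is_pseries_ps. apply (km_series _ _ _ _ HK z). }
have Hbps : forall z, ps b z (PSum b z).
{ intros z. destruct (Ceq_dec z 0) as [->|Hz].
  - rewrite (PSum_spec b 0 (b O)); apply ps_at_0.
  - have S := ps_shift c z (E z) k Hz (HEps z). change (ps b z) with (ps (fun n => c (n + k)%nat) z). rewrite (PSum_spec b z _ S). exact S. }
destruct (ps_coef_bounds b 3 ltac:(lra) (fun z _ => ex_intro _ _ (Hbps z)) 2 ltac:(lra)) as [K [HK0 HKb]].
have Hin : forall z, Cmod z < 1 -> Cmod (PSum b z) <= 2 * K.
{ intros z Hz. step (apply (PSum_bound b K 2); auto; lra).
  replace (2 * K) with (K * / / 2) by field. unfold Rdiv at 1. apply Rmult_le_compat_l; auto.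
  apply Rinv_le_contravar; lra. }
have Hfin : exists S, 0 <= S /\ forall z, 1 <= Cmod z -> Cmod (PSum b z) <= Cmod (E z) + S.
{ have Hc : forall j, exists S, 0 <= S /\ forall z, 1 <= Cmod z ->
    Cmod (Csum (fun i => c i * z ^ i)%C j) <= S * Cmod z ^ j.
  { induction j as [|j [S [HS IH]]].
    - exists 0. split; [lra|]. intros z _. simpl. rewrite Cmod_0. lra.
    - exists (S + Cmod (c j)). split; [bound|].
      intros z Hz. simpl Csum. step apply Cmod_triangle.
      rewrite Rmult_plus_distr_r. have Hp : 0 <= Cmod z ^ j by bound.
      have Hp2 : Cmod z ^ j <= Cmod z ^ Datatypes.S j.
      { simpl. rewrite <- (Rmult_1_l (Cmod z ^ j)) at 1. apply Rmult_le_compat_r; lra. }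
      apply Rplus_le_compat.
      + step apply IH, Hz. apply Rmult_le_compat_l; auto.
      + rewrite Cmod_mult, Cmod_pow. apply Rmult_le_compat_l; auto. apply Cmod_ge_0. }
  destruct (Hc k) as [S [HS HSb]]. exists S. split; auto. intros z Hz.
  have Hz0 : z <> 0%C by (apply Cneq_0_of_Cmod; lra).
  have Hzk := Cpow_neq_0 z k Hz0.
  have Hpk : 1 <= Cmod z ^ k by (apply pow_R1_Rle; exact Hz).
  rewrite (PSum_spec b z _ (ps_shift c z (E z) k Hz0 (HEps z))).
  rewrite Cmod_div, Cmod_pow by bound.
  times (Cmod z ^ k); [lra|].
  unfold Rdiv. rewrite Rmult_assoc, Rinv_l, Rmult_1_r by lra.
  step apply Cmod_triangle_minus. rewrite Rmult_plus_distr_r.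
  apply Rplus_le_compat; [|bound].
  rewrite <- (Rmult_1_r (Cmod (E z))) at 1. apply Rmult_le_compat_l; [bound|bound]. }
destruct Hfin as [S [HS HSb]].
destruct (kE_growth _ _ _ _ HK) as [cE [kE [HcE [HkE HEg]]]].
constructor.
- bound.
- exists (cE + S + 2 * K), kE. split; [lra|]. split; [bound|]. intros z.
  destruct (Rle_dec 1 (Cmod z)) as [Hz|Hz].
  + step apply HSb, Hz. specialize (HEg z). fold (G N (Cmod z / kE)) in HEg.
    assert (S * 1 <= S * G N (Cmod z / kE)) by bound.
    assert (0 <= K * G N (Cmod z / kE)) by bound. lra.
  + step (apply Hin; lra).
    assert (K * 1 <= K * G N (Cmod z / kE)) by bound.
    assert (0 <= (cE + S) * G N (Cmod z / kE)) by bound. lra.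
- intros de Hde. destruct (kE_decay _ _ _ _ HK) as [be [Hbe Hdec]].
  destruct (Rlt_dec de (2 * PI - omega N * PI)) as [Hd|Hd].
  + destruct (Hdec (2 * PI - omega N * PI - de) 1) as [c2 [Hc2 Hdc]]; [lra|lra|].
    exists (c2 + S + 2 * K). split; [lra|]. intros v Hv.
    destruct (Rle_dec 1 (Cmod (Cexp v))) as [Hz|Hz].
    * step apply HSb, Hz.
      have Q : Cmod (E (Cexp v)) <= c2 * Rpower (Cmod (Cexp v)) (- be).
      { apply Hdc.
        - apply sector_log. exists v. split; auto. apply Rabs_lt_between'. lra.
        - unfold Defs.disc. lra. }
      have Q2 : Rpower (Cmod (Cexp v)) (- be) <= 1.
      { unfold Rpower. rewrite <- exp_0. apply exp_mono.
        assert (0 <= ln (Cmod (Cexp v))) by (rewrite <- ln_1; apply ln_le; lra). nra. }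
      assert (c2 * Rpower (Cmod (Cexp v)) (- be) <= c2 * 1) by bound. lra.
    * step (apply Hin; lra). lra.
  + exists 1. split; [lra|]. intros v Hv. exfalso. lra.
Qed.

(** * The Mellin transform of the kernel has no zeros *)

(** Nearby points are compared by the second-order estimate, distant ones by the
    bound itself. *)
Lemma lipschitz_of_bound F z1 z2 r B : 0 < r -> holo (fun z => Cmod (z - z1) < r) F ->
  (forall z, Cmod (z - z1) < r -> Cmod (F z) <= B) -> Cmod (F z2) <= B ->
  Cmod (F z2 - F z1) <= 8 * B / r * Cmod (z2 - z1).
Proof.
intros Hr HF HB H2.
destruct (second_order F z1 r B Hr HF HB) as [l [_ [Hl H]]].
have H1 : Cmod (F z1) <= B.
{ apply HB. rewrite Cmod_minus_self. exact Hr. }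
have HB0 : 0 <= B by (have Q := Cmod_ge_0 (F z1); lra).
set (h := (z2 - z1)%C).
destruct (Rle_dec (Cmod h) (r / 4)) as [Hs|Hs].
- specialize (H h Hs). replace (z1 + h)%C with z2 in H by (unfold h; ring).
  replace (F z2 - F z1)%C with ((F z2 - F z1 - l * h) + l * h)%C by ring.
  step apply Cmod_triangle. rewrite Cmod_mult.
  have Q1 : Cmod l * Cmod h <= 2 * B / r * Cmod h by bound.
  have Q2 : 8 * B / r ^ 2 * Cmod h ^ 2 <= 2 * (B / r) * Cmod h.
  { replace (8 * B / r ^ 2 * Cmod h ^ 2) with (8 * (B / r) * Cmod h * (Cmod h / r)) by bound.
    through (8 * (B / r) * Cmod h * / 4); [|bound].
    bound. }
  assert (0 <= B / r * Cmod h) by bound.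
  bound.
- step apply Cmod_triangle_minus.
  have Q : B / r * (r / 4) <= B / r * Cmod h by bound.
  replace (B / r * (r / 4)) with (B / 4) in Q by bound. bound.
Qed.

Lemma CI_first_order g K x y : x <= y -> 0 <= K ->
  (forall u u', Cmod (g u - g u') <= K * Rabs (u - u')) ->
  Cmod (CI g x y - RtoC (y - x) * g x) <= K * (y - x) ^ 2.
Proof.
intros Hxy HK Hg. have Hc : forall t, cts g t by (intros t; apply (lipschitz_cts _ K); auto).
rewrite <- CI_const, <- CI_minus; [|bound|intros t _; apply Hc|intros t _; apply cts_const].
replace (K * (y - x) ^ 2) with (K * (y - x) * (y - x)) by ring.
apply CI_bound_const; [bound| |].
- intros t _. apply cts_minus; [bound|apply cts_const].
- intros t Ht. step apply Hg. bound.
Qed.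

Lemma Iinf_minus_bound f g B B' K al : dom f B al -> dom g B' al -> 0 <= K ->
  (forall t, Cmod (f t - g t) <= K * exp (- (al * Rabs t))) ->
  Cmod (Iinf f - Iinf g) <= 2 * K / al.
Proof.
intros Hf Hg HK H.
replace (Iinf f - Iinf g)%C with (Iinf (fun t => f t + (- (1)) * g t)%C).
- apply Iinf_bound. split; [apply Hf|]. split.
  + intros t. apply cts_plus; [apply Hf|apply cts_scal, Hg].
  + intros t. replace (f t + - (1) * g t)%C with (f t - g t)%C by ring. apply H.
- rewrite (Iinf_plus _ _ _ _ _ _ Hf (dom_scal (- (1))%C _ _ _ Hg)), (Iinf_scal _ _ _ _ Hg). ring.
Qed.

(** Fubini: the difference of the two iterated integrals, as a function of the
    upper limit [b], has increments of second order. *)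
Lemma Iinf_CI_swap (f : R -> R -> C) a b B L al : a <= b -> 0 <= L -> (forall u, dom (f u) B al) ->
  (forall u u' w, Cmod (f u w - f u' w) <= L * exp (- (al * Rabs w)) * Rabs (u - u')) ->
  (forall x y w, x <= y -> cts (fun w => CI (fun u => f u w) x y) w) ->
  dom (fun w => CI (fun u => f u w) a b) (B * (b - a)) al /\
  Iinf (fun w => CI (fun u => f u w) a b) = CI (fun u => Iinf (f u)) a b.
Proof.
intros Hab HL Hd Hf Hc. have Hal : 0 < al by apply (Hd 0).
set (e := fun w => exp (- (al * Rabs w))). have He : forall w, 0 < e w by (intros w; apply exp_pos).
have Hcf : forall w u, cts (fun u => f u w) u.
{ intros w u. apply (lipschitz_cts _ (L * e w)); [specialize (He w); bound|]. bound. }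
set (I := fun u => Iinf (f u)). set (K := 2 * L / al). have HK : 0 <= K by (unfold K; bound).
have HI : forall u u', Cmod (I u - I u') <= K * Rabs (u - u').
{ intros u u'. unfold I, K.
  replace (2 * L / al * Rabs (u - u')) with (2 * (L * Rabs (u - u')) / al) by bound.
  apply (Iinf_minus_bound _ _ B B); auto; [bound|].
  intros t. step apply Hf. right. ring. }
have HcI : forall u, cts I u by (intros u; apply (lipschitz_cts _ K); auto).
have HD : forall x y, x <= y -> dom (fun w => CI (fun u => f u w) x y) (B * (y - x)) al.
{ intros x y Hxy. split; [bound|]. split; [auto|]. intros w.
  replace (B * (y - x) * exp (- (al * Rabs w))) with (B * e w * (y - x)) by (unfold e; ring).
  apply CI_bound_const; auto; [intros u _; apply Hcf|]. intros u _. apply Hd. }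
split; [auto|].
set (Del := fun x y => (Iinf (fun w => CI (fun u => f u w) x y) - CI I x y)%C).
have Hadd : forall x y z, x <= y -> y <= z -> (Del x z - Del x y)%C = Del y z.
{ intros x y z Hx Hy. unfold Del. rewrite <- (CI_Chasles I x y z) by (auto; intros u _; apply HcI).
  rewrite (Iinf_ext (fun w => CI (fun u => f u w) x z)
    (fun w => CI (fun u => f u w) x y + CI (fun u => f u w) y z)%C).
  - rewrite (Iinf_plus _ _ _ _ _ _ (HD x y Hx) (HD y z Hy)). ring.
  - intros w. symmetry. apply CI_Chasles; auto. intros u _. apply Hcf. }
have Hquad : forall x y, x <= y -> Cmod (Del x y) <= 2 * K * (y - x) ^ 2.
{ intros x y Hxy. have Ds := dom_scal (RtoC (y - x)) _ _ _ (Hd x).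
  have Q := Iinf_minus_bound _ _ _ _ (L * (y - x) ^ 2) al (HD x y Hxy) Ds.
  rewrite (Iinf_scal _ _ _ _ (Hd x)) in Q. fold (I x) in Q.
  replace (Del x y) with ((Iinf (fun w => CI (fun u => f u w) x y) - RtoC (y - x) * I x) -
    (CI I x y - RtoC (y - x) * I x))%C by bound.
  step apply Cmod_triangle_minus.
  replace (2 * K * (y - x) ^ 2) with (2 * (L * (y - x) ^ 2) / al + K * (y - x) ^ 2) by (unfold K; bound).
  apply Rplus_le_compat; [|apply CI_first_order; auto].
  apply Q; [bound|]. intros w. replace (L * (y - x) ^ 2 * exp (- (al * Rabs w)))
    with (L * e w * (y - x) ^ 2) by (unfold e; ring).
  apply (CI_first_order (fun u => f u w)); auto. specialize (He w). bound. }
have E : Del (a - 1) b = Del (a - 1) a.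
{ apply (Rder_zero_const (Del (a - 1))); [bound|]. intros t Ht eps Heps.
  exists (Rmin 1 (eps / (2 * K + 1))). split; [bound|]. intros s Hs.
  have H1 := Rlt_le_trans _ _ _ Hs (Rmin_l _ _). have H2 := Rlt_le_trans _ _ _ Hs (Rmin_r _ _).
  rewrite Cmult_0_r. replace (Del (a - 1)%R s - Del (a - 1)%R t - 0)%C
    with (Del (a - 1)%R s - Del (a - 1)%R t)%C by ring.
  through (2 * K * Rabs (s - t) * Rabs (s - t)).
  - apply Rabs_lt_between in H1. destruct (Rle_dec t s).
    + rewrite Hadd, Rabs_pos_eq by lra. step (apply Hquad; lra). right. ring.
    + rewrite Cmod_minus_sym, Hadd, Rabs_left by lra. step (apply Hquad; lra). right. ring.
  - apply Rmult_le_compat_r; [bound|]. through ((2 * K + 1) * (eps / (2 * K + 1))); [bound|].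
    right. field. lra. }
apply Cmod_eq_0_minus. change (Cmod (Del a b) <= 0).
rewrite <- (Hadd (a - 1)) by lra. rewrite E.
replace (Del (a - 1)%R a - Del (a - 1)%R a)%C with (RtoC 0) by ring. rewrite Cmod_0. lra.
Qed.

Definition Mellin (ee : C -> C) (s : C) : C := Iinf (fun t => Cexp (s * mkC t 0) * ee (mkC t 0))%C.

Section ZeroFree.

Variables (N : nat -> R) (th : R) (ee : C -> C) (m : nat -> C) (b : nat -> C) (Et : C -> C).
Hypothesis HN : strongly_regular N.
Hypothesis HK : kernel_data N th ee m.
Hypothesis HE : entire_data N th b Et.
Hypothesis Hbm : forall n, (b n * m n)%C = 1%C.

Let P (a1 : R) (v : C) : Prop := Re v <= a1 \/ Rabs (Im v - PI) <= (PI - th) / 2.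

Let gi (v : C) (t : R) : C := (Et (Cexp v * Cexp (mkC t 0)) * ee (mkC t 0))%C.

Lemma gi_bound : exists a1 B al, 0 < B /\ 0 < al /\
  forall v t, P a1 v -> Cmod (gi v t) <= B * exp (- (al * Rabs t)).
Proof.
have Hth := kd_th _ _ _ _ HK.
destruct (kernel_decay N th ee m HN HK (th / 2) ltac:(lra)) as [c0 [C0 [A0 [al [Hc0 [HC0 [HA0 [Hal [Hone Hd]]]]]]]]].
destruct (ed_growth _ _ _ _ HE) as [cE [kE [HcE [HkE HEg]]]].
destruct (ed_bounded _ _ _ _ HE ((PI - th) / 2) ltac:(lra)) as [CE [HCE HEb]].
exists (ln (c0 * kE)), (cE * C0 + CE * C0), al.
have H1 : 0 < cE * C0 by bound.
have H2 : 0 < CE * C0 by bound.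
split; [lra|]. split; [bound|]. intros v t HP.
destruct (Hd 0%nat t 0 ltac:(bound)) as [Hee2 Hdt].
simpl INR in *. simpl pow in *. rewrite (sr_0 N HN), Rmult_0_l, exp_0, !Rmult_1_l, Rmult_1_r in *.
have Hex := exp_pos (- (al * Rabs t)). have Het := exp_pos t.
have Hc0t : 0 <= c0 * exp t by bound.
unfold gi. rewrite Cmod_mult. destruct HP as [HP|HP].
- have E1 : Cmod (Et (Cexp v * Cexp (mkC t 0))) <= cE * G N (c0 * exp t).
  { step apply HEg. apply Rmult_le_compat_l; [lra|]. apply (G_mono N HN).
    - bound.
    - rewrite Cmod_mult, !Cmod_Cexp. simpl (Re (mkC t 0)).
      apply Rle_div_l; [exact HkE|]. replace (c0 * exp t * kE) with (c0 * kE * exp t) by ring.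
      apply Rmult_le_compat_r; [lra|]. rewrite <- (exp_ln (c0 * kE)) by bound. bound. }
  through (cE * G N (c0 * exp t) * Cmod (ee (mkC t 0))); [bound|].
  rewrite Rmult_assoc. through (cE * (C0 * exp (- (al * Rabs t)))); [bound|].
  assert (0 <= CE * C0 * exp (- (al * Rabs t))) by bound. lra.
- have E1 : Cmod (Et (Cexp v * Cexp (mkC t 0))) <= CE.
  { rewrite <- Cexp_add. apply HEb. change (Im (v + mkC t 0)) with (Im v + 0).
    apply Rabs_le_between' in HP. lra. }
  through (CE * (C0 * exp (- (al * Rabs t)))).
  + bound.
  + assert (0 <= cE * C0 * exp (- (al * Rabs t))) by bound. lra.
Qed.

Lemma gi_J v : Iinf (gi v) = J ee Et 0 0 (Cexp v).
Proof.
unfold J, Jint, gi. apply Iinf_ext. intros t. simpl INR.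
replace (Cexp (0 * mkC t 0)) with (RtoC 1); [ring|].
rewrite <- Cexp_0. f_equal. ring.
Qed.

Lemma cts_gi v t : cts (gi v) t.
Proof.
have Hth := kd_th _ _ _ _ HK.
unfold gi. apply cts_mult; [|apply (ee_cts N th ee m HK); rewrite Rabs_R0; lra].
apply cts_comp with (F := Et) (g := fun t => (Cexp v * Cexp (mkC t 0))%C).
- apply cts_scal. apply cts_hor with (H := Cexp). eapply Cder_Ccts, Cder_Cexp.
- destruct (Et_holo N th b Et HE (Cexp v * Cexp (mkC t 0))%C) as [l Hl]. eapply Cder_Ccts, Hl.
Qed.

Lemma holo_Et_exp D c : holo D (fun v => Et (c * Cexp v))%C.
Proof.
intros v _. destruct (Et_holo N th b Et HE (c * Cexp v)%C) as [l Hl].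
eexists. apply (Cder_comp Et (fun v => c * Cexp v)%C); [apply Cder_scal, Cder_Cexp|exact Hl].
Qed.

Lemma holo_gi D t : holo D (fun v => gi v t).
Proof.
intros v Hv. unfold gi. destruct (holo_Et_exp D (Cexp (mkC t 0)) v Hv) as [l Hl].
eexists. apply (Cder_mult (fun v => Et (Cexp v * Cexp (mkC t 0)))%C (fun _ => ee (mkC t 0))); [|apply Cder_const].
eapply Cder_ext; [|exact Hl]. intros w. cbv beta. f_equal. ring.
Qed.

(** The integral of [E (x t) e t / t] is the geometric series: by its power
    series near the origin, and along the negative axis by continuation. *)
Lemma J_geometric : exists a1, a1 < 0 /\ forall v, Re v <= a1 \/ Im v = PI ->
  Iinf (gi v) = (/ (1 - Cexp v))%C.
Proof.
have Hth := kd_th _ _ _ _ HK.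
destruct (J_small N th ee m b Et HN HK HE (th / 2) ltac:(lra))
  as [c1 [C1 [A1 [a [Hc1 [HC1 [HA1 [Ha [Hone [_ [Hsm Hd]]]]]]]]]]].
destruct (J_sector N th ee m b Et HK HE (th / 2) C1 A1 a ((PI - th) / 4) ltac:(lra) Ha ltac:(lra) HC1 Hone Hd)
  as [C2 [_ HJ]].
destruct (HJ O) as [_ [_ HJ3]].
set (a1 := ln (Rmin (/ 2) c1)).
have Hmin : 0 < Rmin (/ 2) c1 by bound.
have Hexp : forall v, Re v <= a1 -> Cmod (Cexp v) <= Rmin (/ 2) c1.
{ intros v Hv. rewrite Cmod_Cexp. rewrite <- (exp_ln (Rmin (/ 2) c1)) by bound. bound. }
have Hl : Rmin (/ 2) c1 <= / 2 by apply Rmin_l. have Hr : Rmin (/ 2) c1 <= c1 by apply Rmin_r.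
have HJs : forall v, Re v <= a1 -> J ee Et 0 0 (Cexp v) = (/ (1 - Cexp v))%C.
{ intros v Hv. specialize (Hexp v Hv). set (x := Cexp v) in *.
  apply (ps_unique (kappa m b 0) x).
  { apply Hsm; [bound|lra]. }
  have Hx1 : (1 - x)%C <> 0%C.
  { apply Cneq_0_of_Cmod. have Q := Cmod_triangle_inv 1 x. rewrite Cmod_1 in Q. lra. }
  apply (ps_ext (fun _ => RtoC 1)).
  { intros n. unfold kappa. rewrite Nat.add_0_r, Hbm. reflexivity. }
  apply (Clim_ext (fun n => / (1 - x) * (1 - x ^ n))%C).
  { intros n. rewrite <- Csum_geom_identity.
    rewrite (Csum_ext (fun j => RtoC 1 * x ^ j)%C (fun j => (x ^ j)%C) n) by (intros; ring). field. exact Hx1. }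
  apply (Clim_0_of_bound _ _ (fun n => Cmod (/ (1 - x)) * (/ 2) ^ n)).
  { apply geom_lim. lra. }
  { intros n. replace (/ (1 - x) * (1 - x ^ n) - / (1 - x))%C with (/ (1 - x) * (- x ^ n))%C by ring.
    rewrite Cmod_mult, Cmod_opp, Cmod_pow. bound. } }
exists a1. split.
{ unfold a1. rewrite <- ln_1. apply ln_increasing; lra. }
intros v [Hv|Hv]; rewrite gi_J; [bound|].
set (e := (PI - th) / 4).
set (H := fun y : C => (J ee Et 0 0 (Cexp (y + mkC 0 PI)) - / (1 - Cexp (y + mkC 0 PI)))%C).
have HIm : forall y, Im (y + mkC 0 PI) = Im y + PI by bound.
have HRe : forall y, Re (y + mkC 0 PI) = Re y by (intros y; change (Re y + 0 = Re y); ring).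
have Hne : forall y, Rabs (Im y) < e -> (1 - Cexp (y + mkC 0 PI))%C <> 0%C.
{ intros y Hy E. apply Rabs_lt_between in Hy. unfold e in Hy.
  have E2 : Cexp (y + mkC 0 PI) = Cexp 0.
  { rewrite Cexp_0. replace (Cexp (y + mkC 0 PI))%C with (1 - (1 - Cexp (y + mkC 0 PI)))%C by ring.
    rewrite E. ring. }
  destruct (Rle_dec (Im y) 0).
  - apply exp_circle_inj in E2.
    + apply (f_equal Im) in E2. rewrite HIm in E2. simpl in E2. lra.
    + rewrite HIm. simpl. bound.
  - replace (Cexp 0) with (Cexp (mkC 0 (2 * PI))) in E2.
    + apply exp_circle_inj in E2.
      * apply (f_equal Im) in E2. rewrite HIm in E2. simpl in E2. lra.
      * rewrite HIm. simpl. bound.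
    + rewrite <- (Cexp_2PI 0). f_equal. ring. }
have HH : forall x, H (RtoC x) = 0%C.
{ apply (strip_identity H a1 e).
  - unfold e; lra.
  - intros y Hy. unfold H.
    destruct (HJ3 0 (y + mkC 0 PI)%C) as [l1 Hl1].
    { bound. }
    { rewrite HIm. apply Rabs_lt_between in Hy. unfold e in Hy. lra. }
    have Dexp : Cder (fun y => Cexp (y + mkC 0 PI)) y (Cexp (y + mkC 0 PI) * 1)%C.
    { apply (Cder_comp Cexp (fun y => y + mkC 0 PI)%C); [|apply Cder_Cexp].
      eapply Cder_eq; [|apply Cder_plus; [apply Cder_id|apply Cder_const]]. ring. }
    apply (holo_minus (fun z => z = y) (fun y => J ee Et 0 0 (Cexp (y + mkC 0 PI)))
      (fun y => / (1 - Cexp (y + mkC 0 PI)))%C); [| |bound].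
    + intros z ->. eexists. apply (Cder_comp (J ee Et 0 0) (fun y => Cexp (y + mkC 0 PI))); [exact Dexp|exact Hl1].
    + apply holo_inv; [intros z ->; apply Hne, Hy|]. apply holo_minus; [apply holo_const|].
      intros z ->. eexists; exact Dexp.
  - intros y Hy Hys. unfold H. rewrite HJs by (rewrite HRe; lra). ring. }
specialize (HH (Re v)). unfold H in HH.
replace (RtoC (Re v) + mkC 0 PI)%C with v in HH.
- replace (J ee Et 0 0 (Cexp v)) with
    (J ee Et 0 0 (Cexp v) - / (1 - Cexp v) + / (1 - Cexp v))%C by ring. rewrite HH. ring.
- apply C_ext; simpl; rewrite <- ?Hv; unfold Re; simpl; ring.
Qed.

Variable s : C.
Hypothesis Hs : 0 < Re s.

Let psi (v : C) : C := (Cexp (- s * v) * / (1 - Cexp v))%C.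
Let phi (v : C) : C := (Cexp (- s * v) * Et (Cexp v))%C.
Let g (t : R) (v : C) : C := (Cexp (- s * v) * gi v t)%C.

(** The path is continued by constants beyond its end points, which keeps it
    Lipschitz. *)
Lemma path_swap a1 B al (path : R -> C) x y r Rq kap : 0 < al -> x <= y -> 0 < r ->
  (forall v t, P a1 v -> Cmod (gi v t) <= B * exp (- (al * Rabs t))) ->
  (forall u u', Cmod (path u - path u') <= Rabs (u - u')) ->
  (forall u z, x <= u <= y -> Cmod (z - path u) < r -> P a1 z /\ Cmod z <= Rq) ->
  exists B', dom (fun t => CI (fun u => kap * g t (path u))%C x y) B' al /\
  Iinf (fun t => CI (fun u => kap * g t (path u))%C x y) =
  CI (fun u => kap * (Cexp (- s * path u) * Iinf (gi (path u))))%C x y.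
Proof.
intros Hal Hxy Hr HB Hp Hn.
have HB0 : 0 <= B.
{ destruct (Hn x (path x) ltac:(lra)) as [Q _].
  { rewrite Cmod_minus_self. exact Hr. }
  specialize (HB (path x) 0 Q). have Q2 := Cmod_ge_0 (gi (path x) 0).
  rewrite Rabs_R0, Rmult_0_r, Ropp_0, exp_0 in HB. lra. }
set (X := exp (Cmod (- s) * Rq)). have HX : 0 < X by apply exp_pos.
set (p := fun u => path (clamp x y u)).
have Hpp : forall u u', Cmod (p u - p u') <= Rabs (u - u').
{ intros u u'. step apply Hp. apply clamp_lipschitz, Hxy. }
have Hpc : forall u, cts p u by (intros u; apply (lipschitz_cts p 1); [lra|]; intros u'; rewrite Rmult_1_l; apply Hpp).
have HK0 := Cmod_ge_0 kap. set (B1 := Cmod kap * X * B).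
have HB1 : 0 <= B1 by (unfold B1; bound).
have Hb : forall u t z, Cmod (z - p u) < r -> Cmod (kap * g t z) <= B1 * exp (- (al * Rabs t)).
{ intros u t z Hz. destruct (Hn _ z (clamp_in x y u Hxy) Hz) as [H1 H2]. unfold g, B1. rewrite !Cmod_mult.
  rewrite !Rmult_assoc. apply Rmult_le_compat_l; auto.
  apply Rmult_le_compat; try apply Cmod_ge_0; [|bound].
  step apply Cmod_Cexp_le. apply exp_mono. bound. }
have Hself : forall u, Cmod (p u - p u) < r.
{ intros u. rewrite Cmod_minus_self. exact Hr. }
have Hhg : forall t, holo (fun _ => True) (fun z => kap * g t z)%C.
{ intros t. apply holo_scal. unfold g. apply holo_mult; [|apply holo_gi]. intros w _. eexists. apply Cder_Cexp_scal. }
rewrite (CI_ext (fun u => kap * (Cexp (- s * path u) * Iinf (gi (path u))))%C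
  (fun u => Iinf (fun t => kap * g t (p u))%C)) by (exact Hxy || (intros u Hu;
  unfold p; rewrite clamp_id by bound; destruct (Hn u (path u) Hu) as [HP _];
  [rewrite Cmod_minus_self; exact Hr|];
  have Dg : dom (gi (path u)) B al by (split; [bound|split; [intros t; apply cts_gi|auto]]);
  rewrite <- (Iinf_scal _ _ _ _ Dg), <- (Iinf_scal kap _ _ _ (dom_scal (Cexp (- s * path u)) _ _ _ Dg)); reflexivity)).
replace (fun t => CI (fun u => kap * g t (path u))%C x y) with (fun t => CI (fun u => kap * g t (p u))%C x y)
  by (extensionality t; apply CI_ext; [bound|]; intros u Hu; unfold p; rewrite clamp_id by bound; reflexivity).
exists (B1 * (y - x)). apply (Iinf_CI_swap (fun u t => kap * g t (p u))%C x y B1 (8 * B1 / r) al); auto.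
- bound.
- intros u. split; [bound|]. split; [|intros t; apply (Hb u); auto].
  intros t. apply cts_scal. unfold g. apply cts_scal, cts_gi.
- intros u u' t.
  step apply (lipschitz_of_bound (fun z => kap * g t z)%C (p u') (p u) r (B1 * exp (- (al * Rabs t)))); auto.
  + apply (holo_sub (fun _ => True)); auto.
  + intros z Hz. apply (Hb u'), Hz.
  + apply (Hb u); auto.
  + bound.
- (* The factor [ee] does not depend on [u], and the rest is holomorphic in [t]. *)
  intros x' y' t Hxy'.
  set (F := fun (z : C) u => (kap * (Cexp (- s * p u) * Et (Cexp z * Cexp (p u))))%C).
  have HF : forall z, icts (F z) x' y'.
  { intros z u _. apply cts_scal, cts_mult.
    - apply (cts_comp (fun v => Cexp (- s * v))%C p); [bound|eapply Cder_Ccts, Cder_Cexp_scal].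
    - apply (cts_comp (fun v => Et (Cexp z * Cexp v)) p); [bound|].
      apply diff_Ccts, (holo_Et_exp (fun _ => True) (Cexp z) (p u) I). }
  apply (cts_ext (fun t => ee (mkC t 0) * CI (F (mkC t 0)) x' y')%C).
  { intros w. rewrite <- CI_scal; auto. apply CI_ext; auto. intros u _. unfold F, g, gi.
    rewrite (Cmult_comm (Cexp (p u))). ring. }
  apply cts_mult; [apply (ee_cts N th ee m HK); rewrite Rabs_R0; have Hth := kd_th _ _ _ _ HK; lra|].
  apply (cts_hor (fun z => CI (F z) x' y')).
  destruct (ed_growth _ _ _ _ HE) as [cE [kE [HcE [HkE HEg]]]].
  destruct (holo_CI (fun _ => True) F x' y' Hxy') with (z := mkC t 0) as [l Hl]; auto; [| |eapply Cder_Ccts, Hl].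
  + intros u _. apply holo_scal, holo_scal. intros z Hz.
    destruct (holo_Et_exp (fun _ => True) (Cexp (p u)) z I) as [l Hl]. exists l.
    apply (Cder_ext (fun v => Et (Cexp (p u) * Cexp v))); [|bound]. intros v. f_equal. ring.
  + intros z _. exists 1, (Cmod kap * (X * (cE * G N (exp (Cmod z + 1 + Rq) / kE)))). split; [lra|].
    intros z' Hz'. split; [bound|]. intros u _. unfold F. rewrite !Cmod_mult.
    destruct (Hn _ (p u) (clamp_in x y u Hxy) (Hself u)) as [_ Hpu].
    apply Rmult_le_compat_l; auto. apply Rmult_le_compat; try apply Cmod_ge_0.
    * step apply Cmod_Cexp_le. apply exp_mono. bound.
    * step apply HEg. apply Rmult_le_compat_l; [lra|]. apply (G_mono N HN); [bound|].
      apply Rmult_le_compat_r; [bound|]. rewrite <- Cexp_add, Cmod_Cexp. apply exp_mono.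
      step apply Rle_abs. step apply re_le_Cmod. step apply Cmod_triangle.
      have Q := Cmod_triangle_inv z' z. lra.
Qed.

Lemma Hor_plus_ext f f1 f2 c x y : x <= y -> (forall u, x <= u <= y ->
  f (mkC u c) = (f1 (mkC u c) + f2 (mkC u c))%C /\ Ccts f1 (mkC u c) /\ Ccts f2 (mkC u c)) ->
  Hor f c x y = (Hor f1 c x y + Hor f2 c x y)%C.
Proof.
intros Hxy H. unfold Hor. rewrite <- CI_plus; auto.
- apply CI_ext; auto. intros u Hu. apply H, Hu.
- intros u Hu. apply cts_hor, H, Hu.
- intros u Hu. apply cts_hor, H, Hu.
Qed.

Lemma Ver_plus_ext f f1 f2 c x y : x <= y -> (forall u, x <= u <= y ->
  f (mkC c u) = (f1 (mkC c u) + f2 (mkC c u))%C /\ Ccts f1 (mkC c u) /\ Ccts f2 (mkC c u)) ->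
  Ver f c x y = (Ver f1 c x y + Ver f2 c x y)%C.
Proof.
intros Hxy H. unfold Ver. rewrite <- CI_plus; auto.
- apply CI_ext; auto. intros u Hu. rewrite (proj1 (H u Hu)). ring.
- intros u Hu. apply cts_scal, cts_ver, H, Hu.
- intros u Hu. apply cts_scal, cts_ver, H, Hu.
Qed.

Lemma Ccts_inv (f : C -> C) (z : C) : f z <> 0%C -> Ccts f z -> Ccts (fun x => / f x)%C z.
Proof.
intros Hz Hf eps He.
destruct (Cder_Ccts _ _ _ (Cder_inv_id (f z) Hz) eps He) as [d1 [Hd1 H1]].
destruct (Hf d1 Hd1) as [d [Hd H]]. exists d. split; auto.
Qed.

Lemma exp_neq_1 (v : C) : Rabs (Im v) <= PI -> v <> 0%C -> (1 - Cexp v)%C <> 0%C.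
Proof.
intros Hv Hn E. apply Hn. apply exp_circle_inj.
- rewrite Cexp_0. replace (Cexp v) with (1 - (1 - Cexp v))%C by ring. rewrite E. ring.
- simpl. rewrite Rminus_0_r. exact Hv.
Qed.

Lemma geometric_holo (v : C) : (1 - Cexp v)%C <> 0%C -> exists l, Cder (fun v => / (1 - Cexp v))%C v l.
Proof.
intros Hv. apply (holo_inv (fun w => w = v)); [intros w ->; exact Hv| |bound].
apply holo_minus; [apply holo_const|]. intros w _. eexists. apply Cder_Cexp.
Qed.

(** The singularity at the origin has the same residue for all exponents. *)
Lemma RI_psi a U : a < 0 < U -> RI psi a U (- PI) PI =
  RI (fun v => / (1 - Cexp v))%C a U (- PI) PI.
Proof.
intros HaU. have HP := PI_RGT_0.
set (psi0 := fun v => (/ (1 - Cexp v))%C).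
set (Q1 := quot (fun v => Cexp (- s * v)) 0 (- s)). set (Q2 := quot Cexp 0 1).
set (H := fun v => (- (1) * (Q1 v * / Q2 v))%C).
have HQ1 : forall v, (Q1 v * v)%C = (Cexp (- s * v) - 1)%C.
{ intros v. have E := quot_spec (fun v => Cexp (- s * v)) 0 (- s) v. cbv beta in E. fold Q1 in E.
  replace (v - 0)%C with v in E by ring. rewrite E. f_equal. f_equal.
  replace (- s * 0)%C with (RtoC 0) by ring. apply Cexp_0. }
have HQ2 : forall v, (Q2 v * v)%C = (Cexp v - 1)%C.
{ intros v. have E := quot_spec Cexp 0 1 v. fold Q2 in E.
  replace (v - 0)%C with v in E by ring. rewrite E. rewrite Cexp_0. reflexivity. }
have Hne : forall v, Rabs (Im v) <= PI -> v <> 0%C -> Q2 v <> 0%C.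
{ intros v Hv Hv0 E. apply (exp_neq_1 v Hv Hv0).
  have E2 := HQ2 v. rewrite E in E2. replace (1 - Cexp v)%C with (- (Cexp v - 1))%C by ring.
  rewrite <- E2. ring. }
have HHd : forall v, Rabs (Im v) <= PI -> v <> 0%C -> exists l, Cder H v l.
{ intros v Hv Hv0.
  destruct (Cder_quot _ 0 (- s) v _ Hv0 (Cder_Cexp_scal (- s) v)) as [l1 Hl1].
  destruct (Cder_quot _ 0 1 v _ Hv0 (Cder_Cexp v)) as [l2 Hl2].
  eexists. unfold H. apply Cder_scal. apply (Cder_mult Q1 (fun v => / Q2 v)%C); [exact Hl1|].
  apply Cder_inv; [bound|exact Hl2]. }
have Hz : Ccts H 0.
{ unfold H. apply (Ccts_mult (fun _ => (- (1))%C)); [eapply Cder_Ccts, Cder_const|].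
  have C2 : Ccts Q2 0.
  { apply Ccts_quot. eapply Cder_eq; [|apply Cder_Cexp]. apply Cexp_0. }
  apply Ccts_mult.
  - apply Ccts_quot. eapply Cder_eq; [|apply Cder_Cexp_scal].
    replace (- s * 0)%C with (RtoC 0) by ring. rewrite Cexp_0. ring.
  - apply Ccts_inv; [|bound]. unfold Q2, quot. destruct Ceq_dec as [_|E]; [|bound].
    intros E. apply (f_equal Re) in E. simpl in E. lra. }
have HRI : RI H a U (- PI) PI = 0%C.
{ apply (RI_removable H a U (- PI) PI 0 0); try lra.
  - intros z Hz2 Hz3. apply HHd; auto. apply Rabs_le_between. destruct Hz2. lra.
  - bound. }
have Hsum : forall v, Rabs (Im v) <= PI -> v <> 0%C ->
  psi v = (psi0 v + H v)%C /\ Ccts psi0 v /\ Ccts H v.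
{ intros v Hv Hv0. have Hx := exp_neq_1 v Hv Hv0. split; [|split].
  - unfold psi, psi0, H.
    replace (1 - Cexp v)%C with (- (Q2 v * v))%C in * by (rewrite HQ2; ring).
    replace (Cexp (- s * v)) with (Q1 v * v + 1)%C by (rewrite HQ1; ring).
    field. split; auto.
  - apply diff_Ccts, (geometric_holo v Hx).
  - apply diff_Ccts, (HHd v Hv Hv0). }
have He : forall x y, (x <> 0 \/ y <> 0) -> mkC x y <> 0%C.
{ intros x y Hxy E. inversion E. lra. }
unfold RI in *.
rewrite (Hor_plus_ext psi psi0 H (- PI) a U), (Hor_plus_ext psi psi0 H PI a U),
  (Ver_plus_ext psi psi0 H U (- PI) PI), (Ver_plus_ext psi psi0 H a (- PI) PI);
  try lra; try (intros u Hu; apply Hsum; [simpl; apply Rabs_le_between; lra|apply He; lra]).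
transitivity (Hor psi0 (- PI) a U + Ver psi0 U (- PI) PI - Hor psi0 PI a U - Ver psi0 a (- PI) PI +
  (Hor H (- PI) a U + Ver H U (- PI) PI - Hor H PI a U - Ver H a (- PI) PI))%C; [ring|].
rewrite HRI. ring.
Qed.

Let D (x : R) : C := Ver phi x (- PI) PI.
Let E2 : C := Cexp (s * mkC 0 (2 * PI)).

Lemma period_shift (h : C -> C) x : (forall v, h (v + mkC 0 (2 * PI))%C = h v) ->
  (Cexp (- s * mkC x (- PI)) * h (mkC x (- PI)))%C = (E2 * (Cexp (- s * mkC x PI) * h (mkC x PI)))%C.
Proof.
intros Hh. replace (mkC x PI) with (mkC x (- PI) + mkC 0 (2 * PI))%C by bound.
rewrite Hh. rewrite Cmult_assoc. f_equal. unfold E2. rewrite <- Cexp_add. f_equal. ring.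
Qed.

Lemma phi_holo v : exists l, Cder phi v l.
Proof.
destruct (Et_holo N th b Et HE (Cexp v)) as [l Hl]. eexists. unfold phi.
apply (Cder_mult (fun v => Cexp (- s * v)) (fun v => Et (Cexp v))); [apply Cder_Cexp_scal|].
apply (Cder_comp Et Cexp); [apply Cder_Cexp|exact Hl].
Qed.

Lemma g_phi t v : g t v = (Cexp (s * mkC t 0) * ee (mkC t 0) * phi (v + mkC t 0))%C.
Proof.
unfold g, gi, phi. rewrite Cexp_add.
replace (Cexp (- s * v)) with (Cexp (s * mkC t 0) * Cexp (- s * (v + mkC t 0)))%C; [ring|].
rewrite <- Cexp_add. f_equal. ring.
Qed.

Lemma g_holo t v : exists l, Cder (g t) v l.
Proof.
apply (holo_mult (fun _ => True) (fun v => Cexp (- s * v)) (fun v => gi v t)); [|apply holo_gi|bound].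
intros w _. eexists. apply Cder_Cexp_scal.
Qed.

Lemma Hor_scal (c : C) f y x x' : x <= x' -> (forall v, exists l, Cder f v l) ->
  Hor (fun v => c * f v)%C y x x' = (c * Hor f y x x')%C.
Proof.
intros Hx Hf. unfold Hor. apply CI_scal; auto. intros u _. apply cts_hor.
apply diff_Ccts, (Hf (mkC u y)).
Qed.

Lemma edges (h : C -> C) x x' : x <= x' -> (forall v, exists l, Cder h v l) ->
  (forall u, h (mkC u (- PI)) = (E2 * h (mkC u PI))%C) ->
  Ver h x' (- PI) PI = (Ver h x (- PI) PI + (1 - E2) * Hor h PI x x')%C.
Proof.
intros Hx Hh Hp. have HPI := PI_RGT_0.
have G := Goursat h x x' (- PI) PI Hx ltac:(lra) (fun z _ => Hh z). unfold RI in G.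
have E : Hor h (- PI) x x' = (E2 * Hor h PI x x')%C.
{ rewrite <- Hor_scal by auto. unfold Hor. apply CI_ext; auto. }
rewrite E in G.
replace (Ver h x' (- PI) PI) with
  ((E2 * Hor h PI x x' + Ver h x' (- PI) PI - Hor h PI x x' - Ver h x (- PI) PI) +
   (Ver h x (- PI) PI + (1 - E2) * Hor h PI x x'))%C by ring.
rewrite G. ring.
Qed.

Lemma phi_period u : phi (mkC u (- PI)) = (E2 * phi (mkC u PI))%C.
Proof. unfold phi. apply (period_shift (fun v => Et (Cexp v))). intros v. rewrite Cexp_2PI. reflexivity. Qed.

(** The difference is an integral over a horizontal edge, on which [E] is bounded and
    [exp (- s * v)] decays. *)
Lemma D_variation : exists C1, 0 <= C1 /\ forall x x', x <= x' -> Cmod (D x' - D x) <= C1 * exp (- (Re s * x)).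
Proof.
have Hth := kd_th _ _ _ _ HK.
destruct (ed_bounded _ _ _ _ HE ((PI - th) / 2) ltac:(lra)) as [CE [HCE HEb]].
set (Cp := exp (Rabs (Im s) * PI) * CE).
have HCp : 0 < Cp by (apply Rmult_lt_0_compat; [bound|bound]).
exists (Cmod (1 - E2) * (Cp / Re s)).
have HE2 := Cmod_ge_0 (1 - E2).
split; [bound|].
intros x x' Hx. unfold D. rewrite (edges phi x x' Hx phi_holo phi_period).
match goal with |- Cmod ?z <= _ => replace z with ((1 - E2) * Hor phi PI x x')%C by ring end.
rewrite Cmod_mult, Rmult_assoc. apply Rmult_le_compat_l; auto.
destruct (RInt_exp_neg (Re s) x x' Hs) as [Hex HR].
unfold Hor.
through (RInt (fun u => Cp * exp (- (Re s * u))) x x').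
- apply CI_bound; auto.
  + intros u _. apply cts_hor. apply diff_Ccts, (phi_holo (mkC u PI)).
  + apply (ex_RInt_scal (V := R_NormedModule)). exact Hex.
  + intros u _. unfold phi. rewrite Cmod_mult. unfold Cp.
    replace (exp (Rabs (Im s) * PI) * CE * exp (- (Re s * u))) with
      (exp (Rabs (Im s) * PI) * exp (- (Re s * u)) * CE) by ring.
    apply Rmult_le_compat; try apply Cmod_ge_0.
    * rewrite Cmod_Cexp, <- exp_plus. apply exp_mono.
      replace (Re (- s * mkC u PI)) with (- Re s * u + Im s * PI) by (unfold Re, Im; simpl; ring).
      have Q := Rle_abs (Im s). nra.
    * apply HEb. simpl. lra.
- rewrite RInt_scal_R by bound. rewrite HR.
  replace (Cp / Re s * exp (- (Re s * x))) with (Cp * (exp (- (Re s * x)) / Re s)) by bound.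
  apply Rmult_le_compat_l; [lra|]. unfold Rdiv. apply Rmult_le_compat_r; [bound|].
  have Q := exp_pos (- (Re s * x')). lra.
Qed.

(** For fixed [t], Cauchy's theorem moves the integral of [exp (- s * v) * E (exp (v + t))]
    over the edge of abscissa [U] to the other three edges of a rectangle of height
    [2 * PI]. There [J_geometric] evaluates the integral against [e t], and the result
    is the integral of [exp (- s * v) / (1 - exp v)] over the edge [U] minus the
    residue at 0. On the edge [U] itself, the integral against [e t] becomes one of
    [D (U + t)] with weight [exp (s * t) * e t]; if the total weight is zero, only the
    variation of [D] contributes. Everything but the residue tends to zero as [U]
    grows. *)
Lemma Mellin_neq_0 : Mellin ee s <> 0%C.
Proof.
intros HF. have Hth := kd_th _ _ _ _ HK.
destruct gi_bound as [a1 [B [al [HB [Hal Hgi]]]]].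
destruct J_geometric as [a2 [Ha2 HJg]].
destruct D_variation as [C1 [HC1 HD]].
destruct (kernel_weight N th ee m HN HK) as [al4 [Hal4 HW]]. destruct (HW (Re s)) as [C4 [HC4 HWs]].
set (a := Rmin (Rmin a1 a2) (- 3) - 1).
have Haa1 : a + 1 <= a1 by (unfold a; have Q := Rmin_l (Rmin a1 a2) (- 3); have Q2 := Rmin_l a1 a2; lra).
have Haa2 : a <= a2 by (unfold a; have Q := Rmin_l (Rmin a1 a2) (- 3); have Q2 := Rmin_r a1 a2; lra).
have Haa3 : a <= - 3 by (unfold a; have Q := Rmin_r (Rmin a1 a2) (- 3); lra).
set (psi0 := fun v => (/ (1 - Cexp v))%C).
have Hpath : forall u u' y, Cmod (mkC u y - mkC u' y) <= Rabs (u - u').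
{ intros. step apply Cmod_le_Re_Im. simpl.
  replace (y + - y) with 0 by ring. rewrite Rabs_R0. unfold Rminus. lra. }
have Hpath2 : forall u u' x, Cmod (mkC x u - mkC x u') <= Rabs (u - u').
{ intros. step apply Cmod_le_Re_Im. simpl.
  replace (x + - x) with 0 by ring. rewrite Rabs_R0. unfold Rminus. lra. }
have Hg_shift : forall t u, g t (mkC u (- PI)) = (E2 * g t (mkC u PI))%C.
{ intros t u. unfold g. apply (period_shift (fun v => gi v t)). intros v. unfold gi. rewrite Cexp_2PI. reflexivity. }
have Hnear : forall u v z r, Cmod (z - mkC u v) < r -> Rabs (Re z - u) < r /\ Rabs (Im z - v) < r /\
  Cmod z <= r + (Rabs u + Rabs v).
{ intros u v z r Hz. split; [|split].
  - eapply Rle_lt_trans; [|exact Hz]. exact (re_le_Cmod (z - mkC u v)%C).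
  - eapply Rle_lt_trans; [|exact Hz]. exact (im_le_Cmod (z - mkC u v)%C).
  - have Q := Cmod_triangle_inv z (mkC u v). have Q2 := Cmod_le_Re_Im (mkC u v).
    simpl in Q2. lra. }
destruct (path_swap a1 B al (fun y => mkC a y) (- PI) PI 1 (1 + (Rabs a + PI)) Ci Hal ltac:(lra) ltac:(lra) Hgi
  (fun u u' => Hpath2 u u' a)) as [BV [DV EV]].
{ intros u z Hu Hz. destruct (Hnear _ _ _ _ Hz) as [H1 [_ H3]].
  apply Rabs_lt_between' in H1. split; [left; lra|].
  assert (Rabs u <= PI) by bound. lra. }
have Main : forall U, 1 <= U -> exists VU BU, (forall t, VU t = Ver (g t) U (- PI) PI) /\
  dom VU BU al /\ Iinf VU = (Ver psi U (- PI) PI - RI psi a U (- PI) PI)%C.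
{ intros U HU.
  destruct (path_swap a1 B al (fun x => mkC x PI) a U ((PI - th) / 2) ((PI - th) / 2 + ((Rabs a + Rabs U) + PI)) 1
    Hal ltac:(lra) ltac:(lra) Hgi (fun u u' => Hpath u u' PI)) as [BH [DH EH]].
  { intros u z Hu Hz. destruct (Hnear _ _ _ _ Hz) as [_ [H2 H3]]. split.
    - right. lra.
    - rewrite (Rabs_pos_eq PI) in H3 by lra.
      assert (Rabs u <= Rabs a + Rabs U).
      { apply Rabs_le_between. have Q1 := Rle_abs U. have Q2 := Rle_abs (- a). rewrite Rabs_Ropp in Q2.
        bound. }
      lra. }
  set (Va := fun t => CI (fun u => (Ci * g t (mkC a u))%C) (- PI) PI) in *.
  set (Hp := fun t => CI (fun u => (1 * g t (mkC u PI))%C) a U) in *.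
  have DH2 := dom_scal (1 - E2)%C _ _ _ DH.
  exists (fun t => Va t + (1 - E2) * Hp t)%C, (BV + Cmod (1 - E2) * BH). split; [|split].
  - intros t. rewrite (edges (g t) a U ltac:(lra) (g_holo t) (Hg_shift t)). unfold Va, Hp, Ver, Hor.
    do 2 f_equal. apply CI_ext; [lra|]. intros u _. ring.
  - apply dom_plus; assumption.
  - rewrite (Iinf_plus _ _ _ _ _ _ DV DH2), (Iinf_scal _ _ _ _ DH). rewrite EV, EH.
    unfold RI.
    replace (CI (fun u => Ci * (Cexp (- s * mkC a u) * Iinf (gi (mkC a u))))%C (- PI) PI)
      with (Ver psi a (- PI) PI).
    2:{ unfold Ver. apply CI_ext; [lra|]. intros u _. rewrite HJg by bound. reflexivity. }
    replace (CI (fun u => 1 * (Cexp (- s * mkC u PI) * Iinf (gi (mkC u PI))))%C a U)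
      with (Hor psi PI a U).
    2:{ unfold Hor. apply CI_ext; [lra|]. intros u _. rewrite HJg by bound. unfold psi. ring. }
    replace (Hor psi (- PI) a U) with (E2 * Hor psi PI a U)%C; [ring|].
    unfold Hor. rewrite <- CI_scal; [|lra|].
    + apply CI_ext; [lra|]. intros u _. symmetry. unfold psi.
      apply (period_shift (fun v => / (1 - Cexp v))%C). intros v. rewrite Cexp_2PI. reflexivity.
    + intros u _. apply cts_hor. unfold psi.
      have Hx : (1 - Cexp (mkC u PI))%C <> 0%C.
      { apply exp_neq_1; [simpl; rewrite Rabs_pos_eq; lra|]. intros E. inversion E. lra. }
      destruct (geometric_holo _ Hx) as [l Hl]. eapply Cder_Ccts.
      apply (Cder_mult (fun v => Cexp (- s * v)) (fun v => / (1 - Cexp v))%C); [apply Cder_Cexp_scal|exact Hl]. }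
(* As the weight [w] has integral zero, [D U] may be subtracted from [D (U + t)]. *)
have Small : forall U, 1 <= U -> Cmod (Ver psi U (- PI) PI - RI psi a U (- PI) PI) <=
  2 * (C1 * (2 * C4)) / Rmin al al4 * exp (- (Re s * U)).
{ intros U HU. destruct (Main U HU) as [VU [BU [HV [DVU EVU]]]]. rewrite <- EVU.
  set (w := fun t => (Cexp (s * mkC t 0) * ee (mkC t 0))%C).
  have Hw : dom w C4 al4.
  { apply (Mellin_dom N th ee m HK); [exact Hal4|rewrite Rabs_R0; lra|].
    intros t. rewrite Re_mult_real. apply HWs. lra. }
  have HVw : forall t, VU t = (w t * D (U + t))%C.
  { intros t. rewrite HV. unfold D, Ver. rewrite <- CI_scal; [|lra|].
    - apply CI_ext; [lra|]. intros y _. rewrite g_phi. unfold w.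
      replace (mkC U y + mkC t 0)%C with (mkC (U + t) y) by bound. ring.
    - intros y _. apply cts_scal, cts_ver. destruct (phi_holo (mkC (U + t) y)) as [l Hl]. eapply Cder_Ccts, Hl. }
  have Hz : Iinf (fun t => VU t + (- D U) * w t)%C = Iinf VU.
  { rewrite (Iinf_plus _ _ _ _ _ _ DVU (dom_scal (- D U)%C _ _ _ Hw)), (Iinf_scal _ _ _ _ Hw).
    replace (Iinf w) with (RtoC 0) by bound. ring. }
  rewrite <- Hz.
  eapply Rle_trans; [apply (Iinf_bound _ (C1 * (2 * C4) * exp (- (Re s * U))) (Rmin al al4))|bound].
  split; [bound|]. split.
  - intros t. apply cts_plus; [apply DVU|apply cts_scal, Hw].
  - intros t. rewrite HVw. replace (w t * D (U + t) + - D U * w t)%C with (w t * (D (U + t) - D U))%C by ring.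
    have HDb : Cmod (D (U + t)%R - D U) <= C1 * exp (- (Re s * U)) * (1 + exp (- (Re s * t))).
    { rewrite Rmult_plus_distr_l, Rmult_1_r, Rmult_assoc, <- exp_plus.
      assert (0 <= C1 * exp (- (Re s * U))) by bound.
      assert (0 <= C1 * exp (- (Re s * U) + - (Re s * t))) by bound.
      destruct (Rle_dec 0 t) as [Ht|Ht].
      - have Q := HD U (U + t) ltac:(lra). lra.
      - have Q := HD (U + t) U ltac:(lra). rewrite Cmod_minus_sym in Q.
        replace (- (Re s * (U + t))) with (- (Re s * U) + - (Re s * t)) in Q by ring. lra. }
    rewrite Cmod_mult. have Hww : Cmod (w t) = exp (Re s * t) * Cmod (ee (mkC t 0)).
    { unfold w. rewrite Cmod_mult, Cmod_Cexp, Re_mult_real. reflexivity. }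
    through (Cmod (w t) * (C1 * exp (- (Re s * U)) * (1 + exp (- (Re s * t))))).
    { bound. }
    rewrite Hww.
    replace (exp (Re s * t) * Cmod (ee (mkC t 0)) * (C1 * exp (- (Re s * U)) * (1 + exp (- (Re s * t))))) with
      (C1 * exp (- (Re s * U)) * ((exp (Re s * t) + exp (Re s * t) * exp (- (Re s * t))) * Cmod (ee (mkC t 0)))) by ring.
    rewrite <- exp_plus. replace (Re s * t + - (Re s * t)) with 0 by ring. rewrite exp_0.
    replace (C1 * (2 * C4) * exp (- (Re s * U)) * exp (- (Rmin al al4 * Rabs t))) with
      (C1 * exp (- (Re s * U)) * (2 * C4 * exp (- (Rmin al al4 * Rabs t)))) by ring.
    apply Rmult_le_compat_l; [bound|].
    have HW0 := HWs 0 t ltac:(lra). have HW1 := HWs (Re s) t ltac:(lra). rewrite Rmult_0_l, exp_0 in HW0.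
    through (2 * C4 * exp (- (al4 * Rabs t))); [lra|].
    apply Rmult_le_compat_l; [lra|]. apply exp_mono.
    have Q := Rmin_r al al4. have Q2 := Rabs_pos t. nra. }
have Hpsi0c : forall x y, Rabs y <= PI -> x <> 0 -> Ccts psi0 (mkC x y).
{ intros x y Hy Hx. have Hx2 : (1 - Cexp (mkC x y))%C <> 0%C.
  { apply exp_neq_1; [bound|]. intros E. inversion E. lra. }
  apply diff_Ccts, (geometric_holo _ Hx2). }
have HRI0 : forall U, 1 <= U -> RI psi a U (- PI) PI = (Ver psi0 U (- PI) PI - Ver psi0 a (- PI) PI)%C.
{ intros U HU. rewrite RI_psi by lra. fold psi0. unfold RI.
  replace (Hor psi0 (- PI) a U) with (Hor psi0 PI a U); [ring|].
  unfold Hor. apply CI_ext; [lra|]. intros u _. unfold psi0.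
  replace (mkC u PI) with (mkC u (- PI) + mkC 0 (2 * PI))%C by bound.
  rewrite Cexp_2PI. reflexivity. }
set (Cs := exp (Rabs (Im s) * PI)). have HCs : 0 < Cs by apply exp_pos.
have Hden : forall U y, 1 <= U -> U <= Cmod (1 - Cexp (mkC U y)).
{ intros U y HU. rewrite Cmod_minus_sym. have Q := Cmod_triangle_inv (Cexp (mkC U y)) 1.
  rewrite Cmod_1, Cmod_Cexp in Q. simpl in Q. have Q2 := exp_ineq1_le U. lra. }
have HV0 : forall U, 1 <= U -> Cmod (Ver psi0 U (- PI) PI) <= / U * (PI - - PI).
{ intros U HU. unfold Ver. apply CI_bound_const; [lra| |].
  - intros y Hy. apply cts_scal, cts_ver, Hpsi0c; [bound|lra].
  - intros y Hy. rewrite Cmod_mult, Cmod_Ci, Rmult_1_l. unfold psi0.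
    have Q := Hden U y HU. rewrite Cmod_inv by (apply Cneq_0_of_Cmod; lra).
    bound. }
have HV1 : forall U, 1 <= U -> Cmod (Ver psi U (- PI) PI) <= Cs * / U * (PI - - PI).
{ intros U HU. unfold Ver. apply CI_bound_const; [lra| |].
  - intros y Hy. apply cts_scal, cts_ver. unfold psi. apply (Ccts_mult (fun v => Cexp (- s * v)) psi0).
    + eapply Cder_Ccts, Cder_Cexp_scal.
    + apply Hpsi0c; [bound|lra].
  - intros y Hy. rewrite Cmod_mult, Cmod_Ci, Rmult_1_l. unfold psi. rewrite Cmod_mult.
    have Q := Hden U y HU. rewrite (Cmod_inv (1 - Cexp (mkC U y))%C) by (apply Cneq_0_of_Cmod; lra).
    apply Rmult_le_compat; [bound|bound| |bound].
    rewrite Cmod_Cexp. unfold Cs. apply exp_mono.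
    replace (Re (- s * mkC U y)) with (- Re s * U + Im s * y) by (unfold Re, Im; simpl; ring).
    have Q1 : Im s * y <= Rabs (Im s) * PI.
    { step apply Rle_abs. rewrite Rabs_mult. bound. }
    nra. }
have Hin : Cmod (Ver psi0 a (- PI) PI - (RtoC (2 * PI) * Ci)%C) <= / 7 * (PI - - PI).
{ replace (RtoC (2 * PI) * Ci)%C with (CI (fun _ => Ci) (- PI) PI).
  2:{ rewrite CI_const. do 2 f_equal. ring. }
  unfold Ver. rewrite <- CI_minus; [|lra| |intros t _; apply cts_const].
  2:{ intros y Hy. apply cts_scal, cts_ver, Hpsi0c; [bound|lra]. }
  apply CI_bound_const; [lra| |].
  - intros y Hy. apply cts_minus; [|apply cts_const].
    apply cts_scal, cts_ver, Hpsi0c; [bound|lra].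
  - intros y Hy. set (x := Cexp (mkC a y)).
    have Hx : Cmod x <= / 8.
    { unfold x. rewrite Cmod_Cexp. simpl Re.
      through (exp (- 3)); [bound|].
      replace (exp (- 3)) with (/ exp 3) by (rewrite <- exp_Ropp; f_equal; lra). apply Rinv_le_contravar; [lra|].
      replace 3 with (1 + 1 + 1) by ring. rewrite !exp_plus.
      have Q := exp_ineq1_le 1. assert (2 * 2 <= exp 1 * exp 1) by bound.
      assert (4 * 2 <= exp 1 * exp 1 * exp 1) by bound. lra. }
    have Q := Cmod_triangle_inv 1 x. rewrite Cmod_1 in Q.
    have Hx1 : (1 - x)%C <> 0%C by (apply Cneq_0_of_Cmod; lra).
    replace (Ci * psi0 (mkC a y) - Ci)%C with (Ci * (x * / (1 - x)))%C.
    2:{ unfold psi0. fold x. field. exact Hx1. }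
    rewrite !Cmod_mult, Cmod_Ci, Rmult_1_l, Cmod_inv by bound.
    through (/ 8 * / (7 / 8)); [|bound].
    bound. }
set (C5 := 2 * (C1 * (2 * C4)) / Rmin al al4).
have HC5 : 0 <= C5.
{ unfold C5. bound. }
set (C6 := 2 * PI + 2 * PI * Cs + C5 / Re s).
have HC6 : 0 <= C6.
{ unfold C6. bound. }
have Hsmall : Cmod (Ver psi0 a (- PI) PI) <= 1.
{ set (U := C6 + 1). have HU : 1 <= U by (unfold U; lra).
  have S := Small U HU. rewrite HRI0 in S by bound. fold C5 in S.
  specialize (HV0 U HU). specialize (HV1 U HU).
  have He : exp (- (Re s * U)) <= / Re s * / U.
  { rewrite exp_Ropp, <- Rinv_mult. apply Rinv_le_contravar; [bound|].
    have Q := exp_ineq1_le (Re s * U). lra. }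
  have S2 : C5 * exp (- (Re s * U)) <= C5 / Re s * / U.
  { unfold Rdiv. rewrite Rmult_assoc. bound. }
  have HT : Cmod (Ver psi0 a (- PI) PI) <= C6 * / U.
  { replace (Ver psi0 a (- PI) PI) with
      ((Ver psi U (- PI) PI - (Ver psi0 U (- PI) PI - Ver psi0 a (- PI) PI)) +
       (Ver psi0 U (- PI) PI - Ver psi U (- PI) PI))%C by ring.
    step apply Cmod_triangle.
    have T := Cmod_triangle_minus (Ver psi0 U (- PI) PI) (Ver psi U (- PI) PI).
    unfold C6. bound. }
  step exact HT. times U; [lra|].
  rewrite Rmult_assoc, Rinv_l by lra. unfold U. lra. }
have T := Cmod_triangle_inv (RtoC (2 * PI) * Ci) (Ver psi0 a (- PI) PI).
rewrite Cmod_mult, Cmod_Ci, Rmult_1_r, Cmod_R, Rabs_pos_eq in T by lra.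
rewrite Cmod_minus_sym in Hin. have P3 := PI2_3_2. bound.
Qed.
End ZeroFree.

(** * Growth of moments *)

Lemma finite_bound (u : nat -> R) n0 : exists B, 1 <= B /\ forall n, (n < n0)%nat -> u n <= B.
Proof.
induction n0 as [|n0 [B [HB H]]]; [exists 1; split; [lra|lia]|].
exists (Rmax B (u n0)). split; [eapply Rle_trans; [exact HB|apply Rmax_l]|].
intros n Hn. destruct (Nat.eq_dec n n0) as [->|Hne]; [apply Rmax_r|].
step (apply H; lia). apply Rmax_l.
Qed.

Section Moments.

Variables (N : nat -> R) (th : R) (ee : C -> C) (m : nat -> R) (Et : C -> C).
Hypothesis HN : strongly_regular N.
Hypothesis HK : kernel_data N th ee (fun n => RtoC (m n)).
Hypothesis HE : entire_data N th (fun n => / RtoC (m n))%C Et.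
Hypothesis Hm : forall n, 0 < m n.

(** One bound is Cauchy's inequality for [E] on the circle of radius [kE * nu n]; the
    other one integrates the decay of the kernel. *)
Lemma moments_comparable : exists A, 1 <= A /\ forall n, N n <= A ^ S n * m n /\ m n <= A ^ S n * N n.
Proof.
have Hth := kd_th _ _ _ _ HK.
destruct (kernel_decay N th ee _ HN HK (th / 2) ltac:(lra)) as [c0 [C0 [A0 [al [Hc0 [HC0 [HA0 [Hal [Hone Hd]]]]]]]]].
destruct (ed_growth _ _ _ _ HE) as [cE [kE [HcE [HkE HEg]]]].
have Hb := b_bound N th _ Et HE cE kE HcE HkE HEg.
have HCa : 0 < 2 * C0 / al by bound.
set (A := 1 + A0 + 2 * C0 / al + cE + / kE).
have Hki : 0 < / kE by bound.
have HA : 1 <= A by (unfold A; lra).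
exists A. split; [bound|]. intros n.
have HNn := M_pos N HN n.
split.
-
  have Hr : 0 < kE * nu N n by bound.
  have Q := Hb (kE * nu N n) n Hr.
  replace (kE * nu N n / kE) with (nu N n) in Q by bound.
  have Q2 := G_at_nu N HN n.
  have Hmn := Hm n.
  rewrite Cmod_inv in Q by (intros E; apply RtoC_inj in E; lra).
  rewrite Cmod_R, Rabs_pos_eq in Q by lra.
  have Q3 : / m n <= cE * (/ kE) ^ n / N n.
  { step exact Q. rewrite Rpow_mult_distr.
    through (cE * (nu N n ^ n / N n) / (kE ^ n * nu N n ^ n)).
    - bound.
    - right. rewrite pow_inv. field. bound. }
  through (cE * (/ kE) ^ n * m n).
  + times (/ m n * / N n).
    { bound. }
    replace (N n * (/ m n * / N n)) with (/ m n) by bound.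
    replace (cE * (/ kE) ^ n * m n * (/ m n * / N n)) with (cE * (/ kE) ^ n / N n) by bound.
    exact Q3.
  + apply Rmult_le_compat_r; [lra|]. simpl. apply Rmult_le_compat; try lra.
    * bound.
    * unfold A; lra.
    * apply pow_incr. unfold A; lra.
- have E := kd_moment _ _ _ _ HK n. cbv beta in E.
  have Hdom : dom (fun t => Cexp (INR n * mkC t 0) * ee (mkC t 0))%C (C0 * (A0 ^ n * N n)) al.
  { apply (Mellin_dom N th ee _ HK); [exact Hal|rewrite Rabs_R0; lra|].
    intros t. rewrite Re_R_mult. apply (Hd n t 0). bound. }
  have Q := Iinf_bound _ _ _ Hdom. rewrite E, Cmod_R, Rabs_pos_eq in Q by (left; apply Hm).
  step exact Q.
  replace (2 * (C0 * (A0 ^ n * N n)) / al) with (2 * C0 / al * A0 ^ n * N n) by bound.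
  apply Rmult_le_compat_r; [lra|]. simpl. apply Rmult_le_compat; try lra.
  + bound.
  + unfold A; lra.
  + apply pow_incr. unfold A; lra.
Qed.

Lemma Mellin_holo : holo (fun s => 0 < Re s) (Mellin ee).
Proof.
have Hth := kd_th _ _ _ _ HK. destruct (kernel_weight N th ee _ HN HK) as [al [Hal HW]].
apply (holo_Iinf (fun s => 0 < Re s) (fun s t => Cexp (s * mkC t 0) * ee (mkC t 0))%C al Hal).
- intros t s _. eexists.
  apply (Cder_mult (fun s => Cexp (s * mkC t 0)) (fun _ => ee (mkC t 0))); [|apply Cder_const].
  apply (Cder_ext (fun s => Cexp (mkC t 0 * s))); [intros; f_equal; ring|]. apply Cder_Cexp_scal.
- intros s t _. apply (cts_Mellin N th ee _ HK). rewrite Rabs_R0. lra.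
- intros z Hz. destruct (HW (2 * Re z)) as [K [HK0 HKd]].
  exists (Re z), K. split; [bound|]. intros y Hy.
  have Q : Rabs (Re y - Re z) < Re z.
  { eapply Rle_lt_trans; [|exact Hy]. exact (re_le_Cmod (y - z)%C). }
  apply Rabs_lt_between' in Q. split; [lra|]. intros t.
  rewrite Cmod_mult, Cmod_Cexp, Re_mult_real. apply HKd. lra.
Qed.

(** Normalised by powers of [nu n], the transform is at most [K0 * B ^ n] on the disc
    of radius [n / 2] about [n], and at its centre it is not smaller than that by
    more than the factor [C1 * D ^ n]; having no zeros there, it varies by a bounded
    factor between [n] and [n + 1]. *)
Lemma moment_ratio_large : exists L, forall n, (9 <= n)%nat ->
  exp (- L) * (nu N n * m n) <= m (S n) <= exp L * (nu N n * m n).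
Proof.
have Hth := kd_th _ _ _ _ HK.
destruct (kernel_decay N th ee _ HN HK (th / 2) ltac:(lra)) as [c0 [C0 [A0 [al [Hc0 [HC0 [HA0 [Hal [Hone Hd]]]]]]]]].
destruct (mg_const N HN) as [Ag [HAg Hmg]].
destruct moments_comparable as [Am [HAm Hcmp]].
set (B := A0 ^ 2 * Ag ^ 6).
have HAg1 : 1 <= Ag ^ 6 by (apply pow_R1_Rle, HAg).
have HB : 1 <= B by (unfold B; nra).
set (K0 := 4 * C0 / al).
have HK0 : 0 < K0 by (unfold K0; apply Rdiv_lt_0_compat; lra).
set (C1 := (1 + K0) * Am). set (D := Am * Ag ^ 2 * B).
have HC1 : 1 <= C1 by (unfold C1; nra).
have HD : 1 <= D.
{ unfold D. assert (1 <= Am * Ag ^ 2) by nra. nra. }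
have HlC : 0 <= ln C1 by (rewrite <- ln_1; apply ln_le; lra).
have HlD : 0 <= ln D by (rewrite <- ln_1; apply ln_le; lra).
set (L := 16 * (ln C1 + ln D)). exists L. intros n Hn.
have HnR : 9 <= INR n by (replace 9 with (INR 9) by (simpl; ring); apply le_INR, Hn).
have Hmn := Hm n.
set (c := ln (nu N n)).
set (H := fun z : C => (Mellin ee (INR n + z) * Cexp (- RtoC c * (INR n + z)))%C).
have HRe : forall z, Re (INR n + z) = INR n + Re z by bound.
have Hpos : forall z, Cmod z < INR n / 2 -> 0 < INR n + Re z <= INR (n + n).
{ intros z Hz. have Q : Rabs (Re z) <= Cmod z by apply re_le_Cmod.
  have Q2 : Rabs (Re z) < INR n / 2 by lra. apply Rabs_lt_between in Q2. rewrite plus_INR. lra. }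
have Hhol : holo (ball0 (INR n / 2)) H.
{ unfold H. apply holo_mult.
  - apply (holo_comp _ (fun s => 0 < Re s) (Mellin ee) (fun z => INR n + z)%C).
    + intros z Hz. rewrite HRe. apply Hpos, Hz.
    + apply holo_plus; [apply holo_const|apply holo_id].
    + apply Mellin_holo.
  - apply holo_Cexp, holo_scal, holo_plus; [apply holo_const|apply holo_id]. }
have Hnz : forall z, Cmod z < INR n / 2 -> H z <> 0%C.
{ intros z Hz. unfold H. apply Cmult_neq_0; [|apply Cexp_neq_0].
  apply (Mellin_neq_0 N th ee _ _ Et HN HK HE).
  - intros j. apply Cinv_l. intros E. apply RtoC_inj in E. have Q := Hm j. lra.
  - rewrite HRe. apply Hpos, Hz. }
have Hval : forall j, H (INR j) = RtoC (m (n + j) / nu N n ^ (n + j)).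
{ intros j. unfold H. replace (RtoC (INR n) + RtoC (INR j))%C with (RtoC (INR (n + j)))
    by (rewrite plus_INR, RtoC_plus; reflexivity).
  unfold Mellin. rewrite (kd_moment _ _ _ _ HK (n + j)).
  replace (- RtoC c * RtoC (INR (n + j)))%C with (RtoC (- (INR (n + j) * c))).
  2:{ rewrite RtoC_opp, RtoC_mult. ring. }
  rewrite Cexp_R, exp_Ropp, exp_INR_mult. unfold c. rewrite exp_ln by bound.
  rewrite <- RtoC_mult. reflexivity. }
have H0 : H 0%C = RtoC (m n / nu N n ^ n).
{ have Q := Hval 0%nat. rewrite Nat.add_0_r in Q. exact Q. }
have H1 : H 1%C = RtoC (m (S n) / nu N n ^ (S n)).
{ have Q := Hval 1%nat. rewrite Nat.add_1_r in Q. exact Q. }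
have Hup : forall z, Cmod z < INR n / 2 -> Cmod (H z) <= K0 * B ^ n.
{ intros z Hz. have Hx := Hpos z Hz. set (x := INR n + Re z) in *.
  set (j := (n + n)%nat) in *.
  have Hj : A0 ^ j * N j <= B ^ n * nu N n ^ j.
  { have U := M_upper_0 N HN j. have Dd := nu_double N HN Ag n HAg Hmg ltac:(lia). fold j in Dd.
    have U2 : N j <= (Ag ^ 3 * nu N n) ^ j.
    { step exact U. bound. }
    through (A0 ^ j * (Ag ^ 3 * nu N n) ^ j).
    - bound.
    - right. unfold B, j. rewrite !Rpow_mult_distr, !pow_add, <- !pow_mult.
      replace (2 * n)%nat with (n + n)%nat by lia. replace (6 * n)%nat with (3 * n + 3 * n)%nat by lia.
      rewrite !pow_add. ring. }
  unfold H. rewrite Cmod_mult, Cmod_Cexp.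
  replace (Re (- RtoC c * (INR n + z))) with (- (c * x)) by (unfold x, Re; simpl; ring).
  (* (e^t / nu)^x is at most 1 + (e^t / nu)^j *)
  have Hdm : dom (fun t => Cexp ((INR n + z) * mkC t 0) * ee (mkC t 0))%C
    (exp (c * x) * (2 * C0 * B ^ n)) al.
  { apply (Mellin_dom N th ee _ HK); [exact Hal|rewrite Rabs_R0; lra|]. intros t. rewrite Re_mult_real, HRe. fold x.
    have Hxt : exp (x * t) <= exp (c * x) * (1 + exp (INR j * t) / nu N n ^ j).
    { replace (x * t) with (c * x + x * (t - c)) by ring. rewrite exp_plus.
      apply Rmult_le_compat_l; [bound|].
      step (apply (exp_between x j (t - c)); lra). right. f_equal.
      unfold Rminus. rewrite Rmult_plus_distr_l, exp_plus. unfold Rdiv. f_equal.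
      replace (INR j * - c) with (- (INR j * c)) by ring. rewrite exp_Ropp, exp_INR_mult.
      unfold c. rewrite exp_ln by bound. reflexivity. }
    destruct (Hd 0%nat t 0 ltac:(bound)) as [D0 _]. simpl INR in D0. rewrite Rmult_0_l, exp_0, Rmult_1_l in D0.
    simpl pow in D0. rewrite (sr_0 N HN), !Rmult_1_r in D0.
    destruct (Hd j t 0 ltac:(bound)) as [Dj _]. set (E := exp (- (al * Rabs t))) in *. have HEp : 0 < E by apply exp_pos.
    have Hnj : 0 < nu N n ^ j by bound.
    have HBn : 1 <= B ^ n by (apply pow_R1_Rle, HB).
    step (apply Rmult_le_compat_r; [bound|exact Hxt]).
    rewrite !Rmult_assoc. apply Rmult_le_compat_l; [bound|].
    rewrite Rmult_plus_distr_r, Rmult_1_l.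
    have T1 : C0 * E <= C0 * (B ^ n * E).
    { apply Rmult_le_compat_l; [lra|]. rewrite <- (Rmult_1_l E) at 1. bound. }
    have T2 : exp (INR j * t) / nu N n ^ j * Cmod (ee (mkC t 0)) <= C0 * (B ^ n * E).
    { times (nu N n ^ j); auto.
      replace (exp (INR j * t) / nu N n ^ j * Cmod (ee (mkC t 0)) * nu N n ^ j) with
        (exp (INR j * t) * Cmod (ee (mkC t 0))) by bound.
      step exact Dj.
      replace (C0 * (B ^ n * E) * nu N n ^ j) with (C0 * (B ^ n * nu N n ^ j) * E) by ring.
      bound. }
    lra. }
  have Q := Iinf_bound _ _ _ Hdm.
  through (2 * (exp (c * x) * (2 * C0 * B ^ n)) / al * exp (- (c * x))).
  { bound. }
  right. unfold K0. rewrite exp_Ropp. field. bound. }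
have Hnn : 0 < nu N n ^ n by bound.
have HH0 : Cmod (H 0%C) = m n / nu N n ^ n.
{ rewrite H0, Cmod_R, Rabs_pos_eq; [bound|]. bound. }
have HH1 : Cmod (H 1%C) = m (S n) / nu N n ^ (S n).
{ rewrite H1, Cmod_R, Rabs_pos_eq; [bound|]. left. apply Rdiv_lt_0_compat; auto. bound. }
set (K := ln C1 + INR n * ln D).
have HKe : exp K = C1 * D ^ n.
{ unfold K. rewrite exp_plus, exp_INR_mult, !exp_ln by lra. reflexivity. }
have HKb : K0 * B ^ n <= exp K * (m n / nu N n ^ n).
{ have Lo := proj1 (Hcmp n). have Np := nu_pow_le N HN Ag n Hmg.
  times (nu N n ^ n); auto.
  replace (exp K * (m n / nu N n ^ n) * nu N n ^ n) with (exp K * m n) by bound.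
  through (K0 * B ^ n * (Ag ^ (n + n) * (Am ^ S n * m n))).
  - apply Rmult_le_compat_l; [bound|].
    step exact Np. bound.
  - rewrite HKe. unfold C1, D.
    replace (K0 * B ^ n * (Ag ^ (n + n) * (Am ^ S n * m n))) with
      (K0 * Am * ((Am * Ag ^ 2 * B) ^ n * m n)).
    + rewrite Rmult_assoc. rewrite !Rmult_assoc. bound.
    + rewrite !Rpow_mult_distr, <- pow_mult, pow_add. simpl (Am ^ S n).
      replace (2 * n)%nat with (n + n)%nat by lia. rewrite pow_add. ring. }
have HKp : 0 <= K by (unfold K; assert (0 <= INR n * ln D) by bound; lra).
destruct (zero_free_ratio H (INR n / 2) K ltac:(lra) HKp Hhol Hnz) as [R1 R2].
{ intros z Hz. rewrite HH0. step apply Hup, Hz. bound. }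
have HLK : 8 * K / (INR n / 2) <= L.
{ times (INR n / 2); [lra|].
  unfold Rdiv at 1. rewrite Rmult_assoc, Rinv_l, Rmult_1_r by lra. unfold K, L. nra. }
rewrite HH0, HH1 in R1, R2.
have HnS : 0 < nu N n ^ S n by bound.
have Ea : m n / nu N n ^ n * nu N n ^ S n = nu N n * m n by (simpl; field; lra).
have Eb : m (S n) / nu N n ^ S n * nu N n ^ S n = m (S n) by bound.
split.
- rewrite <- Ea, <- Eb, <- Rmult_assoc. apply Rmult_le_compat_r; [lra|].
  eapply Rle_trans; [|exact R1]. bound.
- rewrite <- Ea, <- Eb, <- Rmult_assoc. apply Rmult_le_compat_r; [lra|].
  step exact R2. bound.
Qed.

Lemma moment_ratio : exists A, 1 <= A /\ forall n, nu N n <= A * (m (S n) / m n) /\ m (S n) / m n <= A * nu N n.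
Proof.
destruct moment_ratio_large as [L HL].
destruct (finite_bound (fun n => nu N n * m n / m (S n)) 9) as [B1 [HB1 H1]].
destruct (finite_bound (fun n => m (S n) / m n / nu N n) 9) as [B2 [HB2 H2]].
have HeL := exp_pos L.
exists (B1 + B2 + exp L). split; [lra|]. intros n.
have Hnu := nu_pos N HN n. have Hm0 := Hm n. have Hm1 := Hm (S n).
have Hr : 0 < m (S n) / m n by bound.
have E : nu N n <= (B1 + exp L) * (m (S n) / m n) /\ m (S n) / m n <= (B2 + exp L) * nu N n.
{ destruct (le_lt_dec 9 n) as [Hn|Hn].
  - destruct (HL n Hn) as [P1 P2]. split.
    + through (exp L * (m (S n) / m n)).
      * times (exp (- L) * m n); [bound|].
        replace (exp L * (m (S n) / m n) * (exp (- L) * m n)) with (exp L * exp (- L) * m (S n)) by bound.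
        rewrite <- exp_plus. replace (L + - L) with 0 by ring. rewrite exp_0. lra.
      * bound.
    + through (exp L * nu N n); [|bound].
      bound.
  - specialize (H1 n Hn). specialize (H2 n Hn). cbv beta in H1, H2. split.
    + through (B1 * (m (S n) / m n)); [|bound].
      apply Rmult_le_compat_r with (r := m (S n) / m n) in H1; [|lra].
      replace (nu N n * m n / m (S n) * (m (S n) / m n)) with (nu N n) in H1 by bound. exact H1.
    + through (B2 * nu N n); [|bound].
      apply Rmult_le_compat_r with (r := nu N n) in H2; [|lra].
      replace (m (S n) / m n / nu N n * nu N n) with (m (S n) / m n) in H2 by bound. exact H2. }
destruct E as [P1 P2]. split.
- step exact P1. bound.
- step exact P2. bound.
Qed.

End Moments.

Lemma moment_sequence_growth N m : moment_sequence N m -> (forall n, 0 < m n) ->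
  exists A, 1 <= A /\ forall n, N n <= A ^ S n * m n /\ m n <= A ^ S n * N n /\
    nu N n <= A * (m (S n) / m n) /\ m (S n) / m n <= A * nu N n.
Proof.
intros [HN [Hpo [Hom [e [E [me [HK Hme]]]]]]] Hm.
have KD := strong_kernel_data N e E me HN Hpo Hom HK.
have ED := strong_entire_data N e E me 0 HN Hpo Hom HK.
have E1 : (fun n => me (RtoC (INR n))) = (fun n => RtoC (m n)).
{ apply functional_extensionality. exact Hme. }
have E2 : (fun n => / me (RtoC (INR (n + 0))))%C = (fun n => / RtoC (m n))%C.
{ extensionality n. rewrite Nat.add_0_r, Hme. reflexivity. }
rewrite E1 in KD. rewrite E2 in ED.
destruct (moments_comparable N _ _ m _ HN KD ED Hm) as [A1 [HA1 H1]].
destruct (moment_ratio N _ _ m _ HN KD ED Hm) as [A2 [HA2 H2]].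
set (A := Rmax A1 A2). have Q1 : A1 <= A by apply Rmax_l. have Q2 : A2 <= A by apply Rmax_r.
exists A. split; [lra|]. intros n. destruct (H1 n) as [P1 P2], (H2 n) as [P3 P4].
have Hmn := Hm n.
have Hr : 0 < m (S n) / m n by (apply Rdiv_lt_0_compat; auto).
repeat split.
- step exact P1. bound.
- step exact P2. bound.
- step exact P3. bound.
- step exact P4. bound.
Qed.

(** * Quantitative summability *)

(** Summability of a scalar series along [d] with all parameters explicit: the
    Borel sum lives on a sector of opening [theta] together with a disc of radius
    [rho], and is bounded there by [Q * G (|z| / K)]. *)
Definition BS (N m : nat -> R) (d theta rho K Q : R) (u : nat -> C) : Prop :=
  exists g, holo (sdomain d theta rho) g /\
    (forall z, sdomain d theta rho z -> Cmod (g z) <= Q * G N (Cmod z / K)) /\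
    (forall z, Cmod z < rho -> ps (fun l => / RtoC (m l) * u l)%C z (g z)).

Lemma BS_weaken N m d theta rho K Q theta' rho' K' Q' u : strongly_regular N ->
  theta' <= theta -> rho' <= rho -> 0 < K' <= K -> 0 <= Q <= Q' ->
  BS N m d theta rho K Q u -> BS N m d theta' rho' K' Q' u.
Proof.
intros HN Ht Hr HK HQ [g [H1 [H2 H3]]]. exists g. split; [|split].
- apply (holo_sub (sdomain d theta rho)); auto. intros z. apply sdomain_mono; auto.
- intros z Hz. step (apply H2; eapply sdomain_mono; eauto).
  bound.
- intros z Hz. apply H3. lra.
Qed.

Lemma BS_ext N m d theta rho K Q u u' : (forall l, u l = u' l) ->
  BS N m d theta rho K Q u -> BS N m d theta rho K Q u'.
Proof.
intros E [g [H1 [H2 H3]]]. exists g. split; [auto|]. split; [auto|].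
intros z Hz. apply (ps_ext (fun l => / RtoC (m l) * u l)%C); auto. intros l. rewrite E. reflexivity.
Qed.

Lemma BS_zero N m d theta rho K : BS N m d theta rho K 0 (fun _ => RtoC 0).
Proof.
exists (fun _ => RtoC 0). split; [apply holo_const|]. split.
- intros z _. rewrite Cmod_0. lra.
- intros z _. apply (Clim_ext (fun _ => RtoC 0)); [|apply Clim_const].
  intros n. transitivity (Csum (fun _ => RtoC 0) n); [symmetry; apply Csum_zero|]. apply Csum_ext. intros j _. ring.
Qed.

Lemma BS_plus N m d theta rho K Q Q' u u' : BS N m d theta rho K Q u -> BS N m d theta rho K Q' u' ->
  BS N m d theta rho K (Q + Q') (fun l => u l + u' l)%C.
Proof.
intros [g [H1 [H2 H3]]] [g' [H1' [H2' H3']]]. exists (fun z => g z + g' z)%C. split; [apply holo_plus; auto|]. split.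
- intros z Hz. step apply Cmod_triangle. rewrite Rmult_plus_distr_r.
  bound.
- intros z Hz. apply (ps_ext (fun l => / RtoC (m l) * u l + / RtoC (m l) * u' l)%C); [intros; cbv beta; ring|].
  apply ps_plus; auto.
Qed.

Lemma BS_scal N m d theta rho K Q c u : BS N m d theta rho K Q u ->
  BS N m d theta rho K (Cmod c * Q) (fun l => c * u l)%C.
Proof.
intros [g [H1 [H2 H3]]]. exists (fun z => c * g z)%C. split; [apply holo_scal; auto|]. split.
- intros z Hz. rewrite Cmod_mult, Rmult_assoc. bound.
- intros z Hz. apply (ps_ext (fun l => c * (/ RtoC (m l) * u l))%C); [intros; cbv beta; ring|].
  apply ps_scal; auto.
Qed.

Fixpoint Rsum (u : nat -> R) (n : nat) : R := match n with O => 0 | S n => Rsum u n + u n end.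

Lemma BS_Csum N m d theta rho K (Q : nat -> R) (u : nat -> nat -> C) n :
  (forall i, (i < n)%nat -> BS N m d theta rho K (Q i) (u i)) ->
  BS N m d theta rho K (Rsum Q n) (fun l => Csum (fun i => u i l) n).
Proof.
induction n as [|n IH]; intros H; simpl.
- apply BS_zero.
- apply BS_plus; auto.
Qed.

Lemma moment_sequence_neq_0 N m n : moment_sequence N m -> RtoC (m n) <> 0%C.
Proof.
intros [_ [_ [_ [e [E [me [HK Hme]]]]]]]. rewrite <- Hme. apply (km_neq0 _ _ _ _ HK).
Qed.

(** The change of moment sequence is done by the kernel of [N, m] for the Laplace
    part and by that of [N, m'] for the Borel part. *)
Lemma moment_operator N m m' d theta rho K k : moment_sequence N m -> moment_sequence N m' ->
  0 < theta -> 0 < rho -> 0 < K ->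
  exists theta' rho' K' C0 A, 0 < theta' <= theta /\ 0 < rho' /\ 0 < K' /\ 0 < C0 /\ 0 < A /\
  forall u Q, 0 <= Q -> BS N m d theta rho K Q u -> forall n, exists h,
    holo (sdomain d theta' rho') h /\
    (forall z, sdomain d theta' rho' z -> Cmod (h z) <= C0 * (A ^ n * N n) * Q * G N (Cmod z / K')) /\
    (forall z, Cmod z < rho' -> ps (fun l => / RtoC (m' (l + k)%nat) * u (l + n)%nat)%C z (h z)).
Proof.
intros Hm Hm' Ht Hr HK0.
destruct (Hm) as [HN [Hpo [Hom [e [E [me [HK Hme]]]]]]].
destruct (Hm') as [_ [_ [_ [e' [E' [me' [HK' Hme']]]]]]].
have KD := strong_kernel_data N e E me HN Hpo Hom HK.
have ED := strong_entire_data N e' E' me' k HN Hpo Hom HK'.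
destruct (multiplier_operator N _ _ _ _ _ d theta rho K HN KD ED Ht Hr HK0)
  as [theta' [rho' [K' [C0 [A [P1 [P2 [P3 [P4 [P5 H]]]]]]]]]].
exists theta', rho', K', C0, A. repeat (split; [bound|]).
intros u Q HQ [g [H1 [H2 H3]]] n.
destruct (H g _ Q HQ H1 H2 H3 n) as [h [R1 [R2 R3]]].
exists h. split; [bound|]. split; [bound|]. intros z Hz.
eapply ps_ext; [|apply R3, Hz]. intros l. cbv beta. unfold kappa. rewrite Hme, Hme'.
field. split; eapply moment_sequence_neq_0; eauto.
Qed.

(** The factor [N n] comes from the kernel integrals with weight [t ^ n]. *)
Lemma BS_shift N m m' d theta rho K : moment_sequence N m -> moment_sequence N m' ->
  0 < theta -> 0 < rho -> 0 < K ->
  exists theta' rho' K' C0 A, 0 < theta' <= theta /\ 0 < rho' /\ 0 < K' /\ 0 < C0 /\ 0 < A /\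
  forall u Q, 0 <= Q -> BS N m d theta rho K Q u -> forall n,
    BS N m' d theta' rho' K' (C0 * (A ^ n * N n) * Q) (fun l => u (l + n)%nat).
Proof.
intros Hm Hm' Ht Hr HK0.
destruct (moment_operator N m m' d theta rho K 0 Hm Hm' Ht Hr HK0)
  as [theta' [rho' [K' [C0 [A [P1 [P2 [P3 [P4 [P5 H]]]]]]]]]].
exists theta', rho', K', C0, A. repeat (split; [bound|]).
intros u Q HQ Hu n. destruct (H u Q HQ Hu n) as [h [R1 [R2 R3]]].
exists h. split; [bound|]. split; [bound|]. intros z Hz.
eapply ps_ext; [|apply R3, Hz]. intros l. cbv beta. rewrite Nat.add_0_r. reflexivity.
Qed.

Lemma ps_mul_pow c z l k : ps c z l -> ps (fun j => if (j <? k)%nat then RtoC 0 else c (j - k)%nat) z (z ^ k * l)%C.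
Proof.
intros H. unfold ps. apply (Clim_incr _ _ k).
apply (Clim_ext (fun n => z ^ k * Csum (fun j => c j * z ^ j)%C n)%C); [|apply Clim_scal, H].
intros n. rewrite Nat.add_comm, Csum_add.
replace (Csum (fun j => (if (j <? k)%nat then RtoC 0 else c (j - k)%nat) * z ^ j)%C k) with (RtoC 0).
- rewrite Cplus_0_l, <- Csum_scal. apply Csum_ext. intros j _.
  destruct (Nat.ltb_spec (k + j) k); [lia|]. replace (k + j - k)%nat with j by lia.
  rewrite Cpow_add. ring.
- transitivity (Csum (fun _ => RtoC 0) k); [symmetry; apply Csum_zero|]. apply Csum_ext. intros j Hj.
  destruct (Nat.ltb_spec j k); [ring|lia].
Qed.

Lemma BS_mul_pow N m m' d theta rho K k : moment_sequence N m -> moment_sequence N m' ->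
  0 < theta -> 0 < rho -> 0 < K ->
  exists theta' rho' K' C0, 0 < theta' <= theta /\ 0 < rho' /\ 0 < K' /\ 0 < C0 /\
  forall u Q, 0 <= Q -> BS N m d theta rho K Q u ->
    BS N m' d theta' rho' K' (C0 * Q) (fun l => if (l <? k)%nat then RtoC 0 else u (l - k)%nat).
Proof.
intros Hm Hm' Ht Hr HK0. have HN := proj1 Hm.
destruct (moment_operator N m m' d theta rho K k Hm Hm' Ht Hr HK0)
  as [theta' [rho' [K' [C0 [A [P1 [P2 [P3 [P4 [P5 H]]]]]]]]]].
destruct (mg_const N HN) as [Ag [HAg Hmg]].
have HKk : 0 < K' ^ k by bound.
exists theta', rho', (K' / Ag), (C0 * (K' ^ k * N k)).
split; [bound|]. split; [bound|]. split; [bound|].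
split; [bound|].
intros u Q HQ Hu. destruct (H u Q HQ Hu 0%nat) as [h [R1 [R2 R3]]].
exists (fun z => z ^ k * h z)%C. split; [|split].
- apply holo_mult; auto. intros z _. eexists. apply Cder_pow.
- intros z Hz. rewrite Cmod_mult, Cmod_pow. specialize (R2 z Hz).
  simpl pow in R2. rewrite (sr_0 N HN), !Rmult_1_r in R2.
  have Hzk : 0 <= Cmod z / K' by bound.
  have Q1 := G_ge N HN (Cmod z / K') k Hzk.
  have Q2 := G_square N HN Ag HAg Hmg (Cmod z / K') Hzk.
  replace (Ag * (Cmod z / K')) with (Cmod z / (K' / Ag)) in Q2 by bound.
  have Q3 : Cmod z ^ k <= K' ^ k * N k * G N (Cmod z / K').
  { replace (Cmod z ^ k) with (K' ^ k * (Cmod z / K') ^ k).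
    - rewrite Rmult_assoc. bound.
    - unfold Rdiv. rewrite Rpow_mult_distr, pow_inv. field. lra. }
  through (K' ^ k * N k * G N (Cmod z / K') * (C0 * Q * G N (Cmod z / K'))).
  + bound.
  + replace (K' ^ k * N k * G N (Cmod z / K') * (C0 * Q * G N (Cmod z / K'))) with
      (C0 * (K' ^ k * N k) * Q * (G N (Cmod z / K') * G N (Cmod z / K'))) by ring.
    bound.
- intros z Hz. eapply ps_ext; [|apply (ps_mul_pow (fun l => / RtoC (m' (l + k)%nat) * u (l + 0)%nat)%C z (h z) k), R3, Hz].
  intros l. cbv beta. destruct (Nat.ltb_spec l k); [ring|].
  replace (l - k + k)%nat with l by lia. rewrite Nat.add_0_r. reflexivity.
Qed.

(** * Summable series with coefficients in a Banach space *)

Record functional {V : NormedModule C_AbsRing} (c : R) (ell : V -> C) : Prop := {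
  fl_plus : forall a b, ell (plus a b) = (ell a + ell b)%C;
  fl_scal : forall (x : C) a, ell (scal (x : C_AbsRing) a) = (x * ell a)%C;
  fl_nonneg : 0 <= c;
  fl_bound : forall a, Cmod (ell a) <= c * norm a
}.

Lemma fl_minus {V : NormedModule C_AbsRing} c (ell : V -> C) (a b : V) : functional c ell ->
  ell (minus a b) = (ell a - ell b)%C.
Proof.
intros H. unfold minus. rewrite (fl_plus _ _ H).
replace (opp b) with (scal (RtoC (- (1)) : C_AbsRing) b).
- rewrite (fl_scal _ _ H). bound.
- etransitivity; [|apply (@scal_opp_one C_Ring (NormedModule.ModuleSpace C_AbsRing V) b)].
  f_equal. bound.
Qed.

Lemma is_pseries_eps {V : NormedModule C_AbsRing} (u : nat -> V) (z : C) (l : V) :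
  is_pseries (K := C_AbsRing) u z l <->
  forall eps, 0 < eps -> exists N, forall n, (N <= n)%nat ->
    norm (minus (sum_n (fun k => scal ((z ^ k)%C : C_AbsRing) (u k)) n) l) < eps.
Proof.
unfold is_pseries, is_series.
split.
- intros H0 eps He. have H := proj1 (filterlim_locally_ball_norm (K := C_AbsRing) (U := V) _ _) H0.
  destruct (H (mkposreal eps He)) as [N HN]. exists N. bound.
- intros H. apply (filterlim_locally_ball_norm (K := C_AbsRing) (U := V)).
  intros eps. destruct (H eps (cond_pos eps)) as [N HN]. exists N. bound.
Qed.

Lemma fl_sum_n {V : NormedModule C_AbsRing} c (ell : V -> C) (u : nat -> V) n : functional c ell ->
  ell (sum_n u n) = Csum (fun k => ell (u k)) (S n).
Proof.
intros H. induction n as [|n IH].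
- rewrite sum_O. simpl. ring.
- rewrite sum_Sn, (fl_plus _ _ H), IH. reflexivity.
Qed.

Lemma fl_ps {V : NormedModule C_AbsRing} c (ell : V -> C) (u : nat -> V) z l : functional c ell ->
  is_pseries (K := C_AbsRing) u z l -> ps (fun k => ell (u k)) z (ell l).
Proof.
intros H Hu. rewrite is_pseries_eps in Hu. intros eps He.
have Hc := fl_nonneg _ _ H.
destruct (Hu (eps / (c + 1)) ltac:(bound)) as [N HN].
exists (S N). intros [|n] Hn; [lia|].
replace (Csum (fun j => ell (u j) * z ^ j)%C (S n)) with
  (ell (sum_n (fun k => scal ((z ^ k)%C : C_AbsRing) (u k)) n)).
- rewrite <- (fl_minus c) by bound. step apply (fl_bound _ _ H).
  specialize (HN n ltac:(lia)).
  through (c * (eps / (c + 1))); [apply Rmult_le_compat_l; [bound|left; exact HN]|].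
  times (c + 1); [lra|]. field_simplify; [|lra]. nra.
- etransitivity; [apply (fl_sum_n c ell _ n H)|]. apply Csum_ext. intros k _. rewrite (fl_scal _ _ H). ring.
Qed.

Lemma fl_Cder {V : NormedModule C_AbsRing} c (ell : V -> C) (g : C -> V) z : functional c ell ->
  ex_derive (K := C_AbsRing) g z -> exists l, Cder (fun y => ell (g y)) z l.
Proof.
intros H [l Hl]. exists (ell l). rewrite is_derive_eps in Hl. have Hc := fl_nonneg _ _ H.
intros eps He. destruct (Hl (eps / (c + 1)) ltac:(bound)) as [d [Hd Hd']].
exists d. split; [bound|]. intros y Hy. specialize (Hd' y Hy).
replace (ell (g y) - ell (g z) - ell l * (y - z))%C with
  (ell (minus (minus (g y) (g z)) (scal ((y - z)%C : C_AbsRing) l))).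
- step apply (fl_bound _ _ H). have Hy0 := Cmod_ge_0 (y - z).
  through (c * (eps / (c + 1) * Cmod (y - z))); [bound|].
  rewrite <- Rmult_assoc. apply Rmult_le_compat_r; auto.
  times (c + 1); [lra|]. field_simplify; [|lra]. nra.
- rewrite !(fl_minus c) by bound. rewrite (fl_scal _ _ H). ring.
Qed.

Lemma increment_minus (A : AbelianGroup) (a t l : A) : minus (minus (plus a t) l) (minus a l) = t.
Proof.
transitivity (plus (minus (plus a t) l) (minus l a)).
{ unfold minus at 1. apply f_equal, opp_minus. }
transitivity (minus (plus a t) a); [symmetry; apply minus_trans|].
transitivity (plus t (plus a (opp a))).
{ unfold minus. rewrite (plus_comm a t). symmetry. apply plus_assoc. }
transitivity (plus t zero); [apply f_equal, plus_opp_r|apply plus_zero_r].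
Qed.

Lemma pseries_terms_bounded {V : NormedModule C_AbsRing} (u : nat -> V) (z : C) (l : V) :
  is_pseries (K := C_AbsRing) u z l ->
  exists B, 0 <= B /\ forall n, norm (scal ((z ^ n)%C : C_AbsRing) (u n)) <= B.
Proof.
rewrite is_pseries_eps. intros H. destruct (H 1 Rlt_0_1) as [N HN].
set (t := fun k => scal ((z ^ k)%C : C_AbsRing) (u k)) in *.
destruct (finite_bound (fun n => norm (t n)) (S N)) as [B [HB HB2]].
exists (B + 2). split; [lra|]. intros n. change (norm (t n) <= B + 2).
destruct (le_lt_dec n N) as [Hn|Hn].
- specialize (HB2 n ltac:(lia)). bound.
- destruct n as [|n]; [lia|].
  have E : t (S n) = minus (minus (sum_n t (S n)) l) (minus (sum_n t n) l).
  { rewrite sum_Sn. symmetry. apply (increment_minus (NormedModule.AbelianGroup C_AbsRing V)). }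
  rewrite E. unfold minus at 1. step apply norm_triangle.
  step (apply Rplus_le_compat_l; right; apply norm_opp).
  have Q1 := HN (S n) ltac:(lia). have Q2 := HN n ltac:(lia). lra.
Qed.

(** A functional commutes with sums and derivatives, so it maps Borel sums to Borel
    sums; its norm enters the bound as a factor, and the other parameters come from
    the given series alone. *)
Lemma summable_functional {V : NormedModule C_AbsRing} N d (v : nat -> V) : summable N d v ->
  exists m theta rho K Q, moment_sequence N m /\ 0 < theta <= 2 * PI /\ 0 < rho /\ 0 < K /\ 0 < Q /\
  forall c (ell : V -> C), functional c ell -> BS N m d theta rho K (c * Q) (fun l => ell (v l)).
Proof.
intros [m [Hm [g [theta [r [Hth [Hr [Hg [Hgr [r0 [Hr0 Hps]]]]]]]]]]].
have HN := proj1 Hm.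
destruct (Hgr (theta / 2) ltac:(lra)) as [cg [K [Hcg [HK Hgb]]]].
set (rho0 := Rmin r r0 / 2).
have HR : 0 < Rmin r r0 by bound.
have Hrho0 : 0 < rho0 by (unfold rho0; lra).
have Hl1 : rho0 < r by (unfold rho0; have Q := Rmin_l r r0; lra).
have Hl2 : rho0 < r0 by (unfold rho0; have Q := Rmin_r r r0; lra).
have Hmr : Cmod (RtoC rho0) = rho0 by (rewrite Cmod_R; apply Rabs_pos_eq; lra).
destruct (pseries_terms_bounded _ _ _ (Hps (RtoC rho0) ltac:(unfold Defs.disc; rewrite Hmr; lra))) as [B [HB HBt]].
exists m, (theta / 2), (rho0 / 2), K, (cg + 2 * B). split; [bound|].
split; [lra|]. split; [lra|]. split; [bound|]. split; [lra|].
intros c ell Hell. have Hc := fl_nonneg _ _ Hell.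
have Hco : forall l, ell (borel m v l) = (/ RtoC (m l) * ell (v l))%C.
{ intros l. unfold borel. rewrite (fl_scal _ _ Hell), RtoC_inv; [bound|].
  intros E. apply (moment_sequence_neq_0 N m l Hm). rewrite E. reflexivity. }
have Hpsl : forall z, Cmod z < r0 -> ps (fun l => / RtoC (m l) * ell (v l))%C z (ell (g z)).
{ intros z Hz. eapply ps_ext; [apply Hco|]. apply (fl_ps c ell (borel m v)); auto. }
have Hcb : forall l, Cmod (/ RtoC (m l) * ell (v l)) <= (c * B) / rho0 ^ l.
{ intros l. rewrite <- Hco. have Hp : 0 < rho0 ^ l by bound.
  times (rho0 ^ l); auto.
  replace (c * B / rho0 ^ l * rho0 ^ l) with (c * B) by bound.
  replace (Cmod (ell (borel m v l)) * rho0 ^ l) with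
    (Cmod (ell (scal ((RtoC rho0 ^ l)%C : C_AbsRing) (borel m v l)))).
  - step apply (fl_bound _ _ Hell). bound.
  - rewrite (fl_scal _ _ Hell), Cmod_mult, Cmod_pow, Hmr. ring. }
exists (fun z => ell (g z)). split; [|split].
- intros z Hz. apply (fl_Cder c); auto. apply Hg. destruct Hz as [Hz|Hz].
  + left. apply sector_log in Hz. apply sector_log. destruct Hz as [y [E Hy]]. exists y. bound.
  + right. unfold Defs.disc. lra.
- intros z Hz.
  destruct Hz as [Hz|Hz].
  + step apply (fl_bound _ _ Hell). specialize (Hgb z Hz). fold (G N (Cmod z / K)) in Hgb.
    rewrite Rmult_assoc. apply Rmult_le_compat_l; auto.
    assert (0 <= 2 * B * G N (Cmod z / K)) by bound. lra.
  + have HcB : 0 <= c * B by bound.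
    rewrite <- (PSum_spec _ _ _ (Hpsl z ltac:(lra))).
    step (apply (PSum_bound _ (c * B) rho0); auto; lra).
    have Hq : Cmod z / rho0 <= / 2.
    { bound. }
    through (c * B * 2).
    { unfold Rdiv at 1. apply Rmult_le_compat_l; auto. replace 2 with (/ / 2) by field.
      bound. }
    rewrite !Rmult_assoc. apply Rmult_le_compat_l; auto.
    assert (cg * 1 <= cg * G N (Cmod z / K)) by bound.
    assert (2 * B * 1 <= 2 * B * G N (Cmod z / K)) by bound.
    bound.
- intros z Hz. apply Hpsl. lra.
Qed.

Lemma functional_id : functional (V := C_NormedModule) 1 (fun z => z).
Proof.
constructor; try reflexivity; [lra|]. intros a. rewrite Rmult_1_l. apply Rle_refl.
Qed.

Lemma BS_summable N m d theta rho K Q u : moment_sequence N m -> 0 < theta <= 2 * PI -> 0 < rho ->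
  0 < K -> 0 <= Q -> BS N m d theta rho K Q u -> summable (V := C_NormedModule) N d u.
Proof.
intros Hm Ht Hr HK HQ [g [H1 [H2 H3]]]. exists m. split; [bound|].
exists g, theta, rho. split; [bound|]. split; [bound|]. split; [|split].
- apply holomorphic_on_holo. exact H1.
- intros theta' Ht'. exists (Q + 1), K. split; [lra|]. split; [bound|]. intros z Hz.
  through (Q * G N (Cmod z / K)).
  + apply H2. left. apply sector_log in Hz. apply sector_log. destruct Hz as [y [E Hy]]. exists y. bound.
  + apply Rmult_le_compat_r; [bound|lra].
- exists rho. split; [bound|]. intros z Hz. apply is_pseries_ps.
  eapply ps_ext; [|apply H3, Hz]. intros l. unfold borel. change (/ RtoC (m l) * u l = RtoC (/ m l) * u l)%C.
  rewrite RtoC_inv; [bound|].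
  intros E. apply (moment_sequence_neq_0 N m l Hm). rewrite E. reflexivity.
Qed.

(** * Bounded holomorphic coefficients *)

Lemma bhol_ball0 r (f : bhol r) : holo (ball0 r) f.
Proof. apply holomorphic_on_holo. apply bhol_holo. Qed.

(** Taylor coefficients by Cauchy's integral, which makes them functionals of norm at
    most [(2 / r) ^ n]. *)
Definition bcoef {r} (n : nat) (f : bhol r) : C := coef f (ln (r / 2)) n.

Lemma bcoef_functional r n : 0 < r -> functional (V := bhol_NormedModule r) ((2 / r) ^ n) (@bcoef r n).
Proof.
intros Hr. have He : exp (ln (r / 2)) = r / 2 by (apply exp_ln; lra).
have Hlt : exp (ln (r / 2)) < r by lra. have HPI := PI_RGT_0.
constructor.
- intros f g. unfold bcoef, coef. rewrite <- Cmult_plus_distr_l. f_equal.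
  rewrite <- CI_plus.
  + apply CI_ext; [lra|]. intros t _.
    bound.
  + lra.
  + intros t _. apply (cts_coef_integrand f r); [apply bhol_ball0|bound].
  + intros t _. apply (cts_coef_integrand g r); [apply bhol_ball0|bound].
- intros x f. unfold bcoef, coef.
  rewrite (CI_ext _ (fun t => x * (f (circ (ln (r / 2)) t) * / (circ (ln (r / 2)) t ^ n)))%C) by
    (try lra; intros t _;
     change ((x * f (circ (ln (r / 2)) t)) * / circ (ln (r / 2)) t ^ n =
       x * (f (circ (ln (r / 2)) t) * / circ (ln (r / 2)) t ^ n))%C; ring).
  rewrite CI_scal; [ring|lra|]. intros t _. apply (cts_coef_integrand f r); [apply bhol_ball0|bound].
- bound.
- intros f. unfold bcoef.
  step apply (coef_bound f r n _ (bhol_norm r f) (bhol_ball0 r f) Hlt).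
  + intros t. apply bhol_norm_le.
  + rewrite He. right. change (norm f) with (bhol_norm r f). unfold Rdiv.
    rewrite !Rpow_mult_distr, !pow_inv. field. bound.
Qed.

Lemma bcoef_sum r (f : bhol r) u n : 0 < r -> sum_near_0 (V := C_NormedModule) f u -> bcoef n f = u n.
Proof.
intros Hr [r0 [Hr0 H]]. unfold bcoef.
have He : exp (ln (r / 2)) = r / 2 by (apply exp_ln; lra).
have Hm : 0 < Rmin (r / 2) r0 by bound.
revert n. apply (ps_inj _ _ (Rmin (r / 2) r0) f Hm).
- intros z Hz. apply (Taylor_coef f r); [apply bhol_ball0|lra|].
  rewrite He. eapply Rlt_le_trans; [exact Hz|apply Rmin_l].
- intros z Hz. apply is_pseries_ps, H. eapply Rlt_le_trans; [exact Hz|apply Rmin_r].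
Qed.

Section Assembly.

Variables (r B : R).
Hypothesis Hr : 0 < r.
Hypothesis HB : 0 < B.
Hypothesis HrB : r * B <= / 2.

Definition geom_bounded (c : nat -> C) : Prop := exists K, 0 <= K /\ forall n, Cmod (c n) <= K * B ^ n.

Lemma geom_inv K n : K * B ^ n = K / (/ B) ^ n.
Proof. unfold Rdiv. rewrite pow_inv, Rinv_inv. reflexivity. Qed.

Lemma r_lt_inv : r < / B /\ forall z, Cmod z < r -> Cmod z / / B <= / 2.
Proof.
have Hi : 0 < / B by bound.
have Hr2 : r <= / 2 * / B.
{ times B; auto. rewrite Rmult_assoc, Rinv_l by lra. lra. }
split; [lra|]. intros z Hz. bound.
Qed.

(** The value 0 for sequences without a geometric bound makes this a function of the
    coefficients alone, without a convergence proof as an argument. *)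
Definition assembled_fun (c : nat -> C) (z : C) : C :=
  if excluded_middle_informative (geom_bounded c /\ Cmod z < r) then PSum c z else RtoC 0.

Lemma assembled_ps c z : geom_bounded c -> Cmod z < r -> ps c z (assembled_fun c z).
Proof.
intros Hc Hz. unfold assembled_fun. destruct excluded_middle_informative as [_|H]; [|tauto].
destruct Hc as [K [HK H]]. apply (PSum_ps c K (/ B)); auto.
- bound.
- intros n. rewrite <- geom_inv. auto.
- destruct r_lt_inv. lra.
Qed.

Lemma assembled_bound c K z : 0 <= K -> (forall n, Cmod (c n) <= K * B ^ n) ->
  Cmod (assembled_fun c z) <= 2 * K.
Proof.
intros HK H. unfold assembled_fun. destruct excluded_middle_informative as [[_ Hz]|_].
2:{ rewrite Cmod_0. lra. }
destruct r_lt_inv as [H1 H2]. specialize (H2 z Hz).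
step (apply (PSum_bound c K (/ B)); auto).
- bound.
- intros n. rewrite <- geom_inv. auto.
- lra.
- replace (2 * K) with (K * / / 2) by field. unfold Rdiv at 1. bound.
Qed.

Definition assembled (c : nat -> C) : bhol r.
Proof.
exists (assembled_fun c).
- apply holomorphic_on_holo. intros z Hz. unfold Defs.disc in Hz.
  destruct (classic (geom_bounded c)) as [Hc|Hc].
  + destruct (Hc) as [K [HK H]].
    destruct (PSum_holo c K (/ B) ltac:(bound) HK) with (z := z) as [l Hl].
    { intros n. rewrite <- geom_inv. auto. }
    { unfold ball0. destruct r_lt_inv. lra. }
    exists l. apply Cder_ext_loc with (PSum c); [|bound].
    destruct (Copen_ball0 r z Hz) as [e [He H']]. exists e. split; [bound|]. intros y Hy.
    apply PSum_spec, assembled_ps; auto. apply H', Hy.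
  + exists 0%C. apply (Cder_ext (fun _ => RtoC 0)); [|apply Cder_const].
    intros y. unfold assembled_fun. destruct excluded_middle_informative; [tauto|bound].
- destruct (classic (geom_bounded c)) as [[K [HK H]]|Hc].
  + exists (2 * K). intros z _. apply assembled_bound; auto.
  + exists 0. intros z _. unfold assembled_fun. destruct excluded_middle_informative; [tauto|].
    rewrite Cmod_0. lra.
- intros z Hz. unfold assembled_fun. destruct excluded_middle_informative as [[_ H]|_]; [|bound].
  exfalso. apply Hz, H.
Defined.

Lemma assembled_norm c K : 0 <= K -> (forall n, Cmod (c n) <= K * B ^ n) ->
  norm (assembled c) <= 2 * K.
Proof.
intros HK H. apply bhol_norm_lub; [lra|]. intros z _. apply assembled_bound; auto.
Qed.

Lemma geom_bounded_plus c c' : geom_bounded c -> geom_bounded c' -> geom_bounded (fun n => c n + c' n)%C.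
Proof.
intros [K [HK H]] [K' [HK' H']]. exists (K + K'). split; [lra|]. intros n.
step apply Cmod_triangle. rewrite Rmult_plus_distr_r. bound.
Qed.

Lemma geom_bounded_scal x c : geom_bounded c -> geom_bounded (fun n => x * c n)%C.
Proof.
intros [K [HK H]]. exists (Cmod x * K). split; [bound|].
intros n. rewrite Cmod_mult, Rmult_assoc. bound.
Qed.

Lemma assembled_out c z : ~ Cmod z < r -> assembled_fun c z = 0%C.
Proof.
intros Hz. unfold assembled_fun. destruct excluded_middle_informative; [tauto|bound].
Qed.

Lemma assembled_plus c c' : geom_bounded c -> geom_bounded c' ->
  plus (assembled c) (assembled c') = assembled (fun n => c n + c' n)%C.
Proof.
intros Hc Hc'. apply bhol_eq. intros z.
change ((assembled_fun c z + assembled_fun c' z)%C = assembled_fun (fun n => c n + c' n)%C z).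
destruct (classic (Cmod z < r)) as [Hz|Hz].
- apply (ps_unique (fun n => c n + c' n)%C z).
  + apply ps_plus; apply assembled_ps; auto.
  + apply assembled_ps; auto. apply geom_bounded_plus; auto.
- rewrite !assembled_out by bound. ring.
Qed.

Lemma assembled_scal (x : C) c : geom_bounded c ->
  scal (x : C_AbsRing) (assembled c) = assembled (fun n => x * c n)%C.
Proof.
intros Hc. apply bhol_eq. intros z.
change ((x * assembled_fun c z)%C = assembled_fun (fun n => x * c n)%C z).
destruct (classic (Cmod z < r)) as [Hz|Hz].
- apply (ps_unique (fun n => x * c n)%C z).
  + apply ps_scal; apply assembled_ps; auto.
  + apply assembled_ps; auto. apply geom_bounded_scal; auto.
- rewrite !assembled_out by bound. ring.
Qed.

Lemma assembled_minus c c' : geom_bounded c -> geom_bounded c' ->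
  minus (assembled c) (assembled c') = assembled (fun n => c n - c' n)%C.
Proof.
intros Hc Hc'. apply bhol_eq. intros z.
change ((assembled_fun c z + (RtoC (- 1) * assembled_fun c' z))%C = assembled_fun (fun n => c n - c' n)%C z).
destruct (classic (Cmod z < r)) as [Hz|Hz].
- apply (ps_unique (fun n => c n + RtoC (- 1) * c' n)%C z).
  + apply ps_plus; [|apply ps_scal]; apply assembled_ps; auto.
  + apply (ps_ext (fun n => c n - c' n)%C).
    { intros n. bound. }
    apply assembled_ps; auto.
    destruct (geom_bounded_plus c (fun n => RtoC (- 1) * c' n)%C Hc (geom_bounded_scal _ _ Hc')) as [K [HK H]].
    exists K. split; [bound|]. intros n. specialize (H n). cbv beta in H.
    replace (c n - c' n)%C with (c n + RtoC (- 1) * c' n)%C by bound. exact H.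
- rewrite !assembled_out by bound. ring.
Qed.

Lemma geom_bounded_minus c c' : geom_bounded c -> geom_bounded c' -> geom_bounded (fun n => c n - c' n)%C.
Proof.
intros Hc Hc'. destruct (geom_bounded_plus c _ Hc (geom_bounded_scal (- (1))%C c' Hc')) as [K [HK H]].
exists K. split; [bound|]. intros n. specialize (H n). cbv beta in H.
replace (c n - c' n)%C with (c n + - (1) * c' n)%C by ring. exact H.
Qed.

(** The Borel sum is put together from those of the coefficients in [z]. As
    [r * B <= / 2], estimates for the coefficients with constants geometric in [n]
    add up to estimates in the supremum norm. *)
Lemma assemble N m d theta rho K C0 (W : nat -> nat -> C) : moment_sequence N m ->
  0 < theta <= 2 * PI -> 0 < rho -> 0 < K -> 0 <= C0 ->
  (forall n, BS N m d theta rho K (C0 * B ^ n) (W n)) ->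
  exists v : nat -> bhol r, (forall l, sum_near_0 (V := C_NormedModule) (v l) (fun n => W n l)) /\
    summable N d v.
Proof.
intros Hm Hth Hrho HK HC0 HW. have HN := proj1 Hm.
destruct (fun_choice _ HW) as [g Hg].
have Hgb : forall z, sdomain d theta rho z -> forall n, Cmod (g n z) <= C0 * G N (Cmod z / K) * B ^ n.
{ intros z Hz n. destruct (Hg n) as [_ [H _]]. step apply H, Hz. bound. }
have HGp := fun t => G_pos N t.
have Hgg : forall z, sdomain d theta rho z -> geom_bounded (fun n => g n z).
{ intros z Hz. exists (C0 * G N (Cmod z / K)). bound. }
set (X := G N (rho / K)).
have Hcoef : forall n l, Cmod (/ RtoC (m l) * W n l) <= C0 * B ^ n * X / (3 * rho / 4) ^ l.
{ intros n l. destruct (Hg n) as [H1 [H2 H3]].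
  destruct (Taylor_unique (g n) rho rho (fun l => / RtoC (m l) * W n l)%C Hrho Hrho) as [_ T].
  - apply (holo_sub (sdomain d theta rho)); auto. intros z Hz. right. exact Hz.
  - bound.
  - apply (T (3 * rho / 4)); [lra|]. intros z Hz.
    step (apply H2; right; lra).
    apply Rmult_le_compat_l; [bound|].
    apply (G_mono N HN).
    + bound.
    + bound. }
have HX : 0 < X by apply HGp.
have HWg : forall l, geom_bounded (fun n => W n l).
{ intros l. have Hml := moment_sequence_neq_0 N m l Hm.
  exists (Cmod (RtoC (m l)) * (C0 * X / (3 * rho / 4) ^ l)). split.
  - bound.
  - intros n. replace (W n l) with (RtoC (m l) * (/ RtoC (m l) * W n l))%C by (field; exact Hml).
    rewrite Cmod_mult, Rmult_assoc. apply Rmult_le_compat_l; [bound|].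
    step apply Hcoef. bound. }
exists (fun l => assembled (fun n => W n l)). split.
{ intros l. exists r. split; [bound|]. intros z Hz. apply is_pseries_ps. apply assembled_ps; auto. }
exists m. split; [bound|].
exists (fun z => assembled (fun n => g n z)), theta, rho.
split; [bound|]. split; [bound|]. split; [|split].
- intros z0 Hz0. change (sdomain d theta rho z0) in Hz0.
  destruct (Copen_domain d theta rho z0 Hz0) as [e0 [He0 Hball]].
  set (e := Rmin e0 1). have He : 0 < e by (apply Rmin_pos; lra).
  have Hee0 : e <= e0 by apply Rmin_l. have He1 : e <= 1 by apply Rmin_r.
  set (X0 := C0 * G N ((Cmod z0 + 1) / K)).
  have HX0 : 0 <= X0 by (apply Rmult_le_pos; auto; left; apply HGp).
  have Hs : forall n, exists l, Cder (g n) z0 l /\ Cmod l <= 2 * (X0 * B ^ n) / e /\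
    forall h, Cmod h <= e / 4 -> Cmod (g n (z0 + h)%C - g n z0 - l * h) <= 8 * (X0 * B ^ n) / e ^ 2 * Cmod h ^ 2.
  { intros n. apply second_order; auto.
    - intros z Hz. apply Hg. apply Hball. lra.
    - intros z Hz. step (apply Hgb, Hball; lra).
      apply Rmult_le_compat_r; [bound|]. apply Rmult_le_compat_l; auto.
      apply (G_mono N HN).
      + bound.
      + apply Rmult_le_compat_r; [bound|].
        have Q := Cmod_triangle_inv z z0. lra. }
  destruct (fun_choice _ Hs) as [l Hl].
  have Hlg : geom_bounded l.
  { exists (2 * X0 / e). split; [bound|].
    intros n. destruct (Hl n) as [_ [H _]]. bound. }
  exists (assembled l). apply is_derive_eps. intros eps Heps.
  set (Y := 16 * X0 / e ^ 2).
  have HY : 0 <= Y by (apply Rmult_le_pos; [lra|bound]).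
  exists (Rmin (e / 4) (eps / (Y + 1))). split.
  { bound. }
  intros y Hy. set (h := (y - z0)%C) in *.
  have Q1 := Rmin_l (e / 4) (eps / (Y + 1)). have Q2 := Rmin_r (e / 4) (eps / (Y + 1)).
  have Hyd : sdomain d theta rho y by (apply Hball; fold h; lra).
  have Eq : minus (minus (assembled (fun n => g n y)) (assembled (fun n => g n z0)))
     (scal (h : C_AbsRing) (assembled l)) = assembled (fun n => g n y - g n z0 - h * l n)%C.
  { rewrite (assembled_scal h l Hlg). rewrite (assembled_minus _ _ (Hgg y Hyd) (Hgg z0 Hz0)).
    apply assembled_minus; [apply geom_bounded_minus; auto|apply geom_bounded_scal; auto]. }
  step (right; exact (f_equal norm Eq)).
  have Hh0 := Cmod_ge_0 h.
  step apply (assembled_norm _ (8 * X0 / e ^ 2 * Cmod h ^ 2)).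
  + bound.
  + intros n. destruct (Hl n) as [_ [_ H]]. specialize (H h ltac:(lra)).
    replace (z0 + h)%C with y in H by (unfold h; ring).
    replace (g n y - g n z0 - h * l n)%C with (g n y - g n z0 - l n * h)%C by ring.
    bound.
  + replace (2 * (8 * X0 / e ^ 2 * Cmod h ^ 2)) with (Y * Cmod h * Cmod h) by (unfold Y; field; lra).
    apply Rmult_le_compat_r; auto.
    through (Y * (eps / (Y + 1))); [bound|].
    times (Y + 1); [lra|]. field_simplify; [|lra]. nra.
- intros theta' Ht'. exists (2 * C0 + 1), K. split; [lra|]. split; [bound|]. intros z Hz.
  have Hzd : sdomain d theta rho z.
  { left. apply sector_log in Hz. apply sector_log. destruct Hz as [y [E Hy]]. exists y. bound. }
  have HG := HGp (Cmod z / K).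
  step apply (assembled_norm _ (C0 * G N (Cmod z / K))).
  + bound.
  + bound.
  + fold (G N (Cmod z / K)). bound.
- exists (rho / 2). split; [lra|]. intros z Hz. unfold Defs.disc in Hz. apply is_pseries_eps.
  intros eps Heps.
  have Hlim : is_lim_seq (fun n => 6 * (C0 * X) * (2 / 3) ^ n) 0 by (apply geom_lim; lra).
  apply is_lim_seq_spec in Hlim. destruct (Hlim (mkposreal eps Heps)) as [n0 Hn0].
  exists n0. intros n Hn. specialize (Hn0 (S n) ltac:(lia)). simpl pos in Hn0.
  rewrite Rminus_0_r in Hn0. apply Rabs_lt_between in Hn0.
  set (P := fun n j => Csum (fun k => (/ RtoC (m k) * W j k) * z ^ k)%C n).
  have HPg : forall n, geom_bounded (P n) /\
    (forall n', n = S n' -> sum_n (fun k => scal ((z ^ k)%C : C_AbsRing) (borel m (fun l => assembled (fun n => W n l)) k)) n' = assembled (P n)).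
  { have Ht : forall k, scal ((z ^ k)%C : C_AbsRing) (borel m (fun l => assembled (fun n => W n l)) k) =
      assembled (fun j => (/ RtoC (m k) * W j k) * z ^ k)%C /\
      geom_bounded (fun j => (/ RtoC (m k) * W j k) * z ^ k)%C.
    { intros k. split.
      - unfold borel. rewrite (assembled_scal (RtoC (/ m k))) by auto.
        rewrite assembled_scal by (apply geom_bounded_scal; auto). f_equal.
        extensionality j. rewrite RtoC_inv; [ring|].
        intros E. apply (moment_sequence_neq_0 N m k Hm). rewrite E. reflexivity.
      - destruct (geom_bounded_scal (/ RtoC (m k) * z ^ k)%C _ (HWg k)) as [K1 [HK1 H]].
        exists K1. split; auto. intros j. specialize (H j). cbv beta in H.
        replace (/ RtoC (m k) * W j k * z ^ k)%C with (/ RtoC (m k) * z ^ k * W j k)%C by ring. exact H. }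
    induction n1 as [|n1 [IH1 IH2]].
    - split; [|intros; lia]. exists 0. split; [lra|]. intros j. unfold P. simpl. rewrite Cmod_0. lra.
    - split.
      + apply (geom_bounded_plus (P n1)); [bound|apply Ht].
      + intros n' E. injection E as <-. destruct n1 as [|n1].
        * rewrite sum_O. rewrite (proj1 (Ht O)). f_equal. apply functional_extensionality.
          intros j. bound.
        * rewrite sum_Sn, (IH2 n1 eq_refl), (proj1 (Ht (S n1))).
          apply assembled_plus; [bound|apply Ht]. }
  destruct (HPg (S n)) as [HP1 HP2].
  have Hzd : sdomain d theta rho z by (right; lra).
  step (right; apply (f_equal norm); rewrite (HP2 n eq_refl); apply (assembled_minus _ _ HP1 (Hgg z Hzd))).
  apply Rle_lt_trans with (2 * (3 * (C0 * X) * (2 / 3) ^ S n)); [|lra].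
  apply assembled_norm.
  { bound. }
  intros j.
  have HK2 : 0 <= C0 * B ^ j * X by bound.
  destruct (bounds_ps (fun k => / RtoC (m k) * W j k)%C (C0 * B ^ j * X) (3 * rho / 4) z ltac:(lra) HK2 (Hcoef j) ltac:(lra))
    as [l [Hl1 Hl2]].
  destruct (Hg j) as [_ [_ H3]]. rewrite <- (ps_unique _ _ _ _ Hl1 (H3 z ltac:(lra))).
  step apply (Hl2 (S n)).
  have Hq : 0 <= Cmod z / (3 * rho / 4) <= 2 / 3.
  { bound. }
  set (q := Cmod z / (3 * rho / 4)) in *.
  have Hqn : q ^ S n <= (2 / 3) ^ S n by bound.
  have Hq0 : 0 <= q ^ S n by bound.
  have Hi : / (1 - q) <= 3.
  { replace 3 with (/ / 3) by field. bound. }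
  replace (3 * (C0 * X) * (2 / 3) ^ S n * B ^ j) with (C0 * B ^ j * X * 3 * (2 / 3) ^ S n) by ring.
  apply Rmult_le_compat; auto.
  + bound.
  + apply Rmult_le_compat_l; auto.
Qed.

End Assembly.

(** * The formal solution *)

Lemma strong_recursion {A : Type} (a0 : A) (Phi : nat -> (nat -> A) -> A) :
  (forall n f g, (forall i, (i < n)%nat -> f i = g i) -> Phi n f = Phi n g) ->
  exists V, forall n, V n = Phi n V.
Proof.
intros Hext.
set (tab := fix tab (j : nat) : nat -> A := match j with
  | O => fun _ => a0
  | S j' => fun i => if Nat.eq_dec i j' then Phi j' (tab j') else tab j' i end).
exists (fun n => tab (S n) n).
have H : forall j i, (i < j)%nat -> tab j i = tab (S i) i.
{ induction j as [|j IH]; intros i Hi; [lia|].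
  destruct (Nat.eq_dec i j) as [->|Hne]; [bound|].
  transitivity (tab j i); [|apply IH; lia].
  simpl. destruct (Nat.eq_dec i j); [contradiction|bound]. }
intros n. transitivity (Phi n (tab n)).
- simpl. destruct (Nat.eq_dec n n); [bound|contradiction].
- bound.
Qed.

Lemma strong_unique {A : Type} (Phi : nat -> (nat -> A) -> A) V V' :
  (forall n f g, (forall i, (i < n)%nat -> f i = g i) -> Phi n f = Phi n g) ->
  (forall n, V n = Phi n V) -> (forall n, V' n = Phi n V') -> forall n, V n = V' n.
Proof.
intros Hext H H'. induction n as [n IH] using (well_founded_induction lt_wf).
rewrite H, H'. bound.
Qed.

Lemma iter_moment_derive m p u n : (forall n, m n <> 0) ->
  Nat.iter p (moment_derive m) u n = (RtoC (m (n + p)%nat / m n) * u (n + p)%nat)%C.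
Proof.
intros Hm. revert n. induction p as [|p IH]; intros n; simpl.
- rewrite Nat.add_0_r. replace (m n / m n) with 1 by (field; apply Hm). ring.
- unfold moment_derive at 1. rewrite IH. replace (n + S p)%nat with (S n + p)%nat by lia.
  rewrite Cmult_assoc, <- RtoC_mult. do 2 f_equal. field. bound.
Qed.

Lemma fps_mul_Csum (u v : nat -> C) n : fps_mul u v n = Csum (fun i => u i * v (n - i)%nat)%C (S n).
Proof. apply sum_n_Csum. Qed.

Lemma formal_solution k p m a f : (1 <= k)%nat -> exists w, sp_equation k p m a f w /\
  forall w', sp_equation k p m a f w' -> w' = w.
Proof.
intros Hk.
set (Phi := fun l (w : nat -> nat -> C) => fun n =>
  (mul_eps_pow k (fun l' => fps_mul a (moment_derive_z m p w l')) l n - f l n)%C).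
have Hext : forall l w w', (forall i, (i < l)%nat -> w i = w' i) -> Phi l w = Phi l w'.
{ intros l w w' H. extensionality n. unfold Phi, mul_eps_pow, moment_derive_z.
  destruct (Nat.ltb_spec l k); [bound|]. rewrite H by lia. reflexivity. }
have Hiff : forall w, sp_equation k p m a f w <-> forall l, w l = Phi l w.
{ intros w. split.
  - intros H l. extensionality n. unfold Phi. rewrite <- (H l n). ring.
  - intros H l n. replace (w l n) with (Phi l w n) by (rewrite <- H; reflexivity). unfold Phi. ring. }
destruct (strong_recursion (fun _ => RtoC 0) Phi Hext) as [w Hw].
exists w. split; [apply Hiff, Hw|]. intros w' Hw'. apply functional_extensionality.
apply (strong_unique Phi); auto. apply Hiff, Hw'.
Qed.

(** * Geometric bounds *)

Lemma Cmod_Csum_le (u : nat -> C) q n : (forall i, (i < n)%nat -> Cmod (u i) <= q i) ->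
  Cmod (Csum u n) <= Rsum q n.
Proof.
induction n as [|n IH]; intros H; simpl.
- rewrite Cmod_0. lra.
- step apply Cmod_triangle. bound.
Qed.

Lemma Rsum_ext u v n : (forall i, (i < n)%nat -> u i = v i) -> Rsum u n = Rsum v n.
Proof. induction n; intros H; simpl; [bound|]. rewrite IHn, H; auto. Qed.

Lemma Rsum_scal c u n : Rsum (fun i => c * u i) n = c * Rsum u n.
Proof. induction n; simpl; [ring|]. bound. Qed.

Lemma Rsum_le u v n : (forall i, (i < n)%nat -> u i <= v i) -> Rsum u n <= Rsum v n.
Proof. induction n; intros H; simpl; [lra|]. bound. Qed.

Lemma Rsum_geom_conv a b n : Rsum (fun i => a ^ i * b ^ (n - i)) (S n) * (b - a) = b ^ S n - a ^ S n.
Proof.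
induction n as [|n IH]; [simpl; ring|].
change (Rsum (fun i => a ^ i * b ^ (S n - i)) (S (S n))) with
  (Rsum (fun i => a ^ i * b ^ (S n - i)) (S n) + a ^ S n * b ^ (S n - S n)).
rewrite (Rsum_ext _ (fun i => b * (a ^ i * b ^ (n - i)))).
- rewrite Rsum_scal, Nat.sub_diag, Rmult_plus_distr_r, Rmult_assoc, IH. simpl. ring.
- intros i Hi. replace (S n - i)%nat with (S (n - i)) by lia. simpl. ring.
Qed.

Lemma Rsum_geom_le a b n : 0 <= a -> a < b -> Rsum (fun i => a ^ i * b ^ (n - i)) (S n) <= b / (b - a) * b ^ n.
Proof.
intros Ha Hb. times (b - a); [lra|]. rewrite Rsum_geom_conv.
have H : 0 <= a ^ S n by bound.
replace (b / (b - a) * b ^ n * (b - a)) with (b ^ S n) by (simpl; field; lra). lra.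
Qed.

(** Holomorphy on the closed disc of radius [R0], read on the coefficients. *)
Definition beyond (R0 : R) (u : nat -> C) : Prop :=
  exists R1 K, R0 < R1 /\ 0 <= K /\ forall n, Cmod (u n) <= K / R1 ^ n.

Lemma beyond_iff R0 u : 0 < R0 ->
  (exists g, holomorphic_on_cdisc R0 g /\ sum_near_0 (V := C_NormedModule) g u) <-> beyond R0 u.
Proof.
intros HR0. split.
- intros [g [[R1 [HR Hg]] [r [Hr Hs]]]]. apply holomorphic_on_holo in Hg.
  destruct (Taylor_unique g R1 r u Hr ltac:(lra) Hg) as [H _].
  { intros z Hz. apply is_pseries_ps, Hs, Hz. }
  destruct (ps_coef_bounds u R1 ltac:(lra) (fun z Hz => ex_intro _ _ (H z Hz)) ((R0 + R1) / 2) ltac:(lra))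
    as [K [HK HKb]].
  exists ((R0 + R1) / 2), K. bound.
- intros [R1 [K [HR [HK H]]]]. exists (PSum u). split.
  + exists R1. split; [bound|]. apply holomorphic_on_holo. apply (PSum_holo u K R1); auto. lra.
  + exists R1. split; [lra|]. intros z Hz. apply is_pseries_ps. apply (PSum_ps u K R1); auto. lra.
Qed.

Lemma radius_mono K R1 R2 n : 0 < R2 <= R1 -> 0 <= K -> K / R1 ^ n <= K / R2 ^ n.
Proof.
intros HR HK. bound.
Qed.

Lemma beyond_minus R0 u v : 0 < R0 -> beyond R0 u -> beyond R0 v -> beyond R0 (fun n => u n - v n)%C.
Proof.
intros HR0 [R1 [K [HR [HK H]]]] [R1' [K' [HR' [HK' H']]]].
have Hm : R0 < Rmin R1 R1' by (apply Rmin_glb_lt; auto).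
exists (Rmin R1 R1'), (K + K'). split; [bound|]. split; [lra|]. intros n.
step apply Cmod_triangle_minus.
replace ((K + K') / Rmin R1 R1' ^ n) with (K / Rmin R1 R1' ^ n + K' / Rmin R1 R1' ^ n) by bound.
apply Rplus_le_compat.
- step apply H. apply radius_mono; auto. split; [lra|apply Rmin_l].
- step apply H'. apply radius_mono; auto. split; [lra|apply Rmin_r].
Qed.

Lemma beyond_mul R0 u v : 0 < R0 -> beyond R0 u -> beyond R0 v -> beyond R0 (fps_mul u v).
Proof.
intros HR0 [R1 [K [HR [HK H]]]] [R1' [K' [HR' [HK' H']]]].
set (R2 := (R0 + Rmin R1 R1') / 2).
have Hm : R0 < Rmin R1 R1' by (apply Rmin_glb_lt; auto).
have Q1 := Rmin_l R1 R1'. have Q2 := Rmin_r R1 R1'.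
have HR2 : R0 < R2 /\ R2 < R1 /\ R2 < R1' by (unfold R2; lra).
have Hi : / R1 < / R2 by (apply Rinv_lt_contravar; [bound|lra]).
have Hi1 : 0 < / R1 by bound.
set (X := / R2 / (/ R2 - / R1)).
have HX : 0 < X by (apply Rdiv_lt_0_compat; lra).
exists R2, (K * K' * X). split; [lra|]. split; [bound|].
intros n. rewrite fps_mul_Csum.
step apply (Cmod_Csum_le _ (fun i => K * K' * ((/ R1) ^ i * (/ R2) ^ (n - i)))).
- intros i Hi'. rewrite Cmod_mult. through (K / R1 ^ i * (K' / R2 ^ (n - i))).
  + apply Rmult_le_compat; try apply Cmod_ge_0; [bound|].
    step apply H'. bound.
  + right. rewrite !pow_inv. bound.
- rewrite Rsum_scal. step (apply Rmult_le_compat_l; [|apply Rsum_geom_le; lra]).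
  + bound.
  + right. unfold X. rewrite pow_inv. bound.
Qed.

Lemma beyond_moment_derive R0 (m : nat -> R) u : 0 < R0 -> (forall n, 0 < m n) ->
  (forall x, 1 < x -> exists C, 0 < C /\ forall n, m (S n) / m n <= C * x ^ n) ->
  beyond R0 u -> beyond R0 (moment_derive m u).
Proof.
intros HR0 Hm Hsub [R1 [K [HR [HK H]]]].
set (R2 := (R0 + R1) / 2).
have Hx : 1 < R1 / R2.
{ apply Rmult_lt_reg_r with R2; [unfold R2; lra|]. unfold Rdiv. rewrite Rmult_assoc, Rinv_l by (unfold R2; lra).
  unfold R2; lra. }
destruct (Hsub _ Hx) as [X [HX Hxb]].
exists R2, (X * K / R1). split; [unfold R2; lra|].
split; [bound|].
intros n. unfold moment_derive. rewrite Cmod_mult, Cmod_R, Rabs_pos_eq by (left; apply Rdiv_lt_0_compat; apply Hm).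
through (X * (R1 / R2) ^ n * (K / R1 ^ S n)).
- apply Rmult_le_compat; auto; [left; apply Rdiv_lt_0_compat; apply Hm|bound].
- right. unfold Rdiv. rewrite Rpow_mult_distr, pow_inv. simpl. field.
  assert (R1 <> 0) by lra. assert (R2 <> 0) by (unfold R2; lra).
  repeat split; auto; apply pow_nonzero; auto.
Qed.

(** The coefficients of [eps ^ l] are obtained from those of lower order by moment
    derivatives and products, which preserve [beyond R0]. *)
Lemma solution_holomorphic R0 k p m a f w : 0 < R0 -> (1 <= k)%nat -> (forall n, 0 < m n) ->
  (forall x, 1 < x -> exists C, 0 < C /\ forall n, m (S n) / m n <= C * x ^ n) ->
  beyond R0 a -> sp_equation k p m a f w -> (forall l, beyond R0 (f l)) -> forall l, beyond R0 (w l).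
Proof.
intros HR0 Hk Hm Hsub Ha Hw Hf.
induction l as [l IH] using (well_founded_induction lt_wf).
have E : w l = (fun n => mul_eps_pow k (fun l' => fps_mul a (moment_derive_z m p w l')) l n - f l n)%C.
{ extensionality n. rewrite <- (Hw l n). ring. }
rewrite E. apply beyond_minus; auto. unfold mul_eps_pow. destruct (Nat.ltb_spec l k).
- exists (R0 + 1), 0. split; [lra|]. split; [lra|]. intros n. rewrite Cmod_0. bound.
- apply (beyond_mul R0 a (moment_derive_z m p w (l - k))); auto.
  unfold moment_derive_z. have Hl := IH (l - k)%nat ltac:(lia).
  have Hit : forall q u, beyond R0 u -> beyond R0 (Nat.iter q (moment_derive m) u).
  { induction q as [|q IHq]; intros u Hu; simpl; [bound|]. apply beyond_moment_derive; auto. }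
  apply Hit, Hl.
Qed.

(** * Families of summable series *)

(** The first index is the power of [z], the second one that of [eps]. Bounds that
    are geometric in [n] amount to convergence on some disc in [z]. *)
Definition GBS (N m : nat -> R) (d theta rho K : R) (W : nat -> nat -> C) : Prop :=
  exists C0 B, 0 <= C0 /\ 0 < B /\ forall n, BS N m d theta rho K (C0 * B ^ n) (W n).

Lemma GBS_weaken N m d theta rho K theta' rho' K' W : strongly_regular N ->
  theta' <= theta -> rho' <= rho -> 0 < K' <= K ->
  GBS N m d theta rho K W -> GBS N m d theta' rho' K' W.
Proof.
intros HN H1 H2 H3 [C0 [B [HC [HB H]]]]. exists C0, B. split; [bound|]. split; [bound|].
intros n. apply (BS_weaken N m d theta rho K (C0 * B ^ n)); auto.
bound.
Qed.

Lemma GBS_plus N m d theta rho K W W' : strongly_regular N -> 0 < K -> GBS N m d theta rho K W ->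
  GBS N m d theta rho K W' -> GBS N m d theta rho K (fun n l => W n l + W' n l)%C.
Proof.
intros HN HK [C1 [B1 [HC1 [HB1 H1]]]] [C2 [B2 [HC2 [HB2 H2]]]].
exists (C1 + C2), (B1 + B2). split; [lra|]. split; [lra|]. intros n.
apply (BS_weaken N m d theta rho K (C1 * B1 ^ n + C2 * B2 ^ n)); auto; try lra.
- split.
  + bound.
  + rewrite Rmult_plus_distr_r. bound.
- apply BS_plus; auto.
Qed.

Lemma GBS_weight N m d theta rho K W (c : nat -> C) X D : strongly_regular N -> 0 < K -> 0 <= X -> 0 < D ->
  (forall n, Cmod (c n) <= X * D ^ n) ->
  GBS N m d theta rho K W -> GBS N m d theta rho K (fun n l => c n * W n l)%C.
Proof.
intros HN HK HX HD Hc [C1 [B1 [HC1 [HB1 H1]]]].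
exists (X * C1), (D * B1). split; [bound|]. split; [bound|]. intros n.
apply (BS_weaken N m d theta rho K (Cmod (c n) * (C1 * B1 ^ n))); auto; try lra.
- split; [bound|].
  rewrite Rpow_mult_distr. through (X * D ^ n * (C1 * B1 ^ n)); [|bound].
  bound.
- apply BS_scal; auto.
Qed.

Lemma GBS_index N m d theta rho K W p : GBS N m d theta rho K W ->
  GBS N m d theta rho K (fun n => W (n + p)%nat).
Proof.
intros [C1 [B1 [HC1 [HB1 H1]]]]. exists (C1 * B1 ^ p), B1.
split; [bound|]. split; [bound|]. intros n.
replace (C1 * B1 ^ p * B1 ^ n) with (C1 * B1 ^ (n + p)) by (rewrite pow_add; ring). apply H1.
Qed.

Lemma GBS_conv N m d theta rho K W (c : nat -> C) X D : strongly_regular N -> 0 < K -> 0 <= X -> 0 < D ->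
  (forall n, Cmod (c n) <= X * D ^ n) ->
  GBS N m d theta rho K W ->
  GBS N m d theta rho K (fun n l => Csum (fun i => c i * W (n - i)%nat l)%C (S n)).
Proof.
intros HN HK HX HD Hc [C1 [B1 [HC1 [HB1 H1]]]].
set (B := B1 + D).
exists (X * C1 * (B / (B - D))), B.
have Hq : 0 < B / (B - D) by (apply Rdiv_lt_0_compat; unfold B; lra).
split; [bound|]. split; [unfold B; lra|]. intros n.
have HP : forall i, 0 <= C1 * B1 ^ (n - i) by (intros i; apply Rmult_le_pos; auto; apply pow_le; lra).
apply (BS_weaken N m d theta rho K (Rsum (fun i => Cmod (c i) * (C1 * B1 ^ (n - i))) (S n))); auto; try lra.
- split.
  + rewrite <- (Rmult_0_l (Rsum (fun _ => 0) (S n))), <- Rsum_scal. apply Rsum_le. intros i _.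
    bound.
  + through (X * C1 * Rsum (fun i => D ^ i * B ^ (n - i)) (S n)).
    * rewrite <- Rsum_scal. apply Rsum_le. intros i _.
      through (X * D ^ i * (C1 * B ^ (n - i))); [|bound].
      apply Rmult_le_compat; auto; [bound|].
      apply Rmult_le_compat_l; auto. apply pow_incr. unfold B; lra.
    * rewrite !Rmult_assoc. rewrite <- (Rmult_assoc X C1). rewrite <- (Rmult_assoc X C1).
      apply Rmult_le_compat_l; [bound|]. apply Rsum_geom_le; unfold B; lra.
- apply (BS_Csum N m d theta rho K _ (fun i l => c i * W (n - i)%nat l)%C). intros i _. apply BS_scal, H1.
Qed.

Lemma GBS_mul_pow N m d theta rho K k : moment_sequence N m ->
  0 < theta -> 0 < rho -> 0 < K ->
  exists theta' rho' K', 0 < theta' <= theta /\ 0 < rho' /\ 0 < K' /\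
  forall W, GBS N m d theta rho K W ->
    GBS N m d theta' rho' K' (fun n l => if (l <? k)%nat then RtoC 0 else W n (l - k)%nat).
Proof.
intros Hm H1 H2 H3.
destruct (BS_mul_pow N m m d theta rho K k Hm Hm H1 H2 H3) as [theta' [rho' [K' [C0 [P1 [P2 [P3 [P4 H]]]]]]]].
exists theta', rho', K'. split; [bound|]. split; [bound|]. split; [bound|].
intros W [C1 [B1 [HC1 [HB1 HW]]]]. exists (C0 * C1), B1. split; [bound|]. split; [bound|].
intros n. rewrite Rmult_assoc. apply H; auto. bound.
Qed.

Lemma GBS_of_summable r N d (v : nat -> bhol r) : 0 < r -> summable N d v ->
  exists m theta rho K, moment_sequence N m /\ 0 < theta <= 2 * PI /\ 0 < rho /\ 0 < K /\
    GBS N m d theta rho K (fun n l => bcoef n (v l)).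
Proof.
intros Hr Hv. destruct (summable_functional N d v Hv) as [m [theta [rho [K [Q [H1 [H2 [H3 [H4 [H5 H]]]]]]]]]].
exists m, theta, rho, K. repeat (split; [bound|]).
exists Q, (2 / r). split; [lra|]. split; [bound|].
intros n. rewrite Rmult_comm. apply H, bcoef_functional, Hr.
Qed.

Lemma multisummable_of_GBS N1 N2 d1 d2 W1 W2 m1 th1 rho1 K1 m2 th2 rho2 K2 :
  moment_sequence N1 m1 -> 0 < th1 <= 2 * PI -> 0 < rho1 -> 0 < K1 ->
  moment_sequence N2 m2 -> 0 < th2 <= 2 * PI -> 0 < rho2 -> 0 < K2 ->
  GBS N1 m1 d1 th1 rho1 K1 W1 -> GBS N2 m2 d2 th2 rho2 K2 W2 ->
  multisummable_eps N1 N2 d1 d2 (fun l n => W1 n l + W2 n l)%C.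
Proof.
intros Hm1 Ht1 Hr1 HK1 Hm2 Ht2 Hr2 HK2 [C1 [B1 [HC1 [HB1 HW1]]]] [C2 [B2 [HC2 [HB2 HW2]]]].
set (r := / (2 * (B1 + B2))).
have Hr : 0 < r by (apply Rinv_0_lt_compat; lra).
have HrB : r * B1 + r * B2 = / 2 by (unfold r; field; lra).
have P1 : 0 < r * B1 by bound.
have P2 : 0 < r * B2 by bound.
destruct (assemble r B1 Hr HB1 ltac:(lra) N1 m1 d1 th1 rho1 K1 C1 W1 Hm1 Ht1 Hr1 HK1 HC1 HW1) as [v1 [E1 S1]].
destruct (assemble r B2 Hr HB2 ltac:(lra) N2 m2 d2 th2 rho2 K2 C2 W2 Hm2 Ht2 Hr2 HK2 HC2 HW2) as [v2 [E2 S2]].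
exists r. split; [bound|]. exists (fun l => plus (v1 l) (v2 l)). split.
- intros l. destruct (E1 l) as [r1 [Hr1' H1]], (E2 l) as [r2 [Hr2' H2]].
  exists (Rmin r1 r2). split; [bound|]. intros z Hz. unfold Defs.disc in Hz.
  apply is_pseries_ps. change (plus (v1 l) (v2 l) z) with (v1 l z + v2 l z)%C.
  apply ps_plus; apply is_pseries_ps; [apply H1|apply H2]; unfold Defs.disc.
  + eapply Rlt_le_trans; [exact Hz|apply Rmin_l].
  + eapply Rlt_le_trans; [exact Hz|apply Rmin_r].
- exists v1, v2. bound.
Qed.

(** * The Cauchy problem in [z] *)

Section Recursion.

Variables (N m m2 N2 : nat -> R) (d theta rho K : R) (k p : nat) (alpha : nat -> C).
Hypothesis HN : strongly_regular N.
Hypothesis HN2 : strongly_regular N2.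
Hypothesis HK : 0 < K.
Hypothesis Hp : (1 <= p)%nat.
Hypothesis Hm2 : forall n, 0 < m2 n.
Variables (A X D : R).
Hypothesis HA : 1 <= A.
Hypothesis HX : 0 <= X.
Hypothesis HD : 0 < D.
Hypothesis Hratio : forall n, m2 n / m2 (n + p)%nat <= A * (N2 n / N2 (n + p)%nat).
Hypothesis Ha0 : alpha O <> 0%C.
Hypothesis Halpha : forall n, Cmod (alpha n) <= X * D ^ n.
Variables (F I0 : nat -> nat -> C) (CF BF CI0 H : R).
Hypothesis HCF : 0 <= CF.
Hypothesis HBF : 0 < BF.
Hypothesis HCI : 0 <= CI0.
Hypothesis HH : 0 < H.
Hypothesis HF : forall n s, BS N m d theta rho K (CF * BF ^ n * (H ^ s * N2 (p * s)%nat)) (fun l => F n (l + k * s)%nat).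
Hypothesis HI : forall j, (j < p)%nat -> forall s,
  BS N m d theta rho K (CI0 * (H ^ s * N2 (p * s)%nat)) (fun l => I0 j (l + k * s)%nat).

(** [V n] stands for the coefficient of [z ^ n] in the [p]-th derivative of the
    solution [Wof V] with Cauchy data [I0]. *)
Definition Wof (m2 : nat -> R) (p : nat) (I0 V : nat -> nat -> C) (n l : nat) : C :=
  if (n <? p)%nat then I0 n l else (RtoC (m2 (n - p)%nat / m2 n) * V (n - p)%nat l)%C.

Definition Vstep (m2 : nat -> R) (k p : nat) (alpha : nat -> C) (F I0 : nat -> nat -> C) (n : nat)
  (V : nat -> nat -> C) : nat -> C :=
  fun l => (/ alpha O * (Wof m2 p I0 V n (l + k)%nat + F n (l + k)%nat -
    Csum (fun i => alpha (S i) * V (n - S i)%nat l) n))%C.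

Lemma Vstep_ext m2' F' I' n V V' : (forall i, (i < n)%nat -> V i = V' i) ->
  Vstep m2' k p alpha F' I' n V = Vstep m2' k p alpha F' I' n V'.
Proof.
intros E. extensionality l. unfold Vstep, Wof.
rewrite (Csum_ext _ (fun i => alpha (S i) * V' (n - S i)%nat l)%C).
- destruct (Nat.ltb_spec n p); [bound|]. rewrite (E (n - p)%nat) by lia. reflexivity.
- intros i Hi. rewrite E by lia. reflexivity.
Qed.

Let T (n s : nat) : R := N2 (n + p * s)%nat / N2 n.

Lemma T_pos n s : 0 < T n s.
Proof. apply Rdiv_lt_0_compat; apply (M_pos N2 HN2). Qed.

Lemma T_mono i n s : (i <= n)%nat -> T i s <= T n s.
Proof. intros Hi. apply (M_ratio_mono N2 HN2), Hi. Qed.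

Lemma T_base n s : N2 (p * s)%nat <= T n s.
Proof.
have Q := T_mono 0 n s ltac:(lia). unfold T at 1 in Q. rewrite (sr_0 N2 HN2), Nat.add_0_l in Q.
bound.
Qed.

(** Each step in [z] by [p] divides by a quotient of moments and consumes one
    shift by [k] in [eps]. The two costs balance along the induction, which
    therefore has to control all the shifts at once. *)
Lemma recursion_GBS V : (forall n, V n = Vstep m2 k p alpha F I0 n V) ->
  GBS N m d theta rho K (Wof m2 p I0 V).
Proof.
intros HV.
set (a0 := Cmod (/ alpha O)). have Ha0p : 0 <= a0 by apply Cmod_ge_0.
set (CW := CI0 + 1). set (CV := 2 * a0 * H * (CW + CF)).
have HCV : 0 <= CV.
{ unfold CV, CW. bound. }
set (B := 1 + BF + (D + 2 * a0 * (X * D)) + A * CV).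
have HaXD : 0 <= 2 * a0 * (X * D) by bound.
have HACV : 0 <= A * CV by bound.
have HB1 : 1 <= B by (unfold B; lra). have HBBF : BF <= B by (unfold B; lra).
have HBD : D + 2 * a0 * (X * D) <= B - 1 by (unfold B; lra).
have HBC : A * CV <= B by (unfold B; lra).
have HBp : forall n, 0 < B ^ n by (intros n; apply pow_lt; lra).
have HHp : forall s, 0 < H ^ s by (intros s; apply pow_lt, HH).
have HNp : forall n, 0 < N2 n by (apply (M_pos N2 HN2)).
have HT := T_pos.
have Claim : forall n,
  (forall s, BS N m d theta rho K (CW * B ^ n * H ^ s * T n s) (fun l => Wof m2 p I0 V n (l + k * s)%nat)) /\
  (forall s, BS N m d theta rho K (CV * B ^ n * H ^ s * T n (S s)) (fun l => V n (l + k * s)%nat)).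
{ induction n as [n IH] using (well_founded_induction lt_wf).
  have HWn : forall s, BS N m d theta rho K (CW * B ^ n * H ^ s * T n s) (fun l => Wof m2 p I0 V n (l + k * s)%nat).
  { intros s. have HTn := HT n s.
    destruct (Nat.ltb_spec n p) as [Hn|Hn].
    - apply (BS_ext _ _ _ _ _ _ _ (fun l => I0 n (l + k * s)%nat)).
      { intros l. unfold Wof. destruct (Nat.ltb_spec n p); [bound|lia]. }
      apply (BS_weaken N m d theta rho K (CI0 * (H ^ s * N2 (p * s)%nat))); auto; try lra.
      have Q := T_base n s.
      have HB1n : 1 <= B ^ n by (apply pow_R1_Rle, HB1).
      split; [bound|].
      rewrite !Rmult_assoc. apply Rmult_le_compat; auto; [bound|unfold CW; lra|].
      rewrite <- (Rmult_1_l (H ^ s * N2 (p * s)%nat)).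
      bound.
    - destruct (IH (n - p)%nat ltac:(lia)) as [_ IHV].
      apply (BS_ext _ _ _ _ _ _ _ (fun l => RtoC (m2 (n - p)%nat / m2 n) * V (n - p)%nat (l + k * s)%nat)%C).
      { intros l. unfold Wof. destruct (Nat.ltb_spec n p); [lia|bound]. }
      have Hr0 : 0 < m2 (n - p)%nat / m2 n by (apply Rdiv_lt_0_compat; apply Hm2).
      have HQ0 : 0 <= CV * B ^ (n - p) * H ^ s * T (n - p) (S s).
      { apply Rmult_le_pos; [|left; apply HT]. bound. }
      apply (BS_weaken N m d theta rho K (Cmod (RtoC (m2 (n - p)%nat / m2 n)) *
        (CV * B ^ (n - p) * H ^ s * T (n - p) (S s)))); auto; try lra; [|apply BS_scal, IHV].
      rewrite Cmod_R, Rabs_pos_eq by lra. split; [bound|].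
      have Hra := Hratio (n - p)%nat. replace (n - p + p)%nat with n in Hra by lia.
      through (A * (N2 (n - p)%nat / N2 n) * (CV * B ^ (n - p) * H ^ s * T (n - p) (S s))).
      { bound. }
      replace (A * (N2 (n - p)%nat / N2 n) * (CV * B ^ (n - p) * H ^ s * T (n - p) (S s))) with
        (A * CV * B ^ (n - p) * (H ^ s * T n s)).
      2:{ unfold T. replace (n - p + p * S s)%nat with (n + p * s)%nat by lia.
          field. split; apply Rgt_not_eq, HNp. }
      replace (CW * B ^ n * H ^ s * T n s) with (CW * B ^ n * (H ^ s * T n s)) by ring.
      apply Rmult_le_compat_r; [bound|].
      replace (B ^ n) with (B ^ p * B ^ (n - p)) by (rewrite <- pow_add; f_equal; lia).
      rewrite <- Rmult_assoc. apply Rmult_le_compat_r; [bound|].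
      through B; [bound|]. through (1 * B ^ p).
      + rewrite Rmult_1_l. rewrite <- (pow_1 B) at 1. apply Rle_pow; auto.
      + apply Rmult_le_compat_r; [bound|unfold CW; lra]. }
  split; [bound|]. intros s.
  have HTn := HT n (S s). have HBn := HBp n.
  set (Qs := fun i => Cmod (alpha (S i)) * (CV * B ^ (n - S i) * H ^ s * T (n - S i) (S s))).
  set (QW := CW * B ^ n * H ^ S s * T n (S s)).
  set (QF := CF * BF ^ n * (H ^ S s * N2 (p * S s)%nat)).
  have HQs : 0 <= Rsum Qs n.
  { rewrite <- (Rmult_0_l (Rsum (fun _ => 0) n)), <- Rsum_scal. apply Rsum_le. intros i _.
    rewrite Rmult_0_l. apply Rmult_le_pos; [bound|].
    apply Rmult_le_pos; [|left; apply HT]. bound. }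
  have HBSV : BS N m d theta rho K (a0 * ((QW + QF) + Cmod (- (1)) * Rsum Qs n)) (fun l => V n (l + k * s)%nat).
  { apply (BS_ext _ _ _ _ _ _ _ (fun l => / alpha O * ((Wof m2 p I0 V n (l + k * S s)%nat + F n (l + k * S s)%nat) +
      - (1) * Csum (fun i => alpha (S i) * V (n - S i)%nat (l + k * s)%nat) n))%C).
    { intros l. replace (V n (l + k * s)%nat) with (Vstep m2 k p alpha F I0 n V (l + k * s)%nat) by (rewrite <- HV; reflexivity).
      unfold Vstep. replace (l + k * s + k)%nat with (l + k * S s)%nat by lia. ring. }
    apply BS_scal. apply BS_plus; [apply BS_plus; [apply HWn|apply HF]|]. apply BS_scal.
    apply (BS_Csum N m d theta rho K Qs (fun i l => alpha (S i) * V (n - S i)%nat (l + k * s)%nat)%C).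
    intros i Hi. apply BS_scal. apply IH. lia. }
  rewrite Cmod_opp, Cmod_1, Rmult_1_l in HBSV.
  have HQF : 0 <= QF <= CF * (B ^ n * H ^ S s * T n (S s)).
  { have Q := T_base n (S s).
    unfold QF. split.
    - bound.
    - rewrite !Rmult_assoc. bound. }
  have HQW : 0 <= QW.
  { unfold QW. apply Rmult_le_pos; [|lra]. apply Rmult_le_pos; [|bound].
    apply Rmult_le_pos; [unfold CW; lra|lra]. }
  (* the earlier derivatives contribute at most half of the claimed bound *)
  have HSum : a0 * Rsum Qs n <= CV / 2 * (B ^ n * H ^ s * T n (S s)).
  { destruct n as [|n].
    - simpl Rsum. rewrite Rmult_0_r. bound.
    - through (a0 * (CV * H ^ s * T (S n) (S s) * (X * D) * Rsum (fun i => D ^ i * B ^ (n - i)) (S n))).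
      + apply Rmult_le_compat_l; auto. rewrite <- Rsum_scal. apply Rsum_le. intros i Hi. unfold Qs.
        replace (S n - S i)%nat with (n - i)%nat by lia.
        through (X * D ^ S i * (CV * B ^ (n - i) * H ^ s * T (S n) (S s))); [|right; simpl; ring].
        apply Rmult_le_compat; [bound| |bound|].
        * apply Rmult_le_pos; [bound|left; apply HT].
        * apply Rmult_le_compat_l; [bound|]. apply T_mono. lia.
      + have G := Rsum_geom_le D B n ltac:(lra) ltac:(lra).
        have E : a0 * (X * D) * (B / (B - D) * B ^ n) <= / 2 * B ^ S n.
        { simpl. replace (a0 * (X * D) * (B / (B - D) * B ^ n)) with (a0 * (X * D) / (B - D) * (B * B ^ n)) by bound.
          bound. }
        replace (a0 * (CV * H ^ s * T (S n) (S s) * (X * D) * Rsum (fun i => D ^ i * B ^ (n - i)) (S n))) with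
          (CV * H ^ s * T (S n) (S s) * (a0 * (X * D) * Rsum (fun i => D ^ i * B ^ (n - i)) (S n))) by ring.
        replace (CV / 2 * (B ^ S n * H ^ s * T (S n) (S s))) with (CV * H ^ s * T (S n) (S s) * (/ 2 * B ^ S n)) by field.
        apply Rmult_le_compat_l; [bound|].
        eapply Rle_trans; [|exact E]. bound. }
  apply (BS_weaken N m d theta rho K (a0 * (QW + QF + Rsum Qs n))); auto; try lra.
  split; [bound|].
  replace (CV * B ^ n * H ^ s * T n (S s)) with
    (a0 * H * (CW + CF) * (B ^ n * H ^ s * T n (S s)) + CV / 2 * (B ^ n * H ^ s * T n (S s))) by (unfold CV; field).
  rewrite Rmult_plus_distr_l. apply Rplus_le_compat; [|bound].
  through (a0 * (CW * (B ^ n * H ^ S s * T n (S s)) + CF * (B ^ n * H ^ S s * T n (S s)))).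
  - apply Rmult_le_compat_l; auto. apply Rplus_le_compat; [right; unfold QW; ring|bound].
  - right. simpl. ring. }
exists CW, B. split; [unfold CW; lra|]. split; [lra|]. intros n.
have Q := proj1 (Claim n) 0%nat.
have ET : T n 0 = 1 by (unfold T; rewrite Nat.mul_0_r, Nat.add_0_r; field; apply Rgt_not_eq, HNp).
rewrite ET in Q. simpl pow in Q. rewrite !Rmult_1_r in Q.
apply (BS_ext _ _ _ _ _ _ _ (fun l => Wof m2 p I0 V n (l + k * 0)%nat)); [|bound].
intros l. f_equal. lia.
Qed.

End Recursion.

(** * Comparison of the growth rates *)

(** Logarithmic convexity: [M n ^ (1 / n)] is nondecreasing. *)
Lemma M_root_mono M a b : strongly_regular M -> (a <= b)%nat -> M a ^ b <= M b ^ a.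
Proof.
intros HM Hab.
have L := M_lower M HM a (b - a). replace (a + (b - a))%nat with b in L by lia.
have U := M_upper_0 M HM a.
through ((M a * nu M a ^ (b - a)) ^ a).
- rewrite Rpow_mult_distr. replace (M a ^ b) with (M a ^ a * M a ^ (b - a)) by (rewrite <- pow_add; f_equal; lia).
  apply Rmult_le_compat_l; [bound|].
  rewrite <- pow_mult, Nat.mul_comm, pow_mult. bound.
- bound.
Qed.

(** Since [M n ^ (1 / n)] is nondecreasing, [M (k * s) ^ p] is at most
    [M (p * s) ^ k]; a geometric factor makes up for values of [M] below 1. *)
Lemma power_comparison M k p sigma s2 : strongly_regular M -> (1 <= k)%nat -> (k <= p)%nat ->
  0 < sigma -> 0 < s2 -> sigma * INR k <= s2 * INR p ->
  exists c, forall s, Rpower (M (k * s)%nat) sigma <= exp c ^ s * Rpower (M (p * s)%nat) s2.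
Proof.
intros HM Hk Hkp Hsig Hs2 Hle.
have HkR : 0 < INR k by bound.
set (L := ln (nu M 0)). exists (s2 * INR p * Rabs L). intros s.
rewrite <- exp_INR_mult. unfold Rpower. rewrite <- exp_plus. apply exp_mono.
set (x := ln (M (k * s)%nat)). set (y := ln (M (p * s)%nat)).
have Hxy : INR p * x <= INR k * y.
{ destruct s as [|s].
  - unfold x, y. rewrite !Nat.mul_0_r, (sr_0 M HM), ln_1. lra.
  - have Q := M_root_mono M (k * S s) (p * S s) HM ltac:(apply Nat.mul_le_mono_r; exact Hkp).
    apply ln_le in Q; [|bound].
    rewrite !ln_pow in Q by bound. fold x y in Q. rewrite !mult_INR in Q.
    have HS : 0 < INR (S s) by bound.
    times (INR (S s)); auto. lra. }
have Hx : INR k * INR s * L <= x.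
{ unfold x, L. rewrite <- mult_INR, <- ln_pow by bound.
  apply ln_le; [bound|apply (M_lower_0 M HM)]. }
have HL := Rle_abs (- L). rewrite Rabs_Ropp in HL.
have Hy : s2 * (INR p / INR k * x) <= s2 * y.
{ apply Rmult_le_compat_l; [lra|]. times (INR k); auto.
  replace (INR p / INR k * x * INR k) with (INR p * x) by bound. lra. }
have HsL : 0 <= s2 * INR p * Rabs L * INR s by bound.
destruct (Rle_dec 0 x) as [Hx0|Hx0].
- assert (sigma * x <= s2 * INR p / INR k * x).
  { bound. }
  bound.
- assert (sigma * x <= 0) by nra.
  have E : - (s2 * INR p * Rabs L * INR s) <= s2 * (INR p / INR k * x).
  { replace (s2 * (INR p / INR k * x)) with (s2 * INR p * (x / INR k)) by bound.
    replace (- (s2 * INR p * Rabs L * INR s)) with (s2 * INR p * (- Rabs L * INR s)) by ring.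
    apply Rmult_le_compat_l; [bound|].
    times (INR k); auto. replace (x / INR k * INR k) with x by bound.
    assert (- Rabs L * INR s * INR k <= INR k * INR s * L); [|lra].
    replace (INR k * INR s * L) with (L * (INR s * INR k)) by ring. rewrite Rmult_assoc.
    bound. }
  bound.
Qed.

Section SecondMoments.

Variables (N2 m2 : nat -> R) (A : R).
Hypothesis HN2 : strongly_regular N2.
Hypothesis Hm2 : forall n, 0 < m2 n.
Hypothesis HA : 1 <= A.
Hypothesis Hgrow : forall n, N2 n <= A ^ S n * m2 n /\ m2 n <= A ^ S n * N2 n /\
  nu N2 n <= A * (m2 (S n) / m2 n) /\ m2 (S n) / m2 n <= A * nu N2 n.

Lemma quotient_lower p n : m2 n / m2 (n + p)%nat <= A ^ p * (N2 n / N2 (n + p)%nat).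
Proof.
have HNp := M_pos N2 HN2. induction p as [|p IH].
- rewrite Nat.add_0_r. simpl. right. field. split; apply Rgt_not_eq; try apply Hm2; apply HNp.
- destruct (Hgrow (n + p)%nat) as [_ [_ [Q _]]]. replace (n + S p)%nat with (S (n + p)) by lia.
  have P2 := Hm2 (n + p)%nat. have P3 := Hm2 (S (n + p)).
  have R2 := HNp (n + p)%nat. have R3 := HNp (S (n + p)).
  unfold nu in Q.
  replace (m2 n / m2 (S (n + p))) with (m2 n / m2 (n + p)%nat * (m2 (n + p)%nat / m2 (S (n + p)))) by bound.
  replace (A ^ S p * (N2 n / N2 (S (n + p)))) with
    (A ^ p * (N2 n / N2 (n + p)%nat) * (A * (N2 (n + p)%nat / N2 (S (n + p))))) by (simpl; field; lra).
  apply Rmult_le_compat; auto; try (left; apply Rdiv_lt_0_compat; auto).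
  times (m2 (S (n + p)) / m2 (n + p)%nat * (N2 (S (n + p)) / N2 (n + p)%nat)).
  { bound. }
  replace (m2 (n + p)%nat / m2 (S (n + p)) * (m2 (S (n + p)) / m2 (n + p)%nat * (N2 (S (n + p)) / N2 (n + p)%nat)))
    with (N2 (S (n + p)) / N2 (n + p)%nat) by bound.
  replace (A * (N2 (n + p)%nat / N2 (S (n + p))) * (m2 (S (n + p)) / m2 (n + p)%nat * (N2 (S (n + p)) / N2 (n + p)%nat)))
    with (A * (m2 (S (n + p)) / m2 (n + p)%nat)) by bound. exact Q.
Qed.

Lemma quotient_subexp x : 1 < x -> exists C, 0 < C /\ forall n, m2 (S n) / m2 n <= C * x ^ n.
Proof.
intros Hx. destruct (nu_subexp N2 HN2 x Hx) as [C0 [HC H]].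
exists (A * C0). split; [bound|]. intros n.
destruct (Hgrow n) as [_ [_ [_ Q]]]. step exact Q. rewrite Rmult_assoc.
bound.
Qed.

Lemma quotient_upper p : exists X D, 0 <= X /\ 0 < D /\ forall n, m2 (n + p)%nat / m2 n <= X * D ^ n.
Proof.
destruct (quotient_subexp 2 ltac:(lra)) as [C0 [HC H]].
induction p as [|p [X [D [HX [HD IH]]]]].
- exists 1, 1. split; [lra|]. split; [lra|]. intros n. rewrite Nat.add_0_r, pow1.
  right. field. apply Rgt_not_eq, Hm2.
- exists (X * C0 * 2 ^ p), (D * 2).
  split; [bound|]. split; [lra|]. intros n.
  replace (n + S p)%nat with (S (n + p)) by lia.
  have P1 := Hm2 n. have P2 := Hm2 (n + p)%nat. have P3 := Hm2 (S (n + p)).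
  replace (m2 (S (n + p)) / m2 n) with (m2 (n + p)%nat / m2 n * (m2 (S (n + p)) / m2 (n + p)%nat)) by bound.
  replace (X * C0 * 2 ^ p * (D * 2) ^ n) with (X * D ^ n * (C0 * 2 ^ (n + p))) by (rewrite Rpow_mult_distr, pow_add; ring).
  bound.
Qed.

Lemma shift_cost M k p sigma s2 c1 B : strongly_regular M -> (1 <= k)%nat -> (k <= p)%nat ->
  0 < sigma -> 0 < s2 -> sigma * INR k <= s2 * INR p -> 0 < c1 -> 0 < B ->
  (forall n, c1 ^ n * Rpower (M n) s2 <= m2 n) ->
  exists H, 0 < H /\ forall s, B ^ (k * s) * seq_power M sigma (k * s)%nat <= A * (H ^ s * N2 (p * s)%nat).
Proof.
intros HM Hk Hkp Hsig Hs2 Hle Hc1 HB Hlow.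
destruct (power_comparison M k p sigma s2 HM Hk Hkp Hsig Hs2 Hle) as [c Hc].
exists (B ^ k * exp c * (A / c1) ^ p). split.
{ bound. }
intros s. unfold seq_power.
have HB2 : 0 < B ^ (k * s) by bound.
have Hc1s : 0 < c1 ^ (p * s) by bound.
have Q1 : Rpower (M (p * s)%nat) s2 <= A ^ S (p * s) * (A * N2 (p * s)%nat) / A / c1 ^ (p * s) .
{ times (c1 ^ (p * s)); auto.
  replace (A ^ S (p * s) * (A * N2 (p * s)%nat) / A / c1 ^ (p * s) * c1 ^ (p * s)) with (A ^ S (p * s) * N2 (p * s)%nat) by bound.
  destruct (Hgrow (p * s)%nat) as [_ [Q _]]. eapply Rle_trans; [|exact Q]. rewrite Rmult_comm. apply Hlow. }
through (B ^ (k * s) * (exp c ^ s * (A ^ S (p * s) * (A * N2 (p * s)%nat) / A / c1 ^ (p * s)))).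
- apply Rmult_le_compat_l; [lra|]. step apply Hc. bound.
- right. unfold Rdiv. rewrite !Rpow_mult_distr, <- !pow_mult, !pow_inv.
  replace (A ^ S (p * s)) with (A * A ^ (p * s)) by bound. field. bound.
Qed.

End SecondMoments.

(** * Both implications, for one of the two summands *)

Section Summand.

Variables (N : nat -> R) (d : R) (m2 : nat -> R) (k p : nat) (alpha : nat -> C).
Variables (X D : R).
Hypothesis HX : 0 <= X.
Hypothesis HD : 0 < D.
Hypothesis Halpha : forall n, Cmod (alpha n) <= X * D ^ n.
Hypothesis Hm2 : forall n, 0 < m2 n.

(** The left-hand side of the equation, coefficient by coefficient. *)
Definition residual (m2 : nat -> R) (k p : nat) (alpha : nat -> C) (W : nat -> nat -> C) (n l : nat) : C :=
  ((if (l <? k)%nat then RtoC 0 else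
     Csum (fun i => alpha i * (RtoC (m2 (n - i + p)%nat / m2 (n - i)%nat) * W (n - i + p)%nat (l - k)%nat)) (S n)) +
   - (1) * W n l)%C.

Lemma residual_summable r (v : nat -> bhol r) X2 D2 : 0 < r -> summable N d v ->
  0 <= X2 -> 0 < D2 -> (forall n, m2 (n + p)%nat / m2 n <= X2 * D2 ^ n) ->
  exists m theta rho K, moment_sequence N m /\ 0 < theta <= 2 * PI /\ 0 < rho /\ 0 < K /\
    GBS N m d theta rho K (residual m2 k p alpha (fun n l => bcoef n (v l))).
Proof.
intros Hr Hv HX2 HD2 Hup.
destruct (GBS_of_summable r N d v Hr Hv) as [m [theta [rho [K [Hm [Ht [Hrho [HK HW]]]]]]]].
have HN := proj1 Hm.
destruct (GBS_mul_pow N m d theta rho K k Hm ltac:(lra) Hrho HK) as [theta' [rho' [K' [P1 [P2 [P3 H]]]]]].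
set (K1 := Rmin K K'). have HK1 : 0 < K1 by (apply Rmin_pos; auto).
exists m, theta', (Rmin rho rho'), K1. split; [bound|]. split; [lra|].
split; [bound|]. split; [bound|].
apply GBS_plus; auto.
- apply (GBS_weaken N m d theta' rho' K'); auto; try lra; [apply Rmin_r|split; [bound|apply Rmin_r]|].
  set (W1 := fun n l => Csum (fun i => alpha i * (RtoC (m2 (n - i + p)%nat / m2 (n - i)%nat) * bcoef (n - i + p) (v l)))%C (S n)).
  apply (H W1). unfold W1.
  apply (GBS_conv N m d theta rho K (fun n l => RtoC (m2 (n + p)%nat / m2 n) * bcoef (n + p) (v l))%C alpha X D); auto.
  apply (GBS_weight N m d theta rho K (fun n l => bcoef (n + p) (v l)) (fun n => RtoC (m2 (n + p)%nat / m2 n)) X2 D2); auto.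
  + intros n. rewrite Cmod_R, Rabs_pos_eq; [bound|]. left. apply Rdiv_lt_0_compat; apply Hm2.
  + apply (GBS_index N m d theta rho K (fun n l => bcoef n (v l))). exact HW.
- apply (GBS_weight N m d theta' (Rmin rho rho') K1 (fun n l => bcoef n (v l)) (fun _ => (- (1))%C) 1 1); auto; try lra.
  + intros n. rewrite Cmod_opp, Cmod_1, pow1. lra.
  + apply (GBS_weaken N m d theta rho K); auto; try lra; [apply Rmin_l|split; [bound|apply Rmin_l]].
Qed.

Lemma coefficient_summable r (v : nat -> bhol r) n c : 0 < r -> summable N d v ->
  summable (V := C_NormedModule) N d (fun l => c * bcoef n (v l))%C.
Proof.
intros Hr Hv.
destruct (GBS_of_summable r N d v Hr Hv) as [m [theta [rho [K [Hm [Ht [Hrho [HK [C0 [B [HC [HB HW]]]]]]]]]]]].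
apply (BS_summable N m d theta rho K (Cmod c * (C0 * B ^ n))); auto.
- bound.
- apply BS_scal. apply (HW n).
Qed.

Lemma common_shift m q (I0 : nat -> nat -> C) : moment_sequence N m ->
  (forall j, (j < q)%nat -> summable (V := C_NormedModule) N d (I0 j)) ->
  exists theta rho K C0 B, 0 < theta /\ 0 < rho /\ 0 < K /\ 0 < C0 /\ 0 < B /\
    forall j, (j < q)%nat -> forall s, BS N m d theta rho K (C0 * (B ^ s * N s)) (fun l => I0 j (l + s)%nat).
Proof.
intros Hm. have HN := proj1 Hm. induction q as [|q IH]; intros HI.
- exists 1, 1, 1, 1, 1. repeat (split; [lra|]). intros; lia.
- destruct IH as [theta [rho [K [C0 [B [P1 [P2 [P3 [P4 [P5 H]]]]]]]]]]; [bound|].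
  destruct (summable_functional N d (I0 q) (HI q ltac:(lia))) as [m' [th [rh [K0 [Q [Hm' [R1 [R2 [R3 [R4 Hf]]]]]]]]]].
  have HB := Hf 1 (fun z => z) functional_id. rewrite Rmult_1_l in HB.
  destruct (BS_shift N m' m d th rh K0 Hm' Hm ltac:(lra) R2 R3) as [th' [rh' [K' [C' [A' [S1 [S2 [S3 [S4 [S5 Hs]]]]]]]]]].
  have Hshift := Hs (I0 q) Q ltac:(lra) HB.
  have HCQ : 0 < C' * Q by bound.
  exists (Rmin theta th'), (Rmin rho rh'), (Rmin K K'), (C0 + C' * Q), (B + A').
  split; [bound|]. split; [bound|]. split; [bound|].
  split; [lra|]. split; [lra|]. intros j Hj s.
  destruct (Nat.eq_dec j q) as [->|Hne].
  + apply (BS_weaken N m d th' rh' K' (C' * (A' ^ s * N s) * Q)); auto; try apply Rmin_r.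
    * split; [bound|apply Rmin_r].
    * split; [bound|].
      replace (C' * (A' ^ s * N s) * Q) with (C' * Q * (A' ^ s * N s)) by ring.
      bound.
  + apply (BS_weaken N m d theta rho K (C0 * (B ^ s * N s))); auto; try apply Rmin_l.
    * split; [bound|apply Rmin_l].
    * bound.
    * apply H. lia.
Qed.

Lemma cauchy_problem_summable N2 A r (v : nat -> bhol r) (I0 : nat -> nat -> C) : (1 <= p)%nat ->
  alpha O <> 0%C -> strongly_regular N2 -> 1 <= A ->
  (forall n, m2 n / m2 (n + p)%nat <= A * (N2 n / N2 (n + p)%nat)) ->
  (forall B, 0 < B -> exists X0 H, 0 < X0 /\ 0 < H /\
     forall s, B ^ (k * s) * N (k * s)%nat <= X0 * (H ^ s * N2 (p * s)%nat)) ->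
  0 < r -> summable N d v ->
  (forall j, (j < p)%nat -> summable (V := C_NormedModule) N d (I0 j)) ->
  exists V m theta rho K, moment_sequence N m /\ 0 < theta <= 2 * PI /\ 0 < rho /\ 0 < K /\
    (forall n, V n = Vstep m2 k p alpha (fun n l => bcoef n (v l)) I0 n V) /\
    GBS N m d theta rho K (Wof m2 p I0 V).
Proof.
intros Hp Ha0 HN2 HA Hra Hcost Hr Hv HI.
set (F := fun n l => bcoef n (v l)).
destruct (strong_recursion (fun _ => RtoC 0) (Vstep m2 k p alpha F I0)) as [V HV].
{ intros n f g E. apply Vstep_ext; auto. }
destruct (GBS_of_summable r N d v Hr Hv) as [m [theta [rho [K [Hm [Ht [Hrho [HK [CF [BF [HCF [HBF HW]]]]]]]]]]]].
have HN := proj1 Hm.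
destruct (BS_shift N m m d theta rho K Hm Hm ltac:(lra) Hrho HK) as [th1 [rh1 [K1 [C1 [A1 [P1 [P2 [P3 [P4 [P5 Hs]]]]]]]]]].
destruct (common_shift m p I0 Hm HI) as [th2 [rh2 [K2 [C2 [A2 [Q1 [Q2 [Q3 [Q4 [Q5 Hi]]]]]]]]]].
set (B := A1 + A2).
destruct (Hcost B ltac:(unfold B; lra)) as [X0 [H [HX0 [HH Hc]]]].
have HKm : 0 < Rmin K1 K2 by bound.
exists V, m, (Rmin th1 th2), (Rmin rh1 rh2), (Rmin K1 K2).
split; [bound|]. split; [split; [bound|]; have T := Rmin_l th1 th2; lra|].
split; [bound|]. split; [bound|]. split; [bound|].
have HNp := M_pos N HN.
have Hcc : forall a s, 0 < a <= B -> a ^ (k * s) * N (k * s)%nat <= X0 * (H ^ s * N2 (p * s)%nat).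
{ intros a s Ha. eapply Rle_trans; [|apply Hc]. bound. }
apply (recursion_GBS N m m2 N2 d (Rmin th1 th2) (Rmin rh1 rh2) (Rmin K1 K2) k p alpha HN HN2 HKm Hp Hm2 A X D HA HX HD
  Hra Halpha F I0 (C1 * CF * X0) BF (C2 * X0) H); auto.
- bound.
- bound.
- intros n s.
  have HCB : 0 <= CF * BF ^ n by bound.
  apply (BS_weaken N m d th1 rh1 K1 (C1 * (A1 ^ (k * s) * N (k * s)%nat) * (CF * BF ^ n))); auto; try apply Rmin_l.
  + split; [bound|apply Rmin_l].
  + split; [bound|].
    replace (C1 * CF * X0 * BF ^ n * (H ^ s * N2 (p * s)%nat)) with
      (C1 * (X0 * (H ^ s * N2 (p * s)%nat)) * (CF * BF ^ n)) by ring.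
    apply Rmult_le_compat_r; auto. apply Rmult_le_compat_l; [lra|]. apply Hcc. unfold B; lra.
- intros j Hj s.
  apply (BS_weaken N m d th2 rh2 K2 (C2 * (A2 ^ (k * s) * N (k * s)%nat))); auto; try apply Rmin_r.
  + split; [bound|apply Rmin_r].
  + split; [bound|].
    rewrite Rmult_assoc. apply Rmult_le_compat_l; [lra|]. apply Hcc. unfold B; lra.
Qed.

End Summand.

(** * The singularly perturbed problem *)

Lemma beyond_geometric R0 u : 0 < R0 -> beyond R0 u ->
  exists X D, 0 <= X /\ 0 < D /\ forall n, Cmod (u n) <= X * D ^ n.
Proof.
intros HR0 [R1 [K [HR [HK H]]]]. exists K, (/ R1). split; [bound|].
split; [bound|]. intros n. rewrite pow_inv. apply H.
Qed.

Lemma equation_residual k p m2 (alpha : nat -> C) f w : (forall n, m2 n <> 0) -> sp_equation k p m2 alpha f w ->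
  forall l n, f l n = residual m2 k p alpha (fun n l => w l n) n l.
Proof.
intros Hm H l n. rewrite <- (H l n). unfold residual, mul_eps_pow. destruct (Nat.ltb_spec l k); [ring|].
rewrite fps_mul_Csum. unfold Cminus. f_equal; [|ring]. apply Csum_ext. intros i Hi.
unfold moment_derive_z. rewrite iter_moment_derive by bound. reflexivity.
Qed.

Lemma residual_plus k p m2 (alpha : nat -> C) W1 W2 n l :
  residual m2 k p alpha (fun n l => W1 n l + W2 n l)%C n l =
  (residual m2 k p alpha W1 n l + residual m2 k p alpha W2 n l)%C.
Proof.
unfold residual. destruct (Nat.ltb_spec l k); [ring|].
set (c := fun i => (alpha i * RtoC (m2 (n - i + p)%nat / m2 (n - i)%nat))%C).
have E : forall W : nat -> nat -> C,
  Csum (fun i => alpha i * (RtoC (m2 (n - i + p)%nat / m2 (n - i)%nat) * W (n - i + p)%nat (l - k)%nat))%C (S n) =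
  Csum (fun i => c i * W (n - i + p)%nat (l - k)%nat)%C (S n).
{ intros W. apply Csum_ext. intros i _. bound. }
rewrite !E, (E (fun n l => W1 n l + W2 n l)%C).
rewrite (Csum_ext (fun i => c i * (W1 (n - i + p)%nat (l - k)%nat + W2 (n - i + p)%nat (l - k)%nat))%C
  (fun i => c i * W1 (n - i + p)%nat (l - k)%nat + c i * W2 (n - i + p)%nat (l - k)%nat)%C) by (intros; ring).
rewrite Csum_plus. ring.
Qed.

Lemma residual_ext k p m2 (alpha : nat -> C) W W' n l : (forall n l, W n l = W' n l) ->
  residual m2 k p alpha W n l = residual m2 k p alpha W' n l.
Proof.
intros E. replace W' with W; [bound|].
extensionality i. apply functional_extensionality. apply E.
Qed.

(** Solving the equation for the leading term, which is multiplied by [alpha 0]. *)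
Lemma equation_Vstep k p m2 (alpha : nat -> C) f w : (1 <= p)%nat -> (forall n, m2 n <> 0) -> alpha O <> 0%C ->
  sp_equation k p m2 alpha f w ->
  let V := fun n l => (RtoC (m2 (n + p)%nat / m2 n) * w l (n + p)%nat)%C in
  (forall n l, Wof m2 p (fun n l => w l n) V n l = w l n) /\
  forall n, V n = Vstep m2 k p alpha (fun n l => f l n) (fun n l => w l n) n V.
Proof.
intros Hp Hm Ha H V.
have HW : forall n l, Wof m2 p (fun n l => w l n) V n l = w l n.
{ intros n l. unfold Wof. destruct (Nat.ltb_spec n p); [bound|]. unfold V.
  replace (n - p + p)%nat with n by lia. rewrite Cmult_assoc, <- RtoC_mult.
  replace (m2 (n - p)%nat / m2 n * (m2 n / m2 (n - p)%nat)) with 1 by (field; split; apply Hm). ring. }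
split; [bound|]. intros n. extensionality l. unfold Vstep. rewrite HW.
rewrite <- (H (l + k)%nat n). unfold mul_eps_pow.
destruct (Nat.ltb_spec (l + k) k); [lia|]. replace (l + k - k)%nat with l by lia.
rewrite fps_mul_Csum, Csum_shift_l, Nat.sub_0_r.
unfold moment_derive_z at 1. rewrite iter_moment_derive by bound. fold (V n l).
rewrite (Csum_ext (fun j => alpha (S j) * moment_derive_z m2 p w l (n - S j)%nat)%C
  (fun i => alpha (S i) * V (n - S i)%nat l)%C).
- change (RtoC (m2 (n + p)%nat / m2 n) * w l (n + p)%nat)%C with (V n l). field. exact Ha.
- intros j _. unfold moment_derive_z. rewrite iter_moment_derive by bound. reflexivity.
Qed.

Lemma Vstep_plus k p m2 (alpha : nat -> C) F1 F2 I1 I2 n V1 V2 : (1 <= p)%nat ->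
  Vstep m2 k p alpha (fun n l => F1 n l + F2 n l)%C (fun n l => I1 n l + I2 n l)%C n (fun n l => V1 n l + V2 n l)%C =
  (fun l => Vstep m2 k p alpha F1 I1 n V1 l + Vstep m2 k p alpha F2 I2 n V2 l)%C.
Proof.
intros Hp. extensionality l. unfold Vstep, Wof.
rewrite (Csum_ext _ (fun i => alpha (S i) * V1 (n - S i)%nat l + alpha (S i) * V2 (n - S i)%nat l)%C) by (intros; ring).
rewrite Csum_plus. destruct (Nat.ltb_spec n p); ring.
Qed.

Lemma trace_value m2 j w l : (forall n, m2 n <> 0) ->
  at_z0 (moment_derive_z m2 j w) l = (RtoC (m2 j / m2 O) * w l j)%C.
Proof. intros Hm. unfold at_z0, moment_derive_z. rewrite iter_moment_derive by bound. reflexivity. Qed.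

Theorem theorem3
  (M : nat -> R) (HM : strongly_regular M)
  (HMpo : admits_nonzero_proximate_order M)
  (k p : nat) (Hk : (1 <= k)%nat) (Hkp : (k < p)%nat)
  (s1 s2 : R) (Hs1 : 0 < s1) (Hs2 : 0 < s2)
  (Hs : s1 * INR k < s2 * INR p)
  (Homega : omega M * (s2 * INR p / INR k) < 2)
  (m2 : nat -> R)
  (Hm2 : exists N : nat -> R, moment_sequence N m2)
  (Hm2M : exists c1 c2 : R, 0 < c1 /\ 0 < c2 /\
     forall n : nat,
       c1 ^ n * Rpower (M n) s2 <= m2 n <= c2 ^ n * Rpower (M n) s2)
  (R0 : R) (HR0 : 0 < R0)
  (a : C -> C) (Ha : holomorphic_on_cdisc R0 a)
  (Hainv : exists b : C -> C, holomorphic_on_cdisc R0 b /\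
     forall z : C, cdisc R0 z -> Cmult (a z) (b z) = RtoC 1)
  (alpha : fps) (Halpha : sum_near_0 (V := C_NormedModule) a alpha)
  (f : fps2) :
  exists w : fps2,
    (* (i) *)
    ((forall (psi : nat -> fps) (w' : fps2),
        sp_solution k p m2 alpha f psi w' <->
        w' = w /\
        forall j : nat, (j < p)%nat ->
          forall l : nat, psi j l = at_z0 (moment_derive_z m2 j w) l) /\
     (coeffs_holomorphic R0 f -> coeffs_holomorphic R0 w)) /\
    (* (ii) *)
    (forall d1 d2 : R,
       Rabs (d1 - d2) < PI * omega M / 2 * (s2 * INR p / INR k - s1) ->
       let M1 := seq_power M s1 in
       let M2 := seq_power M (s2 * INR p / INR k) in
       multisummable_eps M1 M2 d1 d2 w <->
       multisummable_eps M1 M2 d1 d2 f /\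
       forall j : nat, (j < p)%nat ->
         multisummable (V := C_NormedModule) M1 M2 d1 d2
           (at_z0 (moment_derive_z m2 j w))).
Proof.
destruct Hm2M as [c1 [c2 [Hc1 [_ Hm2M]]]]. destruct Hm2 as [N2 HN2m].
have Hpos : forall n, 0 < m2 n.
{ intros n. eapply Rlt_le_trans; [|apply (Hm2M n)].
  apply Rmult_lt_0_compat; [bound|apply exp_pos]. }
have Hne : forall n, m2 n <> 0 by (intros n; apply Rgt_not_eq, Hpos).
have HN2 := proj1 HN2m.
destruct (moment_sequence_growth N2 m2 HN2m Hpos) as [A [HA Hgrow]].
have HkR : 0 < INR k by bound.
have Halb : beyond R0 alpha by (apply beyond_iff; auto; exists a; split; auto).
destruct (beyond_geometric R0 alpha HR0 Halb) as [X [D [HX [HD HXD]]]].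
have Ha0 : alpha O <> 0%C.
{ destruct Hainv as [b [_ Hb]]. destruct Halpha as [r [Hr Hal]].
  have E : a 0%C = alpha O.
  { apply (ps_unique alpha 0); [|apply ps_at_0]. apply is_pseries_ps, Hal.
    unfold Defs.disc. rewrite Cmod_0. exact Hr. }
  specialize (Hb 0%C ltac:(unfold cdisc; rewrite Cmod_0; lra)). rewrite E in Hb.
  intros E0. rewrite E0, Cmult_0_l in Hb. apply RtoC_inj in Hb. lra. }
destruct (formal_solution k p m2 alpha f Hk) as [w [Hw Huniq]].
exists w. split.
{ split.
  - intros psi w'. split.
    + intros [H1 H2]. rewrite (Huniq w' H1) in *. split; [bound|]. intros j Hj l. symmetry. apply H2, Hj.
    + intros [-> H]. split; [bound|]. intros j Hj l. symmetry. apply H, Hj.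
  - intros Hf l. apply beyond_iff; auto.
    apply (solution_holomorphic R0 k p m2 alpha f w); auto.
    + intros x Hx. apply (quotient_subexp N2 m2 A HN2 HA Hgrow x Hx).
    + intros l'. apply beyond_iff; auto. }
intros d1 d2 _ M1 M2. split.
- intros [r [Hr [v [Hv [v1 [v2 [Hsum [Hv1 Hv2]]]]]]]].
  set (W1 := fun n l => bcoef n (v1 l)). set (W2 := fun n l => bcoef n (v2 l)).
  have HwW : forall n l, w l n = (W1 n l + W2 n l)%C.
  { intros n l. rewrite <- (bcoef_sum r (v l) (w l) n Hr (Hv l)), Hsum.
    apply (fl_plus _ _ (bcoef_functional r n Hr)). }
  destruct (quotient_upper N2 m2 A HN2 Hpos HA Hgrow p) as [X2 [D2 [HX2 [HD2 Hup]]]].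
  split.
  + destruct (residual_summable M1 d1 m2 k p alpha X D HX HD HXD Hpos r v1 X2 D2 Hr Hv1 HX2 HD2 Hup)
      as [n1 [t1 [r1 [K1 [P1 [P2 [P3 [P4 P5]]]]]]]].
    destruct (residual_summable M2 d2 m2 k p alpha X D HX HD HXD Hpos r v2 X2 D2 Hr Hv2 HX2 HD2 Hup)
      as [n2 [t2 [r2 [K2 [Q1 [Q2 [Q3 [Q4 Q5]]]]]]]].
    replace f with (fun l n => residual m2 k p alpha W1 n l + residual m2 k p alpha W2 n l)%C.
    * exact (multisummable_of_GBS M1 M2 d1 d2 _ _ n1 t1 r1 K1 n2 t2 r2 K2 P1 P2 P3 P4 Q1 Q2 Q3 Q4 P5 Q5).
    * extensionality l. extensionality n.
      rewrite (equation_residual k p m2 alpha f w Hne Hw l n), <- residual_plus.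
      apply residual_ext. bound.
  + intros j Hj.
    exists (fun l => RtoC (m2 j / m2 O) * bcoef j (v1 l))%C, (fun l => RtoC (m2 j / m2 O) * bcoef j (v2 l))%C.
    split; [|split; apply (coefficient_summable _ _ r); auto].
    intros l. rewrite trace_value by bound. rewrite HwW.
    change ((RtoC (m2 j / m2 O) * (W1 j l + W2 j l))%C =
      (RtoC (m2 j / m2 O) * W1 j l + RtoC (m2 j / m2 O) * W2 j l)%C). ring.
- intros [[r [Hr [v [Hv [v1 [v2 [Hsum [Hv1 Hv2]]]]]]]] Htr].
  have Hp1 : (1 <= p)%nat by lia.
  have Hsplit : exists P : nat -> (nat -> C) * (nat -> C), forall j, (j < p)%nat ->
    (forall l, at_z0 (moment_derive_z m2 j w) l = (fst (P j) l + snd (P j) l)%C) /\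
    summable (V := C_NormedModule) M1 d1 (fst (P j)) /\ summable (V := C_NormedModule) M2 d2 (snd (P j)).
  { apply (fun_choice (fun j Q => (j < p)%nat ->
      (forall l, at_z0 (moment_derive_z m2 j w) l = (fst Q l + snd Q l)%C) /\
      summable (V := C_NormedModule) M1 d1 (fst Q) /\ summable (V := C_NormedModule) M2 d2 (snd Q))).
    intros j. destruct (lt_dec j p) as [Hj|Hj].
    - destruct (Htr j Hj) as [u1 [u2 [E [S1 S2]]]]. exists (u1, u2). bound.
    - exists (fun _ => RtoC 0, fun _ => RtoC 0). intros; contradiction. }
  destruct Hsplit as [P HP].
  have Hscal : forall N d (u : nat -> C) (c : C), summable (V := C_NormedModule) N d u ->
    summable (V := C_NormedModule) N d (fun l => c * u l)%C.
  { intros N d u c Hu. destruct (summable_functional N d u Hu) as [m [th [rh [K [Q [T1 [T2 [T3 [T4 [T5 T6]]]]]]]]]].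
    have T := T6 1 (fun z => z) functional_id.
    apply (BS_summable N m d th rh K (Cmod c * (1 * Q))); auto.
    - bound.
    - apply BS_scal, T. }
  set (I1 := fun j l => (RtoC (m2 O / m2 j) * fst (P j) l)%C). set (I2 := fun j l => (RtoC (m2 O / m2 j) * snd (P j) l)%C).
  set (F1 := fun n l => bcoef n (v1 l)). set (F2 := fun n l => bcoef n (v2 l)).
  have HAp : 1 <= A ^ p by (apply pow_R1_Rle, HA).
  have Hlow : forall n, c1 ^ n * Rpower (M n) s2 <= m2 n by (intros n; apply Hm2M).
  have Hcost : forall sigma, 0 < sigma -> sigma * INR k <= s2 * INR p -> forall B, 0 < B ->
    exists X0 H, 0 < X0 /\ 0 < H /\
      forall s, B ^ (k * s) * seq_power M sigma (k * s)%nat <= X0 * (H ^ s * N2 (p * s)%nat).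
  { intros sigma Hsig Hle B HB.
    destruct (shift_cost N2 m2 A HA Hgrow M k p sigma s2 c1 B HM Hk ltac:(lia) Hsig Hs2 Hle Hc1 HB Hlow) as [H [HH HC]].
    exists A, H. bound. }
  have Hsig : 0 < s2 * INR p / INR k by bound.
  destruct (cauchy_problem_summable M1 d1 m2 k p alpha X D HX HD HXD Hpos N2 (A ^ p) r v1 I1 Hp1 Ha0 HN2 HAp
    (quotient_lower N2 m2 A HN2 Hpos Hgrow p) (Hcost s1 Hs1 ltac:(lra)) Hr Hv1)
    as [V1 [n1 [t1 [r1 [K1 [P1 [P2 [P3 [P4 [EV1 P5]]]]]]]]]].
  { intros j Hj. apply Hscal. apply HP, Hj. }
  destruct (cauchy_problem_summable M2 d2 m2 k p alpha X D HX HD HXD Hpos N2 (A ^ p) r v2 I2 Hp1 Ha0 HN2 HAp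
    (quotient_lower N2 m2 A HN2 Hpos Hgrow p)
    (Hcost _ Hsig ltac:(right; field; lra)) Hr Hv2)
    as [V2 [n2 [t2 [r2 [K2 [Q1 [Q2 [Q3 [Q4 [EV2 Q5]]]]]]]]]].
  { intros j Hj. apply Hscal. apply HP, Hj. }
  fold F1 in EV1. fold F2 in EV2.
  destruct (equation_Vstep k p m2 alpha f w Hp1 Hne Ha0 Hw) as [HWof HVst].
  set (V := fun n l => (RtoC (m2 (n + p)%nat / m2 n) * w l (n + p)%nat)%C) in *.
  have HF : (fun n l => f l n) = (fun n l => F1 n l + F2 n l)%C.
  { extensionality n. extensionality l.
    rewrite <- (bcoef_sum r (v l) (f l) n Hr (Hv l)), Hsum.
    apply (fl_plus _ _ (bcoef_functional r n Hr)). }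
  have HI : forall j, (j < p)%nat -> forall l, w l j = (I1 j l + I2 j l)%C.
  { intros j Hj l. destruct (HP j Hj) as [E _]. specialize (E l). rewrite trace_value in E by bound.
    unfold I1, I2. rewrite <- Cmult_plus_distr_l, <- E, Cmult_assoc, <- RtoC_mult.
    replace (m2 O / m2 j * (m2 j / m2 O)) with 1 by (field; split; apply Hne). ring. }
  set (I12 := fun j l => (I1 j l + I2 j l)%C).
  have HVst2 : forall n, V n = Vstep m2 k p alpha (fun n l => F1 n l + F2 n l)%C I12 n V.
  { intros n. transitivity (Vstep m2 k p alpha (fun n l => f l n) (fun n l => w l n) n V); [exact (HVst n)|].
    rewrite HF. extensionality l. unfold Vstep, Wof, I12.
    destruct (Nat.ltb_spec n p); [|bound]. rewrite HI by bound. reflexivity. }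
  have HVV : forall n, V n = (fun l => V1 n l + V2 n l)%C.
  { apply (strong_unique (Vstep m2 k p alpha (fun n l => F1 n l + F2 n l)%C I12)); [|bound|].
    - intros n g h E. apply Vstep_ext; auto.
    - intros n. unfold I12. rewrite Vstep_plus by bound.
      extensionality l. rewrite <- EV1, <- EV2. reflexivity. }
  replace w with (fun l n => Wof m2 p I1 V1 n l + Wof m2 p I2 V2 n l)%C.
  + exact (multisummable_of_GBS M1 M2 d1 d2 _ _ n1 t1 r1 K1 n2 t2 r2 K2 P1 P2 P3 P4 Q1 Q2 Q3 Q4 P5 Q5).
  + extensionality l. extensionality n.
    rewrite <- (HWof n l). unfold Wof. destruct (Nat.ltb_spec n p) as [Hn|Hn].
    * symmetry. apply HI, Hn.
    * rewrite HVV. ring.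
Qed.
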